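(* Let $k\ge 1$, let $C_k$ be a nonsingular real algebraic curve of degree $k$ in the projective plane, and let $S_4$ be a real algebraic $M$-quartic with an oval $O$ which is a snake coiling around $C_k$. Then there exists a real conic $C_2$ such that: 1) $\mathbb{R}C_2$ intersects each oval of $S_4$, and $\mathbb{R}C_2$ intersects $\mathbb{R}C_k$ at $2k$ pairwise distinct points which lie inside $O$; 2) the curve $\mathbb{R}S_4\cup\mathbb{R}C_k$ is rigidly isotopic to $\mathbb{R}\widetilde{C}_2^2\cup\mathbb{R}C_k$, where $\widetilde{C}_2^2$ is a small perturbation of the square of $C_2$.
   Context: All curves are real curves in $\mathbb{P}^2$; $\mathbb{R}X\subset\mathbb{R}P^2$ denotes the set of real points of $X$. Connected components of $\mathbb{R}X$ for $X$ nonsingular are called branches of $X$; a branch is an oval if it bounds a disk in $\mathbb{R}P^2$. ''Inside an oval'' means in the disk bounded by this oval. An $M$-quartic is a nonsingular real quartic whose real point set has the maximal number, four, of connected components (these are four ovals lying outside each other). Snake: let $C_k$ be a nonsingular real curve of degree $k$. An oval $O$ of a real quartic $S$ is called a snake coiling around $C_k$ if, denoting by $B$ the union of the branches of $C_k$ that intersect $O$, the disk bounded by $O$ is divided by $B$ into $2k-1$ curvilinear quadrangles and two digons. Equivalently, $O\cup B$ is isotopic in $\mathbb{R}P^2$ to $O'\cup B$, where $O'$ is the boundary of a small thickening of a smoothly embedded segment which transversally crosses $\mathbb{R}C_k$ at $2k$ points. Rigid isotopy: a rigid isotopy of algebraic curves of a given class is an isotopy through curves of this class. Here the class is that of unions of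 a nonsingular real quartic and a nonsingular real curve of degree $k$ intersecting each other transversally. Small perturbation of the square: if $C_2=\{f=0\}$ with $f$ a real quadratic form, a small perturbation of the square of $C_2$ is a nonsingular real quartic given by a real quartic form sufficiently close to $f^2$ in the space of real quartic forms; the conclusion 2) means that such a perturbation exists arbitrarily close to $f^2$. *)

(* Defs.v *)
From HB Require Import structures.
From mathcomp Require Import all_boot all_order all_algebra.
From mathcomp Require Import generic_quotient.
From mathcomp Require Import all_classical all_reals all_analysis.
From mathcomp Require Import complex.
(* The notations of mpoly clash with those of mathcomp-analysis; [mpoly 3 K]
   is the type of polynomials in three variables over K. *)
From mathcomp Require Import -(notations) mpoly.

Set Implicit Arguments.
Unset Strict Implicit.
Unset Printing Implicit Defensive.

Import Order.TTheory GRing.Theory Num.Theory numFieldNormedType.Exports.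

Local Open Scope card_scope.
Local Open Scope classical_set_scope.
Local Open Scope ring_scope.

(** * The real projective plane *)

Definition nzvec (R : realType) : topologicalType :=
  set_type [set v : 'rV[R]_3 | v != 0].

Definition proportional (R : realType) (u v : nzvec R) : bool :=
  `[< exists2 a : R, a != 0 & set_val u = a *: set_val v >].

Lemma proportional_equiv (R : realType) : equiv_class_of (@proportional R).
Proof.
split.
- by move=> u; apply/asboolP; exists 1; rewrite ?oner_eq0 ?scale1r.
- have sym (u v : nzvec R) : proportional u v -> proportional v u.
    move=> /asboolP[a a0 E]; apply/asboolP; exists a^-1; rewrite ?invr_eq0//.
    by rewrite E scalerA mulVf// scale1r.
  by move=> u v; apply/idP/idP; exact: sym.
- move=> v u w /asboolP[a a0 E] /asboolP[b b0 F]; apply/asboolP.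
  by exists (a * b); rewrite ?mulf_neq0// E F scalerA.
Qed.

Canonical proportional_equiv_rel (R : realType) :=
  EquivRelPack (proportional_equiv R).

Definition RP2 (R : realType) : topologicalType :=
  quotient_topology {eq_quot (@proportional_equiv_rel R)}%qT.

(** * Plane algebraic curves

A curve is given by a form (a homogeneous polynomial) in three variables; two
forms give the same curve when they differ by a nonzero constant factor. *)

Definition is_form (K : nzRingType) (d : nat) (f : mpoly 3 K) : Prop :=
  f \is ishomog1 d mdeg.

Definition same_curve (K : nzRingType) (f g : mpoly 3 K) : Prop :=
  exists2 a : K, a != 0 & f = a *: g.

Definition eval_form (K : comNzRingType) (f : mpoly 3 K) (v : 'rV[K]_3) : K :=
  meval (v 0) f.

Definition grad (K : comNzRingType) (f : mpoly 3 K) (v : 'rV[K]_3) :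
    'rV[K]_3 :=
  \row_i eval_form (mderiv i f) v.

Definition complexify (R : realType) (f : mpoly 3 R) : mpoly 3 R[i] :=
  map_mpoly (real_complex R) f.

(* For a form, vanishing does not depend on the representative [repr p]. *)
Definition real_points (R : realType) (f : mpoly 3 R) : set (RP2 R) :=
  [set p | eval_form f (set_val (repr p)) = 0].

(* Nonsingularity and transversality are those of the complex curves. *)
Definition nonsingular (R : realType) (d : nat) (f : mpoly 3 R) : Prop :=
  is_form d f /\
  forall v : 'rV[R[i]]_3, v != 0 ->
    eval_form (complexify f) v = 0 -> grad (complexify f) v != 0.

Definition transversal_curves (R : realType) (f g : mpoly 3 R) : Prop :=
  forall v : 'rV[R[i]]_3, v != 0 ->
    eval_form (complexify f) v = 0 -> eval_form (complexify g) v = 0 ->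
    \rank (col_mx (grad (complexify f) v) (grad (complexify g) v)) = 2%N.

Definition conic (R : realType) (f : mpoly 3 R) : Prop :=
  f != 0 /\ is_form 2 f.

(** * Branches and ovals *)

Definition components (T : topologicalType) (A : set T) : set (set T) :=
  [set connected_component A x | x in A].

Definition unit_disk (R : realType) : set (R * R) :=
  [set z | z.1 ^+ 2 + z.2 ^+ 2 <= 1].
Definition open_unit_disk (R : realType) : set (R * R) :=
  [set z | z.1 ^+ 2 + z.2 ^+ 2 < 1].
Definition unit_circle (R : realType) : set (R * R) :=
  [set z | z.1 ^+ 2 + z.2 ^+ 2 = 1].

Definition branch (R : realType) (f : mpoly 3 R) (A : set (RP2 R)) : Prop :=
  components (real_points f) A.

(* [D] is the interior of a closed disk embedded in RP^2 with boundary [A]; an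
   injective continuous map from a compact space to RP^2 is an embedding. *)
Definition bounds_disk (R : realType) (A D : set (RP2 R)) : Prop :=
  exists h : R * R -> RP2 R,
    [/\ {within @unit_disk R, continuous h},
        set_inj (@unit_disk R) h,
        h @` @unit_circle R = A &
        h @` @open_unit_disk R = D].

Definition oval (R : realType) (f : mpoly 3 R) (A : set (RP2 R)) : Prop :=
  branch f A /\ exists D, bounds_disk A D.

(* The disk bounded by an oval is unique, its complement in RP^2 being a Moebius
   band. *)
Definition inside (R : realType) (A : set (RP2 R)) : set (RP2 R) :=
  [set p | exists2 D, bounds_disk A D & D p].

Definition M_quartic (R : realType) (s : mpoly 3 R) : Prop :=
  nonsingular 4 s /\ components (real_points s) #= `I_4.

(** * Snakes *)

Definition unit_square (R : realType) : set (R * R) :=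
  [set z | 0 <= z.1 <= 1 /\ 0 <= z.2 <= 1].
Definition open_unit_square (R : realType) : set (R * R) :=
  [set z | 0 < z.1 < 1 /\ 0 < z.2 < 1].

(* [P] is the interior of an embedded quadrangle with two opposite sides on [O]
   and the two other sides on [B]. *)
Definition quadrangle (R : realType) (O B P : set (RP2 R)) : Prop :=
  exists h : R * R -> RP2 R,
    [/\ {within @unit_square R, continuous h},
        set_inj (@unit_square R) h,
        h @` @open_unit_square R = P,
        (forall t : R, 0 <= t <= 1 -> O (h (t, 0)) /\ O (h (t, 1))) &
        (forall t : R, 0 <= t <= 1 -> B (h (0, t)) /\ B (h (1, t)))].

(* [P] is the interior of an embedded digon with one side on [O] and the other
   on [B], the images of the upper and of the lower half of the unit circle. *)
Definition digon (R : realType) (O B P : set (RP2 R)) : Prop :=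
  exists h : R * R -> RP2 R,
    [/\ {within @unit_disk R, continuous h},
        set_inj (@unit_disk R) h,
        h @` @open_unit_disk R = P,
        (forall z, unit_circle z -> 0 <= z.2 -> O (h z)) &
        (forall z, unit_circle z -> z.2 <= 0 -> B (h z))].

Definition branches_meeting (R : realType) (c : mpoly 3 R) (O : set (RP2 R)) :
    set (RP2 R) :=
  \bigcup_(A in [set A | branch c A /\ A `&` O !=set0]) A.

(* The pieces into which [B] divides [D] are the components of [D `\` B]. *)
Definition snake (R : realType) (k : nat) (c s : mpoly 3 R)
    (O : set (RP2 R)) : Prop :=
  oval s O /\
  exists2 D, bounds_disk O D &
    let B := branches_meeting c O in
    let pieces := components (D `\` B) in
    [/\ pieces `<=` quadrangle O B `|` digon O B,
        pieces `&` quadrangle O B #= `I_(2 * k).-1 &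
        pieces `&` digon O B #= `I_2].

(** * Rigid isotopies *)

(* The class of curves within which the isotopies take place. *)
Definition quartic_union (R : realType) (k : nat) (F : mpoly 3 R) : Prop :=
  exists s c : mpoly 3 R,
    [/\ nonsingular 4 s, nonsingular k c, transversal_curves s c & F = s * c].

(* A rigid isotopy in a class of curves is a path of curves in this class,
   continuous in the coefficients of the defining forms. *)
Definition rigidly_isotopic (R : realType) (class : mpoly 3 R -> Prop)
    (F G : mpoly 3 R) : Prop :=
  exists Phi : R -> mpoly 3 R,
    [/\ forall m, {within `[0, 1], continuous (fun t => mcoeff m (Phi t))},
        forall t, 0 <= t <= 1 -> class (Phi t),
        same_curve (Phi 0) F &
        same_curve (Phi 1) G].

Definition near_form (R : realType) (e : R) (f g : mpoly 3 R) : Prop :=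
  forall m, `|mcoeff m f - mcoeff m g| < e.

(* Main.v *)
(* The four ovals of the quartic s are the zero sets of continuous functions
   v_i on the plane whose product has the sign of s (up to a global sign), and
   at most one v_i is nonpositive at each point; hence s is positive somewhere
   on each arc between two of the regions v_i < 0.

   The interior D of the snake is in the region of its oval. Otherwise D would
   meet every line through points of the other regions too often, or contain
   such a line; but the double angle of a pair of linear forms turns once along
   a line, while it can be lifted on a disk.

   Two pieces have no common germ of a boundary arc on O, so there are at least
   4k corners, and by Bezout these are all the common points of c and s, at
   which the curves are transversal. The conic goes through a point of each of
   the two digons and through a point of each of the three other regions. If s
   were nonnegative somewhere on the arc between the first two points, s would
   have at least ten zeros on the conic. So this arc lies in D; it leads from
   one digon to the other, hence crosses the 2k arcs cut out by c in D, and by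
   counting roots the conic has no other point on c.

   For a > 0 and b >= 0 the form F = a s + b f^2 is nonsingular: a line or a
   conic through a singular point (or a pair of conjugate ones) and points of
   the four regions where F < 0 would meet F too often. For b > 0 it is positive
   at the ends of each of the 2k arcs and negative where the conic crosses, so
   it has 4k zeros on c and is transversal to c, by Bezout again. *)

Require Import Defs.
From HB Require Import structures.
From mathcomp Require Import all_boot all_order all_algebra.
From mathcomp Require Import all_classical all_reals all_analysis.
From mathcomp Require Import perm complex.
From mathcomp Require Import -(notations) mpoly.
From mathcomp Require Import zify ring lra.

Set Implicit Arguments.
Unset Strict Implicit.
Unset Printing Implicit Defensive.

Import Order.TTheory GRing.Theory Num.Theory numFieldNormedType.Exports.

Local Open Scope classical_set_scope.
Local Open Scope ring_scope.

(** * Vectors with three coordinates *)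

(** Two obstacles shape the proof. The disk and the pieces are given only as images of continuous
    injections, so the planar topology rests on one tool, the lifting of an angle over a square: it
    yields the openness of injective plane maps, and, as H^1(RP^2, Z) = 0, the half angles that
    split s into sign functions. Also, a snake only counts its pieces and does not say how they fit
    together; their order is recovered by walking from one digon across the arcs until all pieces
    are used up.

    Transversality concerns complex points too. It comes from equality in Bezout's bound: 4k
    distinct real points leave no room for a tangency or for a further complex point. The bound
    needs no separate irreducibility hypothesis, since two factors of a form would meet in a
    singular point.

    The arguments called counting too many zeros share one scheme: on a parametrized line or conic,
    a sign pattern in the regions forces six roots where the degree is four, or ten where it is
    eight. A singular point contributes a square factor, which is divided out first so that it is
    not counted together with the sign changes. *)

Definition i0 : 'I_3 := @Ordinal 3 0 isT.
Definition i1 : 'I_3 := @Ordinal 3 1 isT.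
Definition i2 : 'I_3 := @Ordinal 3 2 isT.

Lemma ord3P (P : 'I_3 -> Prop) : P i0 -> P i1 -> P i2 -> forall i, P i.
Proof.
move=> P0 P1 P2 [[|[|[|i]]]] //= H.
- by rewrite (_ : Ordinal H = i0)//; apply/val_inj.
- by rewrite (_ : Ordinal H = i1)//; apply/val_inj.
- by rewrite (_ : Ordinal H = i2)//; apply/val_inj.
Qed.

Lemma sum3 (V : nmodType) (F : 'I_3 -> V) : \sum_i F i = F i0 + F i1 + F i2.
Proof.
rewrite !big_ord_recl big_ord0 addr0 addrA.
by congr (F _ + F _ + F _); apply/val_inj.
Qed.

Section Det3.
Variable K : comNzRingType.
Implicit Types u v w x : 'rV[K]_3.

Lemma row3P u v : u 0 i0 = v 0 i0 -> u 0 i1 = v 0 i1 -> u 0 i2 = v 0 i2 -> u = v.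
Proof. by move=> h0 h1 h2; apply/rowP; apply: ord3P. Qed.

Definition det3 u v w : K :=
  u 0 i0 * (v 0 i1 * w 0 i2 - v 0 i2 * w 0 i1)
  - u 0 i1 * (v 0 i0 * w 0 i2 - v 0 i2 * w 0 i0)
  + u 0 i2 * (v 0 i0 * w 0 i1 - v 0 i1 * w 0 i0).

Lemma cramer3 u v w x :
  det3 u v w *: x = det3 x v w *: u + det3 u x w *: v + det3 u v x *: w.
Proof. by apply: row3P; rewrite !mxE /det3; ring. Qed.

Definition dot u v : K := \sum_i u 0 i * v 0 i.

Lemma dotE u v : dot u v = u 0 i0 * v 0 i0 + u 0 i1 * v 0 i1 + u 0 i2 * v 0 i2.
Proof. exact: sum3. Qed.

Lemma dotDr u v w : dot u (v + w) = dot u v + dot u w.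
Proof. by rewrite !dotE !mxE; ring. Qed.

Lemma dotZr u a v : dot u (a *: v) = a * dot u v.
Proof. by rewrite !dotE !mxE; ring. Qed.

Lemma dotZl u a v : dot (a *: u) v = a * dot u v.
Proof. by rewrite !dotE !mxE; ring. Qed.

Lemma dotC u v : dot u v = dot v u.
Proof. by rewrite !dotE; ring. Qed.

Lemma dot_eq0 u : (forall v, dot u v = 0) -> u = 0.
Proof.
move=> h; apply/rowP => i; rewrite mxE; have := h (delta_mx 0 i).
rewrite /dot (bigD1 i)//= big1 ?addr0; first by rewrite !mxE !eqxx mulr1.
by move=> j ji; rewrite !mxE eqxx /= (negbTE ji) mulr0.
Qed.

Definition cross u v : 'rV[K]_3 :=
  \row_i (if i == i0 then u 0 i1 * v 0 i2 - u 0 i2 * v 0 i1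
          else if i == i1 then u 0 i2 * v 0 i0 - u 0 i0 * v 0 i2
          else u 0 i0 * v 0 i1 - u 0 i1 * v 0 i0).

Lemma dot_cross u v w : dot (cross u v) w = det3 u v w.
Proof. by rewrite dotE !mxE /= /det3; ring. Qed.

End Det3.

Section Det3Field.
Variable K : fieldType.
Implicit Types u v w x : 'rV[K]_3.

Lemma det3_basis u v w x : det3 u v w != 0 ->
  x = (det3 x v w / det3 u v w) *: u + (det3 u x w / det3 u v w) *: v
      + (det3 u v x / det3 u v w) *: w.
Proof.
move=> d0; apply: (scalerI d0); rewrite cramer3 !scalerDr !scalerA.
by rewrite !mulrA !(mulrC (det3 u v w)) !mulfK.
Qed.

Lemma det3_free u v w a b c : det3 u v w != 0 ->
  a *: u + b *: v + c *: w = 0 -> [/\ a = 0, b = 0 & c = 0].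
Proof.
move=> d0 e.
have z t1 t2 : det3 0 t1 t2 = 0 :> K by rewrite /det3 !mxE; ring.
have z1 t1 t2 : det3 t1 0 t2 = 0 :> K by rewrite /det3 !mxE; ring.
have z2 t1 t2 : det3 t1 t2 0 = 0 :> K by rewrite /det3 !mxE; ring.
split; apply/eqP.
- have : det3 (a *: u + b *: v + c *: w) v w = 0 by rewrite e z.
  have -> : det3 (a *: u + b *: v + c *: w) v w = a * det3 u v w.
    by rewrite /det3 !mxE; ring.
  by move/eqP; rewrite mulf_eq0 (negbTE d0) orbF.
- have : det3 u (a *: u + b *: v + c *: w) w = 0 by rewrite e z1.
  have -> : det3 u (a *: u + b *: v + c *: w) w = b * det3 u v w.
    by rewrite /det3 !mxE; ring.
  by move/eqP; rewrite mulf_eq0 (negbTE d0) orbF.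
- have : det3 u v (a *: u + b *: v + c *: w) = 0 by rewrite e z2.
  have -> : det3 u v (a *: u + b *: v + c *: w) = c * det3 u v w.
    by rewrite /det3 !mxE; ring.
  by move/eqP; rewrite mulf_eq0 (negbTE d0) orbF.
Qed.

Definition indep u v := forall a b : K, a *: u + b *: v = 0 -> a = 0 /\ b = 0.

Lemma cross_eq0 u v : cross u v = 0 -> forall i j, u 0 i * v 0 j = u 0 j * v 0 i.
Proof.
move=> c0; have e i : cross u v 0 i = 0 by rewrite c0 mxE.
have e0 := e i0; have e1 := e i1; have e2 := e i2.
rewrite !mxE /= in e0 e1 e2; move: e0 e1 e2 => /subr0_eq e0 /subr0_eq e1 /subr0_eq e2.
by apply: ord3P; apply: ord3P.
Qed.

Lemma cross_neq0 u v : indep u v -> cross u v != 0.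
Proof.
move=> uv; apply/eqP => /cross_eq0 e.
have h i : u 0 i = 0 /\ v 0 i = 0.
  have [|b a] := uv (v 0 i) (- u 0 i).
    by apply/rowP => j; rewrite !mxE mulNr e mulrC subrr.
  by move/eqP: a; rewrite oppr_eq0 => /eqP.
have u0 : u = 0 by apply/rowP => i; rewrite mxE; have [] := h i.
have [] := uv 1 0; first by rewrite u0 scale0r scaler0 addr0.
by move/eqP; rewrite oner_eq0.
Qed.

Lemma indep_det3 u v : indep u v -> exists w, det3 u v w != 0.
Proof.
move=> /cross_neq0 c0; apply: contrapT => h; case/negP: c0; apply/eqP/dot_eq0 => w.
by rewrite dot_cross; apply/eqP/negPn/negP => d; apply: h; exists w.
Qed.

Lemma det3_indep u v w : det3 u v w != 0 -> indep u v.
Proof.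
move=> d0 a b e; have [|-> -> _] := @det3_free u v w a b 0 d0; last by [].
by rewrite scale0r addr0.
Qed.

Lemma cross_dep u v : u != 0 -> cross u v = 0 -> exists a, v = a *: u.
Proof.
move=> /rV0Pn[i ui] /cross_eq0 e; exists (v 0 i / u 0 i).
apply/rowP => j; apply: (mulfI ui); rewrite mxE e; field; exact: ui.
Qed.

End Det3Field.

(** * Evaluation of forms *)

Section MpolyInd.
Variables (n : nat) (K : comNzRingType).

Lemma mpoly_ring_ind (P : mpoly n K -> Prop) :
  (forall c, P (mpolyC n c)) -> (forall i, P (mpolyX K (mnm1 i))) ->
  (forall p q, P p -> P q -> P (p + q)) ->
  (forall p q, P p -> P q -> P (p * q)) -> forall p, P p.
Proof.
move=> hC hX hD hM p; rewrite [p]mpolyE.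
have h0 : P 0 by rewrite -(mpolyC0 n K).
have h1 : P 1 by have := hC 1.
apply: (big_ind P h0 hD) => m _; rewrite -mul_mpolyC; apply: (hM) => //.
rewrite mpolyXE_id; apply: (big_ind P h1 hM) => i _.
by elim: (m i) => [|k ih]; rewrite ?expr0// exprS; apply: hM.
Qed.
End MpolyInd.

Section Substitution.
Variables (n : nat) (K S : comNzRingType).

Lemma rmorph_mmap (T : comNzRingType) (g : {rmorphism S -> T})
    (f : {rmorphism K -> S}) (h : 'I_n -> S) (p : mpoly n K) :
  g (mmap f h p) = mmap (g \o f) (g \o h) p.
Proof.
rewrite /mmap rmorph_sum; apply: eq_bigr => m _; rewrite rmorphM /mmap1 /=.
by congr (_ * _); rewrite rmorph_prod; apply: eq_bigr => i _; rewrite rmorphXn.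
Qed.

Lemma eq_mmap (f f' : K -> S) (h h' : 'I_n -> S) p :
  f =1 f' -> h =1 h' -> mmap f h p = mmap f' h' p.
Proof.
move=> ff hh; rewrite /mmap; apply: eq_bigr => m _; rewrite ff; congr (_ * _).
by apply: eq_bigr => i _; rewrite hh.
Qed.

Lemma mmap_homog (f : {rmorphism K -> S}) (h : 'I_n -> S) (x : S) d p :
  p \is @ishomog1 n K d mdeg ->
  mmap f (fun i => x * h i) p = x ^+ d * mmap f h p.
Proof.
move=> /dhomogP hp; rewrite /mmap mulr_sumr [LHS]big_seq_cond [RHS]big_seq_cond.
apply: eq_bigr => m; rewrite andbT => /hp md; have {}md : mdeg m = d := md.
rewrite mulrCA; congr (_ * _); rewrite /mmap1 -md mdegE -prodrXr -big_split /=.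
by apply: eq_bigr => i _; rewrite exprMn.
Qed.

(** Both sides are derivations in [p] that vanish on constants, so it is enough to compare them on
    the variables. Applied to the derivative of [{poly K}], this is the chain rule along a
    parametrized curve. *)
Lemma mmap_deriv (f : {rmorphism K -> S}) (h : 'I_n -> S) (D : S -> S) p :
  (forall x y, D (x + y) = D x + D y) ->
  (forall x y, D (x * y) = D x * y + x * D y) ->
  (forall c, D (f c) = 0) ->
  D (mmap f h p) = \sum_i mmap f h (mderiv i p) * D (h i).
Proof.
move=> DD DM DC; elim/mpoly_ring_ind: p => [c|j|p q ihp ihq|p q ihp ihq].
- by rewrite mmapC DC big1// => i _; rewrite mderivC mmap0 mul0r.
- rewrite mmapX mmap1U (bigD1 j)//= big1 ?addr0.
    have e0 : mnm_sub (mnm1 j) (mnm1 j) = mnm0.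
      by apply/mnmP => k; rewrite mnmBE mnm0E subnn.
    by rewrite mderivX mnm1E eqxx scale1r e0 mmapX mmap11 mul1r.
  move=> i ij; rewrite mderivX mnm1E eq_sym (negbTE ij).
  by rewrite scale0r mmap0 mul0r.
- rewrite mmapD DD ihp ihq -big_split /=; apply: eq_bigr => i _.
  by rewrite mderivD mmapD mulrDl.
- rewrite rmorphM DM ihp ihq mulr_suml mulr_sumr -big_split /=.
  apply: eq_bigr => i _; rewrite mderivM mmapD !rmorphM mulrDl.
  by rewrite /= mulrAC mulrA.
Qed.

End Substitution.

Section EvalForm.
Variable K : comNzRingType.
Implicit Types (f g : mpoly 3 K) (v w : 'rV[K]_3) (q : 'rV[{poly K}]_3).

Lemma eval_formD f g v : eval_form (f + g) v = eval_form f v + eval_form g v.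
Proof. exact: mevalD. Qed.
Lemma eval_formM f g v : eval_form (f * g) v = eval_form f v * eval_form g v.
Proof. exact: mevalM. Qed.
Lemma eval_formZ a f v : eval_form (a *: f) v = a * eval_form f v.
Proof. exact: mevalZ. Qed.
Lemma eval_formX f v d : eval_form (f ^+ d) v = eval_form f v ^+ d.
Proof. exact: rmorphXn. Qed.

Lemma eval_form_scale d f a v : is_form d f ->
  eval_form f (a *: v) = a ^+ d * eval_form f v.
Proof.
move=> fd; rewrite /eval_form /meval -(mmap_homog _ _ _ fd).
by apply: eq_mmap => // i; rewrite mxE.
Qed.

(* The restriction of [f] to the curve [u |-> (q_0(u), q_1(u), q_2(u))]. *)
Definition along (q : 'rV[{poly K}]_3) f : {poly K} :=
  mmap (polyC : {rmorphism K -> {poly K}}) (fun i => q 0 i) f.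

Definition curve_at (q : 'rV[{poly K}]_3) (u : K) : 'rV[K]_3 := \row_i (q 0 i).[u].

Lemma along_eval q f u : (along q f).[u] = eval_form f (curve_at q u).
Proof.
rewrite /along -[LHS]/(horner_eval u _) rmorph_mmap /eval_form /meval.
by apply: eq_mmap => [c|i] /=; rewrite /horner_eval ?hornerC ?mxE.
Qed.

Lemma along_deriv q f u :
  (along q f)^`().[u] = dot (grad f (curve_at q u)) (\row_i (q 0 i)^`().[u]).
Proof.
rewrite /along (@mmap_deriv _ _ _ _ _ (fun p => p^`())) => [|x y|x y|c].
- rewrite horner_sum /dot; apply: eq_bigr => i _; rewrite hornerM !mxE.
  by congr (_ * _); rewrite -along_eval.
- exact: derivD.
- exact: derivM.
- exact: derivC.
Qed.

Definition lineq v w : 'rV[{poly K}]_3 := \row_i ((v 0 i)%:P + (w 0 i) *: 'X).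

Lemma lineq_at v w u : curve_at (lineq v w) u = v + u *: w.
Proof. by apply/rowP => i; rewrite !mxE hornerD hornerC hornerZ hornerX mulrC. Qed.

Lemma lineq_deriv v w u : (\row_i (lineq v w 0 i)^`().[u]) = w.
Proof. by apply/rowP => i; rewrite !mxE derivD derivC add0r derivZ derivX hornerZ hornerC mulr1. Qed.

(** A monomial of degree [d] multiplies [d] polynomials of size at most [m.+1], and their
    coefficients of degree [m] multiply. The coefficient of degree [d * m] is thus the value of the
    form at the point at infinity of the curve, which no finite parameter reaches. *)
Lemma along_size q f d m : is_form d f -> (forall i, (size (q 0%R i) <= m.+1)%N) ->
  (size (along q f) <= (d * m).+1)%N /\
  (along q f)`_(d * m) = eval_form f (\row_i (q 0 i)`_m).
Proof.
move=> /dhomogP fd qm; have fd' e : e \in msupp f -> mdeg e = d := fd e.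
have key (p1 p2 : {poly K}) a b : (size p1 <= a.+1)%N -> (size p2 <= b.+1)%N ->
    (size (p1 * p2)%R <= (a + b).+1)%N /\ (p1 * p2)`_(a + b) = p1`_a * p2`_b.
  move=> s1 s2; split.
    by apply: leq_trans (size_polyMleq _ _) _; lia.
  rewrite coefM (bigD1 (@Ordinal (a + b).+1 a ltac:(lia)))//= big1 ?addr0.
    by congr (_ * _`_ _); lia.
  move=> [i ib]; rewrite -val_eqE /= => ia.
  have [ia'|ia'] := ltnP a i.
    by rewrite [p1`_i]nth_default ?mul0r//; exact: leq_trans s1 ia'.
  by rewrite [p2`__]nth_default ?mulr0//; apply: leq_trans s2 _; lia.
have keyX (p : {poly K}) e : (size p <= m.+1)%N ->
    (size (p ^+ e)%R <= (e * m).+1)%N /\ (p ^+ e)`_(e * m) = p`_m ^+ e.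
  move=> sp; elim: e => [|e [ih1 ih2]].
    by rewrite !expr0 mul0n size_poly1 coef1.
  rewrite !exprS mulSn; have [k1 k2] := key _ _ _ _ sp ih1.
  by split=> //; rewrite k2 ih2.
have keyP (e : multinom 3) : (size (mmap1 (fun i => q 0%R i) e) <= (mdeg e * m).+1)%N /\
   (mmap1 (fun i => q 0 i) e)`_(mdeg e * m) = \prod_i (q 0 i)`_m ^+ e i.
  rewrite /mmap1 mdegE big_distrl /=.
  elim: (index_enum (fintype_ordinal__canonical__fintype_Finite 3)) => [|i r [ih1 ih2]].
    by rewrite !big_nil size_poly1 coef1.
  rewrite !big_cons; have [k1 k2] := keyX (q 0 i) (e i) (qm i).
  have [l1 l2] := key _ _ _ _ k1 ih1.
  by split=> //; rewrite l2 k2 ih2.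
rewrite /along /mmap /eval_form mevalE; split.
  apply: leq_trans (size_sum _ _ _) _; apply/bigmax_leqP_seq => e ein _.
  apply: leq_trans (size_polyMleq _ _) _.
  have [h _] := keyP e; rewrite (fd' _ ein) in h.
  move: h (size_polyC_leq1 (mcoeff e f)); move: (size _) (size _) => x y; lia.
rewrite coef_sum big_seq [RHS]big_seq; apply: eq_bigr => e ein.
rewrite coefCM; congr (_ * _); have [_ h] := keyP e; rewrite -(fd' _ ein) h.
by apply: eq_bigr => i _; rewrite mxE.
Qed.

Lemma lineq_size v w i : (size (lineq v w 0%R i) <= 2)%N.
Proof.
rewrite !mxE; apply: leq_trans (size_polyD _ _) _; rewrite geq_max size_polyC.
by rewrite (leq_trans (size_scale_leq _ _)) ?size_polyX// andbT; case: (_ != 0).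
Qed.

Lemma lineq_lead v w : (\row_i (lineq v w 0 i)`_1) = w.
Proof. by apply/rowP => i; rewrite !mxE coefD coefC add0r coefZ coefX mulr1. Qed.

Lemma along_line_size d f v w : is_form d f ->
  (size (along (lineq v w) f) <= d.+1)%N /\ (along (lineq v w) f)`_d = eval_form f w.
Proof.
move=> fd; have [] := along_size fd (lineq_size v w).
by rewrite muln1 lineq_lead.
Qed.

End EvalForm.

(** * Bezout's bound *)

Section WeightedDet.
Variable K : comNzRingType.

(* [p] has degree at most [r - c], and [p = 0] if [r < c]. *)
Definition degle (p : {poly K}) (r c : nat) :=
  forall t, (r < t + c)%N -> p`_t = 0.

Definition top (p : {poly K}) (r c : nat) : K :=
  if (c <= r)%N then p`_(r - c) else 0.

Lemma degle_top_prod (I : Type) (s : seq I) (P : I -> {poly K}) (r c : I -> nat) :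
  (forall i, degle (P i) (r i) (c i)) ->
  degle (\prod_(i <- s) P i) (\sum_(i <- s) r i)%N (\sum_(i <- s) c i)%N /\
  top (\prod_(i <- s) P i) (\sum_(i <- s) r i)%N (\sum_(i <- s) c i)%N
    = \prod_(i <- s) top (P i) (r i) (c i).
Proof.
move=> hP; elim: s => [|i s [ih1 ih2]].
  rewrite !big_nil; split=> [t|]; last by rewrite /top /= coef1.
  by rewrite addn0 coef1; case: t.
rewrite !big_cons; set p := \prod_(_ <- s) _ in ih1 ih2 *.
set r' := (\sum_(_ <- s) _)%N in ih1 ih2 *; set c' := (\sum_(_ <- s) _)%N in ih1 ih2 *.
split=> [t ht|].
  rewrite coefM big1// => -[u /= ut] _.
  have [h|h] := ltnP (r i) (u + c i); first by rewrite hP ?mul0r.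
  by rewrite ih1 ?mulr0//; lia.
rewrite -ih2 /top; have [h1|h1] := leqP (c i) (r i); last first.
  have -> : P i = 0 by apply/polyP => t; rewrite coef0 hP//; lia.
  by rewrite !mul0r coef0 if_same.
have [h2|h2] := leqP c' r'; last first.
  have -> : p = 0 by apply/polyP => t; rewrite coef0 ih1//; lia.
  by rewrite !mulr0 coef0 if_same.
rewrite ifT; last lia.
rewrite coefM (bigD1 (@Ordinal (r i + r' - (c i + c')).+1 (r i - c i) ltac:(lia)))//=.
rewrite big1 ?addr0; first by congr (_ * _`_ _); lia.
move=> [u /= ut]; rewrite -val_eqE /= => ui.
have [h|h] := ltnP (r i) (u + c i); first by rewrite hP ?mul0r.
by rewrite ih1 ?mulr0//; lia.
Qed.

(** In the Leibniz expansion every permutation gives a product of the same weight, as it only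
    permutes the column weights. The coefficients of top weight therefore form the expansion of
    another determinant. *)
Lemma weighted_det n (M : 'M[{poly K}]_n) (r c : 'I_n -> nat) :
  (\sum_i c i <= \sum_i r i)%N ->
  (forall i j, degle (M i j) (r i) (c j)) ->
  (size (\det M) <= (\sum_i r i - \sum_i c i).+1)%N /\
  (\det M)`_(\sum_i r i - \sum_i c i)%N = \det (\matrix_(i, j) top (M i j) (r i) (c j)).
Proof.
move=> rc hM; rewrite /determinant.
have key (s : 'S_n) := degle_top_prod (index_enum (fintype_ordinal__canonical__fintype_Finite n)) (fun i => hM i (s i)).
have cs (s : 'S_n) : (\sum_i c (s i) = \sum_i c i)%N.
  by rewrite [RHS](reindex_inj (@perm_inj _ s)).
split.
  apply/leq_sizeP => t ht; rewrite coef_sum big1// => s _.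
  have [k1 _] := key s; rewrite cs in k1.
  by case: (odd_perm s); rewrite ?expr1 ?expr0 ?mulN1r ?mul1r ?coefN k1 ?oppr0//; lia.
rewrite coef_sum; apply: eq_bigr => s _.
have [_ k2] := key s; rewrite cs in k2.
have -> : \prod_i (\matrix_(i, j) top (M i j) (r i) (c j)) i (s i)
   = \prod_i top (M i (s i)) (r i) (c (s i)) by apply: eq_bigr => i _; rewrite mxE.
rewrite -k2 /top rc.
by case: (odd_perm s); rewrite ?expr1 ?expr0 ?mulN1r ?mul1r ?coefN.
Qed.

(* Two variables: the outer indeterminate is [z], the inner one is [x]. *)
Definition wdeg d (p : {poly {poly K}}) := forall l i, (d < i + l)%N -> p`_l`_i = 0.

(** The part of total degree [d], taken at x = 1; its roots are points of the curve on the line at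
    infinity. *)
Definition topform d (p : {poly {poly K}}) : {poly K} :=
  \poly_(l < d.+1) p`_l`_(d - l).

(** The Sylvester matrix with explicit block sizes, so that the matrices for two polynomials and for
    their top forms have the same type. *)
Definition syl (S : nzRingType) h g (u v : {poly S}) : 'M[S]_(g + h) :=
  \matrix_(i < g + h, j < g + h) match fintype.split i with
    | inl k => u`_(j - k) *+ (k <= j)%N | inr k => v`_(j - k) *+ (k <= j)%N end.

Lemma resultant_syl (S : comNzRingType) h g (u v : {poly S}) :
  size u = h.+1 -> size v = g.+1 -> resultant u v = \det (syl h g u v).
Proof.
move=> su sv; have -> : h = (size u).-1 by rewrite su.
have -> : g = (size v).-1 by rewrite sv.
by congr (\det _); apply/matrixP => i j; rewrite Sylvester_mxE mxE.
Qed.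

(** Rows of [p] get the weights h + k, rows of [q] the weights g + k, and column j the weight j. An
    entry then has degree at most row weight minus column weight, and the total weights of rows and
    columns differ by h g. *)
Lemma resultant_wdeg h g (p q : {poly {poly K}}) :
  size p = h.+1 -> size q = g.+1 -> wdeg h p -> wdeg g q ->
  (size (resultant p q) <= (h * g).+1)%N /\
  (size (topform h p) = h.+1 -> size (topform g q) = g.+1 ->
   (resultant p q)`_(h * g) = resultant (topform h p) (topform g q)).
Proof.
move=> sp sq wp wq; rewrite (resultant_syl sp sq).
pose r (i : 'I_(g + h)) : nat :=
  match fintype.split i with inl k => h + k | inr k => g + k end%N.
pose c (j : 'I_(g + h)) : nat := j.
have rc : (\sum_i r i = \sum_i c i + h * g)%N.
  rewrite !big_split_ord /=.
  under eq_bigr do rewrite /r (unsplitK (inl _)).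
  rewrite [X in (_ + X)%N](eq_bigr (fun i : 'I_h => g + i)%N); last first.
    by move=> i _; rewrite /r (unsplitK (inr _)).
  rewrite !big_split /= !sum_nat_const !card_ord; lia.
have hr i j : degle (syl h g p q i j) (r i) (c j).
  move=> t; rewrite mxE /r /c; case: (fintype.split i) => k ht.
    by case: leqP => kj; rewrite ?mulr0n ?coef0// mulr1n wp//; lia.
  by case: leqP => kj; rewrite ?mulr0n ?coef0// mulr1n wq//; lia.
have [|hs ht] := @weighted_det (g + h) (syl h g p q) r c _ hr.
  by rewrite rc; lia.
rewrite rc in hs ht; rewrite (_ : (_ + h * g - _)%N = h * g)%N in hs ht; last lia.
split=> // tp tq; rewrite ht (resultant_syl tp tq); congr (\det _).
apply/matrixP => i j; rewrite !mxE /top /r /c; case: (fintype.split i) => k.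
  have [kj|kj] := leqP k j; last first.
    by rewrite !mulr0n coef0 if_same.
  rewrite !mulr1n coef_poly; have [jk|jk] := ltnP (j - k) h.+1.
    by rewrite ifT; [congr (nth _ _ _); lia|lia].
  by rewrite ifF//; lia.
have [kj|kj] := leqP k j; last first.
  by rewrite !mulr0n coef0 if_same.
rewrite !mulr1n coef_poly; have [jk|jk] := ltnP (j - k) g.+1.
  by rewrite ifT; [congr (nth _ _ _); lia|lia].
by rewrite ifF//; lia.
Qed.

End WeightedDet.

Section TwoVariables.
Variable K : numClosedFieldType.
Implicit Types (p q : {poly {poly K}}) (f : mpoly 3 K) (v w : 'rV[K]_3).

Lemma natK_inj : injective (fun n : nat => n%:R : K).
Proof. by move=> m n /eqP; rewrite eqr_nat => /eqP. Qed.

Lemma poly0_of_roots (p : {poly K}) : (forall x, x != 0 -> p.[x] = 0) -> p = 0.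
Proof.
move=> hp; apply/eqP/negPn/negP => p0.
have := max_poly_roots p0 (rs := [seq n.+1%:R | n <- iota 0 (size p)]).
rewrite size_map size_iota ltnn => h; suff: false by []; apply: h.
  by apply/allP => _ /mapP[n _ ->]; rewrite rootE hp// pnatr_eq0.
by rewrite map_inj_uniq ?iota_uniq// => m n /natK_inj [].
Qed.

Lemma common_root (p q : {poly K}) : (1 < size (gcdp p q))%N ->
  exists x, root p x /\ root q x.
Proof.
move=> s; have /closed_rootP[x rx] : size (gcdp p q) != 1%N by rewrite neq_ltn s orbT.
by exists x; apply/andP; rewrite -root_gcd.
Qed.

Definition specx (a : K) : {rmorphism {poly {poly K}} -> {poly K}} :=
  map_poly (horner_eval a).

Lemma specx_eval a p b : (specx a p).[b] = p.[b%:P].[a].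
Proof.
by rewrite -[RHS]/(horner_eval a _) -horner_map /= /horner_eval hornerC.
Qed.

Lemma wdegM h g p q : wdeg h p -> wdeg g q -> wdeg (h + g) (p * q).
Proof.
move=> wp wq l i hi; rewrite coefM coef_sum big1// => -[l' hl] _ /=.
rewrite coefM big1// => -[i' hi'] _ /=.
have [hh|hh] := ltnP h (i' + l'); first by rewrite wp ?mul0r.
by rewrite wq ?mulr0//; lia.
Qed.

(* Substituting [t ^+ N] for [x] and [t ^+ N.+1] for [z] makes the total degree
   additive. *)
Definition kron N p : {poly K} :=
  (map_poly (fun c : {poly K} => c \Po 'X^N) p).['X^(N.+1)].

Lemma kronM N p q : kron N (p * q) = kron N p * kron N q.
Proof.
have -> : kron N = (fun p => (map_poly (comp_poly ('X^N : {poly K})) p).['X^(N.+1)]) by [].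
by rewrite /= rmorphM hornerM.
Qed.

Lemma kron_coef N p l i : (0 < N)%N -> (size p <= N)%N -> (l < N)%N ->
  (kron N p)`_(N * (i + l) + l) = p`_l`_i.
Proof.
move=> N0 sp lN; rewrite /kron horner_poly coef_sum.
have key (c : {poly K}) l' t : (l' < N)%N -> ((c \Po 'X^N) * 'X^(N.+1) ^+ l')`_(N * t + l) =
    if (l == l')%N && (l <= t)%N then c`_(t - l) else 0.
  move=> l'N; rewrite -exprM coefMXn coef_comp_poly_Xn//; have [->|ll'] := eqVneq l l'.
    have -> : (N * t + l' < N.+1 * l')%N = (t < l')%N.
      by rewrite mulSn addnC ltn_add2l ltn_mul2l N0.
    rewrite [X in _ = (if X then _ else _)]leqNgt; case: ltnP => //= lt.
    have -> : (N * t + l' - N.+1 * l' = N * (t - l'))%N by rewrite mulnBr; lia.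
    by rewrite dvdn_mulr// mulKn.
  case: ltnP => //= h; case: ifP => // /dvdnP[m hm]; exfalso.
  have e : (t * N + l = (m + l') * N + l')%N by lia.
  have := congr1 (modn^~ N) e; rewrite /= !modnMDl !modn_small// => e'.
  by rewrite e' eqxx in ll'.
have [sl|sl] := ltnP l (size p); last first.
  rewrite (nth_default _ sl) coef0 big1// => -[l' hl] _ /=.
  rewrite key ?(leq_trans hl)//; case: eqP => //= ll'.
  by move: hl; rewrite -ll' ltnNge sl.
rewrite (bigD1 (Ordinal sl))//= big1 ?addr0.
  by rewrite key ?(leq_trans sl)// eqxx leq_addl /= addnK.
move=> [l' hl]; rewrite -val_eqE /= => ll'.
by rewrite key ?(leq_trans hl)// eq_sym (negbTE ll').
Qed.

Lemma kron_coef_le N p k t : (0 < N)%N -> (size p <= k.+1)%N -> wdeg k p ->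
  (N * k + k < t)%N -> (kron N p)`_t = 0.
Proof.
move=> N0 sp wp ht; rewrite /kron horner_poly coef_sum big1// => -[l hl] _ /=.
rewrite -exprM coefMXn; case: ltnP => // h1.
rewrite coef_comp_poly_Xn//; case: ifP => // /dvdnP[m hm].
rewrite hm mulnK// wp//.
have hl' := leq_trans hl sp; rewrite ltnS in hl'.
rewrite -(ltn_pmul2l N0) mulnDr; lia.
Qed.

(** A term of [p] with i + l > h would give [kron N p] degree at least N (h + 1), while [q]
    contributes at least N g + g through its constant leading coefficient. Degrees add in K[t], and
    the sum exceeds N (h + g) + (h + g), the most that the total degree of the product allows,
    because N > h + g. *)
Lemma wdeg_factor h g p q (c : K) : size p = h.+1 -> size q = g.+1 -> c != 0 ->
  q`_g = c%:P -> wdeg (h + g) (p * q) -> wdeg h p.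
Proof.
move=> sp sq c0 qg wpq l i hi.
pose N := (h + g).+1.
have spq : (size (p * q)%R <= (h + g).+1)%N.
  by apply: leq_trans (size_polyMleq _ _) _; rewrite sp sq; lia.
have [hl|hl] := ltnP h l; first by rewrite [p`_l]nth_default ?sp// coef0.
apply/eqP/negPn/negP => pli.
have kp : (kron N p)`_(N * (i + l) + l) != 0.
  by rewrite kron_coef// ?sp /N; lia.
have kq : (kron N q)`_(N * g + g) != 0.
  have := @kron_coef N q g 0; rewrite add0n => ->; rewrite ?sq /N; try lia.
  by rewrite qg coefC.
have sz (r : {poly K}) t : r`_t != 0 -> (t < size r)%N.
  by move=> rt; rewrite ltnNge; apply: contraNN rt => ?; rewrite nth_default.
have s1 := sz _ _ kp; have s2 := sz _ _ kq.
have n1 : kron N p != 0 by rewrite -size_poly_gt0; lia.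
have n2 : kron N q != 0 by rewrite -size_poly_gt0; lia.
have s3 : (size (kron N (p * q)) <= (N * (h + g) + (h + g)).+1)%N.
  by apply/leq_sizeP => t ht; exact: (@kron_coef_le N _ (h + g) t isT spq wpq).
rewrite kronM size_mul// in s3.
have hN : (h + g < N)%N by [].
have : (N * h.+1 <= N * (i + l))%N by rewrite leq_mul2l hi orbT.
move: s1 s2 s3 hN; clear; clearbody N.
by move: (size _) (size _) => x y; lia.
Qed.

(** Gauss's lemma over K[x], K being algebraically closed: the roots a of [d] are removed one at a
    time. At x = a the product [q * r] vanishes, hence so does one of its factors, and x - a divides
    all the coefficients of that factor. *)
Lemma gauss_split (d : {poly K}) (p q r : {poly {poly K}}) : d != 0 -> d *: p = q * r ->
  exists q' r', [/\ p = q' * r', size q' = size q & size r' = size r].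
Proof.
have [n] := ubnP (size d); elim: n d q r => // n ih d q r hn d0 e.
have [/closed_rootP[a ra]|] := boolP (size d != 1%N); last first.
  rewrite negbK => /size_poly1P [c c0 dc].
  exists ((c^-1)%:P *: q), r; split=> //.
    rewrite -scalerAl -e dc scalerA -polyCM mulVf// scale1r //.
  by rewrite size_scale// polyC_eq0 invr_eq0.
have [d1 dd] := factor_theorem d a ra.
have d10 : d1 != 0 by apply: contraNneq d0 => d10; rewrite dd d10 mul0r.
have sd : (size d1 < n)%N.
  by move: hn; rewrite dd size_mul ?polyXsubC_eq0// size_XsubC; move: (size d1) => x; lia.
have key q1 r1 : (d1 * ('X - a%:P)) *: p = q1 * r1 -> specx a q1 = 0 ->
   exists q', [/\ d1 *: p = q' * r1 & size q' = size q1].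
  move=> e1 sq; pose q' := map_poly (fun c : {poly K} => c %/ ('X - a%:P)) q1.
  have q'q : q1 = ('X - a%:P) *: q'.
    apply/polyP => i; rewrite coefZ coef_map_id0 ?div0p// mulrC divpK//.
    have := congr1 (fun p : {poly K} => p`_i) sq.
    by rewrite /specx coef0 coef_map /= /horner_eval => qi; rewrite dvdp_XsubCl rootE qi.
  exists q'; split; last by rewrite q'q size_scale// polyXsubC_eq0.
  have x0 : ('X - a%:P)%:P != 0 :> {poly {poly K}} by rewrite polyC_eq0 polyXsubC_eq0.
  by apply: (mulfI x0); rewrite !mul_polyC scalerA mulrC e1 scalerAl -q'q.
have : specx a (q * r) = 0.
  apply/polyP => i; rewrite -e /specx coef_map coefZ /= /horner_eval hornerM.
  by move/rootP: ra => ->; rewrite mul0r coef0.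
rewrite rmorphM => /eqP; rewrite mulf_eq0 => /orP[]/eqP sp.
  rewrite dd in e; have [q' [e' sq']] := key _ _ e sp.
  have [q'' [r'' [E1 E2 E3]]] := ih d1 q' r sd d10 e'.
  by exists q'', r''; rewrite E2 sq'.
rewrite dd mulrC in e; rewrite mulrC in e; rewrite [q * r]mulrC in e.
have [r' [e' sr']] := key _ _ e sp; rewrite mulrC in e'.
have [q'' [r'' [E1 E2 E3]]] := ih d1 q r' sd d10 e'.
by exists q'', r''; rewrite E3 sr'.
Qed.

(** If the top forms are coprime, the resultant has degree exactly h g > 0, so it has a root a,
    above which the two polynomials have a common root. Otherwise the top forms share a root: a
    common zero at infinity. *)
Lemma common_zero h g p q (c c' : K) : (0 < h)%N -> (0 < g)%N ->
  size p = h.+1 -> size q = g.+1 -> wdeg h p -> wdeg g q ->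
  c != 0 -> c' != 0 -> p`_h = c%:P -> q`_g = c'%:P ->
  (exists a b, p.[b%:P].[a] = 0 /\ q.[b%:P].[a] = 0) \/
  (exists b, root (topform h p) b /\ root (topform g q) b).
Proof.
move=> h0 g0 sp sq wp wq c0 c'0 ph qg.
have stop n (r : {poly {poly K}}) (d : K) : d != 0 -> r`_n = d%:P -> size (topform n r) = n.+1.
  move=> d0 rn; rewrite size_poly_eq// subnn rn coefC //.
have tp := stop _ _ _ c0 ph; have tq := stop _ _ _ c'0 qg.
have [sr /(_ tp tq) rt] := resultant_wdeg sp sq wp wq.
have [s|s] := ltnP 1 (size (gcdp (topform h p) (topform g q))).
  by right; apply: common_root.
left; have rn0 : (resultant p q)`_(h * g) != 0.
  by rewrite rt resultant_eq0 -leqNgt.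
have /closed_rootP[a /rootP ra] : size (resultant p q) != 1%N.
  rewrite neq_ltn orbC ltnNge; apply/orP; left; apply: contraNN rn0 => s1.
  by rewrite nth_default// (leq_trans s1)// muln_gt0 h0.
have : resultant (specx a p) (specx a q) = 0.
  rewrite -[RHS]ra -[RHS]/(horner_eval a _) map_resultant//.
    by rewrite lead_coefE sp /= /horner_eval ph hornerC.
  by rewrite lead_coefE sq /= /horner_eval qg hornerC.
move=> /eqP; rewrite resultant_eq0 => /common_root[b [/rootP r1 /rootP r2]].
by exists a, b; rewrite -!specx_eval.
Qed.

End TwoVariables.

Section Bezout.
Variable K : numClosedFieldType.
Implicit Types (f : mpoly 3 K) (v w : 'rV[K]_3).

Section Chart.
Variables a b e : 'rV[K]_3.

(** Dehomogenization in the basis (a, b, e): the coordinate of [b] is 1, the inner variable x is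
    that of [a] and the outer variable z that of [e]. *)
Definition aff f : {poly {poly K}} :=
  mmap (polyC \o polyC : {rmorphism K -> {poly {poly K}}})
    (fun i => (lineq b a 0 i)%:P + ((e 0 i)%:P)%:P * 'X) f.

Lemma aff_curve f (B : {poly K}) :
  (aff f).[B] = along (lineq b a + \row_i (e 0 i *: B)) f.
Proof.
rewrite -[LHS]/(horner_eval B _) rmorph_mmap; apply: eq_mmap => [c|i] /=.
  by rewrite /horner_eval hornerC.
by rewrite /horner_eval !hornerE !mxE mul_polyC.
Qed.

Lemma aff_eval f x z : (aff f).[z%:P].[x] = eval_form f (x *: a + b + z *: e).
Proof.
rewrite aff_curve along_eval; congr (eval_form _ _); apply/rowP => i.
by rewrite !mxE !hornerE; ring.
Qed.

Lemma aff_wdeg d f : is_form d f -> wdeg d (aff f) /\ (size (aff f) <= d.+1)%N.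
Proof.
move=> /dhomogP fd.
have h1 i : wdeg 1 ((lineq b a 0 i)%:P + ((e 0 i)%:P)%:P * 'X).
  move=> l j hl; rewrite coefD coefC coefCM coefX !mxE.
  case: l hl => [|[|l]] hl; rewrite /= ?mulr0 ?addr0 ?add0r ?mulr1 ?coef0//.
    by rewrite coefD coefC coefZ coefX; case: j hl => [|[|j]]//= _; rewrite mulr0 addr0.
  by rewrite coefC; case: j hl.
have wX (p : {poly {poly K}}) n : wdeg 1 p -> wdeg n (p ^+ n).
  move=> wp; elim: n => [|n ih]; last by rewrite exprS -add1n; apply: wdegM.
  by move=> l j; rewrite expr0 coef1; case: l => [|l] /=; rewrite ?coef0// coef1; case: j.
have hm (m : multinom 3) : wdeg (mdeg m)
    (mmap1 (fun i => (lineq b a 0 i)%:P + ((e 0 i)%:P)%:P * 'X) m).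
  rewrite /mmap1 mdegE.
  elim: (index_enum (fintype_ordinal__canonical__fintype_Finite 3)) => [|i r ih].
    by rewrite !big_nil => l j; rewrite coef1; case: l => [|l] /=; rewrite ?coef0// coef1; case: j.
  by rewrite !big_cons; apply: wdegM ih; apply: wX.
have w : wdeg d (aff f).
  move=> l j hl; rewrite /aff /mmap coef_sum coef_sum big_seq big1// => m /fd md.
  have {}md : mdeg m = d := md.
  move: (hm m); rewrite md; set M := mmap1 _ m => h2.
  transitivity ((((mcoeff m f)%:P)%:P * M)`_l`_j); first by [].
  by rewrite coefCM coefCM h2 ?mulr0.
split=> //; apply/leq_sizeP => l hl; apply/polyP => j; rewrite coef0 w//; lia.
Qed.

Lemma aff_lead d f : is_form d f -> (aff f)`_d = (eval_form f e)%:P.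
Proof.
move=> fd; have [w s] := aff_wdeg fd.
apply/polyP => -[|i]; rewrite coefC /=; last by rewrite w//; lia.
have [_ <-] := along_line_size b e fd.
have -> : along (lineq b e) f = specx 0 (aff f).
  rewrite rmorph_mmap; apply: eq_mmap => [c|i] /=.
    by rewrite map_polyC /= /horner_eval hornerC.
  rewrite rmorphD rmorphM /= !map_polyC /= map_polyX /horner_eval hornerC !mxE.
  by rewrite !hornerE -mul_polyC.
by rewrite coef_map /= /horner_eval horner_coef0.
Qed.

Lemma aff_size d f : is_form d f -> eval_form f e != 0 -> size (aff f) = d.+1.
Proof.
move=> fd fe; have [_ s] := aff_wdeg fd; apply/eqP; rewrite eqn_leq s ltnNge.
apply: contraNN fe => s'; move: (aff_lead fd); rewrite nth_default// => /esym/eqP.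
by rewrite polyC_eq0.
Qed.

End Chart.

(** The form vanishes identically on the degenerate line v + u v, so its derivative there is zero.
    This is Euler's relation without the factor d. *)
Lemma euler0 d f v : is_form d f -> eval_form f v = 0 -> dot (grad f v) v = 0.
Proof.
move=> fd fv; have := along_deriv (lineq v v) f 0.
rewrite lineq_at lineq_deriv scale0r addr0 => <-.
suff -> : along (lineq v v) f = 0 by rewrite deriv0 horner0.
apply: poly0_of_roots => x _; rewrite along_eval lineq_at.
by rewrite -{1}[v]scale1r -scalerDl (eval_form_scale _ _ fd) fv mulr0.
Qed.

Lemma grad_line f v w : dot (grad f v) w = (along (lineq v w) f)^`().[0].
Proof. by rewrite along_deriv lineq_at lineq_deriv scale0r addr0. Qed.

Lemma grad0_of_dirs d f v w1 w2 : is_form d f -> eval_form f v = 0 ->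
  det3 v w1 w2 != 0 -> dot (grad f v) w1 = 0 -> dot (grad f v) w2 = 0 ->
  grad f v = 0.
Proof.
move=> fd fv d0 h1 h2; apply: dot_eq0 => x.
by rewrite (det3_basis x d0) !dotDr !dotZr (euler0 fd fv) h1 h2 !mulr0 !addr0.
Qed.

Lemma deriv0_prod (p q : {poly K}) x : p.[x] = 0 -> q.[x] = 0 -> (p * q)^`().[x] = 0.
Proof. by move=> p0 q0; rewrite derivM !hornerE p0 q0 mulr0 mul0r addr0. Qed.

Definition smooth_form d f := is_form d f /\
  forall v, v != 0 -> eval_form f v = 0 -> grad f v != 0.

(* A factorization of a dehomogenized form yields a singular point, as the two
   factors have a common zero, possibly on the line at infinity. *)
Lemma smooth_irreducible d f a b e h g (p q : {poly {poly K}}) (c c' : K) : smooth_form d f ->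
  det3 a b e != 0 -> (0 < h)%N -> (0 < g)%N -> d = (h + g)%N ->
  aff a b e f = p * q -> size p = h.+1 -> size q = g.+1 ->
  c != 0 -> c' != 0 -> p`_h = c%:P -> q`_g = c'%:P -> False.
Proof.
move=> [fd fs] d0 h0 g0 dhg fpq sp sq c0 c'0 ph qg.
have [w _] := aff_wdeg a b e fd.
have wp : wdeg h p by apply: (wdeg_factor sp sq c'0 qg); rewrite -fpq -dhg.
have wq : wdeg g q by apply: (wdeg_factor sq sp c0 ph); rewrite mulrC addnC -fpq -dhg.
have evE x z : eval_form f (x *: a + b + z *: e) = p.[z%:P].[x] * q.[z%:P].[x].
  by rewrite -aff_eval fpq !hornerM.
have [[x [z [px qx]]]|[z [pz qz]]] := common_zero h0 g0 sp sq wp wq c0 c'0 ph qg.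
  pose v := x *: a + b + z *: e.
  have dv : det3 v a e != 0.
    have -> : det3 v a e = - det3 a b e by rewrite /det3 !mxE; ring.
    by rewrite oppr_eq0.
  have v0 : v != 0.
    by apply: contraNneq dv => ->; rewrite /det3 !mxE; apply/eqP; ring.
  have fv : eval_form f v = 0 by rewrite evE px mul0r.
  have /eqP[] := fs v v0 fv; apply: (grad0_of_dirs fd fv dv).
    rewrite grad_line; have -> : along (lineq v a) f =
        (p.[z%:P] \Po ('X + x%:P)) * (q.[z%:P] \Po ('X + x%:P)).
      apply/eqP; rewrite -subr_eq0; apply/eqP/poly0_of_roots => u _.
      rewrite !hornerE along_eval lineq_at !horner_comp !hornerE -evE.
      by apply/eqP; rewrite subr_eq0; apply/eqP; congr eval_form; apply/rowP => i; rewrite !mxE; ring.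
    by apply: deriv0_prod; rewrite horner_comp !hornerE.
  rewrite grad_line; have -> : along (lineq v e) f =
      (specx x p \Po ('X + z%:P)) * (specx x q \Po ('X + z%:P)).
    apply/eqP; rewrite -subr_eq0; apply/eqP/poly0_of_roots => u _.
    rewrite !hornerE along_eval lineq_at !horner_comp !specx_eval !hornerE -evE.
    by apply/eqP; rewrite subr_eq0; apply/eqP; congr eval_form; apply/rowP => i; rewrite !mxE; ring.
  by apply: deriv0_prod; rewrite horner_comp !hornerE specx_eval.
(* In the chart at infinity the coordinate of [a] is 1 and [y] is that of [b]; a factor r becomes
   y^n r(1/y, t/y). [hom n r t] is this polynomial in y, in a form that makes sense at y = 0, where
   the common zero lies. *)
pose hom n (r : {poly {poly K}}) (t : K) : {poly K} :=
  \sum_(l < n.+1) \sum_(i < n.+1) (r`_l`_i * t ^+ l) *: 'X^(n - l - i).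
have homE n (r : {poly {poly K}}) (t y : K) : size r = n.+1 -> wdeg n r -> y != 0 ->
    (hom n r t).[y] = y ^+ n * r.[(t / y)%:P].[y^-1].
  move=> sr wr y0; rewrite [X in _ = _ * X.[_]]horner_coef sr !horner_sum mulr_sumr.
  apply: eq_bigr => l _; rewrite horner_sum hornerM -polyC_exp hornerC.
  have sl : (size (r`_l)%R <= n.+1)%N by apply/leq_sizeP => j hj; rewrite wr//; lia.
  rewrite (horner_coef_wide _ sl) mulr_suml mulr_sumr; apply: eq_bigr => i _.
  rewrite hornerZ hornerXn; have [il|il] := leqP (i + l) n; last by rewrite wr// !mul0r mulr0.
  have -> : y ^+ n = y ^+ i * y ^+ l * y ^+ (n - l - i) by rewrite -!exprD; congr (_ ^+ _); lia.
  by rewrite !exprMn !exprVn; field; rewrite !expf_neq0.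
have hom0 n (r : {poly {poly K}}) t : wdeg n r -> (hom n r t).[0] = (topform n r).[t].
  move=> wr; rewrite horner_sum horner_poly; apply: eq_bigr => l _.
  rewrite horner_sum (bigD1 (@Ordinal n.+1 (n - l) ltac:(by rewrite ltnS leq_subr)))//=.
  rewrite subnn hornerZ hornerXn expr0n /= mulr1 big1 ?addr0// => -[i hi]; rewrite -val_eqE /= => il.
  have [hh|hh] := ltnP n (i + l); first by rewrite wr// mul0r scale0r horner0.
  have /negbTE nz : (n - l - i != 0)%N by lia.
  by rewrite hornerZ hornerXn expr0n nz mulr0.
pose v := a + z *: e.
have vE t y : y != 0 -> eval_form f (a + t *: e + y *: b) = (hom h p t).[y] * (hom g q t).[y].
  move=> y0; rewrite !homE// mulrACA -exprD -dhg -evE -(eval_form_scale _ _ fd).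
  congr eval_form; apply/rowP => i; rewrite !mxE; field; exact: y0.
have alE t : along (lineq (a + t *: e) b) f = hom h p t * hom g q t.
  apply/eqP; rewrite -subr_eq0; apply/eqP/poly0_of_roots => y y0.
  by rewrite !hornerE along_eval lineq_at vE// subrr.
have v0E t : eval_form f (a + t *: e) = (topform h p).[t] * (topform g q).[t].
  by rewrite -!hom0// -hornerM -alE along_eval lineq_at scale0r addr0.
move: pz qz => /rootP pz /rootP qz.
have fv : eval_form f v = 0 by rewrite v0E pz mul0r.
have dv : det3 v b e != 0.
  by have -> : det3 v b e = det3 a b e by rewrite /det3 !mxE; ring.
have v0 : v != 0.
  by apply: contraNneq dv => ->; rewrite /det3 !mxE; apply/eqP; ring.
have /eqP[] := fs v v0 fv; apply: (grad0_of_dirs fd fv dv); rewrite grad_line.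
  by rewrite alE; apply: deriv0_prod; rewrite hom0.
have -> : along (lineq v e) f =
      (topform h p \Po ('X + z%:P)) * (topform g q \Po ('X + z%:P)).
  apply/eqP; rewrite -subr_eq0; apply/eqP/poly0_of_roots => u _.
  rewrite !hornerE along_eval lineq_at !horner_comp !hornerE -v0E.
  by apply/eqP; rewrite subr_eq0; apply/eqP; congr eval_form; apply/rowP => i; rewrite !mxE; ring.
by apply: deriv0_prod; rewrite horner_comp !hornerE.
Qed.

(** The only property of forms and determinants that the choice of points in general position
    requires. *)
Definition polynomial_on_lines (phi : 'rV[K]_3 -> K) :=
  forall v w, exists p : {poly K}, forall u, p.[u] = phi (v + u *: w).

(** If v is good for the product so far and w for the next function, both restrict to nonzero
    polynomials on the line through v and w. Their product is nonzero, so some point of this line is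
    good for both. *)
Lemma generic_point (T : eqType) (s : seq T) (phi : T -> 'rV[K]_3 -> K) :
  (forall t, polynomial_on_lines (phi t)) -> (forall t, exists v, phi t v != 0) ->
  exists v, forall t, t \in s -> phi t v != 0.
Proof.
move=> hl hn.
suff : exists v, \prod_(t <- s) phi t v != 0.
  move=> [v hv]; exists v => t ts; apply: contraNneq hv => tv.
  by rewrite (big_rem t ts) /= tv mul0r.
have : polynomial_on_lines (fun v => \prod_(t <- s) phi t v) /\
    exists v, \prod_(t <- s) phi t v != 0; last by case.
elim: s => [|t s [ihl [v ihv]]].
  split; last by exists 0; rewrite big_nil oner_eq0.
  by move=> v w; exists 1 => u; rewrite big_nil hornerC.
split=> [x y|].
  have [p hp] := hl t x y; have [q hq] := ihl x y.
  by exists (p * q) => u; rewrite big_cons hornerM hp hq.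
have [w hw] := hn t; have [p hp] := hl t v (w - v); have [q hq] := ihl v (w - v).
have p0 : p != 0.
  by apply: contraNneq hw => p0; rewrite -[w](subrK v) addrC -(scale1r (w - v)) -hp p0 horner0.
have q0 : q != 0.
  by apply: contraNneq ihv => q0; have := hq 0; rewrite scale0r addr0 q0 horner0 => <-.
have [u hu] : exists u, (p * q).[u] != 0.
  apply: contrapT => h; have /eqP : p * q = 0.
    by apply: poly0_of_roots => u _; apply/eqP/negPn/negP => hu; apply: h; exists u.
  by rewrite mulf_eq0 (negbTE p0) (negbTE q0).
by exists (v + u *: (w - v)); rewrite big_cons -hp -hq -hornerM.
Qed.

Lemma det3_lines v w : polynomial_on_lines (det3 v w).
Proof.
move=> x y; exists ((det3 v w x)%:P + det3 v w y *: 'X) => u.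
by rewrite !hornerE /det3 !mxE; ring.
Qed.

Lemma form_lines f : polynomial_on_lines (eval_form f).
Proof. by move=> v w; exists (along (lineq v w) f) => u; rewrite along_eval lineq_at. Qed.

Lemma linesM phi psi : polynomial_on_lines phi -> polynomial_on_lines psi ->
  polynomial_on_lines (fun v => phi v * psi v).
Proof.
move=> h1 h2 v w; have [p hp] := h1 v w; have [q hq] := h2 v w.
by exists (p * q) => u; rewrite hornerM hp hq.
Qed.

Lemma double_root (p : {poly K}) x : p.[x] = 0 -> p^`().[x] = 0 ->
  ('X - x%:P) ^+ 2 %| p.
Proof.
move=> /rootP/factor_theorem[q ->]; rewrite derivM derivXsubC !hornerE subrr mulr0 add0r.
by move=> /rootP/factor_theorem[r ->]; rewrite -mulrA -expr2 dvdp_mulIr.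
Qed.

Lemma lead_const_factor (p q : {poly {poly K}}) (c : K) h g :
  size p = h.+1 -> size q = g.+1 -> c != 0 -> (p * q)`_(h + g) = c%:P ->
  exists c1 c2 : K, [/\ c1 != 0, c2 != 0, p`_h = c1%:P & q`_g = c2%:P].
Proof.
move=> sp sq c0.
have -> : (p * q)`_(h + g) = p`_h * q`_g.
  have := lead_coefM p q; rewrite !lead_coefE sp sq size_mul -?size_poly_gt0 ?sp ?sq//.
  by rewrite addSn addnS /=.
move=> e; have : size (p`_h * q`_g) == 1%N by rewrite e size_polyC c0.
rewrite size_mul_eq1 => /andP[/size_poly1P[c1 c10 ->] /size_poly1P[c2 c20 ->]].
by exists c1, c2.
Qed.

(** A zero resultant means a common factor over K(x), which [gauss_split] turns into a factorization
    of c over K[x]. By [smooth_irreducible] the common factor is then all of c, so c divides f,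
    against the point [b]. *)
Lemma resultant_neq0 d m c f a b e : smooth_form d c -> is_form m f ->
  (0 < d)%N -> (0 < m)%N -> det3 a b e != 0 ->
  eval_form c e != 0 -> eval_form f e != 0 ->
  eval_form c b = 0 -> eval_form f b != 0 ->
  resultant (aff a b e c) (aff a b e f) != 0.
Proof.
move=> cs fm d0 m0 abe ce fe cb fb; apply/negP; rewrite resultant_eq0 => s.
have sc := aff_size a b cs.1 ce; have sf := aff_size a b fm fe.
set p := aff a b e c in s sc *; set q := aff a b e f in s sf *.
set H := gcdp p q in s.
have /Pdiv.Idomain.dvdpP[[d1 G] /= d10 e1] := dvdp_gcdl p q.
have /Pdiv.Idomain.dvdpP[[d2 G'] /= d20 e2] := dvdp_gcdr p q.
have [p1 [p2 [pE s1 s2]]] := gauss_split d10 e1.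
have p0 : p != 0 by rewrite -size_poly_gt0 sc.
have p10 : p1 != 0 by apply: contraNneq p0 => h; rewrite pE h mul0r.
have p20 : p2 != 0 by apply: contraNneq p0 => h; rewrite pE h mulr0.
have [g sp1] : exists g, size p1 = g.+1.
  by exists (size p1).-1; rewrite prednK// size_poly_gt0.
have [h sp2] : exists h, size p2 = h.+1.
  by exists (size p2).-1; rewrite prednK// size_poly_gt0.
have dE : d = (g + h)%N.
  by move: sc; rewrite pE size_mul// sp1 sp2 addSn /= addnS => -[->].
have cl := aff_lead a b e cs.1; rewrite -/p pE dE in cl.
have [c1 [c2 [c10 c20 l1 l2]]] := lead_const_factor sp1 sp2 ce cl.
have h0 : (0 < h)%N by move: s; rewrite -/H -s2 sp2.
have [g0|] := posnP g; last first.
  by move=> g0; exact: (smooth_irreducible cs abe g0 h0 dE pE sp1 sp2 c10 c20 l1 l2).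
have /size_poly1P[u u0 Gu] : size G == 1%N by rewrite -s1 sp1 g0.
(* So far [p] divides only a multiple of [q] by a polynomial in x. Division of [q] by the monic [p']
   settles this: a nonzero multiple of the remainder is divisible by [p] and has smaller size, so
   the remainder is zero. *)
pose p' := ((eval_form c e)^-1)%:P *: p.
have p'm : p' \is monic.
  have sp' : size p' = d.+1 by rewrite size_scale// polyC_eq0 invr_eq0.
  rewrite monicE lead_coefE sp' coefZ /p (aff_lead a b e cs.1) -polyCM mulVf//.
have qE := Pdiv.RingMonic.rdivp_eq p'm q.
have sr : (size (Pdiv.Ring.rmodp q p') < size p')%N.
  by rewrite Pdiv.Ring.ltn_rmodpN0// monic_neq0.
set r := Pdiv.Ring.rmodp q p' in qE sr; set t := Pdiv.Ring.rdivp q p' in qE.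
have r0 : r = 0.
  apply/eqP/negPn/negP => r0.
  have sp' : size p' = size p by rewrite size_scale// polyC_eq0 invr_eq0.
  have E : (u * d2) *: r = p * (d1 *: G' - ((u * d2) * ((eval_form c e)^-1)%:P) *: t).
    have -> : r = q - t * p' by rewrite {1}qE addrC addKr.
    have e3 : u%:P * (d2%:P * q) = G' * (d1%:P * p).
      by rewrite [d2%:P * q]mul_polyC [d1%:P * p]mul_polyC e2 e1 Gu mulrCA.
    have -> : (u * d2) *: (q - t * p') = u%:P * (d2%:P * q) - u%:P * d2%:P * t * p'.
      by rewrite -mul_polyC rmorphM /=; ring.
    by rewrite e3 /p' -!mul_polyC !rmorphM /=; ring.
  have n0 : (u * d2) *: r != 0 by rewrite -mul_polyC mulf_neq0// polyC_eq0 mulf_neq0.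
  have X0 : d1 *: G' - ((u * d2) * ((eval_form c e)^-1)%:P) *: t != 0.
    by apply: contraNneq n0 => X0; rewrite E X0 mulr0.
  have : (size p <= size ((u * d2) *: r))%N.
    by rewrite E size_mul// -subn1 -addnBA ?size_poly_gt0// leq_addr.
  rewrite size_scale ?mulf_neq0// leqNgt -sp' sr //.
have ev f' : (aff a b e f').[0%:P].[0] = eval_form f' b.
  by rewrite aff_eval !scale0r addr0 add0r.
move: fb; rewrite -ev -/q qE r0 addr0 !hornerM /p' !hornerZ -/p.
by rewrite hornerM ev cb !mulr0 eqxx.
Qed.

(** Projection from a generic centre [e] gives each [P i] its own abscissa, a root of the resultant.
    As the resultant lies in the ideal of the two polynomials, it inherits a double root where both
    curves have contact with the line in direction [w i]. *)
Lemma bezout_resultant d m c f b N (P w : 'I_N -> 'rV[K]_3) :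
  smooth_form d c -> is_form m f -> (0 < d)%N -> (0 < m)%N ->
  b != 0 -> eval_form c b = 0 -> eval_form f b != 0 ->
  (forall i, eval_form c (P i) = 0 /\ eval_form f (P i) = 0) ->
  (forall i j, i != j -> indep (P i) (P j)) -> (forall i, indep (P i) (w i)) ->
  exists (r : {poly K}) (al : 'I_N -> K),
  [/\ r != 0, (size r <= (d * m).+1)%N, injective al, (forall i, root r (al i)) &
    forall i, dot (grad c (P i)) (w i) = 0 -> dot (grad f (P i)) (w i) = 0 ->
      ('X - (al i)%:P) ^+ 2 %| r].
Proof.
move=> cs fm d0 m0 b0 cb fb hP hPP hPw.
have [v0 cv0] : exists v, eval_form c v != 0.
  apply: contrapT => h; have c0 v : eval_form c v = 0.
    by apply/eqP/negPn/negP => hv; apply: h; exists v.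
  case/negP: (cs.2 b b0 cb); apply/eqP/dot_eq0 => x.
  rewrite grad_line (_ : along _ _ = 0) ?deriv0 ?horner0//.
  by apply: poly0_of_roots => u _; rewrite along_eval c0.
(* The centre avoids both curves, the lines joining two of the points, and the line through [P i] in
   direction [w i]. For i = j the condition only repeats that it is off c. *)
pose phi (t : (unit + 'I_N * 'I_N + 'I_N)%type) : 'rV[K]_3 -> K :=
  match t with
  | inl (inl _) => fun v => eval_form c v * eval_form f v
  | inl (inr (i, j)) => if i == j then eval_form c else det3 (P i) (P j)
  | inr i => det3 (P i) (w i) end.
have [||e he] := @generic_point _ (enum {: (unit + 'I_N * 'I_N + 'I_N)%type}) phi.
- case=> [[[]|[i j]]|i] /=; first exact: linesM (form_lines _) (form_lines _).
    by case: ifP => _; [exact: form_lines|exact: det3_lines].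
  exact: det3_lines.
- case=> [[[]|[i j]]|i] /=; last by have [x] := indep_det3 (hPw i); exists x.
    have [||v hv] := @generic_point _ [:: true; false] (fun t => eval_form (if t then c else f)).
    + by move=> t; exact: form_lines.
    + by case; [exists v0|exists b].
    by exists v; rewrite mulf_neq0 ?(hv true) ?(hv false) ?inE.
  have [_|ij] := eqVneq i j; first by exists v0.
  by have [x] := indep_det3 (hPP _ _ ij); exists x.
have ce : eval_form c e != 0.
  by have := he (inl (inl tt)) (mem_enum _ _); rewrite mulf_eq0 negb_or => /andP[].
have fe : eval_form f e != 0.
  by have := he (inl (inl tt)) (mem_enum _ _); rewrite mulf_eq0 negb_or => /andP[].
have he2 i j : i != j -> det3 (P i) (P j) e != 0.
  by move=> ij; have := he (inl (inr (i, j))) (mem_enum _ _); rewrite /= (negbTE ij).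
have he3 i : det3 (P i) (w i) e != 0 by exact: (he (inr i) (mem_enum _ _)).
have eindep v : v != 0 -> eval_form c v = 0 -> indep e v.
  move=> v0' cv x y xy; have [x0|x0] := eqVneq x 0.
    move: xy; rewrite x0 scale0r add0r => /eqP; rewrite scaler_eq0 (negbTE v0') orbF.
    by move=> /eqP.
  case/negP: ce; have -> : e = (- (y / x)) *: v.
    apply: (scalerI x0); rewrite scalerA mulrN mulrCA divff// mulr1 scaleNr.
    by apply/eqP; rewrite -addr_eq0 xy.
  by rewrite (eval_form_scale _ _ cs.1) cv mulr0.
have P0 i : P i != 0.
  apply: contraTneq (he3 i) => ->; rewrite negbK; apply/eqP; rewrite /det3 !mxE; ring.
(* [a] is chosen with [b] and all the [P i] off the line through [a] and [e], so that these points
   are finite in the chart. *)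
pose psi (t : option 'I_N) : 'rV[K]_3 -> K :=
  if t is Some i then det3 e (P i) else det3 e b.
have [||a ha] := @generic_point _ (enum {: option 'I_N}) psi.
- by case=> [i|]; exact: det3_lines.
- case=> [i|] /=; apply: indep_det3; apply: eindep => //; exact: (hP i).1.
have abe : det3 a b e != 0.
  have := ha None (mem_enum _ _); have -> : psi None a = - det3 a b e; last by rewrite oppr_eq0.
  by rewrite /psi /det3; ring.
have ape i : det3 a (P i) e != 0.
  have := ha (Some i) (mem_enum _ _); have -> : psi (Some i) a = - det3 a (P i) e; last by rewrite oppr_eq0.
  by rewrite /psi /det3; ring.
have coord v : det3 a v e != 0 -> exists x y z, y != 0 /\ v = y *: (x *: a + b + z *: e).
  move=> av; exists (det3 v b e / det3 a v e), (det3 a v e / det3 a b e), (det3 a b v / det3 a v e).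
  split; first by rewrite mulf_neq0// invr_eq0.
  rewrite {1}(det3_basis v abe) !scalerDr !scalerA; congr (_ *: _ + _ + _ *: _); field; exact/andP.
have /choice[X hX] : forall i, exists X : K * K * K,
    X.1.2 != 0 /\ P i = X.1.2 *: (X.1.1 *: a + b + X.2 *: e).
  by move=> i; have [x [y [z h]]] := coord _ (ape i); exists (x, y, z).
pose r := resultant (aff a b e c) (aff a b e f).
have sc := aff_size a b cs.1 ce; have sf := aff_size a b fm fe.
have r0 : r != 0 by exact: (resultant_neq0 cs fm d0 m0 abe ce fe cb fb).
have [||[u v] /= _ rE] := @resultant_in_ideal _ (aff a b e c) (aff a b e f).
- by rewrite sc.
- by rewrite sf.
have rev (B : {poly K}) : r = u.[B] * (aff a b e c).[B] + v.[B] * (aff a b e f).[B].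
  by rewrite -!hornerM -hornerD -rE hornerC.
have f0 g n i : is_form n g -> eval_form g (P i) = 0 ->
    (aff a b e g).[(X i).2%:P].[(X i).1.1] = 0.
  move=> gn; have [y0 {1}->] := hX i; rewrite (eval_form_scale _ _ gn) aff_eval => /eqP.
  by rewrite mulf_eq0 expf_eq0 (negbTE y0) andbF => /eqP.
exists r, (fun i => (X i).1.1); split=> //.
- have [_ _] := aff_wdeg a b e cs.1.
  have [w1 _] := aff_wdeg a b e cs.1; have [w2 _] := aff_wdeg a b e fm.
  by have [] := resultant_wdeg sc sf w1 w2.
- move=> i j xij; apply/eqP/negPn/negP => ij; case/negP: (he2 _ _ ij); apply/eqP.
  have [_ ->] := hX i; have [_ ->] := hX j; rewrite xij /det3 !mxE; ring.
- move=> i; apply/rootP; rewrite (rev (X i).2%:P) hornerD !hornerM.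
  by rewrite (f0 c d i cs.1 (hP i).1) (f0 f m i fm (hP i).2) !mulr0 addr0.
move=> i hc hf.
have [y0 PE] := hX i; set x := (X i).1.1 in PE *; set y := (X i).1.2 in y0 PE.
set z := (X i).2 in PE.
pose w1 := det3 (w i) b e / det3 a b e; pose w2 := det3 a (w i) e / det3 a b e.
pose w3 := det3 a b (w i) / det3 a b e.
have wE : w i = w1 *: a + w2 *: b + w3 *: e := det3_basis _ abe.
have w10 : w1 - w2 * x != 0.
  apply: contraNneq (he3 i) => h; rewrite PE wE.
  have -> : w1 = w2 * x by apply/eqP; rewrite -subr_eq0 h.
  apply/eqP; rewrite /det3 !mxE; ring.
pose z' := (w3 - w2 * z) / (w1 - w2 * x).
(* The line through [P i] in direction [w i] is the graph z = B(x); it is a graph because it misses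
   the centre of projection. *)
pose B : {poly K} := z%:P + z' *: ('X - x%:P).
have along0 g n : is_form n g -> eval_form g (P i) = 0 -> dot (grad g (P i)) (w i) = 0 ->
    ('X - x%:P) ^+ 2 %| (aff a b e g).[B].
  move=> gn gP gw; rewrite aff_curve; apply: double_root.
    rewrite along_eval; have -> : curve_at (lineq b a + \row_i (e 0 i *: B)) x = y^-1 *: P i.
      apply/rowP => j; rewrite !mxE /B !hornerE PE !mxE; field; exact: y0.
    by rewrite (eval_form_scale _ _ gn) gP mulr0.
  rewrite along_deriv.
  have -> : curve_at (lineq b a + \row_i (e 0 i *: B)) x = y^-1 *: P i.
    apply/rowP => j; rewrite !mxE /B !hornerE PE !mxE; field; exact: y0.
  have -> : \row_j ((lineq b a + \row_i (e 0 i *: B)) 0 j)^`().[x] =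
      (w1 - w2 * x)^-1 *: (w i - (w2 / y) *: P i).
    apply/rowP => j; rewrite !mxE /B !(derivD, derivC, derivZ, derivX, derivN) !(hornerD, hornerC, hornerZ, hornerN) PE wE !mxE /z'; field.
    by rewrite w10 y0.
  have gs t : dot (grad g (y^-1 *: P i)) t = (y^-1) ^+ n * (y * dot (grad g (P i)) t).
    rewrite -[t in LHS](scale1r) -(mulVf y0) -scalerA grad_line.
    have -> : along (lineq (y^-1 *: P i) (y^-1 *: (y *: t))) g =
        (y^-1 ^+ n)%:P * along (lineq (P i) (y *: t)) g.
      apply/eqP; rewrite -subr_eq0; apply/eqP/poly0_of_roots => s _.
      rewrite !(hornerD, hornerN, hornerM, hornerC) !along_eval !lineq_at.
      rewrite -(eval_form_scale _ _ gn) -[X in _ - X = 0](_ : eval_form g (y^-1 *: P i + s *: (y^-1 *: (y *: t))) = _) ?subrr//.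
      by congr eval_form; apply/rowP => j; rewrite !mxE; ring.
    by rewrite derivM derivC mul0r add0r hornerM hornerC -grad_line dotZr.
  rewrite gs dotZr dotDr gw add0r.
  have -> : - ((w2 / y) *: P i) = (- (w2 / y)) *: P i by rewrite scaleNr.
  by rewrite dotZr (euler0 gn gP) !mulr0.
by rewrite (rev B) dvdp_add// dvdp_mull//;
  [exact: along0 cs.1 (hP i).1 hc|exact: along0 fm (hP i).2 hf].
Qed.

(** A form of degree 0 is constant; if it had a zero it would vanish identically, with its
    gradient. *)
Lemma smooth_pos d c v : smooth_form d c -> v != 0 -> eval_form c v = 0 -> (0 < d)%N.
Proof.
move=> cs v0 cv; rewrite lt0n; apply/negP => /eqP d0.
have c0 x : eval_form c x = 0.
  have cst y : eval_form c y = eval_form c 0.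
    by rewrite -(scale0r y) (eval_form_scale _ _ cs.1) d0 mul1r.
  by rewrite cst -(cst v).
case/negP: (cs.2 v v0 cv); apply/eqP/dot_eq0 => x.
rewrite grad_line (_ : along _ _ = 0) ?deriv0 ?horner0//.
by apply: poly0_of_roots => u _; rewrite along_eval c0.
Qed.

Lemma indep_ex v : v != 0 -> exists w, indep v w.
Proof.
move=> /rV0Pn[i vi]; pose j := i + 1; exists (delta_mx 0 j) => x y.
have ji : (i == j) = false by move: i @j {vi}; apply: ord3P.
move=> /rowP h; have := h i; rewrite !mxE /= ji mulr0 addr0 => /eqP.
rewrite mulf_eq0 (negbTE vi) orbF => /eqP x0; split=> //.
by have := h j; rewrite !mxE x0 mul0r add0r !eqxx mulr1.
Qed.

(** The resultant has degree at most d m and distinct roots for distinct points. The point [b] of c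
    off f expresses that c is not a component of f. *)
Lemma bezout_card d m c f b N (P : 'I_N -> 'rV[K]_3) :
  smooth_form d c -> is_form m f -> (0 < m)%N ->
  b != 0 -> eval_form c b = 0 -> eval_form f b != 0 ->
  (forall i, P i != 0) ->
  (forall i, eval_form c (P i) = 0 /\ eval_form f (P i) = 0) ->
  (forall i j, i != j -> indep (P i) (P j)) -> (N <= d * m)%N.
Proof.
move=> cs fm m0 b0 cb fb P0 hP hPP.
have /choice[w hw] := fun i => indep_ex (P0 i).
have d0 := smooth_pos cs b0 cb.
have [r [al [r0 sr ai ra _]]] := bezout_resultant cs fm d0 m0 b0 cb fb hP hPP hw.
have := max_poly_roots r0 (rs := codom al); rewrite size_codom card_ord.
move=> h; rewrite -ltnS; apply: leq_trans sr; apply: h; last by apply/injectiveP.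
by apply/allP => _ /codomP[i ->].
Qed.

(** The root at the tangency is double. Once its square is divided out, the quotient has degree at
    most d m - 2 and still vanishes at the N - 1 other roots. *)
Lemma bezout_tangent d m c f b N (P : 'I_N -> 'rV[K]_3) (t : 'I_N) v :
  smooth_form d c -> is_form m f -> (0 < m)%N ->
  b != 0 -> eval_form c b = 0 -> eval_form f b != 0 ->
  (forall i, P i != 0) ->
  (forall i, eval_form c (P i) = 0 /\ eval_form f (P i) = 0) ->
  (forall i j, i != j -> indep (P i) (P j)) ->
  indep (P t) v -> dot (grad c (P t)) v = 0 -> dot (grad f (P t)) v = 0 ->
  (N < d * m)%N.
Proof.
move=> cs fm m0 b0 cb fb P0 hP hPP iv cv fv.
have /choice[w hw] := fun i => indep_ex (P0 i).
pose w' i := if i == t then v else w i.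
have hw' i : indep (P i) (w' i) by rewrite /w'; case: eqP => [->|].
have d0 := smooth_pos cs b0 cb.
have [r [al [r0 sr ai ra]]] := bezout_resultant cs fm d0 m0 b0 cb fb hP hPP hw'.
move=> /(_ t); rewrite /w' eqxx => /(_ cv fv) /dvdpP[q qE].
have q0 : q != 0 by apply: contraNneq r0 => q0; rewrite qE q0 mul0r.
have := max_poly_roots q0 (rs := [seq al i | i <- enum 'I_N & i != t]).
rewrite size_map (_ : size _ = N.-1); last first.
  have sN : size (enum 'I_N) = N by rewrite size_enum_ord.
  have := count_predC (pred1 t) (enum 'I_N).
  rewrite sN count_uniq_mem ?enum_uniq// mem_enum /= => h.
  by rewrite (size_filter (predC (pred1 t))) -[in RHS]h.
have sq : (size q).+2 = size r.
  rewrite qE size_mul// ?expf_neq0 ?polyXsubC_eq0// size_exp_XsubC; move: (size q) => x; lia.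
have Npos : (0 < N)%N by apply: leq_ltn_trans (ltn_ord t).
move=> h; have : (N.-1 < size q)%N.
  apply: h; last by rewrite map_inj_uniq//; apply: filter_uniq; apply: enum_uniq.
  rewrite all_map; apply/allP => i; rewrite mem_filter => /andP[it _] /=.
  have := ra i; rewrite qE rootM => /orP[//|]; rewrite rootE hornerE !hornerE.
  by rewrite expf_eq0 /= subr_eq0 => /eqP/ai ai'; rewrite ai' eqxx in it.
move: sq sr; move: (size q) (size r) => x y; lia.
Qed.

End Bezout.

(** * Topology of the real projective plane *)

Section PointwiseContinuity.
Variables (R : realType) (T : topologicalType) (x : T).
Implicit Types f g : T -> R.

Lemma contD f g : continuous_at x f -> continuous_at x g ->
  continuous_at x (fun y => f y + g y).
Proof. exact: continuousD. Qed.

Lemma contB f g : continuous_at x f -> continuous_at x g ->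
  continuous_at x (fun y => f y - g y).
Proof. exact: continuousB. Qed.

Lemma contM f g : continuous_at x f -> continuous_at x g ->
  continuous_at x (fun y => f y * g y).
Proof. exact: continuousM. Qed.

Lemma contC (c : R) : continuous_at x (fun _ : T => c).
Proof. exact: cst_continuous. Qed.

Lemma near_gt0 f : continuous_at x f -> 0 < f x -> \forall y \near x, 0 < f y.
Proof.
move=> fc fx; have h : nbhs (f x) [set y | 0 < y].
  by apply: open_nbhs_nbhs; split=> //; exact: open_gt.
exact: (fc _ h).
Qed.

Lemma near_lt0 f : continuous_at x f -> f x < 0 -> \forall y \near x, f y < 0.
Proof.
move=> fc fx; have h : nbhs (f x) [set y | y < 0].
  by apply: open_nbhs_nbhs; split=> //; exact: open_lt.
exact: (fc _ h).
Qed.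

Lemma contE f g : f =1 g -> continuous_at x g -> continuous_at x f.
Proof. by move=> /funext ->. Qed.

Lemma contV f : f x != 0 -> continuous_at x f -> continuous_at x (fun y => (f y)^-1).
Proof. exact: continuousV. Qed.

Lemma contX f n : continuous_at x f -> continuous_at x (fun y => f y ^+ n).
Proof.
move=> fc; elim: n => [|n ih].
  rewrite (_ : (fun _ => _) = fun=> 1); first exact: contC.
  by apply/funext => y; rewrite expr0.
rewrite (_ : (fun _ => _) = fun y => f y * f y ^+ n); first exact: contM.
by apply/funext => y; rewrite exprS.
Qed.

Lemma cont_comp (S : topologicalType) (h : T -> S) (g : S -> R) :
  continuous_at x h -> continuous_at (h x) g -> continuous_at x (fun y => g (h y)).
Proof. exact: continuous_comp. Qed.

Lemma cont_pair (U V : topologicalType) (f : T -> U) (g : T -> V) :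
  continuous_at x f -> continuous_at x g -> continuous_at x (fun y => (f y, g y)).
Proof. by move=> fc gc; exact: cvg_pair fc gc. Qed.

End PointwiseContinuity.

Lemma cont_fst (U V : topologicalType) (z : U * V) : continuous_at z fst.
Proof. exact: cvg_fst. Qed.

Lemma cont_snd (U V : topologicalType) (z : U * V) : continuous_at z snd.
Proof. exact: cvg_snd. Qed.

Section RP2Topology.
Variable R : realType.
Implicit Types (v w : 'rV[R]_3) (p q : RP2 R) (f : mpoly 3 R).

Let e0 : 'rV[R]_3 := delta_mx 0 i0.

Lemma e0_neq0 : [set v : 'rV[R]_3 | v != 0] e0.
Proof. by apply/eqP => /rowP /(_ i0); rewrite !mxE !eqxx; apply/eqP; rewrite oner_eq0. Qed.

(** The zero vector is sent to an arbitrary nonzero one, which makes [pt] a total function on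
    vectors. *)
Definition nzv v : nzvec R :=
  match pselect (v != 0) with
  | left h => SigSub (@mem_set _ [set v : 'rV[R]_3 | v != 0] v h)
  | right _ => SigSub (mem_set e0_neq0)
  end.

Lemma nzvK v : v != 0 -> set_val (nzv v) = v.
Proof. by move=> v0; rewrite /nzv; case: pselect => // h; rewrite set_valE. Qed.

Definition pt v : RP2 R := \pi_(RP2 R)%qT (nzv v).
Definition rep p : 'rV[R]_3 := set_val (repr p).

Lemma rep_neq0 p : rep p != 0.
Proof. by rewrite /rep set_valE; exact: (set_valP (repr p)). Qed.

Lemma nzv_val (x : nzvec R) : nzv (set_val x) = x.
Proof.
have x0 : set_val x != 0 by rewrite set_valE; exact: (set_valP x).
by apply: val_inj; rewrite -[LHS]/(val _); have := nzvK x0; rewrite !set_valE.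
Qed.

Lemma pt_rep p : pt (rep p) = p.
Proof. by rewrite /pt /rep nzv_val reprK. Qed.

Lemma pi_eqE (x y : nzvec R) :
  (\pi_(RP2 R)%qT x = \pi_(RP2 R)%qT y) <-> proportional x y.
Proof.
split=> [/eqmodP//|h]; exact/eqmodP.
Qed.

Lemma pt_eq v w : v != 0 -> w != 0 -> pt v = pt w <-> exists2 a, a != 0 & v = a *: w.
Proof.
move=> v0 w0; rewrite /pt pi_eqE; split.
  by move=> /asboolP[a a0]; rewrite !nzvK// => ->; exists a.
by move=> [a a0 e]; apply/asboolP; exists a => //; rewrite !nzvK.
Qed.

Lemma rep_pt v : v != 0 -> exists2 a, a != 0 & rep (pt v) = a *: v.
Proof. by move=> v0; apply/pt_eq; rewrite ?rep_neq0// pt_rep. Qed.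

Lemma pt_scale a v : a != 0 -> v != 0 -> pt (a *: v) = pt v.
Proof. by move=> a0 v0; apply/pt_eq; rewrite ?scaler_eq0 ?negb_or ?a0//; exists a. Qed.

Lemma real_points_pt d f v : is_form d f -> v != 0 ->
  real_points f (pt v) <-> eval_form f v = 0.
Proof.
move=> fd v0; have [a a0 e] := rep_pt v0; rewrite /real_points /= -/(rep _) e.
rewrite (eval_form_scale _ _ fd); split=> [/eqP|->]; last by rewrite mulr0.
by rewrite mulf_eq0 expf_eq0 (negbTE a0) andbF => /eqP.
Qed.

(** The projection is continuous and open: the saturation of an open set W of vectors is the union
    of its dilates, which is open. *)
Lemma nbhs_pt v (U : set (RP2 R)) : v != 0 ->
  nbhs (pt v) U <-> \forall w \near v, U (pt w).
Proof.
move=> v0.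
have oN : open [set w : 'rV[R]_3 | w != 0].
  have -> : [set w : 'rV[R]_3 | w != 0] = ~` [set 0].
    by apply/seteqP; split=> x /= /eqP.
  by apply: closed_openC; apply: accessible_closed_set1; apply: hausdorff_accessible; exact: norm_hausdorff.
split=> [|h].
  rewrite nbhsE => -[V [oV Vv] VU].
  have : open (\pi_(RP2 R)%qT @^-1` V) := oV.
  move=> [W oW WV].
  have Wv : W v.
    have : (set_val @^-1` W) (nzv v) by rewrite WV.
    by rewrite /= nzvK.
  have nW : nbhs v (W `&` [set w | w != 0]).
    by apply: open_nbhs_nbhs; split; [exact: openI|].
  apply: filterS nW => w [Ww w0]; apply: VU.
  have : (set_val @^-1` W) (nzv w) by rewrite /= nzvK.
  by rewrite WV.
have {}h : nbhs v (fun w => U (pt w)) := h.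
move: h; rewrite (nbhsE v) => -[W [oW Wv] WU].
rewrite nbhsE; exists (pt @` (W `&` [set w | w != 0])); last first.
  by move=> _ [w [Ww _] <-]; exact: WU.
split; last by exists v.
rewrite /open /= /quotient_open.
exists (\bigcup_(a in [set a : R | a != 0]) [set x : 'rV[R]_3 | W (a *: x)]).
  apply: bigcup_open => a _; apply: open_comp => // x _; exact: scaler_continuous.
apply/seteqP; split=> x /=.
  move=> [a a0 /= Wx]; have x0 : set_val x != 0 by rewrite set_valE; exact: (set_valP x).
  exists (a *: set_val x); first by split=> //=; rewrite scaler_eq0 negb_or a0.
  by rewrite pt_scale// /pt nzv_val.
move=> [w [Ww w0]]; rewrite -[x]nzv_val.
have x0 : set_val x != 0 by rewrite set_valE; exact: (set_valP x).
move/(pt_eq w0 x0) => [a a0 e]; exists a => //=.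
by rewrite nzvK// -e.
Qed.

Lemma pt_continuous v : v != 0 -> {for v, continuous pt}.
Proof. by move=> v0 U; rewrite nbhs_simpl => /(nbhs_pt _ v0). Qed.

Lemma continuous_at_pt (T : topologicalType) (g : RP2 R -> T) v : v != 0 ->
  {for v, continuous (g \o pt)} -> {for pt v, continuous g}.
Proof. by move=> v0 gc U gU; apply/(nbhs_pt _ v0); exact: gc. Qed.

Lemma continuous_pt (T : topologicalType) (g : RP2 R -> T) :
  (forall v, v != 0 -> {for v, continuous (g \o pt)}) -> continuous g.
Proof.
move=> h p; rewrite -[p]pt_rep; apply: continuous_at_pt; first exact: rep_neq0.
by apply: h; exact: rep_neq0.
Qed.

Lemma near_neq0 v : v != 0 -> \forall w \near v, w != 0.
Proof.
move=> v0; apply: (@open_nbhs_nbhs _ v [set w | w != 0]); split=> //.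
have -> : [set w : 'rV[R]_3 | w != 0] = ~` [set 0].
  by apply/seteqP; split=> x /= /eqP.
by apply: closed_openC; apply: accessible_closed_set1; apply: hausdorff_accessible; exact: norm_hausdorff.
Qed.

Definition lift_fun (T : Type) (g : 'rV[R]_3 -> T) : RP2 R -> T := g \o rep.

Lemma lift_fun_pt (T : Type) (g : 'rV[R]_3 -> T) v :
  (forall a v, a != 0 -> v != 0 -> g (a *: v) = g v) ->
  v != 0 -> lift_fun g (pt v) = g v.
Proof. by move=> h v0; have [a a0 e] := rep_pt v0; rewrite /lift_fun /= e h. Qed.

(** The choice of representatives [rep] is not continuous, but for a function invariant under
    scaling the composition with [pt] agrees with [g] near every nonzero vector. *)
Lemma lift_fun_continuous (T : topologicalType) (g : 'rV[R]_3 -> T) :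
  (forall a v, a != 0 -> v != 0 -> g (a *: v) = g v) ->
  (forall v, v != 0 -> {for v, continuous g}) -> continuous (lift_fun g).
Proof.
move=> h gc; apply: continuous_pt => v v0.
have e : \forall w \near v, g w = (lift_fun g \o pt) w.
  by apply: filterS (near_neq0 v0) => w w0 /=; rewrite lift_fun_pt.
have e1 : (lift_fun g \o pt) v = g v by rewrite -(nbhs_singleton e).
rewrite /prop_for /continuous_at e1.
exact: (cvg_trans (near_eq_cvg e) (gc v v0)).
Qed.

Lemma eval_form_continuous f : continuous (eval_form f).
Proof.
elim/mpoly_ring_ind: f => [c|i|f g ihf ihg|f g ihf ihg] v.
- rewrite (_ : eval_form _ = fun=> c); first exact: contC.
  by apply/funext => w; rewrite /eval_form mevalC.
- rewrite (_ : eval_form _ = fun w => w 0 i); first exact: coord_continuous.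
  by apply/funext => w; rewrite /eval_form mevalXU.
- rewrite (_ : eval_form _ = fun w => eval_form f w + eval_form g w).
    by apply: contD; [exact: ihf|exact: ihg].
  by apply/funext => w; rewrite eval_formD.
- rewrite (_ : eval_form _ = fun w => eval_form f w * eval_form g w).
    by apply: contM; [exact: ihf|exact: ihg].
  by apply/funext => w; rewrite eval_formM.
Qed.

Lemma dotvv_gt0 v : v != 0 -> 0 < dot v v.
Proof.
move=> v0; have h i : 0 <= v 0 i * v 0 i by rewrite -expr2 sqr_ge0.
rewrite lt_neqAle sumr_ge0// andbT eq_sym; apply: contraNneq v0 => /eqP.
rewrite psumr_eq0// => /allP hv; apply/eqP/rowP => i; rewrite mxE.
by have := hv i (mem_index_enum _); rewrite mulf_eq0 orbb => /eqP.
Qed.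

Lemma row_continuous (T : topologicalType) (g : T -> 'rV[R]_3) x :
  (forall i, continuous_at x (fun y => g y 0 i)) -> continuous_at x g.
Proof.
move=> h U [P hP PU].
have hj j : \forall y \near x, P 0 j (g y 0 j) := h j _ (hP 0 j).
near=> y; apply: PU => i j; rewrite (ord1 i).
by move: j; apply: ord3P; near: y; exact: hj.
Unshelve. all: by end_near. Qed.

Lemma dot_continuous v (g : 'rV[R]_3 -> 'rV[R]_3) w :
  {for w, continuous g} -> {for w, continuous (fun x => dot v (g x))}.
Proof.
move=> gc; rewrite (_ : (fun x => dot v (g x)) = fun x =>
  v 0 i0 * g x 0 i0 + v 0 i1 * g x 0 i1 + v 0 i2 * g x 0 i2); last first.
  by apply/funext => x; rewrite dotE.
have h i : {for w, continuous (fun x => g x 0 i)}.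
  exact: (@continuous_comp _ _ _ g (fun M : 'rV[R]_3 => M 0 i) w gc (@coord_continuous _ _ _ _ _ _)).
by do 2?[apply: contD]; apply: contM; try exact: contC; exact: h.
Qed.

Lemma dotvv_continuous : continuous (fun v => dot v v).
Proof.
move=> w; rewrite (_ : (fun v => dot v v) = fun v : 'rV[R]_3 =>
  v 0 i0 * v 0 i0 + v 0 i1 * v 0 i1 + v 0 i2 * v 0 i2); last first.
  by apply/funext => x; rewrite dotE.
by do 2?[apply: contD]; apply: contM; exact: coord_continuous.
Qed.

(* The values of a form of degree [2 * d] at unit vectors. *)
Definition evfun d f : RP2 R -> R := lift_fun (fun v => eval_form f v / dot v v ^+ d).

Lemma evfun_inv d f : is_form (2 * d) f -> forall (a : R) v, a != 0 -> v != 0 ->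
  eval_form f (a *: v) / dot (a *: v) (a *: v) ^+ d = eval_form f v / dot v v ^+ d.
Proof.
move=> fd a v a0 v0; rewrite (eval_form_scale _ _ fd) dotZl dotZr mulrA -expr2.
have := dotvv_gt0 v0 => /lt0r_neq0 d0.
rewrite exprMn -exprM; field.
by rewrite !expf_neq0.
Qed.

Lemma evfun_pt d f v : is_form (2 * d) f -> v != 0 ->
  evfun d f (pt v) = eval_form f v / dot v v ^+ d.
Proof. by move=> fd v0; apply: lift_fun_pt => //; exact: evfun_inv. Qed.

Lemma evfun_continuous d f : is_form (2 * d) f -> continuous (evfun d f).
Proof.
move=> fd; apply: lift_fun_continuous; first exact: evfun_inv.
move=> v v0; apply: contM; first exact: eval_form_continuous.
apply: contV; first by rewrite expf_neq0// lt0r_neq0// dotvv_gt0.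
by apply: contX; exact: dotvv_continuous.
Qed.

Lemma evfun_sg d f v : is_form (2 * d) f -> v != 0 ->
  Num.sg (evfun d f (pt v)) = Num.sg (eval_form f v).
Proof.
move=> fd v0; rewrite evfun_pt// sgrM (gtr0_sg (x := _^-1)) ?mulr1//.
by rewrite invr_gt0 exprn_gt0// dotvv_gt0.
Qed.

Lemma evfun_eq0 d f p : is_form (2 * d) f -> evfun d f p = 0 <-> real_points f p.
Proof.
move=> fd; rewrite -[p]pt_rep evfun_pt ?rep_neq0// (real_points_pt fd) ?rep_neq0//.
split=> [/eqP|->]; last by rewrite mul0r.
by rewrite mulf_eq0 invr_eq0 expf_eq0 (gt_eqF (dotvv_gt0 (rep_neq0 p))) andbF orbF => /eqP.
Qed.

Lemma proj_dist_inv w : forall (a : R) v, a != 0 -> v != 0 ->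
  dot (cross w (a *: v)) (cross w (a *: v)) / dot (a *: v) (a *: v) =
  dot (cross w v) (cross w v) / dot v v.
Proof.
move=> a v a0 v0.
have -> : cross w (a *: v) = a *: cross w v.
  by apply: row3P; rewrite !mxE /=; ring.
rewrite !dotZl !dotZr; have := dotvv_gt0 v0 => /lt0r_neq0 d0; field.
by rewrite a0 d0.
Qed.

(* Up to a constant, the squared sine of the angle between two lines. *)
Definition pdist w : RP2 R -> R :=
  lift_fun (fun v => dot (cross w v) (cross w v) / dot v v).

Lemma pdist_pt w v : v != 0 -> pdist w (pt v) = dot (cross w v) (cross w v) / dot v v.
Proof. by move=> v0; apply: lift_fun_pt => //; exact: proj_dist_inv. Qed.

Lemma cross_continuous w : continuous (cross w).
Proof.
have h i (M : 'rV[R]_3) : continuous_at M (fun v => v 0 i) by exact: coord_continuous.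
move=> v; apply: row_continuous; apply: ord3P;
  (apply: contE; first by move=> y; rewrite mxE /=; reflexivity);
  by apply: contB; apply: contM; try exact: contC; exact: h.
Qed.

Lemma pdist_continuous w : continuous (pdist w).
Proof.
apply: lift_fun_continuous; first exact: proj_dist_inv.
move=> v v0; apply: contM.
  apply: (@continuous_comp _ _ _ (cross w) (fun x => dot x x)).
    exact: cross_continuous.
  exact: dotvv_continuous.
by apply: contV; [rewrite lt0r_neq0// dotvv_gt0|exact: dotvv_continuous].
Qed.

Lemma RP2_hausdorff : hausdorff_space (RP2 R).
Proof.
rewrite open_hausdorff => p q pq.
have d0 : pdist (rep p) p = 0.
  rewrite -[X in pdist _ X](pt_rep p) pdist_pt ?rep_neq0//.
  have -> : cross (rep p) (rep p) = 0 by apply: row3P; rewrite !mxE /=; ring.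
  by rewrite dotE !mxE !mul0r !addr0 mul0r.
have d1 : 0 < pdist (rep p) q.
  rewrite -[X in pdist _ X](pt_rep q) pdist_pt ?rep_neq0// divr_gt0 ?dotvv_gt0 ?rep_neq0//.
  apply: contra_neq pq => c0; have [a e] := cross_dep (rep_neq0 p) c0.
  have a0 : a != 0 by apply: contraTneq (rep_neq0 q) => a0; rewrite e a0 scale0r eqxx.
  by rewrite -(pt_rep q) e pt_scale ?rep_neq0// pt_rep.
set c := pdist (rep p) q in d1.
exists (pdist (rep p) @^-1` [set x | x < c / 2], pdist (rep p) @^-1` [set x | c / 2 < x]) => /=.
  by split; apply/mem_set => /=; rewrite ?d0 -/c; lra.
split.
- by apply: open_comp; [move=> x _; exact: pdist_continuous|exact: open_lt].
- by apply: open_comp; [move=> x _; exact: pdist_continuous|exact: open_gt].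
- by apply/eqP/seteqP; split=> x //= [] /=; lra.
Qed.

(* The upper unit hemisphere as a graph over the unit disk. *)
Definition hemi (z : R * R) : 'rV[R]_3 :=
  \row_i (if i == i0 then z.1 else if i == i1 then z.2
          else Num.sqrt (1 - z.1 ^+ 2 - z.2 ^+ 2)).

Lemma hemi_neq0 z : hemi z != 0.
Proof.
apply/eqP => /rowP h; have h0 := h i0; have h1 := h i1; have h2 := h i2.
move: h2; rewrite !mxE /= in h0 h1 *; rewrite h0 h1 expr0n /= !subr0 sqrtr1.
by move/eqP; rewrite oner_eq0.
Qed.

Lemma hemi_continuous : continuous hemi.
Proof.
have f1 (z : R * R) : continuous_at z fst by exact: cvg_fst.
have f2 (z : R * R) : continuous_at z snd by exact: cvg_snd.
move=> z; apply: row_continuous; apply: ord3P;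
  (apply: contE; first by move=> y; rewrite mxE /=; reflexivity);
  [exact: f1|exact: f2|].
apply: (@cont_comp _ _ _ _ (fun x : R * R => 1 - x.1 ^+ 2 - x.2 ^+ 2) Num.sqrt); last exact: sqrt_continuous.
by apply: contB; [apply: contB; [exact: contC|]|]; apply: contX.
Qed.

Lemma hemi_surj p : exists z, [/\ z.1 ^+ 2 + z.2 ^+ 2 <= 1 & pt (hemi z) = p].
Proof.
pose v := rep p; have v0 : v != 0 := rep_neq0 p.
pose n := Num.sqrt (dot v v).
have n2 : n ^+ 2 = dot v v by rewrite sqr_sqrtr// ltW// dotvv_gt0.
have n0 : 0 < n by rewrite sqrtr_gt0 dotvv_gt0.
pose e : R := if 0 <= v 0 i2 then 1 else -1.
have e2 : e ^+ 2 = 1 by rewrite /e; case: ifP; rewrite ?sqrrN expr1n.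
have en0 : e != 0 by apply: contra_eq_neq e2 => ->; rewrite expr0n /= eq_sym oner_eq0.
have ev : 0 <= e * v 0 i2 by rewrite /e; case: ifPn => [h|]; [rewrite mul1r|rewrite -ltNge mulN1r oppr_ge0; exact: ltW].
have nv : 1 - (e / n * v 0 i0) ^+ 2 - (e / n * v 0 i1) ^+ 2 = (e / n * v 0 i2) ^+ 2.
  rewrite !exprMn exprVn n2 e2 !mul1r.
  have := dotvv_gt0 v0 => /lt0r_neq0; rewrite dotE => d0; field; exact: d0.
exists (e / n * v 0 i0, e / n * v 0 i1) => /=; split.
  by have := sqr_ge0 (e / n * v 0 i2); rewrite -nv -addrA -opprD subr_ge0.
have -> : hemi (e / n * v 0 i0, e / n * v 0 i1) = (e / n) *: v.
  apply: row3P; rewrite !mxE //= nv sqrtr_sqr ger0_norm// mulrAC divr_ge0// ltW//.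
by rewrite pt_scale ?pt_rep// mulf_neq0// invr_eq0 gt_eqF.
Qed.

Lemma compact_disk : compact (@unit_disk R).
Proof.
pose I : set R := `[-1, 1]%classic.
apply: (@subclosed_compact _ _ (I `*` I : set (R * R)%type)).
- have -> : @unit_disk R = (fun z : R * R => z.1 ^+ 2 + z.2 ^+ 2) @^-1` [set x | x <= 1] by [].
  apply: closed_comp; last exact: closed_le.
  by move=> z _; apply: contD; apply: contX; [exact: cvg_fst|exact: cvg_snd].
- by apply: compact_setX; exact: segment_compact.
- move=> [x y]; rewrite /unit_disk /= => h.
  have := sqr_ge0 x; have := sqr_ge0 y => y0 x0.
  by split; rewrite /I /= in_itv /=; apply/andP; split; nra.
Qed.

Lemma RP2_compact : compact [set: RP2 R].
Proof.
have -> : [set: RP2 R] = (pt \o hemi) @` (@unit_disk R).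
  by apply/seteqP; split=> p // _; have [z [z1 <-]] := hemi_surj p; exists z.
apply: continuous_compact; last exact: compact_disk.
apply: continuous_subspaceT => z.
apply: (@continuous_comp _ _ _ hemi pt); first exact: hemi_continuous.
by apply: pt_continuous; exact: hemi_neq0.
Qed.

End RP2Topology.

Arguments pt {R} v.
Arguments rep {R} p.
Arguments hemi {R} z.

(** * Continuous choice of an angle *)

Section Angle.
Variable R : realType.
Implicit Types (t x y : R) (z : R * R).

Definition has_angle (t a b : R) :=
  a = Num.sqrt (a ^+ 2 + b ^+ 2) * cos t /\ b = Num.sqrt (a ^+ 2 + b ^+ 2) * sin t.

Lemma sqrt_norm_gt0 (a b : R) : 0 < a ^+ 2 + b ^+ 2 -> 0 < Num.sqrt (a ^+ 2 + b ^+ 2).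
Proof. by rewrite sqrtr_gt0. Qed.

Lemma has_angle_exists (a b : R) : 0 < a ^+ 2 + b ^+ 2 -> exists t, has_angle t a b.
Proof.
move=> h; set r := Num.sqrt (a ^+ 2 + b ^+ 2); have r0 : 0 < r := sqrt_norm_gt0 h.
have r2 : r ^+ 2 = a ^+ 2 + b ^+ 2 by rewrite sqr_sqrtr// ltW.
have ab : -1 <= a / r <= 1.
  rewrite -ler_norml normrM normfV (gtr0_norm r0) ler_pdivrMr// mul1r.
  by rewrite -(@ler_pXn2r _ 2)// ?nnegrE ?(ltW r0)// -normrX ger0_norm ?sqr_ge0// r2 lerDl sqr_ge0.
have c : cos (acos (a / r)) = a / r by rewrite acosK// in_itv.
have s : sin (acos (a / r)) = `|b| / r.
  rewrite sin_acos// -[RHS]ger0_norm ?divr_ge0// ?ltW// -sqrtr_sqr.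
  by congr Num.sqrt; rewrite !exprMn !exprVn real_normK ?num_real// r2; field; rewrite gt_eqF.
have [b0|b0] := leP 0 b.
  exists (acos (a / r)); rewrite /has_angle -/r c s ger0_norm//.
  by split; field; rewrite gt_eqF.
exists (- acos (a / r)); rewrite /has_angle -/r cosN sinN c s ltr0_norm//.
by split; field; rewrite gt_eqF.
Qed.

(** The quotient of a' + i b' by a + i b has positive real part, so its argument is an arctangent,
    which depends continuously on the data. *)
Lemma has_angle_step t (a b a' b' : R) : 0 < a ^+ 2 + b ^+ 2 ->
  0 < a * a' + b * b' -> has_angle t a b ->
  has_angle (t + atan ((a * b' - b * a') / (a * a' + b * b'))) a' b'.
Proof.
move=> h; set re := a * a' + b * b'; set im := a * b' - b * a' => re0.
rewrite /has_angle; set r := Num.sqrt (a ^+ 2 + b ^+ 2) => -[ha hb].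
have r0 : 0 < r := sqrt_norm_gt0 h.
have r2 : r ^+ 2 = a ^+ 2 + b ^+ 2 by rewrite sqr_sqrtr// ltW.
have h' : 0 < a' ^+ 2 + b' ^+ 2.
  rewrite lt_neqAle addr_ge0 ?sqr_ge0// andbT eq_sym paddr_eq0 ?sqr_ge0// !sqrf_eq0.
  by apply: contraTN re0 => /andP[/eqP a'0 /eqP b'0]; rewrite /re a'0 b'0 !mulr0 addr0 ltxx.
set r' := Num.sqrt (a' ^+ 2 + b' ^+ 2).
have r'0 : 0 < r' := sqrt_norm_gt0 h'.
have r'2 : r' ^+ 2 = a' ^+ 2 + b' ^+ 2 by rewrite sqr_sqrtr// ltW.
have c : cos (atan (im / re)) = re / (r * r').
  rewrite cos_atan; have -> : 1 + (im / re) ^+ 2 = (r * r' / re) ^+ 2.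
    by rewrite !exprMn r2 r'2 exprVn /im /re; field; rewrite -/re gt_eqF.
  by rewrite sqrtr_sqr ger0_norm ?invf_div// divr_ge0// ?mulr_ge0// ltW.
have s : sin (atan (im / re)) = im / (r * r').
  have := atanK (im / re); rewrite /tan => /(canRL (divfK _)) -> //.
    by rewrite c; field; rewrite !gt_eqF.
  by rewrite c mulf_neq0 ?gt_eqF// invr_gt0 mulr_gt0.
have ct : cos t = a / r by rewrite [in RHS]ha; field; rewrite gt_eqF.
have st : sin t = b / r by rewrite [in RHS]hb; field; rewrite gt_eqF.
rewrite cosD sinD c s ct st; split.
  transitivity ((a * re - b * im) / r ^+ 2); last by field; rewrite !gt_eqF.
  rewrite /re /im r2; field; by rewrite gt_eqF.
transitivity ((b * re + a * im) / r ^+ 2); last by field; rewrite !gt_eqF.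
rewrite /re /im r2; field; by rewrite gt_eqF.
Qed.

Lemma has_angle_cosB t t' (a b a' b' : R) : 0 < a ^+ 2 + b ^+ 2 -> 0 < a' ^+ 2 + b' ^+ 2 ->
  has_angle t a b -> has_angle t' a' b' ->
  a * a' + b * b' = Num.sqrt (a ^+ 2 + b ^+ 2) * Num.sqrt (a' ^+ 2 + b' ^+ 2) * cos (t - t').
Proof.
move=> _ _; rewrite /has_angle cosB; move: (Num.sqrt _) (Num.sqrt _) => r r' [-> ->] [-> ->]; ring.
Qed.

Lemma has_angle_same t t' (a b : R) : 0 < a ^+ 2 + b ^+ 2 ->
  has_angle t a b -> has_angle t' a b -> cos (t - t') = 1.
Proof.
move=> h ht ht'; have := has_angle_cosB h h ht ht'.
rewrite -!expr2 sqr_sqrtr ?ltW// => /esym e; apply: (mulfI (lt0r_neq0 h)).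
by rewrite e mulr1.
Qed.

Lemma cos_eq1_ge2pi x : 0 < x -> cos x = 1 -> pi *+ 2 <= x.
Proof.
move=> x0 cx; rewrite leNgt; apply/negP => xp.
have s0 : 0 < sin (x / 2).
  apply: sin_gt0_pi; rewrite divr_gt0//= ltr_pdivrMr//.
  by move: xp; rewrite mulr2n; lra.
have := cx; rewrite [x in cos x](_ : x = (x / 2) *+ 2); last by rewrite mulr2n; field.
rewrite cos_mulr2n cos2sin2; have := exprn_gt0 2 s0.
by rewrite mulr2n; move: (sin (x / 2) ^+ 2) => u; lra.
Qed.

(** If the two end values differed, they would differ by at least 2 pi. By the intermediate value
    theorem [d] would then take the smaller end value plus pi, where the cosine is negative. *)
Lemma angle_const (d : R -> R) x y : x <= y ->
  (forall t, continuous_at t d) -> (forall t, x <= t <= y -> 0 < cos (d t)) ->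
  cos (d y - d x) = 1 -> d y = d x.
Proof.
move=> xy dc dpos c1.
have ivt v : Num.min (d x) (d y) <= v <= Num.max (d x) (d y) -> 0 < cos v.
  move=> hv; have [|t txy <-] := @IVT R d x y v xy _ hv.
    by apply: continuous_subspaceT => u; exact: dc.
  by apply: dpos; move: txy; rewrite in_itv.
have p0 := pi_gt0 R.
have [lt|lt|->//] := ltgtP (d x) (d y).
  have := cos_eq1_ge2pi (x := d y - d x); rewrite subr_gt0 lt => /(_ isT c1) h.
  have c0 : 0 < cos (d x) by apply: dpos; rewrite lexx xy.
  have : 0 < cos (d x + pi).
    apply: ivt; rewrite (min_l (ltW lt)) (max_r (ltW lt)); move: h; rewrite mulr2n => h.
    by apply/andP; split; lra.
  rewrite cosDpi; lra.
have := cos_eq1_ge2pi (x := d x - d y); rewrite subr_gt0 lt -[cos (d x - _)]cosN opprB.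
move=> /(_ isT c1) h.
have c0 : 0 < cos (d y) by apply: dpos; rewrite lexx xy.
have : 0 < cos (d y + pi).
  apply: ivt; rewrite (min_r (ltW lt)) (max_l (ltW lt)); move: h; rewrite mulr2n => h.
  by apply/andP; split; lra.
rewrite cosDpi; lra.
Qed.

Definition box (M : R) : set (R * R) := [set z | `|z.1| <= M /\ `|z.2| <= M].

Lemma box_compact M : compact (box M).
Proof.
pose I : set R := `[-M, M]%classic.
have -> : box M = (I `*` I : set (R * R)%type).
  apply/seteqP; split=> -[x y]; rewrite /box /I /= !in_itv /= !ler_norml => //.
by apply: compact_setX; exact: segment_compact.
Qed.

(** By compactness there is one step length below which two values of (a, b) make an acute angle, as
    [has_angle_step] requires. *)
Lemma angle_uniform (a b : R * R -> R) (M : R) :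
  continuous a -> continuous b -> (forall z, box M z -> 0 < a z ^+ 2 + b z ^+ 2) ->
  exists2 d : R, 0 < d & forall z w, box M z ->
    `|z.1 - w.1| < d -> `|z.2 - w.2| < d -> 0 < a z * a w + b z * b w.
Proof.
move=> ac bc ab0.
pose re z w := a z * a w + b z * b w.
have := (compact_near_coveringP (box M)).1 (@box_compact M) R (0^'+)
   (fun d z => forall w, `|z.1 - w.1| < d -> `|z.2 - w.2| < d -> 0 < re z w) _.
case=> [z Kz|e /= e0 he]; last first.
  exists (e / 2); first by rewrite divr_gt0.
  move=> z w Kz w1 w2; apply: (he (e / 2)) => //=; last by rewrite divr_gt0.
  by rewrite sub0r normrN gtr0_norm ?divr_gt0//; lra.
have cre : continuous_at (z, z) (fun p : (R * R) * (R * R) => re p.1 p.2).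
  have c1 : continuous_at (z, z) (fst : (R * R) * (R * R) -> R * R) by exact: cvg_fst.
  have c2 : continuous_at (z, z) (snd : (R * R) * (R * R) -> R * R) by exact: cvg_snd.
  by apply: contD; apply: contM; apply: cont_comp; try exact: c1; try exact: c2; [exact: ac|exact: ac|exact: bc|exact: bc].
have : \forall p \near (z, z), 0 < re p.1 p.2.
  by apply: (near_gt0 cre); rewrite /re -!expr2 ab0.
move=> [[U V] /= [Uz Vz] UV].
have [e /= e0 he] : exists2 e : R, 0 < e & forall w, `|z.1 - w.1| < e -> `|z.2 - w.2| < e -> U w /\ V w.
  have : nbhs z (U `&` V) by exact: filterI.
  move=> /nbhs_ballP[e /= e0 he]; exists e => // w w1 w2; apply: (he w); by split.
have e20 : 0 < e / 2 by rewrite divr_gt0.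
have n1 : \forall z' \near z, `|z.1 - z'.1| < e / 2.
  have c1 : continuous_at z (fst : R * R -> R) by exact: cvg_fst.
  by move/cvgrPdist_lt: c1; apply.
have n2 : \forall z' \near z, `|z.2 - z'.2| < e / 2.
  have c1 : continuous_at z (snd : R * R -> R) by exact: cvg_snd.
  by move/cvgrPdist_lt: c1; apply.
have n3 : \forall d \near 0^'+, d < e / 2 by exact: nbhs_right_lt.
near=> z' d => w w1 w2.
have h1 : `|z.1 - z'.1| < e / 2 by near: z'.
have h2 : `|z.2 - z'.2| < e / 2 by near: z'.
have hd : d < e / 2 by near: d.
apply: (UV (z', w)); split=> /=.
  by apply: (he z' _ _).1; apply: lt_trans (_ : e / 2 < e); rewrite // ltr_pdivrMr// ltr_pMr// ltr1n.
apply: (he w _ _).2.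
  by rewrite (splitr e) (le_lt_trans (ler_distD z'.1 _ _))// ltrD// (lt_trans w1).
by rewrite (splitr e) (le_lt_trans (ler_distD z'.2 _ _))// ltrD// (lt_trans w2).
Unshelve. all: by end_near. Qed.

(** A point is reached from the origin along its radius in n + 1 short steps; its angle is the
    initial one plus the sum of the arctangents of the steps. Each term is continuous in the
    point. *)
Lemma angle_lift (a b : R * R -> R) (M : R) : 0 < M ->
  continuous a -> continuous b -> (forall z, box M z -> 0 < a z ^+ 2 + b z ^+ 2) ->
  exists th : R * R -> R, forall z, `|z.1| < M -> `|z.2| < M ->
    continuous_at z th /\ has_angle (th z) (a z) (b z).
Proof.
move=> M0 ac bc ab0; have [d d0 hd] := angle_uniform ac bc ab0.
have [n hn] : exists n, M / n.+1%:R < d.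
  have := archi_boundP (divr_ge0 (ltW M0) (ltW d0)); set n := Num.bound _ => hn.
  exists n; rewrite ltr_pdivrMr// mulrC -ltr_pdivrMr// (lt_le_trans hn)// ler_nat.
  by [].
pose sc (j : nat) z : R * R := (j%:R / n.+1%:R * z.1, j%:R / n.+1%:R * z.2).
have n0 : 0 < n.+1%:R :> R by rewrite ltr0n.
have scb j z : (j <= n.+1)%N -> `|z.1| < M -> `|z.2| < M -> box M (sc j z).
  move=> jn z1 z2; have q1 : 0 <= (j%:R / n.+1%:R : R) <= 1.
    by rewrite divr_ge0//= ler_pdivrMr// mul1r ler_nat.
  move/andP: q1 => [q1 q2].
  by split; rewrite /= normrM (ger0_norm q1) (le_trans (ler_wpM2r (normr_ge0 _) q2))// mul1r ltW.
have scd j z : `|z.1| < M -> `|z.2| < M ->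
    `|(sc j z).1 - (sc j.+1 z).1| < d /\ `|(sc j z).2 - (sc j.+1 z).2| < d.
  have key (u : R) : `|u| < M -> `|j%:R / n.+1%:R * u - j.+1%:R / n.+1%:R * u| < d.
    move=> uM; rewrite -(natr1 j); have -> : j%:R / n.+1%:R * u - (j%:R + 1) / n.+1%:R * u = - (u / n.+1%:R).
      by field; rewrite gt_eqF.
    rewrite normrN normrM (ger0_norm (x := n.+1%:R^-1)) ?invr_ge0 ?ltW//.
    by apply: lt_trans hn; rewrite ltr_pM2r ?invr_gt0.
  by move=> z1 z2; split; exact: key.
have scc j : continuous (sc j).
  move=> z; apply: cont_pair; apply: contM; try exact: contC; [exact: cont_fst|exact: cont_snd].
pose ai j z := a (sc j z); pose bi j z := b (sc j z).
have aic j z : continuous_at z (ai j) by apply: cont_comp; [exact: scc|exact: ac].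
have bic j z : continuous_at z (bi j) by apply: cont_comp; [exact: scc|exact: bc].
have sc0 z : sc 0%N z = (0, 0) by rewrite /sc !mul0r.
have ab00 : 0 < a (0, 0) ^+ 2 + b (0, 0) ^+ 2 by apply: ab0; split; rewrite /= normr0 ltW.
have [t0 ht0] := has_angle_exists ab00.
pose re j z := ai j z * ai j.+1 z + bi j z * bi j.+1 z.
pose im j z := ai j z * bi j.+1 z - bi j z * ai j.+1 z.
pose th m z := t0 + \sum_(j < m) atan (im j z / re j z).
have thP m z : (m <= n.+1)%N -> `|z.1| < M -> `|z.2| < M ->
    continuous_at z (th m) /\ has_angle (th m z) (ai m z) (bi m z).
  move=> + z1 z2; elim: m => [|m ih] mn.
    rewrite /th /ai /bi sc0 big_ord0 addr0; split=> //.
    by under [X in continuous_at _ X]eq_fun do rewrite big_ord0; exact: contC.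
  have [ih1 ih2] := ih (ltnW mn).
  have re0 : 0 < re m z.
    by have [s1 s2] := scd m z z1 z2; apply: hd => //; apply: scb => //; exact: ltnW.
  split; last first.
    rewrite /th big_ord_recr /= addrA; apply: has_angle_step => //.
    by apply: ab0; apply: scb => //; exact: ltnW.
  rewrite (_ : th m.+1 = fun z => th m z + atan (im m z / re m z)); last first.
    by apply/funext => x; rewrite /th big_ord_recr /= addrA.
  apply: contD => //; apply: (@cont_comp _ _ _ _ (fun z => im m z / re m z) atan); last exact: continuous_atan.
  apply: contM; first by apply: contB; apply: contM.
  by apply: contV; [rewrite gt_eqF|apply: contD; apply: contM].
exists (th n.+1) => z z1 z2; have [h1 h2] := thP _ z (leqnn _) z1 z2; split=> //.
by move: h2; rewrite /ai /bi (_ : sc n.+1 z = z)//; rewrite /sc divff ?gt_eqF// !mul1r; case: z {z1 z2 h1}.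
Qed.

Lemma unit_angle (a b : R) t : has_angle t a b -> a ^+ 2 + b ^+ 2 = 1 ->
  a = cos t /\ b = sin t.
Proof. by rewrite /has_angle => -[ha hb] e; rewrite e sqrtr1 !mul1r in ha hb. Qed.

(** The angle is lifted on the upper hemisphere, a disk. What remains is that the lift agrees at
    opposite boundary points, which amounts to H^1(RP^2, Z) = 0. *)
Lemma RP2_angle (a b : RP2 R -> R) : continuous a -> continuous b ->
  (forall p, 0 < a p ^+ 2 + b p ^+ 2) ->
  exists th : RP2 R -> R, continuous th /\ forall p, has_angle (th p) (a p) (b p).
Proof.
move=> ac bc ab0.
have hc : continuous (pt \o @hemi R).
  move=> z; apply: continuous_comp; first exact: hemi_continuous.
  by apply: pt_continuous; exact: hemi_neq0.
have [||th hth] := @angle_lift (a \o pt \o @hemi R) (b \o pt \o @hemi R) 2 (ltr0Sn _ _) _ _ (fun z _ => ab0 _).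
- by move=> z; apply: (@cont_comp _ _ _ _ (pt \o @hemi R) a); [exact: hc|exact: ac].
- by move=> z; apply: (@cont_comp _ _ _ _ (pt \o @hemi R) b); [exact: hc|exact: bc].
have small (z : R * R) : unit_disk z -> `|z.1| < 2 /\ `|z.2| < 2.
  rewrite /unit_disk /= => h; have := sqr_ge0 z.1; have := sqr_ge0 z.2 => h1 h2.
  by rewrite !ltr_norml; split; apply/andP; split; nra.
pose ci (u : R) : R * R := (cos u, sin u).
have ci1 u : unit_disk (ci u) by rewrite /unit_disk /ci /= cos2Dsin2.
have cic : continuous ci.
  by move=> u; apply: cont_pair; [exact: continuous_cos|exact: continuous_sin].
have hemiN z : z.1 ^+ 2 + z.2 ^+ 2 = 1 -> pt (hemi (- z.1, - z.2)) = pt (hemi z).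
  move=> z1; have s0 : 1 - z.1 ^+ 2 - z.2 ^+ 2 = 0 by rewrite -z1; ring.
  have -> : hemi (- z.1, - z.2) = (-1) *: hemi z.
    by apply: row3P; rewrite !mxE /= ?sqrrN ?s0 ?sqrtr0 ?mulr0 ?mulN1r.
  by rewrite pt_scale ?hemi_neq0// oppr_eq0 oner_eq0.
(* The angles at opposite points differ by a multiple of 2 pi, which is constant along the circle.
   Half a turn changes its sign, so it is zero. *)
have antip z : z.1 ^+ 2 + z.2 ^+ 2 = 1 -> th (- z.1, - z.2) = th z.
  move=> z1.
  pose dl u := th (ci (u + pi)) - th (ci u).
  have dc u : continuous_at u dl.
    apply: contB; last by apply: cont_comp; [exact: cic|have [s1 s2] := small _ (ci1 u); exact: (hth _ s1 s2).1].
    apply: (@cont_comp _ _ _ _ (fun u => ci (u + pi)) th).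
      apply: (@continuous_comp _ _ _ (fun u => u + pi) ci); last exact: cic.
      by apply: contD; [exact: cvg_id|exact: contC].
    by have [s1 s2] := small _ (ci1 (u + pi)); exact: (hth _ s1 s2).1.
  have ciN u : ci (u + pi) = (- (ci u).1, - (ci u).2) by rewrite /ci cosDpi sinDpi.
  have d1 u : cos (dl u) = 1.
    have [s1 s2] := small _ (ci1 (u + pi)); have [t1 t2] := small _ (ci1 u).
    have [_ h1] := hth _ s1 s2; have [_ h2] := hth _ t1 t2.
    apply: has_angle_same h1 _; first exact: ab0.
    by move: h2; rewrite /= ciN hemiN// /ci /= cos2Dsin2.
  have d0 u : dl u = dl 0.
    have key x y : x <= y -> dl y = dl x.
      move=> xy; apply: angle_const => // [t _|]; first by rewrite d1.
      by rewrite cosB !d1 mulr1 (_ : sin (dl y) = 0) ?mul0r ?addr0//; apply/eqP;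
        rewrite -sqrf_eq0; have := cos2Dsin2 (dl y); rewrite d1 expr1n => /eqP; rewrite -subr_eq0 addrC addKr.
    by have [|/ltW] := leP u 0 => /key.
  have dl0 : dl 0 = 0.
    have : dl pi = - dl 0.
      rewrite /dl add0r opprB (_ : ci (pi + pi) = ci 0)//.
      by rewrite ciN -[pi]add0r ciN /= !opprK.
    by rewrite d0; lra.
  have [u hu] : exists u, ci u = z.
    have z0 : 0 < z.1 ^+ 2 + z.2 ^+ 2 by rewrite z1.
    have [u hu] := has_angle_exists z0; exists u; have [h1 h2] := unit_angle hu z1.
    by rewrite /ci -h1 -h2 -surjective_pairing.
  by have := d0 u; rewrite dl0 /dl ciN hu => /eqP; rewrite subr_eq0 => /eqP.
have same z w : unit_disk z -> unit_disk w -> pt (hemi z) = pt (hemi w) -> th z = th w.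
  move=> zd wd /(pt_eq (hemi_neq0 z) (hemi_neq0 w))[c c0 e].
  have e0 := congr1 (fun v : 'rV[R]_3 => v 0 i0) e.
  have e1 := congr1 (fun v : 'rV[R]_3 => v 0 i1) e.
  have e2 := congr1 (fun v : 'rV[R]_3 => v 0 i2) e.
  rewrite !mxE /= in e0 e1 e2.
  have nrm (x : R * R) : unit_disk x -> x.1 ^+ 2 + x.2 ^+ 2 + (Num.sqrt (1 - x.1 ^+ 2 - x.2 ^+ 2)) ^+ 2 = 1.
    by rewrite /unit_disk /= => h; rewrite sqr_sqrtr; [ring|lra].
  have c2 : c ^+ 2 = 1.
    by have := nrm _ zd; rewrite e2 e0 e1 !exprMn -!mulrDr nrm// mulr1.
  have [cp|cn] := ltP 0 c.
    have c1 : c = 1 by apply/eqP; rewrite -(@eqrXn2 _ 2) ?ltW// c2 expr1n.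
    congr th; rewrite c1 !mul1r in e0 e1; move: e0 e1; case: (z) (w) => [? ?] [? ?] /= -> ->.
    by [].
  have c1 : c = -1.
    by move/eqP: c2; rewrite sqrf_eq1 => /orP[]/eqP // c1; move: cn; rewrite c1 ler10.
  have sw : Num.sqrt (1 - w.1 ^+ 2 - w.2 ^+ 2) = 0.
    have := sqrtr_ge0 (1 - z.1 ^+ 2 - z.2 ^+ 2); have := sqrtr_ge0 (1 - w.1 ^+ 2 - w.2 ^+ 2).
    by rewrite e2 c1; lra.
  have := nrm _ wd; rewrite sw expr0n /= addr0 => w1.
  rewrite -(antip w w1); congr th; rewrite c1 !mulN1r in e0 e1.
  by rewrite -e0 -e1; case: (z).
have /choice[g hg] := @hemi_surj R.
have thg z : unit_disk z -> th (g (pt (hemi z))) = th z.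
  by move=> zd; have [h1 h2] := hg (pt (hemi z)); apply: same.
exists (th \o g); split; last first.
  move=> p; have [h1 h2] := hg p; have [s1 s2] := small _ h1.
  by have [_] := hth _ s1 s2; rewrite /= h2.
(* [g] merely chooses preimages and need not be continuous. The preimage of an open set is instead
   the complement of the image of a compact part of the disk. *)
apply/continuousP => A oA.
have -> : (th \o g) @^-1` A = ~` ((pt \o @hemi R) @` (@unit_disk R `&` th @^-1` (~` A))).
  apply/seteqP; split=> p /=.
    by move=> Ap [z [zd nA] e]; apply: nA; rewrite -(thg _ zd) e.
  move=> h; apply: contrapT => nA; apply: h; have [h1 h2] := hg p.
  by exists (g p).
apply: closed_openC; apply: compact_closed; first exact: RP2_hausdorff.
apply: continuous_compact; first exact: continuous_subspaceT.
apply: (@subclosed_compact _ _ (@unit_disk R)).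
- move=> z cz; have zd : unit_disk z.
    have cd : closed (@unit_disk R) by apply: compact_closed; [exact: norm_hausdorff|exact: compact_disk].
    by apply: cd; apply: closure_subset cz => w [].
  split=> //= Az; have [s1 s2] := small _ zd; have [thc _] := hth _ s1 s2.
  have : nbhs z (th @^-1` A) by apply: thc; exact: open_nbhs_nbhs.
  by move=> /cz[w [[_ nA]]].
- exact: compact_disk.
- by move=> z [].
Qed.

(* Linking number of an odd loop: [h z - h (- t z)] deforms [h z - h 0] into an
   odd map of the circle, whose winding number is odd. *)
Lemma injective_plane_open (h1 h2 : R * R -> R) (r : R) : 0 < r ->
  continuous h1 -> continuous h2 ->
  (forall z w, box r z -> box r w -> h1 z = h1 w -> h2 z = h2 w -> z = w) ->
  exists2 e : R, 0 < e & forall y1 y2 : R, `|y1 - h1 (0, 0)| < e -> `|y2 - h2 (0, 0)| < e ->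
    exists z, [/\ box r z, h1 z = y1 & h2 z = y2].
Proof.
move=> r0 h1c h2c hinj.
have p0 := pi_gt0 R.
have [q q0 qr] : exists2 q : R, 0 < q & q < r by exists (r / 2); lra.
pose ci (s u : R) : R * R := (s * q * cos u, s * q * sin u).
have cn (u : R) : `|cos u| <= 1 /\ `|sin u| <= 1 by rewrite ler_norml cos_geN1 cos_le1 ler_norml sin_geN1 sin_le1.
have cib s u : `|s| <= 1 -> `|(ci s u).1| < r /\ `|(ci s u).2| < r.
  move=> s1; have [c1 c2] := cn u; rewrite /ci /= !normrM (gtr0_norm q0).
  have key (x : R) : 0 <= x <= 1 -> `|s| * q * x < r.
    move=> /andP[x0 x1]; apply: (@le_lt_trans _ _ q); last exact: qr.
    apply: (le_trans (ler_piMr _ x1)); first by rewrite mulr_ge0// ltW.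
    by rewrite ler_piMl// ltW.
  by split; apply: key; rewrite normr_ge0.
have cibox s u : `|s| <= 1 -> box r (ci s u).
  by move=> /(cib _ u)[? ?]; split; exact: ltW.
have box0 : box r (0, 0) by split; rewrite /= normr0 ltW.
pose cl (t : R) := Num.max 0 (Num.min 1 t).
have cl01 t : 0 <= cl t <= 1 by rewrite /cl le_max lexx /= ge_max ler01 ge_min lexx.
have clc : continuous cl.
  move=> t; apply: continuous_max; first exact: contC.
  by apply: continuous_min; [exact: contC|exact: cvg_id].
have cic (f g : R * R -> R) z : continuous_at z f -> continuous_at z g ->
    continuous_at z (fun z => ci (f z) (g z)).
  move=> fc gc; apply: cont_pair; apply: contM; try (apply: contM => //; exact: contC);
  apply: cont_comp => //; [exact: continuous_cos|exact: continuous_sin].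
(* The homotopy h(z) - h(-t z) on the circle of radius q, with t clamped to [0, 1]: at t = 0 it is
   h(z) - h(0), at t = 1 it is odd. It has no zero because h is injective. *)
pose G (h : R * R -> R) z := h (ci 1 z.1) - h (ci (- cl z.2) z.1).
have Gc h : continuous h -> continuous (G h).
  move=> hc z; apply: contB; (apply: cont_comp; last exact: hc); apply: cic;
    try exact: contC; try exact: cont_fst.
  rewrite (_ : (fun _ => _) = (fun z : R * R => 0 - cl z.2)); last by apply/funext => x; rewrite sub0r.
  by apply: contB; [exact: contC|apply: cont_comp; [exact: cont_snd|exact: clc]].
have sumsq (x y : R) : ~ (x = 0 /\ y = 0) -> 0 < x ^+ 2 + y ^+ 2.
  move=> xy; rewrite lt_neqAle addr_ge0 ?sqr_ge0// andbT eq_sym paddr_eq0 ?sqr_ge0//.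
  by rewrite !sqrf_eq0; apply/negP => /andP[/eqP ? /eqP ?]; exact: xy.
have G0 z : 0 < G h1 z ^+ 2 + G h2 z ^+ 2.
  apply: sumsq => -[/subr0_eq e1 /subr0_eq e2]; have /andP[c0 c1] := cl01 z.2.
  have b1 : box r (ci 1 z.1) by apply: cibox; rewrite normr1.
  have b2 : box r (ci (- cl z.2) z.1) by apply: cibox; rewrite normrN ger0_norm.
  have := hinj _ _ b1 b2 e1 e2; rewrite /ci => -[E1 E2]; have := cos2Dsin2 z.1.
  have k (x : R) : 1 * q * x = - cl z.2 * q * x -> x = 0.
    move=> e; have : (1 + cl z.2) * q * x = 0 by lra.
    have p1 : 0 < 1 + cl z.2 by rewrite ltr_wpDr.
    by move/eqP; rewrite mulf_eq0 mulf_eq0 (gt_eqF q0) (gt_eqF p1) => /eqP.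
  by rewrite (k _ E1) (k _ E2) expr0n /= addr0 => /eqP; rewrite eq_sym oner_eq0.
have M0 : 0 < pi *+ 2 + 2 :> R by rewrite mulr2n; lra.
have [th hth] := angle_lift M0 (Gc h1 h1c) (Gc h2 h2c) (fun z _ => G0 z).
have hth' u t : 0 <= u <= pi *+ 2 -> 0 <= t <= 1 -> continuous_at (u, t) th /\
    has_angle (th (u, t)) (G h1 (u, t)) (G h2 (u, t)).
  rewrite mulr2n => /andP[u1 u2] /andP[t1 t2].
  by apply: hth; rewrite /= ger0_norm// mulr2n; lra.
have pair1 (t u : R) : continuous_at u (fun u : R => (u, t)) by apply: cont_pair; [exact: cvg_id|exact: cvg_cst].
have pair2 (t u : R) : continuous_at t (fun t : R => (u, t)) by apply: cont_pair; [exact: cvg_cst|exact: cvg_id].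
pose lo : R := 0.
pose clam (a b t : R) := Num.max a (Num.min b t).
have clamP a b t : a <= b -> a <= clam a b t <= b.
  by move=> ab; rewrite /clam le_max lexx /= ge_max ab ge_min lexx.
have clam_id a b t : a <= t <= b -> clam a b t = t.
  by move=> /andP[t1 t2]; rewrite /clam (min_r t2) (max_r t1).
have clamc a b : continuous (clam a b).
  move=> t; apply: continuous_max; first exact: contC.
  by apply: continuous_min; [exact: contC|exact: cvg_id].
(* turning of [th] along the circle at height [t] *)
pose T t := th (pi *+ 2, t) - th (0, t).
have ci2pi s : ci s (pi *+ 2) = ci s 0.
  by rewrite /ci -[pi *+ 2]add0r cosD2pi sinD2pi.
have pp0 : 0 <= pi *+ 2 :> R by rewrite mulr2n; lra.
have T1 t : 0 <= t <= 1 -> cos (T t) = 1.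
  move=> t01; have [_ a1] := hth' (pi *+ 2) t ltac:(by rewrite pp0 lexx) t01.
  have [_ a2] := hth' 0 t ltac:(by rewrite pp0 lexx) t01.
  apply: has_angle_same (G0 (0, t)) _ a2.
  by move: a1; rewrite /G /= !ci2pi.
have T01 : T 1 = T 0.
  pose d t := T (clam 0 1 t).
  have dE t : 0 <= t <= 1 -> d t = T t by move=> t01; rewrite /d clam_id.
  have := @angle_const d 0 1 ler01; rewrite !dE ?lexx ?ler01//; apply.
  - move=> t; apply: contB; apply: (@cont_comp _ _ _ _ (fun t => (_, clam 0 1 t)) th).
    + by apply: cont_pair; [exact: cvg_cst|exact: clamc].
    + by apply: (hth' _ _ _ _).1; [rewrite pp0 lexx|exact: clamP].
    + by apply: cont_pair; [exact: cvg_cst|exact: clamc].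
    + by apply: (hth' _ _ _ _).1; [rewrite pp0 lexx|exact: clamP].
  - by move=> t t01; rewrite dE// T1.
  - have s0 x : cos (T x) = 1 -> sin (T x) = 0.
      by move=> c; apply/eqP; rewrite -sqrf_eq0; have := cos2Dsin2 (T x); rewrite c expr1n => /eqP; rewrite -subr_eq0 addrC addKr.
    by rewrite cosB !T1 ?lexx ?ler01// s0 ?mul0r ?addr0 ?mulr1// T1// lexx ler01.
(* Half a turn changes the sign of an odd map, so its angle grows by an odd multiple of pi; the
   increment is the same on the second half, and the total is not zero. *)
have T1n0 : T 1 != 0.
  pose d u := th (clam 0 pi u + pi, 1) - th (clam 0 pi u, 1).
  have ciN u : ci 1 (u + pi) = ci (-1) u by rewrite /ci cosDpi sinDpi; congr (_, _); ring.
  have ciN1 u : ci (-1) (u + pi) = ci 1 u by rewrite /ci cosDpi sinDpi; congr (_, _); ring.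
  have cl1 : cl 1 = 1 by rewrite /cl minxx max_r.
  have GN h u : G h (u + pi, 1) = - G h (u, 1) by rewrite /G /= cl1 ciN ciN1 opprB.
  have dm u : cos (d u) = -1.
    have /andP[v0 v1] := clamP 0 pi u (ltW p0); set v := clam 0 pi u in v0 v1.
    have [_ a1] := hth' (v + pi) 1 ltac:(rewrite mulr2n; apply/andP; split; lra) ltac:(by rewrite lexx ler01).
    have [_ a2] := hth' v 1 ltac:(rewrite mulr2n; apply/andP; split; lra) ltac:(by rewrite lexx ler01).
    have := has_angle_cosB (G0 _) (G0 _) a1 a2; rewrite !GN !sqrrN => e.
    rewrite -/v /d -/v in e *; have g0 := G0 (v, 1); have := sqr_sqrtr (ltW g0).
    move: e; set sg := Num.sqrt _; set cc := cos _ => e e2.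
    have : sg ^+ 2 * (cc + 1) = 0 by rewrite mulrDr mulr1 [X in X * cc]expr2 -e e2; ring.
    by rewrite e2 => /eqP; rewrite mulf_eq0 (gt_eqF g0) addr_eq0 => /eqP.
  have dconst : d pi = d 0.
    pose d' u := d u - pi.
    have : d' pi = d' 0; last by rewrite /d'; lra.
    have cd' u : cos (d' u) = 1.
      by have := cosDpi (d' u); rewrite /d' subrK dm => /esym/eqP; rewrite eqr_opp => /eqP.
    apply: angle_const (ltW p0) _ _ _ => [u|u _|]; last 2 first.
    - by rewrite cd'.
    - have s0 x : cos (d' x) = 1 -> sin (d' x) = 0.
        by move=> c; apply/eqP; rewrite -sqrf_eq0; have := cos2Dsin2 (d' x); rewrite c expr1n => /eqP; rewrite -subr_eq0 addrC addKr.
      by rewrite cosB !cd' s0 ?mul0r ?addr0 ?mulr1.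
    apply: contB; last exact: contC.
    have /andP[v0 v1] := clamP 0 pi u (ltW p0).
    apply: contB.
      apply: (@cont_comp _ _ _ _ (fun u => (clam 0 pi u + pi, 1 : R)) th).
        apply: cont_pair; last exact: cvg_cst.
        by apply: contD; [exact: clamc|exact: contC].
      by apply: (hth' _ _ _ _).1; rewrite ?lexx ?ler01// mulr2n; apply/andP; split; lra.
    apply: (@cont_comp _ _ _ _ (fun u => (clam 0 pi u, 1 : R)) th).
      by apply: cont_pair; [exact: clamc|exact: cvg_cst].
    by apply: (hth' _ _ _ _).1; rewrite ?lexx ?ler01// mulr2n; apply/andP; split; lra.
  have -> : T 1 = d pi + d 0.
    by rewrite /T /d !clam_id ?lexx ?ltW// add0r mulr2n; ring.
  rewrite dconst -mulr2n mulrn_eq0 /=; apply/eqP => d00.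
  by have := dm 0; rewrite d00 cos0; lra.
have T0n0 : T 0 != 0 by rewrite -T01.
pose v (h : R * R -> R) u := h (ci 1 u) - h (0, 0).
have ci0 u : ci 0 u = (0, 0) by rewrite /ci !mul0r.
have cl0 : cl 0 = 0 by rewrite /cl min_r ?ler01// maxxx.
have vG h u : G h (u, 0) = v h u by rewrite /G /= cl0 oppr0 ci0.
pose N u := v h1 u ^+ 2 + v h2 u ^+ 2.
have vc h : continuous h -> continuous (v h).
  move=> hc u; apply: contB; last exact: contC.
  apply: cont_comp; last exact: hc.
  by apply: cont_pair; apply: contM; try exact: contC; [exact: continuous_cos|exact: continuous_sin].
have Nc : continuous N by move=> u; apply: contD; apply: contX; exact: vc.
have [c _ cmin] := EVT_min pp0 (continuous_subspaceT Nc : {within `[0, pi *+ 2], continuous N}).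
have Nc0 : 0 < N c by rewrite /N -!vG G0.
(* N c is the least squared distance from h(0) to the image of the circle. Two coordinates, each off
   by less than the root of half of it, keep y closer to h(0) than that image. *)
exists (Num.sqrt (N c / 2)); first by rewrite sqrtr_gt0 divr_gt0.
move=> y1 y2 hy1 hy2; apply: contrapT => hno.
have sq (x : R) : `|x| < Num.sqrt (N c / 2) -> x ^+ 2 < N c / 2.
  move=> hx; rewrite -(@sqr_sqrtr _ (N c / 2)) ?divr_ge0 ?ltW//.
  by rewrite -real_normK ?num_real// ltr_pXn2r// nnegrE ?sqrtr_ge0.
have W0 z : box r z -> 0 < (h1 z - y1) ^+ 2 + (h2 z - y2) ^+ 2.
  move=> rz; apply: sumsq => -[/subr0_eq e1 /subr0_eq e2]; apply: hno.
  by exists z.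
have cB h y : continuous h -> continuous (fun z => h z - y).
  by move=> hc z; apply: contB; [exact: hc|exact: contC].
have [ps hps] := angle_lift r0 (cB _ y1 h1c) (cB _ y2 h2c) W0.
have hps1 u : continuous_at (ci 1 u) ps /\
    has_angle (ps (ci 1 u)) (h1 (ci 1 u) - y1) (h2 (ci 1 u) - y2).
  by have [|? ?] := @cib 1 u; [rewrite normr1|exact: hps].
pose cu := clam 0 (pi *+ 2).
(* If y were missed, the angle [ps] of h - y would exist on the whole box and return to its value
   after a turn. Seen from the circle, h - y and h - h(0) make an acute angle, so the second would
   have turning number zero as well. *)
pose D u := ps (ci 1 (cu u)) - th (cu u, 0).
have cuE u : 0 <= u <= pi *+ 2 -> cu u = u by exact: clam_id.
have : D (pi *+ 2) = D 0.
  apply: (angle_const pp0) => [u|u u01|].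
  - apply: contB.
      apply: (@cont_comp _ _ _ _ (fun u => ci 1 (cu u)) ps); last exact: (hps1 _).1.
      apply: cont_pair; apply: contM; try exact: contC;
      apply: (@cont_comp _ _ _ _ cu) => //; try exact: clamc; [exact: continuous_cos|exact: continuous_sin].
    apply: (@cont_comp _ _ _ _ (fun u => (cu u, 0)) th).
      by apply: cont_pair; [exact: clamc|exact: cvg_cst].
    have [||hc _] := hth' (cu u) 0; last exact: hc.
      exact: (clamP 0 (pi *+ 2) u pp0).
    by rewrite lexx ler01.
  - rewrite /D cuE//; have [_ a1] := hps1 u.
    have [_] := hth' u 0 u01 ltac:(by rewrite lexx ler01); rewrite !vG => a2.
    have n1 : 0 < (h1 (ci 1 u) - y1) ^+ 2 + (h2 (ci 1 u) - y2) ^+ 2.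
      by apply: W0; apply: cibox; rewrite normr1.
    have n2 : 0 < N u by rewrite (lt_le_trans Nc0)// cmin// in_itv.
    have := has_angle_cosB n1 n2 a1 a2.
    have -> : h1 (ci 1 u) - y1 = v h1 u - (y1 - h1 (0, 0)) by rewrite /v; ring.
    have -> : h2 (ci 1 u) - y2 = v h2 u - (y2 - h2 (0, 0)) by rewrite /v; ring.
    have := sq _ hy1; have := sq _ hy2.
    have : N c <= N u by apply: cmin; rewrite in_itv.
    rewrite /N; set d1 := y1 - _; set d2 := y2 - _; set v1 := v h1 u; set v2 := v h2 u.
    move=> hN s2 s1 e.
    have pos : 0 < (v1 - d1) * v1 + (v2 - d2) * v2.
      have := sqr_ge0 (v1 - d1); have := sqr_ge0 (v2 - d2).
      by rewrite /N -/v1 -/v2 in s1 s2 hN *; nra.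
    by move: pos; rewrite e pmulr_rgt0// mulr_gt0// sqrtr_gt0//;
      move: n1; rewrite /v1 /d1 /v2 /d2 /v; congr (0 < _ ^+ 2 + _ ^+ 2); ring.
  rewrite /D !cuE ?lexx ?pp0// ci2pi.
  have -> : ps (ci 1 0) - th (pi *+ 2, 0) - (ps (ci 1 0) - th (0, 0)) = - T 0 by rewrite /T; ring.
  by rewrite cosN T1// lexx ler01.
rewrite /D !cuE ?lexx ?pp0// ci2pi => hh; case/negP: T0n0; rewrite /T subr_eq0.
by apply/eqP; move: hh; lra.
Qed.

End Angle.

(** * Splitting a function on RP^2 along its zero set *)

Section Factor.
Variable R : realType.

Lemma enum_card_eq (T : Type) (A : set T) n : (A #= `I_n)%card ->
  exists f : 'I_n -> T, injective f /\ A = range f.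
Proof.
move=> /card_set_bijP[f [fA fi fs]].
have h (i : 'I_n) : exists x, A x /\ f x = i.
  by have [x Ax e] := fs i (ltn_ord i); exists x.
have [g hg] := choice h; exists g; split=> [i j e|].
  by apply: val_inj; rewrite /= -(hg i).2 -(hg j).2 e.
apply/seteqP; split=> [x Ax|_ [i _ <-]]; last exact: (hg i).1.
exists (Ordinal (fA _ Ax : (f x < n)%N)) => //.
by apply: fi; rewrite ?inE//; [exact: (hg _).1|rewrite (hg _).2].
Qed.

Lemma card_eq_enum (T : Type) n (f : 'I_n -> T) : injective f ->
  (range f #= `I_n)%card.
Proof.
move=> fi; have h : ([set: 'I_n] #= `I_n)%card.
  apply/card_set_bijP; exists val; split=> [i _|i j _ _|i il]; first exact: ltn_ord.
    exact: val_inj.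
  by exists (Ordinal il).
apply: card_eq_trans h; apply: inj_card_eq => i j _ _; exact: fi.
Qed.

Lemma ivt_sign (g : R -> R) x y : x < y -> continuous g -> g x * g y < 0 ->
  exists2 c, x < c < y & g c = 0.
Proof.
move=> xy gc h.
have gw : {within `[x, y], continuous g} by exact: continuous_subspaceT.
have [|c cxy c0] := IVT (v := 0) (ltW xy) gw.
  rewrite ge_min le_max; case: (leP (g x) 0) => g0 /=.
    by apply/orP; right; rewrite leNgt; apply/negP => gy; nra.
  by rewrite (ltW g0) andbT; rewrite leNgt; apply/negP => gy; nra.
exists c => //; move: cxy; rewrite in_itv /= => /andP[c1 c2].
have cx : c != x by apply/eqP => e; move: h; rewrite -e c0 mul0r ltxx.
have cy : c != y by apply/eqP => e; move: h; rewrite -e c0 mulr0 ltxx.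
by rewrite !lt_neqAle eq_sym cx cy c1.
Qed.

(* Half of the argument of [psi + i s], where [psi] separates A from A'. *)
Lemma split_zeros (s : RP2 R -> R) (A A' : set (RP2 R)) : continuous s ->
  closed A -> closed A' -> A `&` A' = set0 -> [set p | s p = 0] = A `|` A' ->
  exists v u : RP2 R -> R, [/\ continuous v, continuous u,
    [set p | v p = 0] = A, [set p | u p = 0] = A' &
    forall p, Num.sg (s p) = Num.sg (v p) * Num.sg (u p)].
Proof.
move=> sc cA cA' dA Zs.
have nor : normal_space (RP2 R) by apply: compact_normal; [exact: RP2_hausdorff|exact: RP2_compact].
have /normal_separatorP - /(_ R) h := nor.
have /(@uniform_separatorP _ R)[f [fc f01 f0 f1]] := h _ _ cA cA' dA.
have fA p : A p -> f p = 0 by move=> Ap; exact: (f0 _ (imageP f Ap)).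
have fA' p : A' p -> f p = 1 by move=> Ap; exact: (f1 _ (imageP f Ap)).
(* Negative on [A] and positive on [A']: where s vanishes, the sign of [a] decides whether the
   cosine or the sine of the half angle vanishes. *)
pose a p := f p - 2^-1.
have ac : continuous a by move=> p; apply: contB; [exact: fc|exact: contC].
have pos p : 0 < a p ^+ 2 + s p ^+ 2.
  have [s0|s0] := eqVneq (s p) 0; last by rewrite ltr_wpDl ?sqr_ge0// lt_neqAle eq_sym sqrf_eq0 s0 sqr_ge0.
  have : (A `|` A') p by rewrite -Zs.
  by rewrite s0 /a => -[/fA ->|/fA' ->]; nra.
have [th [thc hth]] := RP2_angle ac sc pos.
have th2c : continuous (fun p => th p / 2) by move=> p; apply: contM; [exact: thc|exact: contC].
have sE p : s p = 2 * Num.sqrt (a p ^+ 2 + s p ^+ 2) * (cos (th p / 2) * sin (th p / 2)).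
  rewrite {1}(hth p).2; have := sinD (th p / 2) (th p / 2).
  rewrite (_ : th p / 2 + th p / 2 = th p); last by field.
  by move=> ->; ring.
have aE p : a p = Num.sqrt (a p ^+ 2 + s p ^+ 2) * (cos (th p / 2) ^+ 2 - sin (th p / 2) ^+ 2).
  rewrite {1}(hth p).1; have := cosD (th p / 2) (th p / 2).
  rewrite (_ : th p / 2 + th p / 2 = th p); last by field.
  by move=> ->; ring.
have cs p : (cos (th p / 2) ^+ 2 + sin (th p / 2) ^+ 2 = 1)%R by exact: cos2Dsin2.
have q0 p := sqrt_norm_gt0 (pos p).
have aA p : A p -> a p < 0 by move=> /fA e; rewrite /a e; lra.
have aA' p : A' p -> 0 < a p by move=> /fA' e; rewrite /a e; lra.
have cos0 p : cos (th p / 2) = 0 -> a p < 0.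
  move=> c0; rewrite aE; have := cs p; have := q0 p; rewrite c0 expr0n add0r => Q ->.
  by set q := Num.sqrt _ in Q *; rewrite sub0r mulrN1 oppr_lt0.
have sin0 p : sin (th p / 2) = 0 -> 0 < a p.
  move=> c0; rewrite aE; have := cs p; have := q0 p; rewrite c0 expr0n addr0 => Q ->.
  by set q := Num.sqrt _ in Q *; rewrite subr0 mulr1.
have s00 p : s p = 0 -> cos (th p / 2) = 0 \/ sin (th p / 2) = 0.
  rewrite sE => /eqP; rewrite !mulf_eq0 (gt_eqF (q0 p)) pnatr_eq0 /=.
  by move=> /orP[/eqP|/eqP]; [left|right].
have Zs' p : s p = 0 <-> A p \/ A' p.
  by have : [set p | s p = 0] p <-> (A `|` A') p by rewrite Zs.
exists (fun p => cos (th p / 2)), (fun p => sin (th p / 2)); split.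
- by move=> p; apply: (@cont_comp _ _ _ _ (fun p => th p / 2) cos); [exact: th2c|exact: continuous_cos].
- by move=> p; apply: (@cont_comp _ _ _ _ (fun p => th p / 2) sin); [exact: th2c|exact: continuous_sin].
- apply/seteqP; split=> p /=.
    move=> c0; have /Zs'[//|/aA'] : s p = 0 by rewrite sE c0 mul0r mulr0.
    by rewrite ltNge (ltW (cos0 p c0)).
  move=> Ap; have /s00[//|/sin0] : s p = 0 by apply/Zs'; left.
  by rewrite ltNge (ltW (aA p Ap)).
- apply/seteqP; split=> p /=.
    move=> c0; have /Zs'[/aA|//] : s p = 0 by rewrite sE c0 !mulr0.
    by rewrite ltNge (ltW (sin0 p c0)).
  move=> Ap; have /s00[/cos0|//] : s p = 0 by apply/Zs'; right.
  by rewrite ltNge (ltW (aA' p Ap)).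
- by move=> p; rewrite sE !sgrM (gtr0_sg (q0 p)) (gtr0_sg (ltr0Sn _ _)) !mul1r.
Qed.

Lemma factor_zeros n (A : nat -> set (RP2 R)) (s : RP2 R -> R) : continuous s ->
  (forall i, closed (A i)) -> (forall i j, (i <= n)%N -> (j <= n)%N -> i <> j -> A i `&` A j = set0) ->
  (forall p, s p = 0 <-> exists2 i, (i <= n)%N & A i p) ->
  exists v : nat -> RP2 R -> R,
    [/\ forall i, (i <= n)%N -> continuous (v i),
        forall i p, (i <= n)%N -> v i p = 0 <-> A i p &
        forall p, Num.sg (s p) = \prod_(i < n.+1) Num.sg (v i p)].
Proof.
elim: n s => [|n IH] s sc cA dA Zs.
  exists (fun=> s); split=> [i _ //|i p|p]; last by rewrite big_ord1.
  rewrite leqn0 => /eqP ->; rewrite Zs; split=> [[j]|]; last by exists 0%N.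
  by rewrite leqn0 => /eqP ->.
have [||||v [u [vc uc Zv Zu sE]]] := @split_zeros s (\bigcup_(i in `I_n.+1) A i) (A n.+1) sc.
- by apply: closed_bigcup => //; exact: finite_II.
- exact: cA.
- apply/seteqP; split=> // p [[i /= il Ai] An].
  have : (A i `&` A n.+1) p by [].
  by rewrite dA ?(ltnW il)//; lia.
- apply/seteqP; split=> p /=.
    move=> /Zs[i il Ai]; move: il Ai; rewrite leq_eqVlt => /orP[/eqP -> ?|il ?].
      by right.
    by left; exists i.
  by move=> [[i /= il Ai]|An]; apply/Zs; [exists i => //; exact: ltnW|exists n.+1].
have [||||w [wc Zw wE]] := IH v => //.
- by move=> i j il jl; apply: dA; exact: ltnW.
- move=> p; have : [set p | v p = 0] p <-> (\bigcup_(i in `I_n.+1) A i) p by rewrite Zv.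
  by move=> /= ->; split=> -[j]; exists j.
exists (fun i => if (i <= n)%N then w i else u); split=> [i il|i p il|p].
- case: leqP => // h; exact: wc.
- case: leqP => h; first exact: Zw.
  have -> : i = n.+1 by lia.
  by have : [set p | u p = 0] p <-> A n.+1 p by rewrite Zu.
- rewrite big_ord_recr /= ltnn sE wE; congr (_ * _).
  by apply: eq_bigr => i _; rewrite -ltnS ltn_ord.
Qed.

End Factor.

(** * Counting real roots by sign changes *)

Section RealPoly.
Variable R : realType.
Implicit Types (p : {poly R}).

Lemma path_gaps p y0 ys : path <%R y0 ys ->
  {in y0 :: ys, forall y, p.[y] < 0} ->
  {in y0 :: ys &, forall y y', y < y' -> exists2 z, y < z < y' & 0 < p.[z]} ->
  exists rs, [/\ size rs = (2 * size ys)%N, path <%R y0 rs & all (root p) rs].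
Proof.
elim: ys y0 => [|y1 ys IH] y0 /=; first by exists [::].
move=> /andP[y01 pys] hneg hgap.
have [|||rs [srs prs ars]] := IH y1.
- exact: pys.
- by move=> y yin; apply: hneg; rewrite inE yin orbT.
- by move=> y y' yin yin'; apply: hgap; rewrite inE ?yin ?yin' orbT.
have [|||z /andP[z1 z2] z0] := hgap y0 y1; rewrite ?inE ?eqxx ?orbT//.
have n0 : p.[y0] < 0 by apply: hneg; rewrite inE eqxx.
have n1 : p.[y1] < 0 by apply: hneg; rewrite !inE eqxx orbT.
have [|a /andP[a1 a2] a0] := ivt_sign z1 (@continuous_horner _ p); first by nra.
have [|b /andP[b1 b2] b0] := ivt_sign z2 (@continuous_horner _ p); first by nra.
exists [:: a, b & rs]; split=> /=.
- by rewrite srs mulnS.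
- rewrite a1 (lt_trans a2 b1) /=; case: rs {srs ars} prs => //= r rs /andP[r1 ->].
  by rewrite (lt_trans b2 r1).
- by rewrite /root a0 b0 eqxx.
Qed.

(** A gap where p is only nonnegative may hide a double root, which would count once. Adding a small
    constant keeps the negative values negative and makes each gap strictly positive, whence two
    distinct roots per gap. *)
Lemma gaps_size p y0 ys : uniq (y0 :: ys) ->
  {in y0 :: ys, forall y, p.[y] < 0} ->
  {in y0 :: ys &, forall y y', y < y' -> exists2 z, y < z < y' & 0 <= p.[z]} ->
  (2 * size ys < size p)%N.
Proof.
move=> uy hneg hgap.
have [e e0 he] : exists2 e : R, 0 < e & {in y0 :: ys, forall y, p.[y] + e < 0}.
  move: hneg; move: {uy hgap} (y0 :: ys) => s; elim: s => [|y s IH] hs.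
    by exists 1.
  have [|e e0 he] := IH; first by move=> x xs; apply: hs; rewrite inE xs orbT.
  have hy : p.[y] < 0 by apply: hs; rewrite inE eqxx.
  exists (Num.min e (- p.[y] / 2)) => [|x]; first by rewrite lt_min e0 /=; lra.
  have m1 : Num.min e (- p.[y] / 2) <= e by rewrite ge_min lexx.
  have m2 : Num.min e (- p.[y] / 2) <= - p.[y] / 2 by rewrite ge_min lexx orbT.
  by rewrite inE => /orP[/eqP ->|/he]; lra.
pose s := sort <=%R (y0 :: ys); have ps : perm_eq s (y0 :: ys) by rewrite perm_sort.
have ms : s =i (y0 :: ys) by exact: perm_mem.
have ss : sorted <%R s.
  by rewrite lt_sorted_uniq_le (perm_uniq ps) uy; exact: sort_le_sorted.
have sz : size s = (size ys).+1 by rewrite size_sort.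
case: s ss ms ps sz => //= x s ps ms _ [sz].
have pe y : (p + e%:P).[y] = p.[y] + e by rewrite hornerD hornerC.
have [||rs [srs prs ars]] := @path_gaps (p + e%:P) x s ps.
- by move=> y yin; rewrite pe; apply: he; rewrite -ms.
- move=> y y'; rewrite !ms => yin yin' yy'; have [z z1 z0] := hgap y y' yin yin' yy'.
  by exists z => //; rewrite pe; lra.
have n0 : p + e%:P != 0.
  apply/eqP => h; have := he y0; rewrite inE eqxx -pe h horner0 ltxx => /(_ isT).
  by [].
have urs : uniq rs.
  by have := path_sorted prs; rewrite lt_sorted_uniq_le => /andP[].
have := max_poly_roots n0 ars urs; rewrite srs sz => h1.
have [p0|p0] := eqVneq p 0.
  by have := hneg y0; rewrite p0 horner0 ltxx inE eqxx => /(_ isT).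
have h2 : (size (p + e%:P)%R <= size p)%N.
  apply: leq_trans (size_polyD _ _) _; rewrite geq_max leqnn /=.
  by apply: leq_trans (size_polyC_leq1 _) _; rewrite size_poly_gt0.
exact: leq_trans h1 h2.
Qed.

Lemma sign_near_root p : p.[0] = 0 -> 0 < p^`().[0] ->
  exists2 d : R, 0 < d & forall t, 0 < t < d -> 0 < p.[t] /\ p.[- t] < 0.
Proof.
move=> p0 dp; have /factor_theorem[r pr] : root p 0 by apply/eqP.
have pE t : p.[t] = r.[t] * t by rewrite pr hornerM hornerXsubC subr0.
have r0 : 0 < r.[0].
  move: dp; rewrite pr derivM derivXsubC hornerD !hornerM hornerXsubC hornerC.
  by rewrite subrr mulr0 add0r mulr1.
have := near_gt0 (@continuous_horner _ r 0) r0 => /nbhs_ballP[d d0 hd].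
exists d => // t /andP[t0 td]; rewrite !pE; split.
  by apply: mulr_gt0 => //; apply: hd; rewrite /ball /= sub0r normrN gtr0_norm.
by rewrite mulrN oppr_lt0; apply: mulr_gt0 => //; apply: hd; rewrite /ball /= sub0r opprK gtr0_norm.
Qed.

End RealPoly.

(** * Real forms as complex forms *)

Section Complexify.
Variable R : realType.
Implicit Types (f g c : mpoly 3 R) (v w : 'rV[R]_3).

Definition cv v : 'rV[R[i]]_3 := map_mx (real_complex R) v.

Lemma complexifyD f g : complexify (f + g) = complexify f + complexify g.
Proof. exact: rmorphD. Qed.
Lemma complexifyM f g : complexify (f * g) = complexify f * complexify g.
Proof. exact: rmorphM. Qed.
Lemma complexifyC a : complexify (mpolyC 3 a : mpoly 3 R) = mpolyC 3 (real_complex R a).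
Proof. exact: map_mpolyC. Qed.
Lemma complexifyXU i : complexify (mpolyX R (mnm1 i) : mpoly 3 R) = mpolyX R[i] (mnm1 i).
Proof. exact: map_mpolyX. Qed.

Lemma complexifyZ a f : complexify (a *: f) = real_complex R a *: complexify f.
Proof. by rewrite -!mul_mpolyC complexifyM complexifyC. Qed.

Lemma complexify_form d f : is_form d f -> is_form d (complexify f).
Proof.
move=> /dhomogP fd; apply/dhomogP => m; rewrite mcoeff_msupp mcoeff_map_mpoly => h.
by apply: fd; rewrite mcoeff_msupp; apply: contraNneq h => ->.
Qed.

Local Opaque complexify.

Lemma eval_complexify f v : eval_form (complexify f) (cv v) = real_complex R (eval_form f v).
Proof.
elim/mpoly_ring_ind: f => [a|i|f g ihf ihg|f g ihf ihg].
- by rewrite complexifyC /eval_form !mevalC.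
- by rewrite complexifyXU /eval_form !mevalXU mxE.
- rewrite complexifyD (eval_formD (complexify f)) (eval_formD f).
  exact: etrans (congr2 +%R ihf ihg) (esym (rmorphD (real_complex R) _ _)).
- rewrite complexifyM (eval_formM (complexify f)) (eval_formM f).
  exact: etrans (congr2 *%R ihf ihg) (esym (rmorphM (real_complex R) _ _)).
Qed.

Lemma mderiv_complexify i f : mderiv i (complexify f) = complexify (mderiv i f).
Proof.
elim/mpoly_ring_ind: f => [a|j|f g ihf ihg|f g ihf ihg].
- rewrite complexifyC (mderivC i a) (mderivC i (real_complex R a)).
  exact: esym (rmorph0 (map_mpoly (real_complex R))).
- rewrite complexifyXU (mderivX R) (mderivX R[i]).
  rewrite complexifyZ; congr (_ *: _).
    exact: esym (rmorph_nat (real_complex R) _).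
  by symmetry; exact: map_mpolyX.
- rewrite complexifyD (mderivD i (complexify f)) (mderivD i f) complexifyD.
  by congr (_ + _); [exact: ihf|exact: ihg].
- rewrite complexifyM (mderivM i (complexify f)) (mderivM i f) complexifyD 2!complexifyM.
  by congr (_ * _ + _ * _); [exact: ihf|exact: ihg].
Qed.

Lemma grad_complexify f v : grad (complexify f) (cv v) = cv (grad f v).
Proof. by apply/rowP => i; rewrite !mxE mderiv_complexify eval_complexify. Qed.

Lemma cv_eq0 v : (cv v == 0) = (v == 0).
Proof.
apply/eqP/eqP => [/rowP h|->]; last by apply/rowP => i; rewrite !mxE rmorph0.
by apply/rowP => i; have := h i; rewrite !mxE => /complexI.
Qed.

Lemma nonsingular_smooth d f : nonsingular d f -> smooth_form d (complexify f).
Proof. by move=> [fd h]; split=> //; exact: complexify_form. Qed.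

Lemma nonsingular_grad d f v : nonsingular d f -> v != 0 -> eval_form f v = 0 ->
  grad f v != 0.
Proof.
move=> [fd h] v0 fv; have := h (cv v); rewrite cv_eq0 eval_complexify fv rmorph0.
by rewrite grad_complexify cv_eq0; apply.
Qed.

Lemma cv_indep v w : indep v w -> indep (cv v) (cv w).
Proof.
move=> /indep_det3[x hx]; apply: (@det3_indep _ _ _ (cv x)).
have -> : det3 (cv v) (cv w) (cv x) = real_complex R (det3 v w x).
  by rewrite /det3 !mxE (rmorphD (real_complex R)) !(rmorphB (real_complex R)) !(rmorphM (real_complex R)) /= !(rmorphB (real_complex R)) !(rmorphM (real_complex R)).
by apply: contraNneq hx => /complexI ->.
Qed.

End Complexify.

(** * The four regions of an M-quartic *)

Section Regions.
Variable R : realType.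
Implicit Types (f s : mpoly 3 R) (w : 'rV[R]_3) (p q : RP2 R).

Lemma contT (S T V : topologicalType) (h : S -> T) (g : T -> V) x :
  continuous_at x h -> continuous_at (h x) g -> continuous_at x (fun y => g (h y)).
Proof. exact: continuous_comp. Qed.

Lemma cont_line w1 w2 : continuous (fun t : R => w1 + t *: w2).
Proof.
move=> t; apply: cvgD; first exact: cvg_cst.
by apply: cvgZr_tmp || apply: cvgZl; exact: cvg_id.
Qed.

Lemma connected_sign (T : topologicalType) (A : set T) (g : T -> R) x y :
  connected A -> {in A, continuous g} -> (forall z, A z -> g z != 0) ->
  A x -> A y -> 0 < g x * g y.
Proof.
move=> cA gc g0 Ax Ay.
have cg : connected (g @` A).
  apply: connected_continuous_connected => //.
  by apply: continuous_in_subspaceT => z; exact: gc.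
have /connected_intervalP ig := cg.
rewrite ltNge; apply/negP => h.
have mem (z : R) : Num.min (g x) (g y) <= z <= Num.max (g x) (g y) -> (g @` A) z.
  case: (leP (g x) (g y)) => gxy hz.
    by apply: ig hz; [exists x|exists y].
  by apply: ig hz; [exists y|exists x].
have [z Az /eqP] : (g @` A) 0.
  apply: mem; rewrite ge_min le_max; have := g0 _ Ax; have := g0 _ Ay.
  case: (ltgtP (g x) 0) => //= gx; case: (ltgtP (g y) 0) => //= gy; nra.
by rewrite (negbTE (g0 _ Az)).
Qed.

Lemma vec_near w n (U : set (RP2 R)) : w != 0 -> nbhs (pt w) U ->
  exists2 d : R, 0 < d & forall t, `|t| < d -> w + t *: n != 0 /\ U (pt (w + t *: n)).
Proof.
move=> w0 /(nbhs_pt _ w0) hU.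
have c : continuous_at (0 : R) (fun t : R => w + t *: n) by exact: cont_line.
have hw : \forall x \near w, x != 0 /\ U (pt x).
  by apply: filterS2 (near_neq0 w0) hU => x.
have := c; rewrite /continuous_at scale0r addr0 => /(_ _ hw) /nbhs_ballP[d d0 hd].
by exists d => // t td; apply: hd; rewrite /ball /= sub0r normrN.
Qed.

Lemma sign_change d f w (U : set (RP2 R)) : nonsingular d f -> w != 0 -> eval_form f w = 0 ->
  nbhs (pt w) U -> exists x y, [/\ x != 0, y != 0, U (pt x), U (pt y) &
    0 < eval_form f x /\ eval_form f y < 0].
Proof.
move=> fn w0 fw hU; have n0 := nonsingular_grad fn w0 fw; set n := grad f w in n0.
have [d1 d10 h1] := vec_near n w0 hU.
have pE t : (along (lineq w n) f).[t] = eval_form f (w + t *: n) by rewrite along_eval lineq_at.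
have [||d2 d20 h2] := @sign_near_root _ (along (lineq w n) f).
- by rewrite pE scale0r addr0.
- by rewrite along_deriv lineq_at lineq_deriv scale0r addr0 dotvv_gt0.
pose t := Num.min d1 d2 / 2.
have m1 : Num.min d1 d2 <= d1 by rewrite ge_min lexx.
have m2 : Num.min d1 d2 <= d2 by rewrite ge_min lexx orbT.
have m0 : 0 < Num.min d1 d2 by rewrite lt_min d10.
have t0 : 0 < t by rewrite /t; lra.
have [|p1 p2] := h2 t; first by rewrite t0 /t /=; lra.
have [|x0 Ux] := h1 t; first by rewrite gtr0_norm// /t; lra.
have [|y0 Uy] := h1 (- t); first by rewrite normrN gtr0_norm// /t; lra.
by exists (w + t *: n), (w + (- t) *: n); rewrite -!pE; split.
Qed.

(** The parameter u = 1/t turns a neighbourhood of t = 0 into the set of large |u|; [G 0] is the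
    point at infinity of a curve. *)
Lemma infty_near (G : R -> 'rV[R]_3) (U : set (RP2 R)) : continuous_at 0 G ->
  G 0 != 0 -> nbhs (pt (G 0)) U ->
  exists2 M : R, 0 < M & forall u, M <= `|u| -> U (pt (G u^-1)).
Proof.
move=> Gc G0 /(nbhs_pt _ G0) /Gc /nbhs_ballP[d d0 hd].
exists (2 / d); first by rewrite divr_gt0.
move=> u hu; apply: hd; rewrite /ball /= sub0r normrN normfV.
have u0 : 0 < `|u| by rewrite (lt_le_trans _ hu)// divr_gt0.
rewrite -[d]invrK ltf_pV2 ?posrE ?invr_gt0//; apply: lt_le_trans hu.
by have := invr_gt0 d; rewrite d0 => ?; lra.
Qed.

Lemma line_infty w1 w2 : continuous_at (0 : R) (fun t : R => t *: w1 + w2).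
Proof.
apply: cvgD; last exact: cvg_cst.
by apply: cvgZr_tmp || apply: cvgZl; exact: cvg_id.
Qed.

Lemma line_pt_infty w1 w2 u : u != 0 -> w1 + u *: w2 != 0 ->
  pt (w1 + u *: w2) = pt (u^-1 *: w1 + w2).
Proof.
move=> u0 h; rewrite -(@pt_scale _ u^-1 (w1 + u *: w2)) ?invr_eq0//.
by rewrite scalerDr scalerA mulVf// scale1r.
Qed.

Lemma other4 (r : seq 'I_4) : (size r < 4)%N -> exists k, k \notin r.
Proof.
move=> h; apply: contrapT => hn; move: h; rewrite ltnNge => /negP; apply.
suff : (size (enum 'I_4) <= size r)%N by rewrite size_enum_ord.
apply: uniq_leq_size; first exact: enum_uniq.
by move=> k _; apply/negPn/negP => kr; apply: hn; exists k.
Qed.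

Lemma indep_pt w1 w2 : w1 != 0 -> w2 != 0 -> pt w1 <> pt w2 -> indep w1 w2.
Proof.
move=> w10 w20 h a b e.
have [a0|a0] := eqVneq a 0.
  by split=> //; apply/eqP; move/eqP: e; rewrite a0 scale0r add0r scaler_eq0 (negbTE w20) orbF.
have b0 : b != 0.
  by apply: contra_eq_neq e => ->; rewrite scale0r addr0 scaler_eq0 (negbTE w10) orbF.
case: h; rewrite -(pt_scale a0 w10) -(pt_scale (_ : - b != 0) w20) ?oppr_eq0//.
by congr pt; apply/eqP; rewrite scaleNr -addr_eq0 e.
Qed.

Lemma indep_neq0 w1 w2 (u : R) : indep w1 w2 -> w1 + u *: w2 != 0.
Proof.
move=> h; apply/eqP => e; have [] := h 1 u; first by rewrite scale1r.
by move/eqP; rewrite oner_eq0.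
Qed.

Definition regions s (v : 'I_4 -> RP2 R -> R) :=
  [/\ is_form 4 s, forall i, continuous (v i),
      forall i j p, i != j -> v i p <= 0 -> 0 < v j p &
      forall w, w != 0 -> Num.sg (eval_form s w) = \prod_i Num.sg (v i (pt w))].

(* A line meets the quartic in at most four points, while each change of sign
   of a factor gives a point on each of the two arcs. *)
Lemma three_changes s (v : 'I_4 -> RP2 R -> R) p q (i j k : 'I_4) : is_form 4 s ->
  (forall i, continuous (v i)) ->
  (forall i j p, v i p = 0 -> v j p = 0 -> i = j) ->
  (forall w, w != 0 -> Num.sg (eval_form s w) = \prod_i Num.sg (v i (pt w))) ->
  uniq [:: i; j; k] -> {in [:: i; j; k], forall l, v l p * v l q < 0} -> (forall l, v l p != 0) -> False.
Proof.
move=> sf vc vd vs uijk hch hp.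
have P0 := rep_neq0 p; have Q0 := rep_neq0 q; set P := rep p in P0; set Q := rep q in Q0.
have eP : pt P = p by exact: pt_rep.
have eQ : pt Q = q by exact: pt_rep.
have PQ : indep P Q.
  apply: indep_pt => //; rewrite eP eQ => e; have := hch i; rewrite e inE eqxx => /(_ isT).
  by rewrite ltNge -expr2 sqr_ge0.
have n0 u := indep_neq0 u PQ.
pose c (u : R) := pt (P + u *: Q).
have cc l : continuous (fun u => v l (c u)).
  move=> u; apply: (@cont_comp _ _ _ _ c (v l)); last exact: vc.
  exact: (contT (@cont_line P Q u) (pt_continuous (n0 u))).
have [M M0 hM] : exists2 M : R, 0 < M & forall u, M <= `|u| -> {in [:: i; j; k], forall l, v l p * v l (c u) < 0}.
  have nq : nbhs (pt (0 *: P + Q)) [set x | {in [:: i; j; k], forall l, v l p * v l x < 0}].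
    rewrite scale0r add0r eQ.
    have h l : l \in [:: i; j; k] -> \forall x \near q, v l p * v l x < 0.
      move=> /hch hl; apply: (near_lt0 (f := fun x => v l p * v l x) _ hl).
      by apply: contM; [exact: contC|exact: vc].
    have := h i; have := h j; have := h k; rewrite !inE !eqxx ?orbT => /(_ isT) h3 /(_ isT) h2 /(_ isT) h1.
    near=> x => l; rewrite !inE => /or3P[] /eqP ->; near: x; [exact: h1|exact: h2|exact: h3].
  have [|M M0 hM] := infty_near (@line_infty P Q) _ nq; first by rewrite scale0r add0r.
  exists M => // u hu; have u0 : u != 0 by rewrite -normr_gt0 (lt_le_trans M0).
  by rewrite /c line_pt_infty//; exact: hM.
(* The two arcs from p to q on the line are u > 0 and u < 0; on each of them every one of the three
   factors vanishes. *)
have rt l sg : l \in [:: i; j; k] -> sg = 1 \/ sg = -1 -> exists2 u : R, 0 < sg * u & v l (c u) = 0.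
  move=> lin hs.
  have [||u /andP[u1 u2] u0] := @ivt_sign _ (fun u => v l (c (sg * u))) 0 M M0.
  - move=> x; apply: (@cont_comp _ _ _ _ (fun u => sg * u) (fun u => v l (c u))); last exact: cc.
    by apply: contM; [exact: contC|exact: cvg_id].
  - rewrite mulr0 /c scale0r addr0 eP; apply: hM => //.
    by case: hs => ->; rewrite ?mul1r ?mulN1r ?normrN gtr0_norm.
  by exists (sg * u) => //; case: hs => ->; lra.
have rt' l (ss : bool) : exists u : R, l \in [:: i; j; k] -> 0 < (-1) ^+ ss * u /\ v l (c u) = 0.
  have [lin|] := boolP (l \in [:: i; j; k]); last by exists 0.
  by have [|u u1 u2] := rt l ((-1) ^+ ss) lin; [case: ss; [right|left]|exists u].
have [r hr] := choice (fun ls : 'I_4 * bool => rt' ls.1 ls.2).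
pose xs := [seq r ls | ls <- [:: (i, true); (i, false); (j, true); (j, false); (k, true); (k, false)]].
pose F := along (lineq P Q) s.
have F0 : F != 0.
  apply/eqP => e; have := vs _ (n0 0); rewrite -lineq_at -along_eval -/F e horner0 sgr0.
  move/esym/eqP; apply/negP; apply/prodf_neq0 => l _; rewrite sgr_eq0 lineq_at scale0r addr0 eP.
  exact: hp.
have xr : all (root F) xs.
  apply/allP => _ /mapP[[l b] lb ->]; have lin : l \in [:: i; j; k].
    by move: lb; rewrite !inE !xpair_eqE => /or4P[/andP[-> _]|/andP[-> _]|/andP[-> _]|/or3P[/andP[-> _]|/andP[-> _]|/andP[-> _]]]; rewrite ?orbT.
  have [_ z] := hr (l, b) lin; rewrite /root along_eval lineq_at -sgr_eq0 vs ?n0//.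
  by apply/eqP; rewrite (bigD1 l)//= [v l _]z sgr0 mul0r.
have ux : uniq xs.
  rewrite map_inj_in_uniq.
    move: uijk; rewrite /= !inE !xpair_eqE !andbT !andbF !orbF !negb_or.
    by move=> /and3P[/andP[-> ->] _ ->].
  move=> [l b] [l' b'] lb lb' e.
  have lin : l \in [:: i; j; k] /\ l' \in [:: i; j; k].
    by split; [move: lb|move: lb']; rewrite !inE !xpair_eqE => /or4P[/andP[-> _]|/andP[-> _]|/andP[-> _]|/or3P[/andP[-> _]|/andP[-> _]|/andP[-> _]]]; rewrite ?orbT.
  have [s1 z1] := hr (l, b) lin.1; have [s2 z2] := hr (l', b') lin.2.
  rewrite -e in s2 z2; have ll : l = l' := vd _ _ _ z1 z2; rewrite ll; congr (_, _).
  rewrite /= in s1 s2.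
  by move: s1 s2; set x := r _; case: (b) => /=; case: (b') => //=; rewrite ?expr0 ?expr1; lra.
have := max_poly_roots F0 xr ux; have [sz _] := along_line_size P Q sf.
by rewrite ltnNge (leq_trans sz).
Unshelve. all: by end_near. Qed.

(** Each oval gets a function with that zero set. Near a point of an oval only its own function can
    change sign, and it does, since s does at a nonsingular point. Two configurations with three
    sign changes are then excluded by [three_changes]: one fixes a sign of each function on the
    other ovals, the other separates the regions. *)
Lemma quartic_regions s : M_quartic s ->
  exists (e : R) (v : 'I_4 -> RP2 R -> R) (A : 'I_4 -> set (RP2 R)),
  [/\ e ^+ 2 = 1, regions (e *: s) v, components (real_points s) = range A,
      forall i p, v i p = 0 <-> A i p &
      forall i a U, A i a -> nbhs a U ->
        (exists2 p, U p & v i p < 0) /\ (exists2 p, U p & 0 < v i p)].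
Proof.
move=> [ns card4]; have [A [Ai rA]] := enum_card_eq card4.
have sf : is_form (2 * 2) s := ns.1.
set Z := real_points s in rA.
have Acc i : exists2 x, Z x & connected_component Z x = A i.
  by have : range A (A i) by []; rewrite -rA => -[x Zx e]; exists x.
have Zc : closed Z.
  have -> : Z = evfun 2 s @^-1` [set 0].
    by apply/seteqP; split=> p; [move/(evfun_eq0 p sf)|move=> /= /(evfun_eq0 p sf)].
  by apply: closed_comp => [p _|]; [exact: evfun_continuous|exact: closed_eq].
have Acl i : closed (A i).
  by have [x _ <-] := Acc i; exact: component_closed.
have Acon i : connected (A i).
  by have [x _ <-] := Acc i; exact: component_connected.
have Ad i j p : A i p -> A j p -> i = j.
  have [x Zx ex] := Acc i; have [y Zy ey] := Acc j.
  rewrite -ex -ey => hx hy; apply: Ai; rewrite -ex -ey.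
  by rewrite (same_connected_component hx) (same_connected_component hy).
have AZ p : Z p <-> exists i, A i p.
  split=> [Zp|[j]].
    have : range A (connected_component Z p) by rewrite -rA; exists p.
    by move=> [j _ e]; exists j; rewrite e; exact: connected_component_refl.
  by have [x _ <-] := Acc j => /connected_component_sub.
have A0 i : exists a, A i a.
  by have [x Zx <-] := Acc i; exists x; exact: connected_component_refl.
pose A' (k : nat) := A (inord k : 'I_4).
have [|||v0 [v0c v0Z v0s]] := @factor_zeros R 3 A' (evfun 2 s) (evfun_continuous sf).
- by move=> i; exact: Acl.
- move=> i j il jl ij; apply/seteqP; split=> // p [h1 h2]; case: ij.
  by have := Ad _ _ _ h1 h2 => /(congr1 val); rewrite /= !inordK ?ltnS.
- move=> p; rewrite (evfun_eq0 p sf) (AZ p : real_points s p <-> _); split=> [[j Aj]|[j _ Aj]]; last by exists (inord j).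
  by exists j; [rewrite -ltnS|rewrite /A' inord_val].
pose v (i : 'I_4) := v0 i.
have vc i : continuous (v i) by apply: v0c; rewrite -ltnS.
have vZ i p : v i p = 0 <-> A i p by rewrite /v v0Z ?/A' ?inord_val// -ltnS.
have vs w : w != 0 -> Num.sg (eval_form s w) = \prod_i Num.sg (v i (pt w)).
  by move=> w0; rewrite -(evfun_sg (d := 2))// v0s.
have vd i j p : v i p = 0 -> v j p = 0 -> i = j by move=> /vZ h1 /vZ; exact: Ad.
have tc := three_changes sf vc vd vs.
have sg2 (x : R) : x != 0 -> Num.sg x * Num.sg x = 1 by move=> x0; rewrite -expr2 sqr_sg x0.
have sgc (x : R) : x != 0 -> x = 1 \/ x = -1 -> True by [].
(* Near a point of the i-th oval either sign of v_i can be prescribed, while the other functions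
   keep their signs. *)
have nearb i a U (g : R) : A i a -> nbhs a U -> g = 1 \/ g = -1 ->
    exists p, [/\ U p, Num.sg (v i p) = g, (forall l, v l p != 0) &
      forall j, j != i -> Num.sg (v j p) = Num.sg (v j a)].
  move=> Aa Ua hg; have v0a j : j != i -> v j a != 0.
    by move=> ji; apply: contraNneq ji => /vZ Aj; rewrite (Ad _ _ _ Aa Aj).
  have hU : nbhs a (U `&` [set p | forall j, j != i -> 0 < v j a * v j p]).
    apply: filterI => //.
    have h j : \forall p \near a, j != i -> 0 < v j a * v j p.
      have [ji|] := boolP (j != i); last by move=> _; exact: filterE.
      apply: filterS (near_gt0 (f := fun p => v j a * v j p) _ _) => //.
        by apply: contM; [exact: contC|exact: vc].
      by rewrite -expr2 lt_neqAle eq_sym sqrf_eq0 v0a//= sqr_ge0.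
    exact: (@filter_forall _ _ (fun j p => j != i -> 0 < v j a * v j p) _ _ h).
  have a0 := rep_neq0 a; have Za : eval_form s (rep a) = 0.
    by apply/(real_points_pt sf a0); rewrite pt_rep; apply/AZ; exists i.
  rewrite -[a]pt_rep in hU; have [x [y [x0 y0 [Ux hx] [Uy hy] [sx sy]]]] := sign_change ns a0 Za hU.
  rewrite /= pt_rep in hx hy.
  have sgj j p : j != i -> 0 < v j a * v j p -> Num.sg (v j p) = Num.sg (v j a).
    move=> ji; case: (ltgtP (v j a) 0) => h1; case: (ltgtP (v j p) 0) => h2 h; try nra.
    - by rewrite !ltr0_sg.
    - by rewrite !gtr0_sg.
  pose C := \prod_(j | j != i) Num.sg (v j a).
  have pC p w : w != 0 -> p = pt w -> (forall j, j != i -> 0 < v j a * v j p) ->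
      Num.sg (eval_form s w) = Num.sg (v i p) * C.
    move=> w0 -> hh; rewrite vs// (bigD1 i)//=; congr (_ * _).
    by apply: eq_bigr => j ji; exact: sgj (hh j ji).
  have nz p : v i p != 0 -> (forall j, j != i -> 0 < v j a * v j p) -> forall l, v l p != 0.
    move=> i0 hh l; have [->//|li] := eqVneq l i; have := hh l li.
    by apply: contraTneq => ->; rewrite mulr0 ltxx.
  have ex := pC _ _ x0 erefl hx; have ey := pC _ _ y0 erefl hy.
  rewrite gtr0_sg// in ex; rewrite ltr0_sg// in ey.
  have ix : v i (pt x) != 0 by apply/eqP => e; move: ex; rewrite e sgr0 mul0r => /eqP; rewrite oner_eq0.
  have iy : v i (pt y) != 0 by apply/eqP => e; move: ey; rewrite e sgr0 mul0r => /eqP; rewrite oppr_eq0 oner_eq0.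
  have [e|ne] := eqVneq (Num.sg (v i (pt x))) g.
    by exists (pt x); split=> //; [exact: nz|move=> j ji; exact: sgj (hx j ji)].
  exists (pt y); split=> //; [|exact: nz|by move=> j ji; exact: sgj (hy j ji)].
  have C0 : C != 0 by apply: contra_eq_neq ex => ->; rewrite mulr0 oner_neq0.
  have e : Num.sg (v i (pt y)) = - Num.sg (v i (pt x)).
    by apply: (mulIf C0); rewrite mulNr -ex -ey.
  rewrite e; move: ne; case: (sgrP (v i (pt x))) ix => // _ _; case: hg => ->; rewrite ?eqxx ?opprK//.
pose a i := projT1 (cid (A0 i)); have Aa i : A i (a i) := projT2 (cid (A0 i)).
have v0a i j : j != i -> v j (a i) != 0.
  by move=> ji; apply: contraNneq ji => /vZ Aj; rewrite (Ad _ _ _ (Aa i) Aj).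
have sgN (x : R) : x != 0 -> Num.sg x = 1 \/ Num.sg x = -1.
  by case: (sgrP x) => // _ _; [left|right].
have opp2 (x y : R) : x != 0 -> Num.sg y = - Num.sg x -> x * y < 0.
  by move=> x0 h; rewrite -sgr_lt0 sgrM h mulrN sg2// ltrN10.
have opp' (x : R) : x != 0 -> - Num.sg x = 1 \/ - Num.sg x = -1.
  by move=> /sgN[] ->; [right|left]; rewrite ?opprK.
(* If v_j had opposite signs on the ovals i and k, points p and q near these ovals could be chosen
   so that v_i and v_k also change sign from p to q. *)
have same j i k : i != j -> k != j -> i != k -> Num.sg (v j (a i)) = Num.sg (v j (a k)).
  move=> ij kj ik; apply/eqP; apply: contraT => ne; exfalso.
  have ki : k != i by rewrite eq_sym.
  have [p [_ p1 p2 p3]] := nearb i (a i) setT (- Num.sg (v i (a k))) (Aa i) filterT (opp' _ (v0a _ _ ik)).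
  have [q [_ q1 q2 q3]] := nearb k (a k) setT (- Num.sg (v k (a i))) (Aa k) filterT (opp' _ (v0a _ _ ki)).
  apply: (tc p q i j k _ _ p2); first by rewrite /= !inE negb_or ij ik eq_sym kj.
  move=> l; rewrite !inE => /or3P[] /eqP ->; apply: opp2 => //.
  - by rewrite p1 opprK q3.
  - rewrite p3 1?eq_sym// q3 1?eq_sym//; move: ne.
    have := sgN _ (v0a i j _); have := sgN _ (v0a k j _); rewrite ![_ == j]eq_sym in ij kj *.
    by move=> /(_ kj)[] -> /(_ ij)[] ->; rewrite ?eqxx ?opprK.
  - by rewrite q1 p3.
pose jj j : 'I_4 := projT1 (cid (@other4 [:: j] isT)).
have jjP j : jj j != j by have := projT2 (cid (@other4 [:: j] isT)); rewrite inE.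
(* The common sign of v_j on the three other ovals. Multiplying by it makes v_j positive there, and
   the product of these signs is the global sign of s. *)
pose e j := Num.sg (v j (a (jj j))).
have eE j i : i != j -> Num.sg (v j (a i)) = e j.
  move=> ij; have [->//|ne] := eqVneq i (jj j); exact: same.
have e2 j : e j * e j = 1 by apply: sg2; apply: v0a; rewrite eq_sym.
have e0 j : e j != 0 by apply: contra_eq_neq (e2 j) => ->; rewrite mul0r eq_sym oner_neq0.
have ec j : e j = 1 \/ e j = -1 by apply: sgN; apply: v0a; rewrite eq_sym.
have sge j : Num.sg (e j) = e j by rewrite /e sgr_id.
pose u j p := e j * v j p.
have uc j : continuous (u j) by move=> p; apply: contM; [exact: contC|exact: vc].
have uZ j p : u j p = 0 <-> A j p.
  by rewrite -vZ /u; split=> [/eqP|->]; [rewrite mulf_eq0 (negbTE (e0 j)) => /eqP|rewrite mulr0].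
have uA i j p : i != j -> A i p -> 0 < u j p.
  move=> ij Ap; have h : 0 < u j (a i) * u j p.
    apply: (@connected_sign _ (A i) (u j)) => //.
    by move=> z Az; apply: contraNneq ij => /uZ Aj; rewrite (Ad _ _ _ Az Aj).
  have ua : 0 < u j (a i) by rewrite -sgr_gt0 /u sgrM sge (eE j i)// e2.
  by rewrite -(pmulr_rgt0 _ ua).
(* If u_i and u_j were both negative at p, a point q near a third oval k, on the appropriate side of
   it, would have u_i and u_j positive and v_k of the opposite sign: three changes. *)
have ud i j p : i != j -> u i p <= 0 -> 0 < u j p.
  move=> ij; rewrite le_eqVlt => /orP[/eqP/uZ|ui]; first exact: uA.
  have ji : j != i by rewrite eq_sym.
  case: (ltgtP (u j p) 0) => // [uj|/uZ Aj]; last by move: ui; rewrite ltNge (ltW (uA _ _ _ ji Aj)).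
  have [k] := @other4 [:: i; j] isT; rewrite !inE negb_or => /andP[ki kj].
  have hv l : v l p != 0.
    apply/eqP => /vZ Al; have [li|li] := eqVneq l i.
      by move: ui; rewrite ((uZ i p).2 _) ?ltxx// -li.
    by move: ui; rewrite ltNge (ltW (uA _ _ _ li Al)).
  have [q [_ q1 q2 q3]] := nearb k (a k) setT (- Num.sg (v k p)) (Aa k) filterT (opp' _ (hv k)).
  exfalso; apply: (tc p q i j k _ _ hv).
    by rewrite /= !inE negb_or ij eq_sym ki eq_sym kj.
  have uq l : l != k -> 0 < u l q.
    by move=> lk; rewrite -sgr_gt0 /u sgrM sge q3// (eE l k) ?e2// eq_sym.
  have uv l : u l p * u l q = v l p * v l q by rewrite /u mulrACA e2 mul1r.
  move=> l; rewrite !inE => /or3P[] /eqP ->; last exact: opp2.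
    by rewrite -uv nmulr_rlt0// uq// eq_sym.
  by rewrite -uv nmulr_rlt0// uq// eq_sym.
exists (\prod_j e j), u, A; split=> //.
- by rewrite -prodrXl big1// => j _; rewrite expr2.
- split=> //; first by exact: rpredZ.
  move=> w w0; rewrite eval_formZ sgrM vs//.
  have -> : Num.sg (\prod_j e j) = \prod_j e j.
    by rewrite (big_morph _ (@sgrM _) (@sgr1 _)); apply: eq_bigr => j _; exact: sge.
  by rewrite -big_split /=; apply: eq_bigr => j _; rewrite /u sgrM sge.
- move=> i b U Ab Ub; split.
    have [|p [Up p1 _ _]] := nearb i b U (- e i) Ab Ub; first by case: (ec i) => ->; [right|left]; rewrite ?opprK.
    by exists p => //; rewrite -sgr_lt0 /u sgrM sge p1 mulrN e2 ltrN10.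
  have [|p [Up p1 _ _]] := nearb i b U (e i) Ab Ub; first exact: ec.
  by exists p => //; rewrite -sgr_gt0 /u sgrM sge p1 e2.
Qed.

End Regions.

(** * Zeros of quartics on lines and conics *)

Section Curves.
Variable R : realType.
Implicit Types (f F s : mpoly 3 R) (w : 'rV[R]_3) (p : RP2 R).

Lemma curve_cont (q : 'rV[{poly R}]_3) : continuous (curve_at q).
Proof.
move=> u; apply: row_continuous => i.
by apply: contE (@continuous_horner _ (q 0 i) u) => y; rewrite mxE.
Qed.

Lemma contMin (T : topologicalType) (g h : T -> R) x : continuous_at x g ->
  continuous_at x h -> continuous_at x (fun y => Num.min (g y) (h y)).
Proof. by move=> gc hc; apply: continuous_min. Qed.

Lemma form4_sign F (a : R) w : is_form 4 F -> a != 0 ->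
  (eval_form F (a *: w) < 0) = (eval_form F w < 0).
Proof.
move=> Ff a0; rewrite (eval_form_scale _ _ Ff) pmulr_rlt0//.
by rewrite (exprM a 2 2) exprn_gt0// lt_neqAle eq_sym sqrf_eq0 a0 sqr_ge0.
Qed.

Section WithRegions.
Variables (s : mpoly 3 R) (v : 'I_4 -> RP2 R -> R).
Hypothesis rg : regions s v.

Lemma reg_pos w : w != 0 -> (forall i, 0 < v i (pt w)) -> 0 < eval_form s w.
Proof.
move=> w0 h; have [_ _ _ vs] := rg.
by rewrite -sgr_gt0 vs//; apply: prodr_gt0 => i _; rewrite sgr_gt0.
Qed.

Lemma reg_neg i w : w != 0 -> v i (pt w) < 0 -> eval_form s w < 0.
Proof.
move=> w0 h; have [_ _ vd vs] := rg.
rewrite -sgr_lt0 vs// (bigD1 i)//= ltr0_sg// mulN1r oppr_lt0.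
by apply: prodr_gt0 => j ji; rewrite sgr_gt0 (vd i)// ?(ltW h)// eq_sym.
Qed.

Lemma reg_zero i w : w != 0 -> v i (pt w) = 0 -> eval_form s w = 0.
Proof.
move=> w0 h; have [_ _ _ vs] := rg; apply/eqP; rewrite -sgr_eq0 vs//.
by rewrite (bigD1 i)//= h sgr0 mul0r.
Qed.

Lemma reg_neg_ex w : w != 0 -> eval_form s w < 0 -> exists i, v i (pt w) < 0.
Proof.
move=> w0 h; have [_ _ _ vs] := rg; apply: contrapT => hn.
move: h; rewrite -sgr_lt0 vs// ltNge prodr_ge0// => i _.
by rewrite sgr_ge0 leNgt; apply/negP => ?; apply: hn; exists i.
Qed.

Lemma reg_disj i j p : v i p <= 0 -> v j p <= 0 -> i = j.
Proof.
move=> h1 h2; apply/eqP; apply: contraT => ij; have [_ _ vd _] := rg.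
by have := vd _ _ _ ij h1; rewrite ltNge h2.
Qed.

(** Let m be the minimum of the three other functions. Then v_i - m is negative at x and positive at
    y; where it vanishes the two are equal, and they are never both nonpositive. *)
Lemma sep_pos (c : R -> RP2 R) x y i j : continuous c -> x < y -> i != j ->
  v i (c x) <= 0 -> v j (c y) <= 0 -> exists2 z, x < z < y & forall k, 0 < v k (c z).
Proof.
move=> cc xy ij hx hy; have [_ vc vd _] := rg.
pose m p := Num.min (v (lift i i0) p) (Num.min (v (lift i i1) p) (v (lift i i2) p)).
have mc : continuous m by move=> p; exact: (contMin (vc _ p) (contMin (vc _ p) (vc _ p))).
have mle k p : k != i -> m p <= v k p.
  rewrite eq_sym => /unlift_some[l -> _].
  by move: l; apply: ord3P; rewrite /m !ge_min lexx ?orbT.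
have mgt p : (forall k, k != i -> 0 < v k p) -> 0 < m p.
  by move=> h; rewrite /m !lt_min !h// eq_sym neq_lift.
have [||z hz /eqP] := @ivt_sign _ (fun t => v i (c t) - m (c t)) x y xy.
- by move=> t; exact: (contB (contT (cc t) (vc i (c t))) (contT (cc t) (mc (c t)))).
- have h1 : 0 < m (c x) by apply: mgt => k ki; apply: vd hx; rewrite eq_sym.
  have h2 : 0 < v i (c y) by apply: vd hy; rewrite eq_sym.
  have ji : j != i by rewrite eq_sym.
  have h3 := mle j (c y) ji; nra.
rewrite subr_eq0 => /eqP e; exists z => //.
have pi : 0 < v i (c z).
  rewrite ltNge; apply/negP => h; have : 0 < m (c z) by apply: mgt => k ki; apply: vd h; rewrite eq_sym.
  by rewrite -e ltNge h.
move=> k; have [->//|ki] := eqVneq k i.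
by rewrite (lt_le_trans _ (mle k (c z) ki))// -e.
Qed.

Lemma bound_seq (ys : seq R) : exists2 M : R, 0 < M & {in ys, forall y, `|y| < M}.
Proof.
elim: ys => [|y ys [M M0 h]]; first by exists 1.
exists (Num.max M (`|y| + 1)) => [|z]; first by rewrite lt_max M0.
rewrite inE => /orP[/eqP ->|/h zM]; first by rewrite lt_max ltrDl ltr01 orbT.
by rewrite lt_max zM.
Qed.

(* Each of the points [ys] and the point at infinity of the curve is in a
   negative region; between two of them along the curve the quartic is positive
   somewhere. *)
Lemma curve_gaps F (q : 'rV[{poly R}]_3) (G : R -> 'rV[R]_3) d (D r : {poly R})
    (ys : seq R) (i : 'I_4) :
  is_form 4 F -> (forall w, w != 0 -> 0 < eval_form s w -> 0 < eval_form F w) ->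
  (forall u, curve_at q u != 0) -> continuous_at 0 G -> G 0 != 0 ->
  (forall u, u != 0 -> curve_at q u = u ^+ d *: G u^-1) ->
  along q F = D * r -> (forall u, 0 <= D.[u]) ->
  ys != [::] -> uniq ys -> v i (pt (G 0)) < 0 -> eval_form F (G 0) < 0 ->
  {in ys, forall y, eval_form F (curve_at q y) < 0 /\
     exists2 j, i != j & v j (pt (curve_at q y)) < 0} ->
  {in ys &, forall y y', y < y' ->
     (exists j k, [/\ j != k, v j (pt (curve_at q y)) < 0 & v k (pt (curve_at q y')) < 0])
     \/ exists2 z, y < z < y' & 0 <= r.[z]} ->
  (2 * (size ys).+1 < size r)%N.
Proof.
move=> Ff hF q0 Gc G0 hG hDr D0 ys0 uys vi Fi hys hgap; have [_ vc vd _] := rg.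
have F4 : is_form (2 * 2) F := Ff.
have [|M1 M10 hM1] := infty_near (U := [set p | v i p < 0 /\ evfun 2 F p < 0]) Gc G0.
  have h1 := near_lt0 (vc i (pt (G 0))) vi.
  have h2 : \forall p \near pt (G 0), evfun 2 F p < 0.
    apply: near_lt0; first exact: evfun_continuous.
    by rewrite -sgr_lt0 evfun_sg// sgr_lt0.
  exact: filterI.
have [M2 M20 hM2] := bound_seq ys.
pose M := M1 + M2; have M0 : 0 < M by rewrite addr_gt0.
have inM y : y \in ys -> - M < y < M.
  by move=> /hM2; rewrite ltr_norml /M => /andP[]; lra.
have hM u : u = M \/ u = - M -> eval_form F (curve_at q u) < 0 /\ v i (pt (curve_at q u)) < 0.
  move=> hu; have nu : `|u| = M by case: hu => ->; rewrite ?normrN gtr0_norm.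
  have u0 : u != 0 by rewrite -normr_gt0 nu.
  have ud0 : u ^+ d != 0 by rewrite expf_neq0.
  have Gu : G u^-1 != 0 by have := q0 u; rewrite hG// scaler_eq0 negb_or => /andP[].
  have [h1 h2] : v i (pt (G u^-1)) < 0 /\ evfun 2 F (pt (G u^-1)) < 0.
    by apply: hM1; rewrite nu /M; lra.
  rewrite hG// form4_sign// pt_scale//; split=> //.
  by rewrite -sgr_lt0 -(evfun_sg (d := 2))// sgr_lt0.
pose c u := pt (curve_at q u).
have cc : continuous c by move=> u; exact: (contT (@curve_cont q u) (pt_continuous (q0 u))).
have rD u : eval_form F (curve_at q u) = D.[u] * r.[u] by rewrite -along_eval hDr hornerM.
have rneg u : eval_form F (curve_at q u) < 0 -> r.[u] < 0.
  rewrite rD => h; rewrite ltNge; apply/negP => h2.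
  by have := mulr_ge0 (D0 u) h2; rewrite leNgt h.
have gap j k y y' : j != k -> y < y' -> v j (c y) < 0 -> v k (c y') < 0 ->
    exists2 z, y < z < y' & 0 <= r.[z].
  move=> jk yy' hj hk; have [z hz h] := sep_pos cc yy' jk (ltW hj) (ltW hk); exists z => //.
  have := hF _ (q0 z) (reg_pos (q0 z) h); rewrite rD => hp.
  by rewrite leNgt; apply/negP => h2; have := mulr_ge0_le0 (D0 z) (ltW h2); rewrite leNgt hp.
have [hMn hMv] := hM M (or_introl erefl); have [hNn hNv] := hM (- M) (or_intror erefl).
(* The point at infinity is represented by both M and -M, one at each end, so there is one gap more
   than there are points in [ys]. *)
have -> : (size ys).+1 = size (M :: ys) by [].
apply: (@gaps_size _ r (- M)).
- rewrite /= inE negb_or uys andbT; apply/andP; split; [apply/andP; split|].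
  + by rewrite lt_eqF//; lra.
  + by apply/negP => /inM /andP[]; rewrite ltxx.
  + by apply/negP => /inM /andP[]; rewrite ltxx.
- move=> y; rewrite !inE => /or3P[/eqP ->|/eqP ->|yin]; try exact: rneg.
  by apply: rneg; exact: (hys y yin).1.
- have [y0 y0in] : exists y0, y0 \in ys.
    by case: (ys) ys0 => // y0 ? _; exists y0; rewrite inE eqxx.
  move=> y y'; rewrite !inE => /or3P[/eqP ->|/eqP ->|yin] /or3P[/eqP ->|/eqP ->|yin'] yy'.
  + by move: yy'; rewrite ltxx.
  + have [_ [j ij hj]] := hys _ y0in; have /andP[b1 b2] := inM _ y0in.
    have [z /andP[z1 z2] hz] := gap _ _ _ _ ij b1 hNv hj.
    by exists z => //; rewrite z1 (lt_trans z2).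
  + have [_ [j ij hj]] := hys _ yin'; exact: gap ij yy' hNv hj.
  + by move: yy'; lra.
  + by move: yy'; rewrite ltxx.
  + by have /andP[b1 b2] := inM _ yin'; move: yy'; lra.
  + by have /andP[b1 b2] := inM _ yin; move: yy'; lra.
  + have [_ [j ij hj]] := hys _ yin; rewrite eq_sym in ij; exact: gap ij yy' hj hMv.
  + have [[j [k [jk hj hk]]]|//] := hgap _ _ yin yin' yy'; exact: gap jk yy' hj hk.
Qed.

Lemma reg_indep i j w1 w2 : w1 != 0 -> w2 != 0 -> i != j ->
  v i (pt w1) < 0 -> v j (pt w2) < 0 -> indep w1 w2.
Proof.
move=> w10 w20 ij h1 h2; apply: indep_pt => // e.
by case/negP: ij; apply/eqP; apply: (@reg_disj _ _ (pt w1)); rewrite ?(ltW h1)// e ltW.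
Qed.

(** Otherwise a line would pass through three regions, and s, positive somewhere on each of the
    three arcs between them, would have six zeros on it. *)
Lemma three_regions w1 w2 w3 i j k : w1 != 0 -> w2 != 0 -> w3 != 0 ->
  uniq [:: i; j; k] -> v i (pt w1) < 0 -> v j (pt w2) < 0 -> v k (pt w3) < 0 ->
  det3 w1 w2 w3 != 0.
Proof.
move=> w10 w20 w30; rewrite /= !inE negb_or andbT => /andP[/andP[ij ik] jk] h1 h2 h3.
apply/eqP => d0; have [sf vc vd _] := rg.
have I12 := reg_indep w10 w20 ij h1 h2.
have [x hx] := indep_det3 I12.
have := det3_basis w3 hx; rewrite d0 mul0r scale0r addr0.
set al := _ / _; set be := _ / _ => e3.
have al0 : al != 0.
  apply/eqP => a0; move: e3; rewrite a0 scale0r add0r => e3.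
  have be0 : be != 0 by apply: contraNneq w30 => b0; rewrite e3 b0 scale0r.
  by move: h3; rewrite e3 pt_scale// => h3; case/eqP: jk; apply: (@reg_disj _ _ (pt w2)); exact: ltW.
pose u := be / al.
have n0 t := indep_neq0 t I12.
have e3' : w3 = al *: (w1 + u *: w2).
  by rewrite e3 scalerDr scalerA /u; congr (_ + _ *: _); rewrite mulrC divfK.
rewrite e3' pt_scale// in h3.
have u0 : u != 0.
  apply/eqP => u0; move: h3; rewrite u0 scale0r addr0 => h3; case/eqP: ik.
  by apply: (@reg_disj _ _ (pt w1)); exact: ltW.
have := @curve_gaps s (lineq w1 w2) (fun t => t *: w1 + w2) 1 1 (along (lineq w1 w2) s) [:: 0; u] j sf.
rewrite scale0r add0r ltnNge; case/(_ _ _ _ _ _ _ _ _ _ _ _ _ _)/negP => //.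
- by move=> t; rewrite lineq_at.
- exact: line_infty.
- by move=> t t0; rewrite lineq_at expr1 scalerDr scalerA mulfV// scale1r.
- by rewrite mul1r.
- by move=> t; rewrite hornerC ler01.
- by rewrite /= inE eq_sym u0.
- exact: reg_neg h2.
- move=> y; rewrite !inE => /orP[] /eqP ->; rewrite lineq_at ?scale0r ?addr0.
    by split; [exact: reg_neg h1|exists i => //; rewrite eq_sym].
  by split; [exact: reg_neg h3|exists k].
- move=> y y'; rewrite !inE => /orP[] /eqP -> /orP[] /eqP -> yy'; rewrite ?lineq_at ?scale0r ?addr0.
  + by move: yy'; rewrite ltxx.
  + by left; exists i, k.
  + by left; exists k, i; rewrite eq_sym.
  + by move: yy'; rewrite ltxx.
- by have [sz _] := along_line_size w1 w2 sf; apply: leq_trans sz _.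
Qed.

End WithRegions.

Section Conic.
Variable K : fieldType.
Variables (e a b : 'rV[K]_3) (al be ga : K).
Hypothesis eab : det3 e a b != 0.
Hypotheses (al0 : al != 0) (be0 : be != 0) (ga0 : ga != 0).

(* The conic [al x y + be y z + ga z x = 0] in coordinates with basis (e, a, b),
   parametrized by [u = z / y]. *)
Definition conq : 'rV[{poly K}]_3 :=
  \row_i ((- be * e 0 i) *: 'X + (a 0 i)%:P * (al%:P + ga *: 'X)
          + (b 0 i)%:P * (al *: 'X + ga *: 'X ^+ 2)).

Definition conG (t : K) : 'rV[K]_3 :=
  (- be * t) *: e + (al * t ^+ 2 + ga * t) *: a + (al * t + ga) *: b.

Lemma conq_at u : curve_at conq u =
  (- be * u) *: e + (al + ga * u) *: a + (u * (al + ga * u)) *: b.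
Proof.
apply/rowP => i; rewrite !mxE.
rewrite !(hornerD, hornerM, hornerC, hornerZ, hornerX, hornerXn); ring.
Qed.

Lemma conq_infty u : u != 0 -> curve_at conq u = u ^+ 2 *: conG u^-1.
Proof.
by move=> u0; rewrite conq_at; apply/rowP => i; rewrite !mxE; field.
Qed.

Lemma conG0 : conG 0 = ga *: b.
Proof.
by apply/rowP => i; rewrite !mxE; ring.
Qed.

Lemma conq_neq0 u : curve_at conq u != 0.
Proof.
rewrite conq_at; apply/eqP => /(det3_free eab)[/eqP].
rewrite mulf_eq0 oppr_eq0 (negbTE be0) /= => /eqP ->; rewrite mulr0 addr0 => h.
by case/eqP: al0.
Qed.

Lemma conq_size i : (size (conq 0%R i) <= 3)%N.
Proof.
apply/leq_sizeP => j; rewrite mxE => hj.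
rewrite !(coefD, coefCM, coefZ, coefX, coefXn, coefC).
by case: j hj => [|[|[|j]]] // _; rewrite /= !mulr0n; ring.
Qed.

Lemma conq_along_size d (f : mpoly 3 K) : is_form d f -> (size (along conq f) <= (d * 2).+1)%N.
Proof. by move=> fd; have [] := along_size fd conq_size. Qed.

Lemma conq_e : curve_at conq (- al / ga) = (be * al / ga) *: e.
Proof.
rewrite conq_at; have -> : al + ga * (- al / ga) = 0 by field.
by rewrite mulr0 !scale0r !addr0; congr (_ *: _); field.
Qed.

Lemma conq_a : curve_at conq 0 = al *: a.
Proof. by rewrite conq_at; apply/rowP => i; rewrite !mxE; ring. Qed.

(** The equation is linear in x with coefficient al y + ga z. This coefficient is not zero:
    otherwise be y z = 0, so z = 0, and then y = 0. *)
Lemma conq_point x y z : y != 0 -> al * x * y + be * y * z + ga * z * x = 0 ->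
  x *: e + y *: a + z *: b != 0 ->
  exists2 l : K, l != 0 & x *: e + y *: a + z *: b = l *: curve_at conq (z / y).
Proof.
move=> y0 h n0.
have E : x * (al * y + ga * z) + be * y * z = 0 by rewrite -h; ring.
have t0 : al * y + ga * z != 0.
  apply/eqP => t0; have : be * y * z = 0 by move: E; rewrite t0 mulr0 add0r.
  move/eqP; rewrite !mulf_eq0 (negbTE be0) (negbTE y0) /= => /eqP z0.
  by move: t0; rewrite z0 mulr0 addr0 => /eqP; rewrite mulf_eq0 (negbTE al0) (negbTE y0).
have xE : x = - be * y * z / (al * y + ga * z).
  apply: (mulIf t0); rewrite divfK//; apply/eqP; rewrite -subr_eq0 -[X in _ == X]E.
  by apply/eqP; ring.
exists (y ^+ 2 / (al * y + ga * z)); first by rewrite mulf_neq0 ?expf_neq0 ?invr_eq0.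
rewrite conq_at xE; apply/rowP => i; rewrite !mxE; field.
by rewrite t0 y0.
Qed.

End Conic.

Lemma conG_cont (e a b : 'rV[R]_3) al be ga : continuous_at 0 (conG e a b al be ga).
Proof.
apply: row_continuous => i; rewrite /conG.
apply: (contE (g := fun t : R => (- be * t) * e 0 i + (al * t ^+ 2 + ga * t) * a 0 i + (al * t + ga) * b 0 i)).
  by move=> t; rewrite !mxE.
have idc : continuous_at (0 : R) (fun t : R => t) by exact: cvg_id.
have kc (x : R) : continuous_at (0 : R) (fun t : R => x) by exact: contC.
have id2 : continuous_at (0 : R) (fun t : R => t ^+ 2) by exact: contX.
by do 2?[apply: contD]; apply: contM; try exact: kc; try (apply: contD); try exact: kc; apply: contM.
Qed.

End Curves.

Section Gradient.
Variable K : comNzRingType.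

Lemma mderiv_form d (f : mpoly 3 K) i : is_form d.+1 f -> is_form d (mderiv i f).
Proof.
move=> /dhomogP fd; apply/dhomogP => m; rewrite mcoeff_msupp mcoeff_deriv => h.
have hm : mcoeff (mnm_add m (mnm1 i)) f != 0 by apply: contraNneq h => ->; rewrite mul0rn.
by have := fd _ (etrans (mcoeff_msupp _ _) hm); rewrite /= mdegD mdeg1 addn1 => -[].
Qed.

Lemma grad_scale d (f : mpoly 3 K) a v : is_form d.+1 f ->
  grad f (a *: v) = a ^+ d *: grad f v.
Proof.
by move=> fd; apply/rowP => i; rewrite !mxE (eval_form_scale _ _ (mderiv_form i fd)).
Qed.

End Gradient.

Section DoubleRoots.
Variable R : realType.

Lemma real_double_root (p : {poly R}) x : p.[x] = 0 -> p^`().[x] = 0 ->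
  exists r, p = ('X - x%:P) ^+ 2 * r.
Proof.
move=> /rootP/factor_theorem[q ->].
rewrite derivM derivXsubC hornerD !hornerM hornerXsubC subrr mulr0 add0r hornerC mulr1.
by move=> /rootP/factor_theorem[r ->]; exists r; ring.
Qed.

(** The real polynomial with roots c + i d and c - i d. *)
Definition quad (c d : R) : {poly R} := ('X - c%:P) ^+ 2 + (d ^+ 2)%:P.

Lemma quad_size c d : size (quad c d) = 3%N.
Proof.
by rewrite size_polyDl size_exp_XsubC// (leq_ltn_trans (size_polyC_leq1 _)).
Qed.

Notation rc := (real_complex R).

(** The remainder modulo [quad c d] is a real polynomial of degree at most 1 that vanishes at a
    nonreal number, hence zero. *)
Lemma complex_root_quad (p : {poly R}) c d : d != 0 ->
  (map_poly rc p).[(c +i* d)%C] = 0 -> exists r, p = quad c d * r.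
Proof.
move=> d0 h; exists (p %/ quad c d); rewrite mulrC.
have q0 : quad c d != 0 by rewrite -size_poly_gt0 quad_size.
rewrite [LHS](divp_eq p (quad c d)); suff -> : p %% quad c d = 0 by rewrite addr0.
set r := p %% _; have sr : (size r <= 2)%N by rewrite -ltnS -(quad_size c d) ltn_modp.
have rE : r = (r`_0)%:P + r`_1 *: 'X.
  apply/polyP => -[|[|j]]; rewrite coefD coefC coefZ coefX ?mulr0 ?addr0 ?add0r ?mulr1//=.
  by rewrite nth_default// (leq_trans sr).
have qz : (map_poly rc (quad c d)).[(c +i* d)%C] = 0.
  rewrite /quad rmorphD rmorphXn rmorphB /= map_polyX !map_polyC /=.
  rewrite hornerD horner_exp hornerXsubC hornerC expr2; apply/eqP.
  by rewrite eq_complex /=; apply/andP; split; apply/eqP; ring.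
have : (map_poly rc r).[(c +i* d)%C] = 0.
  move: h; rewrite {1}(divp_eq p (quad c d)) rmorphD rmorphM hornerD hornerM qz.
  by rewrite mulr0 add0r.
rewrite rE rmorphD /= map_polyC map_polyZ map_polyX hornerD hornerC hornerZ hornerX.
move/eqP; rewrite eq_complex /= !mul0r subr0 add0r addr0 => /andP[/eqP e1 /eqP e2].
have r1 : r`_1 = 0 by move/eqP: e2; rewrite mulf_eq0 (negbTE d0) orbF => /eqP.
by move: e1; rewrite r1 mul0r addr0 => ->; rewrite scale0r addr0.
Qed.

Lemma complex_double_root (p : {poly R}) c d : d != 0 ->
  (map_poly rc p).[(c +i* d)%C] = 0 -> (map_poly rc p)^`().[(c +i* d)%C] = 0 ->
  exists r, p = quad c d ^+ 2 * r.
Proof.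
move=> d0 h; have [q ->] := complex_root_quad d0 h.
rewrite deriv_map derivM rmorphD !rmorphM /= hornerD !hornerM.
have -> : (map_poly rc (quad c d)).[(c +i* d)%C] = 0.
  rewrite /quad rmorphD rmorphXn rmorphB /= map_polyX !map_polyC /=.
  rewrite hornerD horner_exp hornerXsubC hornerC expr2; apply/eqP.
  by rewrite eq_complex /=; apply/andP; split; apply/eqP; ring.
rewrite mul0r addr0 => /eqP; rewrite mulf_eq0 => /orP[/eqP e|/eqP qz].
  case/eqP: d0; move: e; rewrite /quad derivD derivC addr0 expr2 derivM derivXsubC mul1r mulr1.
  rewrite rmorphD rmorphB /= map_polyX map_polyC hornerD hornerXsubC /= => /eqP.
  by rewrite eq_complex /= => /andP[_ /eqP]; lra.
by have [r ->] := complex_root_quad d0 qz; exists r; ring.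
Qed.

End DoubleRoots.

Section ComplexCurve.
Variable R : realType.
Notation rc := (real_complex R).

Lemma along_complexify (q : 'rV[{poly R}]_3) (f : mpoly 3 R) :
  map_poly rc (along q f) = along (map_mx (map_poly rc) q) (complexify f).
Proof.
elim/mpoly_ring_ind: f => [a|i|f g ihf ihg|f g ihf ihg].
- rewrite complexifyC /along (mmapC _ _ a) (mmapC _ _ (rc a)).
  exact: map_polyC.
- rewrite complexifyXU /along (mmapX _ _ (mnm1 i) : mmap polyC _ (mpolyX R _) = _).
  by rewrite (mmapX _ _ (mnm1 i) : mmap polyC _ (mpolyX R[i] _) = _) !mmap1U mxE.
- rewrite complexifyD /along.
  rewrite (mmapD _ _ f g) (mmapD _ _ (complexify f) (complexify g)).
  by rewrite rmorphD; congr (_ + _); [exact: ihf|exact: ihg].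
- rewrite complexifyM /along.
  rewrite (rmorphM (mmap _ _) f g) (rmorphM (mmap _ _) (complexify f) (complexify g)).
  by rewrite rmorphM; congr (_ * _); [exact: ihf|exact: ihg].
Qed.

(* A singular point on a curve gives a double root. *)
Lemma along_singular (q : 'rV[{poly R}]_3) d (f : mpoly 3 R) (z l : R[i]) (w : 'rV[R[i]]_3) :
  is_form d.+1 f -> l != 0 -> w = l *: curve_at (map_mx (map_poly rc) q) z ->
  eval_form (complexify f) w = 0 -> grad (complexify f) w = 0 ->
  (map_poly rc (along q f)).[z] = 0 /\ (map_poly rc (along q f))^`().[z] = 0.
Proof.
move=> fd l0 e fw gw; have fd' := complexify_form fd.
have -> : map_poly rc (along q f) = along (map_mx (map_poly rc) q) (complexify f).
  exact: along_complexify.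
rewrite along_eval along_deriv; split.
  move/eqP: fw; rewrite e (eval_form_scale _ _ fd') mulf_eq0 expf_eq0 (negbTE l0) andbF.
  by move/eqP.
suff -> : grad (complexify f) (curve_at (map_mx (map_poly rc) q) z) = 0.
  by rewrite /dot big1// => i _; rewrite mxE mul0r.
move/eqP: gw; rewrite e (grad_scale _ _ fd') scaler_eq0 expf_eq0 (negbTE l0) andbF.
by move/eqP.
Qed.

Lemma along_singular_real (q : 'rV[{poly R}]_3) d (f : mpoly 3 R) (z l : R) (w : 'rV[R]_3) :
  is_form d.+1 f -> l != 0 -> w = l *: curve_at q z ->
  eval_form f w = 0 -> grad f w = 0 ->
  (along q f).[z] = 0 /\ (along q f)^`().[z] = 0.
Proof.
move=> fd l0 e fw gw; rewrite along_eval along_deriv; split.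
  move/eqP: fw; rewrite e (eval_form_scale _ _ fd) mulf_eq0 expf_eq0 (negbTE l0) andbF.
  by move/eqP.
suff -> : grad f (curve_at q z) = 0 by rewrite /dot big1// => i _; rewrite mxE mul0r.
by move/eqP: gw; rewrite e (grad_scale _ _ fd) scaler_eq0 expf_eq0 (negbTE l0) andbF => /eqP.
Qed.

End ComplexCurve.

(** * Nonsingularity of quartics that are negative somewhere in each region *)

Section Nonsingular.
Variable R : realType.
Variables (s F : mpoly 3 R) (v : 'I_4 -> RP2 R -> R) (x : 'I_4 -> 'rV[R]_3).
Hypothesis rg : regions s v.
Hypothesis Ff : is_form 4 F.
Hypothesis hF : forall w, w != 0 -> 0 < eval_form s w -> 0 < eval_form F w.
Hypothesis hF' : forall w, w != 0 -> eval_form F w < 0 -> eval_form s w < 0.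
Hypothesis x0 : forall i, x i != 0.
Hypothesis xv : forall i, v i (pt (x i)) < 0.
Hypothesis xF : forall i, eval_form F (x i) < 0.

Lemma indep_ex_real (w : 'rV[R]_3) : w != 0 -> exists w', indep w w'.
Proof.
move=> /rV0Pn[i vi]; pose j := i + 1; exists (delta_mx 0 j) => a b.
have ji : (i == j) = false by move: i @j {vi}; apply: ord3P.
move=> /rowP h; have := h i; rewrite !mxE /= ji mulr0 addr0 => /eqP.
rewrite mulf_eq0 (negbTE vi) orbF => /eqP a0; split=> //.
by have := h j; rewrite !mxE a0 mul0r add0r !eqxx mulr1.
Qed.

Lemma size_factor (D r : {poly R}) y : (D * r).[y] != 0 ->
  size (D * r) = (size D + size r).-1 /\ (0 < size D)%N /\ (0 < size r)%N.
Proof.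
rewrite hornerM mulf_eq0 negb_or => /andP[h1 h2].
have D0 : D != 0 by apply: contraNneq h1 => ->; rewrite horner0.
have r0 : r != 0 by apply: contraNneq h2 => ->; rewrite horner0.
by rewrite size_mul// !size_poly_gt0.
Qed.

Lemma det3_00 (u w : 'rV[R]_3) : (det3 u w u = 0) * (det3 u w w = 0) * (det3 u u w = 0).
Proof. by rewrite /det3; do !split; ring. Qed.

Lemma det3_comb w1 w2 w : indep w1 w2 -> det3 w w1 w2 = 0 ->
  exists a b : R, w = a *: w1 + b *: w2.
Proof.
move=> I d0; have [t ht] := indep_det3 I.
exists (det3 w w2 t / det3 w1 w2 t), (det3 w1 w t / det3 w1 w2 t).
rewrite {1}(det3_basis w ht) (_ : det3 w1 w2 w = 0) ?mul0r ?scale0r ?addr0//.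
by rewrite -d0 /det3; ring.
Qed.

Lemma orth_ex (u t : 'rV[R]_3) : exists n, [/\ n != 0, dot u n = 0 & dot t n = 0].
Proof.
have key (a b : 'rV[R]_3) : a != 0 -> exists n, [/\ n != 0, dot a n = 0 & cross a b = 0 -> dot b n = 0].
  move=> a0; have [c hc] := indep_ex_real a0.
  exists (cross a c); split; first exact: cross_neq0.
    by rewrite dotC dot_cross det3_00.
  by move=> /(cross_dep a0)[k ->]; rewrite dotZl dotC dot_cross det3_00 mulr0.
have [u0|u0] := eqVneq u 0.
  have [t0|t0] := eqVneq t 0.
    exists (x 0); split; rewrite ?x0// ?u0 ?t0 /dot big1// => i _; rewrite mxE mul0r//.
  have [n [n0 h _]] := key t 0 t0; exists n; split=> //.
  by rewrite u0 /dot big1// => i _; rewrite mxE mul0r.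
have [c0|c0] := eqVneq (cross u t) 0.
  by have [n [n0 h1 h2]] := key u t u0; exists n; split=> //; exact: h2.
by exists (cross u t); split=> //; rewrite dotC dot_cross det3_00.
Qed.

(** On the line through [x i] and [x j], F would have a double zero at w. The two arcs between the
    regions give the quotient at least four zeros, so F would have at least six on a line. *)
Lemma line_sing_real w i j : i != j -> w != 0 -> eval_form F w = 0 -> grad F w = 0 ->
  det3 w (x i) (x j) != 0.
Proof.
move=> ij w0 Fw gw; apply/eqP => d0; have [_ vc vd _] := rg.
have I := reg_indep rg (x0 i) (x0 j) ij (xv i) (xv j).
have [al [be e]] := det3_comb I d0.
have al0 : al != 0.
  apply/eqP => a0; move: e; rewrite a0 scale0r add0r => e.
  have b0 : be != 0 by apply: contraNneq w0 => b0; rewrite e b0 scale0r.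
  by have := xF j; rewrite -(form4_sign _ Ff b0) -e Fw ltxx.
have e' : w = al *: curve_at (lineq (x i) (x j)) (be / al).
  by rewrite lineq_at e scalerDr scalerA; congr (_ + _ *: _); rewrite mulrC divfK.
have [p0 p1] := along_singular_real Ff al0 e' Fw gw.
have [r pr] := real_double_root p0 p1.
have := @curve_gaps _ _ _ rg F (lineq (x i) (x j)) (fun t => t *: x i + x j) 1 _ r [:: 0] j Ff hF.
rewrite scale0r add0r => /(_ _ _ _ _ _ pr) h.
have : (4 < size r)%N.
  apply: h => //.
  - by move=> u; rewrite lineq_at; exact: indep_neq0.
  - exact: line_infty.
  - by move=> u u0; rewrite lineq_at expr1 scalerDr scalerA mulfV// scale1r.
  - by move=> u; rewrite horner_exp sqr_ge0.
  - move=> y; rewrite inE => /eqP ->; rewrite lineq_at scale0r addr0; split=> //.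
    by exists i => //; rewrite eq_sym.
  - by move=> y y'; rewrite !inE => /eqP -> /eqP ->; rewrite ltxx.
have n0 : (('X - (be / al)%:P) ^+ 2 * r).[0] != 0.
  by rewrite -pr along_eval lineq_at scale0r addr0 lt_eqF.
have [sz _] := size_factor n0; have [sp _] := along_line_size (x i) (x j) Ff.
move: sp; rewrite pr sz size_exp_XsubC; move: (size r) => k; clear; lia.
Qed.

Definition k0 : 'I_4 := Ordinal (isT : (0 < 4)%N).
Definition k1 : 'I_4 := Ordinal (isT : (1 < 4)%N).
Definition k2 : 'I_4 := Ordinal (isT : (2 < 4)%N).
Definition k3 : 'I_4 := Ordinal (isT : (3 < 4)%N).

(** On the conic through w and the four points [x i], F would have a double zero at w and at least
    eight more by the four gaps: ten, while a quartic has eight on a conic. [line_sing_real] ensures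
    that no three of the five points are collinear. *)
Lemma real_smooth w : w != 0 -> eval_form F w = 0 -> grad F w = 0 -> False.
Proof.
move=> w0 Fw gw; have tr := three_regions rg.
have dt i j k : uniq [:: i; j; k] -> det3 (x i) (x j) (x k) != 0.
  by move=> u; exact: (tr _ _ _ i j k).
have lw i j : i != j -> det3 w (x i) (x j) != 0 by move=> ij; exact: line_sing_real.
have eab : det3 (x k0) (x k1) (x k2) != 0 by exact: dt.
set D := det3 (x k0) (x k1) (x k2) in eab.
pose cx u := det3 u (x k1) (x k2) / D; pose cy u := det3 (x k0) u (x k2) / D.
pose cz u := det3 (x k0) (x k1) u / D.
have cE u : u = cx u *: x k0 + cy u *: x k1 + cz u *: x k2 by exact: det3_basis.
have nz (d : R) : d != 0 -> d / D != 0 by move=> d0; rewrite mulf_neq0// invr_eq0.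
have rot (a b c : 'rV[R]_3) : det3 a b c = det3 b c a by rewrite /det3; ring.
have swap (a b c : 'rV[R]_3) : det3 a b c = - det3 b a c by rewrite /det3; ring.
have cxw : cx w != 0 by apply: nz; exact: lw.
have cyw : cy w != 0 by apply: nz; rewrite swap oppr_eq0; exact: lw.
have czw : cz w != 0 by apply: nz; rewrite rot rot; exact: lw.
set m := x k3.
have cxm : cx m != 0 by apply: nz; exact: dt.
have cym : cy m != 0 by apply: nz; exact: dt.
have czm : cz m != 0 by apply: nz; exact: dt.
(* The conics through the three base points are spanned by xy, yz and zx. The coefficients are the
   cross product of the values of these at w and at the fourth point, so that the conic passes
   through both. *)
pose al := cz w * cz m * (cy w * cx m - cx w * cy m).
pose be := cx w * cx m * (cz w * cy m - cy w * cz m).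
pose ga := cy w * cy m * (cx w * cz m - cz w * cx m).
have detc (u t : 'rV[R]_3) : [/\ det3 u t (x k2) = (cx u * cy t - cy u * cx t) * D,
    det3 u t (x k0) = (cy u * cz t - cz u * cy t) * D &
    det3 u t (x k1) = (cz u * cx t - cx u * cz t) * D].
  have gen (a b c a' b' c' : R) (y0 y1 y2 : 'rV[R]_3) :
      let U := a *: y0 + b *: y1 + c *: y2 in let T := a' *: y0 + b' *: y1 + c' *: y2 in
      let E := det3 y0 y1 y2 in [/\ det3 U T y2 = (a * b' - b * a') * E,
        det3 U T y0 = (b * c' - c * b') * E & det3 U T y1 = (c * a' - a * c') * E].
    by rewrite /= /det3 !mxE; split; ring.
  by have := gen (cx u) (cy u) (cz u) (cx t) (cy t) (cz t) (x k0) (x k1) (x k2); rewrite /= -!cE.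
have [d2 d0 d1] := detc w m.
have dm k : k != k3 -> det3 w m (x k) != 0 by rewrite eq_sym => hk; exact: lw.
have al0 : al != 0.
  apply: mulf_neq0; first exact: mulf_neq0.
  have := dm k2 isT; rewrite d2 mulf_eq0 negb_or => /andP[h _].
  by rewrite -oppr_eq0 opprB.
have be0 : be != 0.
  apply: mulf_neq0; first exact: mulf_neq0.
  have := dm k0 isT; rewrite d0 mulf_eq0 negb_or => /andP[h _].
  by rewrite -oppr_eq0 opprB.
have ga0 : ga != 0.
  apply: mulf_neq0; first exact: mulf_neq0.
  have := dm k1 isT; rewrite d1 mulf_eq0 negb_or => /andP[h _].
  by rewrite -oppr_eq0 opprB.
pose q := conq (x k0) (x k1) (x k2) al be ga.
have q0 u : curve_at q u != 0 by exact: conq_neq0.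
have hcw : al * cx w * cy w + be * cy w * cz w + ga * cz w * cx w = 0.
  by rewrite /al /be /ga; ring.
have hnw : cx w *: x k0 + cy w *: x k1 + cz w *: x k2 != 0 by rewrite -cE ?w0 ?x0.
have [l l0 lw'] := conq_point al0 be0 cyw hcw hnw.
rewrite -cE in lw'.
have hcm : al * cx m * cy m + be * cy m * cz m + ga * cz m * cx m = 0.
  by rewrite /al /be /ga; ring.
have hnm : cx m *: x k0 + cy m *: x k1 + cz m *: x k2 != 0 by rewrite -cE ?w0 ?x0.
have [l' l'0 lm'] := conq_point al0 be0 cym hcm hnm.
rewrite -cE in lm'.
have [p0 p1] := along_singular_real Ff l0 lw' Fw gw.
have [r pr] := real_double_root p0 p1.
have sgn i u c : c != 0 -> curve_at q u = c *: x i ->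
    eval_form F (curve_at q u) < 0 /\ v i (pt (curve_at q u)) < 0.
  by move=> c0 ->; rewrite form4_sign// pt_scale.
have se := sgn _ _ _ _ (conq_e (x k0) (x k1) (x k2) al be ga0).
have sa := sgn _ _ _ al0 (conq_a (x k0) (x k1) (x k2) al be ga).
have sm : eval_form F (curve_at q (cz m / cy m)) < 0 /\ v k3 (pt (curve_at q (cz m / cy m))) < 0.
  apply: (sgn _ _ l'^-1); first by rewrite invr_eq0.
  by rewrite -/m [X in _ = _ *: X]lm' scalerA mulVf// scale1r.
have {}se : eval_form F (curve_at q (- al / ga)) < 0 /\ v k0 (pt (curve_at q (- al / ga))) < 0.
  by apply: se; apply: mulf_neq0; [exact: mulf_neq0|rewrite invr_eq0].
pose us := [:: (- al / ga, k0); (0, k1); (cz m / cy m, k3)].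
have hus : {in us, forall c, eval_form F (curve_at q c.1) < 0 /\ v c.2 (pt (curve_at q c.1)) < 0}.
  by move=> c; rewrite !inE => /or3P[] /eqP ->.
have uus c c' : c \in us -> c' \in us -> c.1 = c'.1 -> c = c'.
  move=> h h' e; have k : c.2 = c'.2.
    apply: (reg_disj rg (p := pt (curve_at q c.1))); first exact: ltW (hus c h).2.
    by rewrite e; exact: ltW (hus c' h').2.
  by case: c c' e k {h h'} => [a b] [a' b'] /= -> ->.
have := @curve_gaps _ _ _ rg F q (conG (x k0) (x k1) (x k2) al be ga) 2 _ r (map fst us) k2 Ff hF.
rewrite conG0 => /(_ _ _ _ _ _ pr) h.
have : (8 < size r)%N.
  apply: h => //.
  - exact: conG_cont.
  - by rewrite scaler_eq0 negb_or ga0 x0.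
  - by move=> u u0; exact: conq_infty.
  - by move=> u; rewrite horner_exp sqr_ge0.
  - rewrite map_inj_in_uniq; first by apply: (@map_uniq _ _ snd).
    by move=> c c'; exact: uus.
  - by rewrite pt_scale.
  - by rewrite form4_sign.
  - move=> y /mapP[c cin ->]; have [h1 h2] := hus c cin; split=> //; exists c.2 => //.
    by move: cin; rewrite !inE => /or3P[] /eqP ->.
  - move=> y y' /mapP[c cin ->] /mapP[c' cin' ->] yy'; left; exists c.2, c'.2.
    have [_ h2] := hus c cin; have [_ h2'] := hus c' cin'; split=> //.
    apply: contraTneq yy' => ek; move: cin cin' ek; rewrite !inE.
    by move=> /or3P[] /eqP -> /or3P[] /eqP -> // _; rewrite ltxx.
have n0 : (('X - (cz w / cy w)%:P) ^+ 2 * r).[0] != 0 by rewrite -pr along_eval lt_eqF// sa.1.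
have [sz _] := size_factor n0.
have := conq_along_size (x k0) (x k1) (x k2) al be ga Ff; rewrite -/q pr sz size_exp_XsubC.
move: (size r) => k; clear; lia.
Qed.

Notation rc := (real_complex R).
Definition cw (X Y : 'rV[R]_3) : 'rV[R[i]]_3 := \row_j (X 0 j +i* Y 0 j)%C.

Lemma line_at_i X Y : curve_at (map_mx (map_poly rc) (lineq X Y)) (0 +i* 1)%C = cw X Y.
Proof.
apply/rowP => j; rewrite !mxE rmorphD /= map_polyC map_polyZ map_polyX.
rewrite hornerD hornerC hornerZ hornerX; apply/eqP; rewrite eq_complex /=.
by apply/andP; split; apply/eqP; ring.
Qed.

Lemma conq_complex (e a b : 'rV[R]_3) (al be ga : R) :
  map_mx (map_poly rc) (conq e a b al be ga) =
  conq (cv e) (cv a) (cv b) (rc al) (rc be) (rc ga).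
Proof.
apply/rowP => j; rewrite !mxE !(rmorphD (map_poly rc)) !(rmorphM (map_poly rc)) /=.
rewrite !(rmorphD (map_poly rc)) /= !map_polyC !map_polyZ /= map_polyXn !map_polyX.
by rewrite rmorphM rmorphN.
Qed.

(** The real line through the singular point and its conjugate carries all four zeros of F, so F has
    constant sign on it, negative because of [x i]. Then s is negative on the whole line, which lies
    in one region; but it meets the line through two points of other regions. *)
Lemma line_sing_complex X Y i : indep X Y -> det3 (x i) X Y = 0 ->
  eval_form (complexify F) (cw X Y) = 0 -> grad (complexify F) (cw X Y) = 0 -> False.
Proof.
move=> I di Fw gw.
have [|p0 p1] := along_singular Ff (oner_neq0 _) _ Fw gw (q := lineq X Y) (z := (0 +i* 1)%C).
  by rewrite scale1r line_at_i.
have [r pr] := complex_double_root (oner_neq0 _) p0 p1.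
have [sp lp] := along_line_size X Y Ff.
have D1 : (quad (0 : R) 1 ^+ 2) \is monic.
  by rewrite monic_exp// monicE /lead_coef quad_size /= coefD coefC addr0 expr2 coefM !big_ord_recr big_ord0 /= !coefB !coefX !coefC /=; apply/eqP; ring.
have sD : size (quad (0 : R) 1 ^+ 2) = 5%N.
  by rewrite expr2 size_mul ?quad_size// -size_poly_gt0 quad_size.
have [al [be e]] := det3_comb I di.
have F0 : along (lineq X Y) F != 0.
  apply/eqP => z; have := xF i; rewrite e.
  have [a0|a0] := eqVneq al 0.
    have b0 : be != 0 by apply: contraNneq (x0 i) => b0; rewrite e a0 b0 !scale0r addr0.
    by rewrite a0 scale0r add0r form4_sign// -lp z coef0 ltxx.
  have -> : al *: X + be *: Y = al *: curve_at (lineq X Y) (be / al).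
    by rewrite lineq_at scalerDr scalerA; congr (_ + _ *: _); rewrite mulrC divfK.
  by rewrite form4_sign// -along_eval z horner0 ltxx.
have r0 : r != 0 by apply: contraNneq F0 => z; rewrite pr z mulr0.
have sr : (size r <= 1)%N.
  move: sp; rewrite pr size_monicM// sD; move: (size r) => k; clear; lia.
have rE := size1_polyC sr; set k := r`_0 in rE.
have Yk : eval_form F Y = k.
  have := monicP D1; rewrite lead_coefE sD /= => lc.
  by rewrite -lp pr rE coefMC lc mul1r.
have Xk u : eval_form F (X + u *: Y) = (quad 0 1).[u] ^+ 2 * k.
  by rewrite -lineq_at -along_eval pr rE hornerM horner_exp hornerC.
have q0 u : 0 < (quad (0 : R) 1).[u] ^+ 2.
  by apply: exprn_gt0; rewrite /quad hornerD horner_exp hornerC expr1n ltr_wpDl// sqr_ge0.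
have comb a b : a *: X + b *: Y != 0 -> (eval_form F (a *: X + b *: Y) < 0) = (k < 0).
  move=> n0; have [a0|a0] := eqVneq a 0.
    have b0 : b != 0 by apply: contraNneq n0 => b0; rewrite a0 b0 !scale0r addr0.
    by rewrite a0 scale0r add0r form4_sign// Yk.
  have -> : a *: X + b *: Y = a *: (X + (b / a) *: Y).
    by rewrite scalerDr scalerA; congr (_ + _ *: _); rewrite mulrC divfK.
  by rewrite form4_sign// Xk pmulr_rlt0.
have kn : k < 0 by rewrite -(comb al be) -e.
have neg a b : a *: X + b *: Y != 0 -> eval_form s (a *: X + b *: Y) < 0.
  by move=> n0; apply: hF' => //; rewrite comb.
have [_ vc vd _] := rg.
(* If a point of the line were in another region, s would be positive somewhere on the segment that
   joins it to [x i]. *)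
have inN a b : a *: X + b *: Y != 0 -> v i (pt (a *: X + b *: Y)) < 0.
  move=> n0; set m := _ + _ in n0 *.
  have hm a' b' : a' *: x i + b' *: m != 0 -> eval_form s (a' *: x i + b' *: m) < 0.
    have -> : a' *: x i + b' *: m = (a' * al + b' * a) *: X + (a' * be + b' * b) *: Y.
      by rewrite e /m; apply/rowP => j; rewrite !mxE; ring.
    exact: neg.
  rewrite ltNge; apply/negP => vm.
  have [j vj] : exists j, v j (pt m) < 0.
    by have := hm 0 1; rewrite scale0r scale1r add0r => /(_ n0) /(reg_neg_ex rg n0)[j hj]; exists j.
  have ij : i != j by apply: contraTneq vj => <-; rewrite -leNgt.
  have I' := reg_indep rg (x0 i) n0 ij (xv i) vj.
  have nn t : (1 - t) *: x i + t *: m != 0.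
    apply/eqP => /I'[t1 t2]; move: t1; rewrite t2 subr0 => /eqP; rewrite oner_eq0//.
  have cc : continuous (fun t : R => pt ((1 - t) *: x i + t *: m)).
    move=> t; have -> : (fun t : R => pt ((1 - t) *: x i + t *: m)) = (fun t => pt (x i + t *: (m - x i))).
      by apply/funext => t'; congr pt; apply/rowP => l; rewrite !mxE; ring.
    have nz : x i + t *: (m - x i) != 0.
      rewrite (_ : _ + _ = (1 - t) *: x i + t *: m)//.
      by apply/rowP => l; rewrite !mxE; ring.
    exact: (contT (@cont_line R (x i) (m - x i) t) (pt_continuous nz)).
  have [||z _ hz] := @sep_pos _ _ _ rg _ 0 1 i j cc ltr01 ij.
  - by rewrite subr0 scale1r scale0r addr0 ltW.
  - by rewrite subrr scale0r scale1r add0r ltW.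
  by have := reg_pos rg (nn z) hz; rewrite ltNge (ltW (hm _ _ (nn z))).
have [j] := @other4 [:: i] isT; rewrite inE => ji.
have [l] := @other4 [:: i; j] isT; rewrite !inE negb_or => /andP[li lj].
have uijl : uniq [:: i; j; l] by rewrite /= !inE negb_or eq_sym ji eq_sym li eq_sym lj.
(* The intersection with the line through [x j] and [x l]. If it is the zero vector, [x j] and [x l]
   lie on the line themselves, and three regions are on one line at once. *)
pose m := det3 X Y (x l) *: x j - det3 X Y (x j) *: x l.
have dm : det3 X Y m = 0 by rewrite /m /det3 !mxE; ring.
have rot (a b c : 'rV[R]_3) : det3 a b c = det3 b c a by rewrite /det3; ring.
have [m0|m0] := eqVneq m 0.
  have Il := reg_indep rg (x0 j) (x0 l) (_ : j != l) (xv j) (xv l).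
  have [||d1 d2] := Il _ (det3 X Y (x l)) (- det3 X Y (x j)); first by rewrite eq_sym.
    by rewrite scaleNr.
  have h : det3 (x i) (x j) (x l) != 0 by exact: (three_regions rg _ _ _ uijl).
  have d2' : det3 X Y (x j) = 0 by apply/eqP; rewrite -oppr_eq0; apply/eqP.
  have [aj [bj ej]] := det3_comb I (etrans (rot _ _ _) d2').
  have [al' [bl' el]] := det3_comb I (etrans (rot _ _ _) d1).
  by move: h; rewrite e ej el /det3 !mxE => /eqP; apply; ring.
have [am [bm em]] := det3_comb I (etrans (rot _ _ _) dm).
have vm : v i (pt m) < 0 by rewrite em; apply: inN; rewrite -em.
have := three_regions rg m0 (x0 j) (x0 l) uijl vm (xv j) (xv l).
by rewrite /m /det3 !mxE => /eqP; apply; ring.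
Qed.

Lemma complex_zero2 (c1 c2 p r : R) : c1 * p - c2 * r = 0 -> c2 * p + c1 * r = 0 ->
  c1 ^+ 2 + c2 ^+ 2 != 0 -> p = 0 /\ r = 0.
Proof.
move=> h1 h2 n; split; apply: (mulfI n); rewrite mulr0.
  have -> : (c1 ^+ 2 + c2 ^+ 2) * p = c1 * (c1 * p - c2 * r) + c2 * (c2 * p + c1 * r) by ring.
  by rewrite h1 h2 !mulr0 addr0.
have -> : (c1 ^+ 2 + c2 ^+ 2) * r = c1 * (c2 * p + c1 * r) - c2 * (c1 * p - c2 * r) by ring.
by rewrite h1 h2 !mulr0 subr0.
Qed.

(* [x (ga z + al y)] has real and imaginary parts zero *)
Lemma degenerate (a1 a2 b1 b2 c1 c2 be ga : R) :
  be * (b1 * c1 - b2 * c2) + ga * (c1 * a1 - c2 * a2) = 0 ->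
  be * (b1 * c2 + b2 * c1) + ga * (c1 * a2 + c2 * a1) = 0 ->
  b1 * c2 - b2 * c1 != 0 -> a1 * b2 - a2 * b1 != 0 -> be = 0 /\ ga = 0.
Proof.
move=> h1 h2 n1 n2.
have c0 : c1 ^+ 2 + c2 ^+ 2 != 0.
  apply: contraNneq n1 => /eqP; rewrite paddr_eq0 ?sqr_ge0// !sqrf_eq0 => /andP[/eqP -> /eqP ->].
  by rewrite !mulr0 subrr.
have [||e1 e2] := complex_zero2 (p := be * b1 + ga * a1) (r := be * b2 + ga * a2) _ _ c0.
- by rewrite -[RHS]h1; ring.
- by rewrite -[RHS]h2; ring.
split; apply: (mulIf n2); rewrite mul0r.
- have -> : be * (a1 * b2 - a2 * b1) = a1 * (be * b2 + ga * a2) - a2 * (be * b1 + ga * a1) by ring.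
  by rewrite e1 e2 !mulr0 subr0.
- have -> : ga * (a1 * b2 - a2 * b1) = b2 * (be * b1 + ga * a1) - b1 * (be * b2 + ga * a2) by ring.
  by rewrite e1 e2 !mulr0 subr0.
Qed.

(** The conic through the singular point, its conjugate and three of the [x i] is real. F would have
    two conjugate double zeros on it and six more zeros in the gaps: ten, against eight. *)
Lemma complex_smooth X Y : indep X Y ->
  eval_form (complexify F) (cw X Y) = 0 -> grad (complexify F) (cw X Y) = 0 -> False.
Proof.
move=> I Fw gw.
have nd i : det3 (x i) X Y != 0 by apply/eqP => h; exact: line_sing_complex I h Fw gw.
have eab : det3 (x k0) (x k1) (x k2) != 0 by apply: (three_regions rg (i := k0) (j := k1) (k := k2)).
set D := det3 (x k0) (x k1) (x k2) in eab.
pose cx u := det3 u (x k1) (x k2) / D; pose cy u := det3 (x k0) u (x k2) / D.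
pose cz u := det3 (x k0) (x k1) u / D.
have cE u : u = cx u *: x k0 + cy u *: x k1 + cz u *: x k2 by exact: det3_basis.
have gen (a b c a' b' c' : R) (y0 y1 y2 : 'rV[R]_3) :
    let U := a *: y0 + b *: y1 + c *: y2 in let T := a' *: y0 + b' *: y1 + c' *: y2 in
    let E := det3 y0 y1 y2 in [/\ det3 y2 U T = (a * b' - a' * b) * E,
      det3 y0 U T = (b * c' - b' * c) * E & det3 y1 U T = (c * a' - c' * a) * E].
  by rewrite /= /det3 !mxE; split; ring.
have := gen (cx X) (cy X) (cz X) (cx Y) (cy Y) (cz Y) (x k0) (x k1) (x k2).
rewrite /= -!cE -/D => -[d2 d0 d1].
set a1 := cx X in d0 d1 d2; set b1 := cy X in d0 d1 d2; set c1 := cz X in d0 d1 d2.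
set a2 := cx Y in d0 d1 d2; set b2 := cy Y in d0 d1 d2; set c2 := cz Y in d0 d1 d2.
have nab : a1 * b2 - a2 * b1 != 0 by have := nd k2; rewrite d2 mulf_eq0 negb_or => /andP[].
have nbc : b1 * c2 - b2 * c1 != 0 by have := nd k0; rewrite d0 mulf_eq0 negb_or => /andP[].
have nca : c1 * a2 - c2 * a1 != 0 by have := nd k1; rewrite d1 mulf_eq0 negb_or => /andP[].
have cX : X = a1 *: x k0 + b1 *: x k1 + c1 *: x k2 by exact: cE.
have cY : Y = a2 *: x k0 + b2 *: x k1 + c2 *: x k2 by exact: cE.
clearbody a1 a2 b1 b2 c1 c2; clear d0 d1 d2 gen cE cx cy cz.
pose vec (p q r : R) : 'rV[R]_3 := \row_j (if j == i0 then p else if j == i1 then q else r).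
(* Real coefficients orthogonal to both the real and the imaginary part of (xy, yz, zx) at the
   singular point give a real conic through it and its conjugate. *)
have [n [n0 h1 h2]] := orth_ex (vec (a1 * b1 - a2 * b2) (b1 * c1 - b2 * c2) (c1 * a1 - c2 * a2))
  (vec (a1 * b2 + a2 * b1) (b1 * c2 + b2 * c1) (c1 * a2 + c2 * a1)).
pose al := n 0 i0; pose be := n 0 i1; pose ga := n 0 i2.
rewrite dotE !mxE /= -/al -/be -/ga in h1 h2; rewrite dotE !mxE /= -/al -/be -/ga in h2.
have nall : ~ [/\ al = 0, be = 0 & ga = 0].
  by move=> [e1 e2 e3]; case/eqP: n0; apply: row3P; rewrite mxE.
have al0 : al != 0.
  apply/eqP => z; rewrite z in h1 h2; apply: nall.
  have [||//|e1 e2] := degenerate (be := be) (ga := ga) (a1 := a1) (a2 := a2) (b1 := b1) (b2 := b2) (c1 := c1) (c2 := c2) _ _ nbc.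
  - by rewrite -[RHS]h1; ring.
  - by rewrite -[RHS]h2; ring.
  by split.
have be0 : be != 0.
  apply/eqP => z; rewrite z in h1 h2; apply: nall.
  have [||//|e1 e2] := degenerate (be := ga) (ga := al) (a1 := b1) (a2 := b2) (b1 := c1) (b2 := c2) (c1 := a1) (c2 := a2) _ _ nca.
  - by rewrite -[RHS]h1; ring.
  - by rewrite -[RHS]h2; ring.
  by split.
have ga0 : ga != 0.
  apply/eqP => z; rewrite z in h1 h2; apply: nall.
  have [||//|e1 e2] := degenerate (be := al) (ga := be) (a1 := c1) (a2 := c2) (b1 := a1) (b2 := a2) (c1 := b1) (c2 := b2) _ _ nab.
  - by rewrite -[RHS]h1; ring.
  - by rewrite -[RHS]h2; ring.
  by split.
pose q := conq (x k0) (x k1) (x k2) al be ga.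
have rc0 (t : R) : t != 0 -> rc t != 0 by move=> t0; apply: contraNneq t0 => /complexI ->.
have wE : cw X Y = (a1 +i* a2)%C *: cv (x k0) + (b1 +i* b2)%C *: cv (x k1) + (c1 +i* c2)%C *: cv (x k2).
  apply/rowP => j; rewrite cX cY !mxE; apply/eqP; rewrite eq_complex /=.
  by apply/andP; split; apply/eqP; ring.
have w0 : cw X Y != 0.
  apply/eqP => /rowP w0; have [] := I 1 0; last by move/eqP; rewrite oner_eq0.
  apply/rowP => j; have := w0 j; rewrite !mxE => /eqP; rewrite eq_complex /= => /andP[/eqP -> _].
  by rewrite mulr0 mul0r addr0.
have B0 : (b1 +i* b2)%C != 0.
  apply/eqP => -[e1 e2]; move: nbc; rewrite e1 e2 !mul0r subrr eqxx//.
have hc : rc al * (a1 +i* a2)%C * (b1 +i* b2)%C + rc be * (b1 +i* b2)%C * (c1 +i* c2)%C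
    + rc ga * (c1 +i* c2)%C * (a1 +i* a2)%C = 0.
  apply/eqP; rewrite eq_complex /=; apply/andP; split; apply/eqP.
    by rewrite -[RHS]h1; ring.
  by rewrite -[RHS]h2; ring.
rewrite wE in w0; have [l l0 wl] := conq_point (rc0 _ al0) (rc0 _ be0) B0 hc w0.
rewrite -wE -(conq_complex _ _ _ al be ga) -/q in wl.
case E : ((c1 +i* c2)%C / (b1 +i* b2)%C) wl => [p d] wl.
have d0 : d != 0.
  apply/eqP => z; have := divfK B0 (c1 +i* c2)%C; rewrite E z => -[e1 e2].
  by case/eqP: nbc; rewrite -e1 -e2; ring.
have [p0 p1] := along_singular Ff l0 wl Fw gw.
have [r pr] := complex_double_root d0 p0 p1.
have q0 u : curve_at q u != 0 by exact: conq_neq0.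
have sgn i u c : c != 0 -> curve_at q u = c *: x i ->
    eval_form F (curve_at q u) < 0 /\ v i (pt (curve_at q u)) < 0.
  by move=> c0 ->; rewrite form4_sign// pt_scale.
have se := sgn _ _ _ _ (conq_e (x k0) (x k1) (x k2) al be ga0).
have sa := sgn _ _ _ al0 (conq_a (x k0) (x k1) (x k2) al be ga).
have {}se : eval_form F (curve_at q (- al / ga)) < 0 /\ v k0 (pt (curve_at q (- al / ga))) < 0.
  by apply: se; apply: mulf_neq0; [exact: mulf_neq0|rewrite invr_eq0].
have ne : - al / ga != 0 by rewrite mulf_neq0 ?oppr_eq0 ?invr_eq0.
have := @curve_gaps _ _ _ rg F q (conG (x k0) (x k1) (x k2) al be ga) 2 _ r [:: - al / ga; 0] k2 Ff hF.
rewrite conG0 => /(_ _ _ _ _ _ pr) h.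
have : (6 < size r)%N.
  apply: h => //.
  - exact: conG_cont.
  - by rewrite scaler_eq0 negb_or ga0 x0.
  - by move=> u u0; exact: conq_infty.
  - by move=> u; rewrite horner_exp sqr_ge0.
  - by rewrite /= inE ne.
  - by rewrite pt_scale.
  - by rewrite form4_sign.
  - move=> y; rewrite !inE => /orP[] /eqP ->.
      by split; [exact: se.1|exists k0 => //; exact: se.2].
    by split; [exact: sa.1|exists k1 => //; exact: sa.2].
  - move=> y y'; rewrite !inE => /orP[] /eqP -> /orP[] /eqP -> yy'; left.
    + by move: yy'; rewrite ltxx.
    + by exists k0, k1; split; [|exact: se.2|exact: sa.2].
    + by exists k1, k0; split; [|exact: sa.2|exact: se.2].
    + by move: yy'; rewrite ltxx.
have n0' : (quad p d ^+ 2 * r).[0] != 0 by rewrite -pr along_eval lt_eqF// sa.1.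
have [sz _] := size_factor n0'.
have := conq_along_size (x k0) (x k1) (x k2) al be ga Ff; rewrite -/q pr sz expr2.
rewrite size_mul ?quad_size -?size_poly_gt0 ?quad_size//.
move: (size r) => k; clear; lia.
Qed.

(** When the real and imaginary parts of a singular vector are dependent, the vector is a complex
    multiple of a real one and the real case applies; otherwise they span a real line. *)
Lemma quartic_nonsingular : nonsingular 4 F.
Proof.
split=> // w w0 Fw; apply/eqP => gw.
pose X : 'rV[R]_3 := \row_j complex.Re (w 0 j); pose Y : 'rV[R]_3 := \row_j complex.Im (w 0 j).
have wE : w = cw X Y by apply/rowP => j; rewrite !mxE; case: (w 0 j).
have red (l : R[i]) (t : 'rV[R]_3) : w = l *: cv t -> False.
  move=> e; have l0 : l != 0 by apply: contraNneq w0 => l0; rewrite e l0 scale0r.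
  have t0 : t != 0.
    by apply: contraNneq w0 => t0; rewrite e t0 (_ : cv 0 = 0) ?scaler0//; apply/eqP; rewrite cv_eq0.
  have Ff' := complexify_form Ff.
  apply: (real_smooth t0).
    move/eqP: Fw; rewrite e (eval_form_scale _ _ Ff') mulf_eq0 expf_eq0 (negbTE l0) andbF /=.
    by rewrite eval_complexify => /eqP /complexI.
  move/eqP: gw; rewrite e (grad_scale _ _ Ff') scaler_eq0 expf_eq0 (negbTE l0) andbF /=.
  by rewrite grad_complexify cv_eq0 => /eqP.
have [X0|X0] := eqVneq X 0.
  apply: (red (0 +i* 1)%C Y); rewrite wE X0; apply/rowP => j; rewrite !mxE; apply/eqP.
  by rewrite eq_complex /=; apply/andP; split; apply/eqP; ring.
have [c0|c0] := eqVneq (cross X Y) 0.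
  have [k Yk] := cross_dep X0 c0.
  apply: (red (1 +i* k)%C X); rewrite wE Yk; apply/rowP => j; rewrite !mxE; apply/eqP.
  by rewrite eq_complex /=; apply/andP; split; apply/eqP; ring.
have I : indep X Y.
  move=> a b e; have z : cross X Y = cross X Y by [].
  have [a0|a0] := eqVneq a 0.
    split=> //; move: e; rewrite a0 scale0r add0r => /eqP; rewrite scaler_eq0 => /orP[/eqP//|/eqP Y0].
    by case/eqP: c0; rewrite Y0; apply: row3P; rewrite !mxE /=; ring.
  exfalso; case/eqP: c0; have -> : X = - (b / a) *: Y.
    apply/eqP; rewrite -subr_eq0 scaleNr opprK -(inj_eq (scalerI a0)) scaler0 scalerDr scalerA.
    by rewrite [a * _]mulrC divfK// e.
  by apply: row3P; rewrite !mxE /=; ring.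
by apply: (complex_smooth I); rewrite -wE.
Qed.

End Nonsingular.

(** * Affine charts and local connectedness of RP^2 *)

Section Charts.
Variable R : realType.
Implicit Types (p q : RP2 R) (w u : 'rV[R]_3).

Lemma det3_cont (f1 f2 f3 : 'rV[R]_3 -> 'rV[R]_3) w : continuous_at w f1 ->
  continuous_at w f2 -> continuous_at w f3 -> continuous_at w (fun u => det3 (f1 u) (f2 u) (f3 u)).
Proof.
move=> h1 h2 h3.
have k (f : 'rV[R]_3 -> 'rV[R]_3) i : continuous_at w f -> continuous_at w (fun u => f u 0 i).
  by move=> fc; exact: (@continuous_comp _ _ _ f (fun M : 'rV[R]_3 => M 0 i) w fc (@coord_continuous _ _ _ _ _ _)).
rewrite /det3; apply: contD; [apply: contB|]; (apply: contM; first exact: k);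
  by apply: contB; apply: contM; exact: k.
Qed.

Lemma det3_cont1 (a b w : 'rV[R]_3) : continuous_at w (fun u => det3 u a b).
Proof.
have i : continuous_at w (fun u : 'rV[R]_3 => u) by exact: cvg_id.
have k (c : 'rV[R]_3) : continuous_at w (fun _ : 'rV[R]_3 => c).
  by apply: row_continuous => j; exact: contC.
exact: (det3_cont i (k a) (k b)).
Qed.
Lemma det3_cont2 (a b w : 'rV[R]_3) : continuous_at w (fun u => det3 a u b).
Proof.
have i : continuous_at w (fun u : 'rV[R]_3 => u) by exact: cvg_id.
have k (c : 'rV[R]_3) : continuous_at w (fun _ : 'rV[R]_3 => c).
  by apply: row_continuous => j; exact: contC.
exact: (det3_cont (k a) i (k b)).
Qed.
Lemma det3_cont3 (a b w : 'rV[R]_3) : continuous_at w (fun u => det3 a b u).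
Proof.
have i : continuous_at w (fun u : 'rV[R]_3 => u) by exact: cvg_id.
have k (c : 'rV[R]_3) : continuous_at w (fun _ : 'rV[R]_3 => c).
  by apply: row_continuous => j; exact: contC.
exact: (det3_cont (k a) (k b) i).
Qed.

Section Chart.
Variables v0 w1 w2 : 'rV[R]_3.
Hypothesis d0 : det3 v0 w1 w2 != 0.

(** The affine chart centred at [pt v0]; [phi1] and [phi2] are its coordinate functions, meaningful
    on [dom], where the coordinate along [v0] is not zero. *)
Definition kap (z : R * R) : RP2 R := pt (v0 + z.1 *: w1 + z.2 *: w2).
Definition phi1 : RP2 R -> R := lift_fun (fun u => det3 v0 u w2 / det3 u w1 w2).
Definition phi2 : RP2 R -> R := lift_fun (fun u => det3 v0 w1 u / det3 u w1 w2).
Definition dom p := det3 (rep p) w1 w2 != 0.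

Lemma det3Z (a : R) (x y z : 'rV[R]_3) : [/\ det3 (a *: x) y z = a * det3 x y z,
  det3 x (a *: y) z = a * det3 x y z & det3 x y (a *: z) = a * det3 x y z].
Proof. by rewrite /det3 !mxE; split; ring. Qed.

Lemma phi1_pt u : u != 0 -> phi1 (pt u) = det3 v0 u w2 / det3 u w1 w2.
Proof.
move=> u0; apply: lift_fun_pt => // a v a0 _; case: (det3Z a v w1 w2) => -> _ _.
by case: (det3Z a v0 v w2) => _ -> _; rewrite -mulf_div divff// mul1r.
Qed.

Lemma phi2_pt u : u != 0 -> phi2 (pt u) = det3 v0 w1 u / det3 u w1 w2.
Proof.
move=> u0; apply: lift_fun_pt => // a v a0 _; case: (det3Z a v w1 w2) => -> _ _.
by case: (det3Z a v0 w1 v) => _ _ ->; rewrite -mulf_div divff// mul1r.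
Qed.

Lemma dom_pt u : u != 0 -> dom (pt u) = (det3 u w1 w2 != 0).
Proof.
move=> u0; rewrite /dom; have [a a0 ->] := rep_pt u0.
by case: (det3Z a u w1 w2) => -> _ _; rewrite mulf_eq0 negb_or a0.
Qed.

Lemma dom_near p : dom p -> \forall q \near p, dom q.
Proof.
rewrite -[p]pt_rep => hp; apply/nbhs_pt; first exact: rep_neq0.
have r0 := rep_neq0 p; rewrite dom_pt// in hp.
have hc : continuous_at (rep p) (fun u : 'rV[R]_3 => det3 u w1 w2 ^+ 2).
  by apply: contX; exact: det3_cont1.
have := near_gt0 hc; rewrite lt_neqAle eq_sym sqrf_eq0 hp sqr_ge0 => /(_ isT) h.
apply: filterS2 (near_neq0 r0) h => u u0 h; rewrite dom_pt//.
by apply: contraTneq h => ->; rewrite expr0n ltxx.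
Qed.

Lemma phi_cont p : dom p -> continuous_at p phi1 /\ continuous_at p phi2.
Proof.
rewrite -[p]pt_rep => hp; have r0 := rep_neq0 p; rewrite dom_pt// in hp.
have key (g : 'rV[R]_3 -> R) (f : RP2 R -> R) : (forall u, u != 0 -> f (pt u) = g u) ->
    continuous_at (rep p) g -> continuous_at (pt (rep p)) f.
  move=> h gc; apply: continuous_at_pt => //.
  have e : \forall u \near rep p, g u = (f \o @pt R) u.
    by apply: filterS (near_neq0 r0) => u u0; rewrite /= h.
  rewrite /prop_for /continuous_at /= h//; exact: (cvg_trans (near_eq_cvg e) gc).
split; [apply: (key _ _ phi1_pt)|apply: (key _ _ phi2_pt)]; apply: contM.
- exact: det3_cont2.
- by apply: contV => //; exact: det3_cont1.
- exact: det3_cont3.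
- by apply: contV => //; exact: det3_cont1.
Qed.

Lemma kap_neq0 z : v0 + z.1 *: w1 + z.2 *: w2 != 0.
Proof.
apply/eqP => e; have := @det3_free _ v0 w1 w2 1 z.1 z.2 d0; rewrite scale1r e.
by case=> // /eqP; rewrite oner_eq0.
Qed.

Lemma kap_cont : continuous kap.
Proof.
move=> z.
have vc : continuous_at z (fun z : R * R => v0 + z.1 *: w1 + z.2 *: w2).
  apply: row_continuous => i.
  apply: (contE (g := fun z : R * R => v0 0 i + z.1 * w1 0 i + z.2 * w2 0 i)).
    by move=> t; rewrite !mxE.
  apply: contD; [apply: contD; first exact: contC|]; (apply: contM; last exact: contC).
    exact: cont_fst.
  exact: cont_snd.
exact: (contT vc (pt_continuous (kap_neq0 z))).
Qed.

Lemma kap_dom z : dom (kap z).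
Proof.
rewrite dom_pt ?kap_neq0//.
by rewrite (_ : det3 _ w1 w2 = det3 v0 w1 w2)//; rewrite /det3 !mxE; ring.
Qed.

Lemma phi1_kap z : phi1 (kap z) = z.1.
Proof.
have h := kap_dom z; rewrite /kap dom_pt ?kap_neq0// in h; rewrite /kap phi1_pt ?kap_neq0//.
by apply: (mulIf h); rewrite divfK//; rewrite /det3 !mxE; ring.
Qed.

Lemma phi2_kap z : phi2 (kap z) = z.2.
Proof.
have h := kap_dom z; rewrite /kap dom_pt ?kap_neq0// in h; rewrite /kap phi2_pt ?kap_neq0//.
by apply: (mulIf h); rewrite divfK//; rewrite /det3 !mxE; ring.
Qed.

Lemma kap_phi p : dom p -> kap (phi1 p, phi2 p) = p.
Proof.
rewrite -[p]pt_rep => hp; have r0 := rep_neq0 p; rewrite dom_pt// in hp.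
rewrite /kap /= phi1_pt// phi2_pt//; apply/pt_eq => //.
  by have := kap_neq0 (det3 v0 (rep p) w2 / det3 (rep p) w1 w2, det3 v0 w1 (rep p) / det3 (rep p) w1 w2).
exists (det3 v0 w1 w2 / det3 (rep p) w1 w2); first by rewrite mulf_neq0// invr_eq0.
have d0' := d0; set D := det3 v0 w1 w2 in d0' *; set E := det3 (rep p) w1 w2 in hp *.
rewrite [X in _ = _ *: X](det3_basis (rep p) d0') -/D -/E.
by apply/rowP => i; rewrite !mxE; field; rewrite d0' hp.
Qed.

Lemma kap0 : kap (0, 0) = pt v0.
Proof. by rewrite /kap /= !scale0r !addr0. Qed.

Lemma kap_nbhs (U : set (RP2 R)) : v0 != 0 -> nbhs (pt v0) U ->
  exists2 r : R, 0 < r & forall z, `|z.1| < r -> `|z.2| < r -> U (kap z).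
Proof.
move=> v00; rewrite -kap0 => /kap_cont /nbhs_ballP[r r0 h]; exists r => // z z1 z2.
by apply: h; split; rewrite /= /ball /= sub0r normrN.
Qed.

Lemma nbhs_kap r : v0 != 0 -> 0 < r ->
  nbhs (pt v0) [set p | dom p /\ (`|phi1 p| < r /\ `|phi2 p| < r)].
Proof.
move=> v00 r0; have hd : dom (pt v0) by rewrite -kap0; exact: kap_dom.
have [c1 c2] := phi_cont hd.
have e1 : phi1 (pt v0) = 0 by rewrite -kap0 phi1_kap.
have e2 : phi2 (pt v0) = 0 by rewrite -kap0 phi2_kap.
have n1 : \forall p \near pt v0, `|phi1 p| < r.
  have h : \forall p \near pt v0, ball (0 : R) r (phi1 p).
    by move: c1; rewrite /continuous_at e1 => /(_ _ (nbhsx_ballx (0 : R) r r0)).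
  by apply: filterS h => q; rewrite /ball /= sub0r normrN.
have n2 : \forall p \near pt v0, `|phi2 p| < r.
  have h : \forall p \near pt v0, ball (0 : R) r (phi2 p).
    by move: c2; rewrite /continuous_at e2 => /(_ _ (nbhsx_ballx (0 : R) r r0)).
  by apply: filterS h => q; rewrite /ball /= sub0r normrN.
apply: filterI; first exact: dom_near.
exact: filterI.
Qed.

End Chart.

Lemma chart_ex w : w != 0 -> exists w1 w2, det3 w w1 w2 != 0.
Proof.
move=> w0; have [w1 hw] := indep_ex_real w0; have [w2 h] := indep_det3 hw.
by exists w1, w2.
Qed.

Lemma seg_connected (T : topologicalType) (g : R -> T) : continuous g ->
  connected (g @` `[0, 1]).
Proof.
move=> gc; apply: connected_continuous_connected; last exact: continuous_subspaceT.
by apply/connected_intervalP; exact: interval_is_interval.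
Qed.

Lemma RP2_loc_conn p (U : set (RP2 R)) : nbhs p U ->
  exists V, [/\ nbhs p V, V `<=` U & connected V].
Proof.
move=> hU; have p0 := rep_neq0 p; have [w1 [w2 d0]] := chart_ex p0.
rewrite -[p]pt_rep in hU; have [r r0 hr] := kap_nbhs d0 p0 hU.
exists [set q | dom w1 w2 q /\ (`|phi1 (rep p) w1 w2 q| < r /\ `|phi2 (rep p) w1 w2 q| < r)].
split.
- by have := nbhs_kap d0 p0 r0; rewrite pt_rep.
- by move=> q [hd [h1 h2]]; rewrite -(kap_phi d0 hd); exact: hr.
- set V := [set q | _]; pose K := kap (rep p) w1 w2.
  pose I := [set z : R * R | `|z.1| < r /\ `|z.2| < r].
  have -> : V = \bigcup_(z in I) ((fun t : R => K (t * z.1, t * z.2)) @` `[0, 1]).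
    apply/seteqP; split=> q.
      move=> [hd [h1 h2]]; exists (phi1 (rep p) w1 w2 q, phi2 (rep p) w1 w2 q); first by split.
      by exists 1; rewrite /= ?in_itv /= ?ler01 ?lexx// !mul1r; exact: kap_phi.
    move=> [z [h1 h2] [t]]; rewrite /= in_itv /= => /andP[t0 t1] <-.
    have ht x : `|x| < r -> `|t * x| < r.
      by move=> hx; rewrite normrM ger0_norm// (le_lt_trans _ hx)// ler_piMl.
    by split; [exact: kap_dom|rewrite phi1_kap// phi2_kap//=; split; exact: ht].
  apply: bigcup_connected.
    exists (K (0, 0)) => z _; exists 0; rewrite /= ?in_itv /= ?lexx ?ler01// !mul0r//.
  move=> z _; apply: seg_connected => t.
  have c2 : continuous_at t (fun t : R => (t * z.1, t * z.2)).
    by apply: cont_pair; (apply: contM; [exact: cvg_id|exact: contC]).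
  have kc : continuous_at (t * z.1, t * z.2) K by exact: kap_cont.
  exact: (contT c2 kc).
Qed.

Lemma component_open (A : set (RP2 R)) p : open A -> open (connected_component A p).
Proof.
move=> oA; rewrite openE => q hq.
have Aq : A q by exact: connected_component_sub hq.
have [V [nV VA cV]] := RP2_loc_conn (open_nbhs_nbhs (conj oA Aq)).
apply: (filterS _ nV) => x Vx.
rewrite (same_connected_component hq).
apply: (@connected_component_max _ A V q) => //; exact: nbhs_singleton nV.
Qed.

(** An injective continuous map on a compact set has a continuous inverse: the part of K outside U
    has a compact image, whose complement is the required neighbourhood. *)
Lemma inverse_near (T : topologicalType) (K : set T) (h : T -> RP2 R) z (U : set T) :
  compact K -> {within K, continuous h} -> set_inj K h -> K z -> open U -> U z ->
  exists2 W, nbhs (h z) W & forall z', K z' -> W (h z') -> U z'.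
Proof.
move=> cK hc hi Kz oU Uz.
have cK' : compact (K `&` ~` U).
  by apply: compact_closedI => //; exact: open_closedC.
have cimg : compact (h @` (K `&` ~` U)).
  apply: continuous_compact => //; apply: continuous_subspaceW hc; exact: subIsetl.
have climg := compact_closed (@RP2_hausdorff R) cimg.
exists (~` (h @` (K `&` ~` U))).
  apply: open_nbhs_nbhs; split; first exact: closed_openC.
  move=> [z' [Kz' nU]] e; apply: nU.
  by have <- : z = z' by apply: hi; rewrite ?inE//.
move=> z' Kz' hn; apply: contrapT => nU; apply: hn.
by exists z'.
Qed.

End Charts.

(** * Local structure of embedded disks and of nonsingular curves *)

Section LocalStructure.
Variable R : realType.
Implicit Types (p q : RP2 R) (c : mpoly 3 R) (w u : 'rV[R]_3).

Lemma contI (S T : topologicalType) (A : set S) (h : S -> T) x :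
  {within A, continuous h} -> nbhs x A -> continuous_at x h.
Proof.
move=> /subspace_continuousP hc nA; have := hc x (nbhs_singleton nA).
by rewrite within_interior.
Qed.

Definition clam (a b t : R) := Num.max a (Num.min b t).
Lemma clamP a b t : a <= b -> a <= clam a b t <= b.
Proof. by move=> ab; rewrite /clam le_max lexx /= ge_max ab ge_min lexx. Qed.
Lemma clam_id a b t : a <= t <= b -> clam a b t = t.
Proof. by move=> /andP[t1 t2]; rewrite /clam (min_r t2) (max_r t1). Qed.
Lemma clam_cont a b : continuous (clam a b).
Proof.
move=> t; apply: continuous_max; first exact: contC.
by apply: continuous_min; [exact: contC|exact: cvg_id].
Qed.

Lemma poly_mvt (P : {poly R}) a b : a < b ->
  exists2 t, a < t < b & P.[b] - P.[a] = P^`().[t] * (b - a).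
Proof.
move=> ab.
have hd x : x \in `]a, b[ -> is_derive x 1 (horner P) (horner P^`() x).
  by move=> _; apply: DeriveDef; [exact: derivable_horner|rewrite derivE derive1E].
have hc : {within `[a, b], continuous (horner P)}.
  by apply: continuous_subspaceT => y; exact: continuous_horner.
have [t tab e] := MVT ab hd hc.
by exists t; [move: tab; rewrite in_itv|].
Qed.

Lemma open_disk_near (z : R * R) : open_unit_disk z -> nbhs z (@open_unit_disk R).
Proof.
move=> hz; have hc : continuous_at z (fun z : R * R => 1 - (z.1 ^+ 2 + z.2 ^+ 2)).
  apply: contB; first exact: contC.
  by apply: contD; apply: contX; [exact: cont_fst|exact: cont_snd].
have h0 : 0 < 1 - (z.1 ^+ 2 + z.2 ^+ 2) by rewrite subr_gt0.
by apply: filterS (near_gt0 hc h0) => y; rewrite subr_gt0.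
Qed.

Lemma open_disk_sub : @open_unit_disk R `<=` @unit_disk R.
Proof. by move=> z; rewrite /open_unit_disk /unit_disk /=; exact: ltW. Qed.

(** Invariance of domain for the disk: a chart of RP^2 reduces it to [injective_plane_open]. *)
Lemma disk_open (h : R * R -> RP2 R) : {within @unit_disk R, continuous h} ->
  set_inj (@unit_disk R) h -> open (h @` @open_unit_disk R).
Proof.
move=> hc hi; rewrite openE => _ [z0 oz0 <-].
have hcz z : open_unit_disk z -> continuous_at z h.
  by move=> oz; apply: (contI hc); apply: (filterS open_disk_sub (open_disk_near oz)).
set p := h z0; have p0 := rep_neq0 p; have [w1 [w2 d0]] := chart_ex p0.
have domp : dom w1 w2 p by rewrite -[p]pt_rep -(kap0 (rep p) w1 w2); exact: kap_dom.
have /nbhs_ballP[r0 r00 hr0] : nbhs z0 [set z | open_unit_disk z /\ dom w1 w2 (h z)].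
  by apply: filterI; [exact: open_disk_near|exact: (hcz z0 oz0 _ (dom_near domp))].
pose r := r0 / 2; have r_0 : 0 < r by rewrite divr_gt0.
(* Clamping both coordinates extends the restriction of h to a small square to a continuous map on
   the whole plane. *)
pose sh (z : R * R) : R * R := (z0.1 + clam (- r) r z.1, z0.2 + clam (- r) r z.2).
have rr0 : r < r0 by rewrite /r ltr_pdivrMr// ltr_pMr// ltr1n.
have rr : - r <= r by rewrite ge0_cp// ltW.
have shin z : open_unit_disk (sh z) /\ dom w1 w2 (h (sh z)).
  apply: hr0; split; rewrite /ball /= opprD addNKr normrN.
    by have /andP[a b] := clamP z.1 rr; rewrite ltr_norml; apply/andP; split; lra.
  by have /andP[a b] := clamP z.2 rr; rewrite ltr_norml; apply/andP; split; lra.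
have shc : continuous sh.
  move=> z; apply: cont_pair; (apply: contD; first exact: contC).
    by apply: (contT (h := fst) (g := clam (- r) r)); [exact: cont_fst|exact: clam_cont].
  by apply: (contT (h := snd) (g := clam (- r) r)); [exact: cont_snd|exact: clam_cont].
have hsc : continuous (fun z => h (sh z)).
  by move=> z; exact: (contT (shc z) (hcz _ (shin z).1)).
pose f1 := phi1 (rep p) w1 w2; pose f2 := phi2 (rep p) w1 w2.
have sh0 : sh (0, 0) = z0.
  by rewrite /sh /= !clam_id ?oppr_le0 ?ltW// !addr0; case: (z0).
have [|||e e0 he] := @injective_plane_open R (fun z => f1 (h (sh z))) (fun z => f2 (h (sh z))) r r_0.
- by move=> z; exact: (contT (hsc z) (phi_cont (rep p) (shin z).2).1).
- by move=> z; exact: (contT (hsc z) (phi_cont (rep p) (shin z).2).2).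
- move=> z w [z1 z2] [w1' w2'] e1 e2.
  have e : h (sh z) = h (sh w).
    by rewrite -(kap_phi d0 (shin z).2) -(kap_phi d0 (shin w).2) -/f1 -/f2 e1 e2.
  have := hi _ _ (mem_set (open_disk_sub (shin z).1)) (mem_set (open_disk_sub (shin w).1)) e.
  rewrite /sh !clam_id -?ler_norml//; case: z w {z1 z2 w1' w2' e1 e2 e} => [a b] [a' b'] /= [].
  by move=> /addrI -> /addrI ->.
have [c1 c2] := phi_cont (rep p) domp.
have n1 : \forall q \near p, `|f1 q - f1 p| < e.
  have hh : \forall q \near p, ball (f1 p) e (f1 q) by apply: c1; exact: nbhsx_ballx.
  by apply: filterS hh => q; rewrite /ball /= distrC.
have n2 : \forall q \near p, `|f2 q - f2 p| < e.
  have hh : \forall q \near p, ball (f2 p) e (f2 q) by apply: c2; exact: nbhsx_ballx.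
  by apply: filterS hh => q; rewrite /ball /= distrC.
rewrite /interior; apply: filterS3 n1 n2 (dom_near domp) => q q1 q2 dq.
have [z [_ ez1 ez2]] := he (f1 q) (f2 q) (eq_rect_r (fun t => `|f1 q - f1 (h t)| < e) q1 sh0) (eq_rect_r (fun t => `|f2 q - f2 (h t)| < e) q2 sh0).
exists (sh z); first exact: (shin z).1.
by rewrite -(kap_phi d0 (shin z).2) -(kap_phi d0 dq) -/f1 -/f2 ez1 ez2.
Qed.

Lemma real_euler d c w : is_form d c -> eval_form c w = 0 -> dot (grad c w) w = 0.
Proof.
move=> cf cw; have := euler0 (complexify_form cf) (v := cv w).
rewrite eval_complexify cw => /(_ erefl); rewrite grad_complexify.
have -> : dot (cv (grad c w)) (cv w) = real_complex R (dot (grad c w) w).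
  by rewrite !dotE !mxE !(rmorphD (real_complex R)) !(rmorphM (real_complex R)).
by move/complexI.
Qed.

(** By Euler's relation the gradient is orthogonal to w, so w, the tangent vector and the gradient
    form an orthogonal basis. *)
Lemma chart_grad d c w : nonsingular d c -> w != 0 -> eval_form c w = 0 ->
  det3 w (cross w (grad c w)) (grad c w) != 0.
Proof.
move=> cn w0 cw; have g0 := nonsingular_grad cn w0 cw; have e := real_euler cn.1 cw.
have x0 : cross w (grad c w) != 0.
  apply: contra_neq g0 => /(cross_dep w0)[a ea]; rewrite ea.
  move: e; rewrite ea dotZl => /eqP; rewrite mulf_eq0 (gt_eqF (dotvv_gt0 w0)) orbF => /eqP ->.
  by rewrite scale0r.
have := dotvv_gt0 x0; rewrite {1}/dot => _.
have := dotvv_gt0 x0; rewrite dot_cross => h.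
by rewrite (_ : det3 _ _ _ = - det3 w (grad c w) (cross w (grad c w))) ?oppr_eq0 ?gt_eqF// /det3; ring.
Qed.

Lemma grad_cont c : continuous (grad c).
Proof.
move=> w; apply: row_continuous => i.
by apply: (contE (g := eval_form (mderiv i c))) => [y|]; [rewrite mxE|exact: eval_form_continuous].
Qed.

(* At a point of a nonsingular curve, in the chart with axes the tangent and the
   gradient, the form increases along the second axis. *)
Lemma chart_increasing d c w : nonsingular d c -> w != 0 -> eval_form c w = 0 ->
  exists2 r : R, 0 < r & forall x y y' : R, `|x| < r -> `|y| < r -> `|y'| < r -> y < y' ->
    eval_form c (w + x *: cross w (grad c w) + y *: grad c w) <
    eval_form c (w + x *: cross w (grad c w) + y' *: grad c w).
Proof.
move=> cn w0 cw; set n := grad c w; set t := cross w n.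
have n0 : n != 0 := nonsingular_grad cn w0 cw.
pose V (z : R * R) := w + z.1 *: t + z.2 *: n.
have Vc : continuous V.
  move=> z; apply: row_continuous => i.
  apply: (contE (g := fun z : R * R => w 0 i + z.1 * t 0 i + z.2 * n 0 i)).
    by move=> y; rewrite !mxE.
  apply: contD; [apply: contD; first exact: contC|]; (apply: contM; last exact: contC).
    exact: cont_fst.
  exact: cont_snd.
have V0 : V (0, 0) = w by rewrite /V /= !scale0r !addr0.
have gc : continuous_at (0, 0) (fun z => dot n (grad c (V z))).
  apply: (@continuous_comp _ _ _ V (fun u => dot n (grad c u))); first exact: Vc.
  by apply: dot_continuous; exact: grad_cont.
have := near_gt0 gc; rewrite V0 -/n (dotvv_gt0 n0) => /(_ isT) /nbhs_ballP[r r0 hr].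
exists r => // x y y' xr yr yr' yy'.
pose P := along (lineq (w + x *: t) n) c.
have PE (u : R) : P.[u] = eval_form c (w + x *: t + u *: n) by rewrite along_eval lineq_at.
have [u /andP[u1 u2] e] := poly_mvt P yy'.
rewrite -!PE -subr_gt0 e mulr_gt0 ?subr_gt0// along_deriv lineq_at lineq_deriv dotC.
apply: (hr (x, u)); split; rewrite /= /ball /= sub0r normrN//.
by move: yr yr'; rewrite !ltr_norml => /andP[? ?] /andP[? ?]; apply/andP; split; lra.
Qed.

Lemma seg_between (s y y0 : R) : 0 <= s -> s <= 1 ->
  y <= y + s * (y0 - y) <= y0 \/ y0 <= y + s * (y0 - y) <= y.
Proof. by move=> s0 s1; have [yy|yy] := leP y y0; [left|right]; apply/andP; split; nra. Qed.

Lemma norm_between (r y y' y0 : R) : `|y| < r -> `|y0| < r ->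
  (y <= y' <= y0 \/ y0 <= y' <= y) -> `|y'| < r.
Proof.
by rewrite !ltr_norml => /andP[? ?] /andP[? ?] [/andP[? ?]|/andP[? ?]]; apply/andP; split; lra.
Qed.

(** In a small box of the chart of [chart_increasing] the curve meets each vertical segment at most
    once and separates the points above from those below. [Up] and [Um] are these two sides, and
    [xi] is the tangential coordinate, which is injective on the curve. *)
Lemma local_structure d c p (U0 : set (RP2 R)) : nonsingular d c -> real_points c p ->
  nbhs p U0 -> exists U Up Um (xi : RP2 R -> R),
  [/\ nbhs p U /\ (forall q, U q -> nbhs q U /\ continuous_at q xi), U `<=` U0,
      forall q, U q -> ~ real_points c q -> Up q \/ Um q,
      [/\ connected Up, connected Um, Up `<=` U `\` real_points c & Um `<=` U `\` real_points c] &
      (forall q, U q -> real_points c q -> forall W, nbhs q W -> (Up `&` W) !=set0 /\ (Um `&` W) !=set0) /\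
      (forall q q', U q -> U q' -> real_points c q -> real_points c q' -> xi q = xi q' -> q = q')].
Proof.
move=> cn cp nU0; have w0 := rep_neq0 p; set w := rep p in w0.
have cf := cn.1; have cw : eval_form c w = 0 by apply/(real_points_pt cf w0); rewrite pt_rep.
have [r1 r10 mono] := chart_increasing cn w0 cw; have d0 := chart_grad cn w0 cw.
set n := grad c w in mono d0; set t := cross w n in mono d0.
have pw : pt w = p by exact: pt_rep.
have [r2 r20 hr2] : exists2 r : R, 0 < r & forall z, `|z.1| < r -> `|z.2| < r -> U0 (kap w t n z).
  by apply: kap_nbhs; rewrite ?pw.
pose r := Num.min r1 r2; have r0 : 0 < r by rewrite lt_min r10.
have rr1 : r <= r1 by rewrite ge_min lexx.
have rr2 : r <= r2 by rewrite ge_min lexx orbT.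
pose G x y := eval_form c (w + x *: t + y *: n).
have Gm x y y' : `|x| < r -> `|y| < r -> `|y'| < r -> y < y' -> G x y < G x y'.
  by move=> h1 h2 h3; apply: mono; apply: lt_le_trans rr1.
have Gcx y : continuous (fun x => G x y).
  move=> x; have -> : (fun x => G x y) = (fun x => eval_form c ((w + y *: n) + x *: t)).
    by apply/funext => x'; rewrite /G addrAC.
  have ec : continuous_at ((w + y *: n) + x *: t) (eval_form c) by exact: eval_form_continuous.
  exact: (contT (@cont_line R (w + y *: n) t x) ec).
pose y1 := r / 2; have y10 : 0 < y1 by rewrite divr_gt0.
have y1r : `|y1| < r by rewrite gtr0_norm// /y1; lra.
have y1r' : `|- y1| < r by rewrite normrN.
have G00 : G 0 0 = 0 by rewrite /G !scale0r !addr0.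
have r00 : `|0 : R| < r by rewrite normr0.
have Gp : 0 < G 0 y1 by rewrite -[X in X < _]G00; apply: Gm.
have Gn : G 0 (- y1) < 0 by rewrite -[X in _ < X]G00; apply: Gm => //; rewrite oppr_lt0.
have /nbhs_ballP[e1 e10 he1] := near_gt0 (Gcx y1 0) Gp.
have /nbhs_ballP[e2 e20 he2] := near_lt0 (Gcx (- y1) 0) Gn.
(* The width is such that the form keeps its sign on the edges at heights y1 and -y1. *)
pose de := Num.min r (Num.min e1 e2).
have de0 : 0 < de by rewrite lt_min r0 lt_min e10.
have der x : `|x| < de -> `|x| < r /\ (0 < G x y1 /\ G x (- y1) < 0).
  rewrite lt_min => /andP[h1]; rewrite lt_min => /andP[h2 h3]; split=> //; split; [apply: he1|apply: he2];
  by rewrite /ball /= sub0r normrN.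
pose f1 := phi1 w t n; pose f2 := phi2 w t n; pose K := kap w t n.
pose U : set (RP2 R) := [set q | dom t n q /\ (`|f1 q| < de /\ `|f2 q| < r)].
have Kn (S : R -> Prop) y : continuous (fun x : R => K (x, y)).
  move=> x; have c2 : continuous_at x (fun x : R => (x, y)) by apply: cont_pair; [exact: cvg_id|exact: cvg_cst].
  have kc : continuous_at (x, y) K by exact: kap_cont.
  exact: (contT c2 kc).
have KU z : `|z.1| < de -> `|z.2| < r -> U (K z).
  by move=> h1 h2; split; [exact: kap_dom|rewrite /f1 /f2 phi1_kap// phi2_kap].
have cK z : real_points c (K z) <-> G z.1 z.2 = 0.
  by rewrite /K /kap (real_points_pt cf) ?kap_neq0.
have UE q : U q -> q = K (f1 q, f2 q) by move=> [hd _]; rewrite /K kap_phi.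
pose Up : set (RP2 R) := K @` [set z | [/\ `|z.1| < de, `|z.2| < r & 0 < G z.1 z.2]].
pose Um : set (RP2 R) := K @` [set z | [/\ `|z.1| < de, `|z.2| < r & G z.1 z.2 < 0]].
have seg (S : set (R * R)) (y0 : R) : `|y0| < r -> (forall x, `|x| < de -> S (x, y0)) ->
    (forall x y y', S (x, y) -> (y <= y' <= y0 \/ y0 <= y' <= y) -> S (x, y')) ->
    (forall z, S z -> `|z.1| < de) -> connected (K @` S).
  move=> yr hS vS dS.
  pose L z := ((fun s : R => K (z.1, z.2 + s * (y0 - z.2))) @` `[0, 1])
              `|` ((fun s : R => K (s * z.1, y0)) @` `[0, 1]).
  have -> : K @` S = \bigcup_(z in S) L z.
    apply/seteqP; split=> q.
      move=> [z Sz <-]; exists z => //; left; exists 0; first by rewrite /= in_itv /= lexx ler01.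
      by rewrite mul0r addr0; case: (z).
    move=> [[x y] Sz] [] [s]; rewrite /= in_itv /= => /andP[s0 s1] <-.
      exists (x, y + s * (y0 - y)) => //; apply: (vS _ _ _ Sz).
      exact: seg_between.
    exists (s * x, y0) => //; apply: hS; rewrite normrM ger0_norm//.
    by rewrite (le_lt_trans _ (dS _ Sz))//= ler_piMl.
  apply: bigcup_connected.
    exists (K (0, y0)) => z Sz; right; exists 0; rewrite ?mul0r//.
    by rewrite /= in_itv /= lexx ler01.
  move=> z Sz; apply: connectedU.
  - exists (K (z.1, y0)); split; exists 1; rewrite /= ?in_itv /= ?ler01 ?lexx//.
      by rewrite mul1r addrC subrK.
    by rewrite mul1r.
  - apply: seg_connected => s.
    have c2 : continuous_at s (fun s : R => (z.1, z.2 + s * (y0 - z.2))).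
      apply: cont_pair; first exact: cvg_cst.
      by apply: contD; [exact: contC|apply: contM; [exact: cvg_id|exact: contC]].
    have kc : continuous_at (z.1, z.2 + s * (y0 - z.2)) K by exact: kap_cont.
    exact: (contT c2 kc).
  - apply: seg_connected => s.
    have c2 : continuous_at s (fun s : R => (s * z.1, y0)).
      by apply: cont_pair; [apply: contM; [exact: cvg_id|exact: contC]|exact: cvg_cst].
    have kc : continuous_at (s * z.1, y0) K by exact: kap_cont.
    exact: (contT c2 kc).
have btw y y' y0 : `|y| < r -> `|y0| < r -> (y <= y' <= y0 \/ y0 <= y' <= y) -> `|y'| < r.
  exact: norm_between.
have Gw x y y' : `|x| < r -> `|y| < r -> `|y'| < r -> y <= y' -> G x y <= G x y'.
  by move=> h1 h2 h3; rewrite le_eqVlt => /orP[/eqP ->//|h]; apply/ltW; apply: Gm.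
exists U, Up, Um, f1; split.
- split.
    have := nbhs_kap d0 w0 de0; rewrite pw; have := nbhs_kap d0 w0 r0; rewrite pw.
    by apply: filterS2 => q [_ [_ h2]] [hd [h1 _]].
  move=> q Uq; have [hd [h1 h2]] := Uq; have [c1 c2] := phi_cont w hd; split=> //.
  have n1 : \forall x \near q, 0 < de - `|f1 x|.
    apply: near_gt0; last by rewrite subr_gt0.
    by apply: contB; [exact: contC|exact: (contT c1 (@norm_continuous _ _ _))].
  have n2 : \forall x \near q, 0 < r - `|f2 x|.
    apply: near_gt0; last by rewrite subr_gt0.
    by apply: contB; [exact: contC|exact: (contT c2 (@norm_continuous _ _ _))].
  by apply: filterS3 n1 n2 (dom_near hd) => x; rewrite !subr_gt0.
- by move=> q Uq; rewrite (UE q Uq); have [_ [h1 h2]] := Uq; apply: hr2; rewrite /= ?(lt_le_trans h2)// (lt_le_trans (der _ h1).1).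
- move=> q Uq; have [_ [h1 h2]] := Uq; rewrite {1}(UE q Uq) => /cK /eqP /= h.
  rewrite (UE q Uq); case: (ltgtP (G (f1 q) (f2 q)) 0) h => // h _; [right|left];
  by exists (f1 q, f2 q).
- split.
  + apply: (seg _ y1 y1r) => [x xd|x y y' [/= h1 h2 h3] hy|z []//].
      by split=> //=; exact: (der x xd).2.1.
    have y'r := btw _ _ _ h2 y1r hy; split=> //=; have [xr [g1 g2]] := der x h1.
    by case: hy => /andP[a b]; [apply: lt_le_trans h3 _|apply: lt_le_trans g1 _]; apply: Gw.
  + apply: (seg _ (- y1) y1r') => [x xd|x y y' [/= h1 h2 h3] hy|z []//].
      by split=> //=; exact: (der x xd).2.2.
    have y'r := btw _ _ _ h2 y1r' hy; split=> //=; have [xr [g1 g2]] := der x h1.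
    by case: hy => /andP[a b]; [apply: le_lt_trans g2|apply: le_lt_trans h3]; apply: Gw.
  + move=> _ [z [h1 h2 h3] <-]; split; first exact: KU.
    by move/cK => h; rewrite h ltxx in h3.
  + move=> _ [z [h1 h2 h3] <-]; split; first exact: KU.
    by move/cK => h; rewrite h ltxx in h3.
- split.
    move=> q Uq cq W nW; have [_ [h1 h2]] := Uq; rewrite (UE q Uq) in cq nW.
    move/cK: cq => /= g0; have [xr _] := der _ h1.
    have kc : continuous_at (f2 q) (fun y => K (f1 q, y)).
      have c2 : continuous_at (f2 q) (fun y : R => (f1 q, y)) by apply: cont_pair; [exact: cvg_cst|exact: cvg_id].
      have kc : continuous_at (f1 q, f2 q) K by exact: kap_cont.
      exact: (contT c2 kc).
    have /nbhs_ballP[e e0 he] := kc _ nW.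
    pose s := Num.min (e / 2) ((r - `|f2 q|) / 2).
    have s0 : 0 < s by rewrite lt_min !divr_gt0// subr_gt0.
    have s1 : s < e by apply: le_lt_trans (_ : e / 2 < e); [rewrite ge_min lexx|rewrite ltr_pdivrMr// ltr_pMr// ltr1n].
    have s2 : s < r - `|f2 q|.
      have : 0 < r - `|f2 q| by rewrite subr_gt0.
      have : s <= (r - `|f2 q|) / 2 by rewrite ge_min lexx orbT.
      by lra.
    have ys x : `|x| = s -> `|f2 q + x| < r by move=> e'; rewrite (le_lt_trans (ler_normD _ _))// e'; lra.
    split.
      have yr := ys s (gtr0_norm s0).
      exists (K (f1 q, f2 q + s)); split; last first.
        by apply: he; rewrite /ball /= opprD addNKr normrN gtr0_norm.
      by exists (f1 q, f2 q + s) => //; split=> //=; rewrite -g0; apply: Gm => //; rewrite ltrDl.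
    have yr := ys (- s) (etrans (normrN _) (gtr0_norm s0)).
    exists (K (f1 q, f2 q - s)); split; last first.
      by apply: he; rewrite /ball /= opprB addrCA subrr addr0 gtr0_norm.
    by exists (f1 q, f2 q - s) => //; split=> //=; rewrite -g0; apply: Gm => //; rewrite ltrBlDr ltrDl.
  move=> q q' Uq Uq' cq cq' e; have [_ [h1 h2]] := Uq; have [_ [h1' h2']] := Uq'.
  rewrite (UE q Uq) in cq *; rewrite (UE q' Uq') in cq' *; move/cK: cq => /= g; move/cK: cq' => /= g'.
  have [xr _] := der _ h1; rewrite -e in g' *; congr (K (_, _)).
  by case: (ltgtP (f2 q) (f2 q')) => // h; have := Gm _ _ _ xr _ _ h; rewrite g g' ltxx; move=> /(_ _ _)/negP; case=> //.
Qed.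

End LocalStructure.

(** * Arcs of the curve across the disk *)

Section Arcs.
Variable R : realType.
Implicit Types (p q : RP2 R) (c : mpoly 3 R) (b : R -> RP2 R).

Definition arc (Z : set (RP2 R)) b :=
  [/\ continuous b, forall t, 0 <= t <= 1 -> Z (b t) &
      forall t u, 0 <= t <= 1 -> 0 <= u <= 1 -> b t = b u -> t = u].

Definition ins b : set (RP2 R) := b @` [set t | 0 < t < 1].

Lemma ins_connected b : continuous b -> connected (ins b).
Proof.
move=> bc; have -> : ins b = b @` `]0, 1[ by congr (_ @` _); apply/seteqP; split=> t; rewrite /= in_itv.
apply: connected_continuous_connected; last exact: continuous_subspaceT.
by apply/connected_intervalP; exact: interval_is_interval.
Qed.

(* Along an arc leaving a point of a curve, the local coordinate of the curve
   takes all small values of one sign. *)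
Lemma half_branch (Z U : set (RP2 R)) (xi : RP2 R -> R) b :
  (forall q, U q -> nbhs q U /\ continuous_at q xi) ->
  (forall q q', U q -> U q' -> Z q -> Z q' -> xi q = xi q' -> q = q') ->
  arc Z b -> U (b 0) ->
  exists sg e : R, [/\ sg = 1 \/ sg = -1, 0 < e &
    forall y, 0 < y < e -> exists t, [/\ 0 < t < 1, U (b t) & xi (b t) = xi (b 0) + sg * y]].
Proof.
move=> hU hxi [bc bZ bi] U0.
have /nbhs_ballP[d0 d00 hd0] := bc 0 _ (hU _ U0).1.
pose d := Num.min (d0 / 2) (2^-1 : R).
have dd : 0 < d by rewrite lt_min; apply/andP; split; [rewrite divr_gt0|rewrite invr_gt0].
have d1 : d < 1 by rewrite (le_lt_trans (_ : d <= 2^-1)) ?ge_min ?lexx ?orbT//; lra.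
have ddd : d < d0.
  by apply: (@le_lt_trans _ _ (d0 / 2)); [rewrite ge_min lexx|rewrite ltr_pdivrMr// ltr_pMr// ltr1n].
have Ud t : 0 <= t <= d -> U (b t).
  move=> /andP[t0 td]; apply: hd0; rewrite /ball /= sub0r normrN ger0_norm//.
  exact: le_lt_trans ddd.
have d01 t : 0 <= t <= d -> 0 <= t <= 1 by move=> /andP[-> h] /=; rewrite (le_trans h)// ltW.
have cl t := clamP t (ltW dd).
have hd : 0 <= d <= d by rewrite lexx ltW.
have h0 : (0 : R) <= 0 <= d by rewrite lexx ltW.
pose g t := xi (b (clam 0 d t)) - xi (b 0).
have gc : continuous g.
  move=> t; apply: contB; last exact: contC.
  have c1 : continuous_at t (fun t => b (clam 0 d t)) := contT (@clam_cont R 0 d t) (bc _).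
  exact: (contT c1 (hU _ (Ud _ (cl t))).2).
have gd : g d != 0.
  rewrite /g clam_id// subr_eq0; apply/eqP => /hxi h.
  have := bi d 0 (d01 _ hd) (d01 _ h0) (h (Ud _ hd) (Ud _ h0) (bZ _ (d01 _ hd)) (bZ _ (d01 _ h0))).
  by move=> e; rewrite e ltxx in dd.
have [sg hsg sgd] : exists2 sg : R, sg = 1 \/ sg = -1 & 0 < sg * g d.
  case: (ltgtP (g d) 0) gd => // h _; first by exists (-1); [right|rewrite mulN1r oppr_gt0].
  by exists 1; [left|rewrite mul1r].
have sg2 : sg * sg = 1 by case: hsg => ->; rewrite ?mulrNN mulr1.
exists sg, (sg * g d); split=> // y /andP[y0 yd].
have [||t /andP[t0 td] ht] := @ivt_sign _ (fun t => sg * g t - y) 0 d dd.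
- by move=> t; apply: contB; [apply: contM; [exact: contC|exact: gc]|exact: contC].
- by rewrite {1}/g clam_id// subrr mulr0 sub0r; nra.
have tt : 0 <= t <= d by rewrite !ltW.
exists t; split; [by rewrite t0 (lt_trans td)|exact: Ud|].
have e : y = sg * g t by move: ht; lra.
by rewrite e mulrA sg2 mul1r /g clam_id// addrC subrK.
Qed.

Lemma sub_arc Z b (x y : R) : arc Z b -> 0 <= x <= 1 -> 0 <= y <= 1 -> x != y ->
  arc Z (fun t => b (x + t * (y - x))).
Proof.
move=> [bc bZ bi] /andP[x0 x1] /andP[y0 y1] xy.
have h t : 0 <= t <= 1 -> 0 <= x + t * (y - x) <= 1.
  by move=> /andP[t0 t1]; apply/andP; split; nra.
split=> [t|t t01|t u t01 u01 /bi e].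
- have c1 : continuous_at t (fun t => x + t * (y - x)).
    by apply: contD; [exact: contC|apply: contM; [exact: cvg_id|exact: contC]].
  exact: (contT c1 (bc _)).
- by apply: bZ; exact: h.
- have /addrI /mulIf := e (h _ t01) (h _ u01); apply.
  by rewrite subr_eq0 eq_sym.
Qed.

(** By [half_branch] the two halves of the arc at an inner point cover one-sided intervals of the
    local coordinate. Injectivity puts these on opposite sides, so together they cover the curve
    near that point. *)
Lemma arc_open d c b t0 : nonsingular d c -> arc (real_points c) b -> 0 < t0 < 1 ->
  nbhs (b t0) [set q | real_points c q -> ins b q].
Proof.
move=> cn ab /andP[t00 t01]; have [bc bZ bi] := ab.
have tt : 0 <= t0 <= 1 by rewrite !ltW.
have [U [Up [Um [xi [[nU hU] _ _ _ [_ hxi]]]]]] := local_structure cn (bZ _ tt) filterT.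
have Ut0 : U (b t0) := nbhs_singleton nU.
have a1 : arc (real_points c) (fun t => b (t0 + t * (1 - t0))).
  by apply: sub_arc; rewrite ?lexx ?ler01// lt_eqF.
have a2 : arc (real_points c) (fun t => b (t0 + t * (0 - t0))).
  by apply: sub_arc; rewrite ?lexx ?ler01// gt_eqF.
have [|s1 [e1 [hs1 e10 h1]]] := half_branch hU hxi a1; first by rewrite mul0r addr0.
have [|s2 [e2 [hs2 e20 h2]]] := half_branch hU hxi a2; first by rewrite mul0r addr0.
rewrite !mul0r !addr0 in h1 h2.
have in1 t : 0 < t < 1 -> t0 < t0 + t * (1 - t0) < 1 by move=> /andP[? ?]; apply/andP; split; nra.
have in2 t : 0 < t < 1 -> 0 < t0 + t * (0 - t0) < t0 by move=> /andP[? ?]; apply/andP; split; nra.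
pose e := Num.min e1 e2; have e0 : 0 < e by rewrite lt_min e10.
have ee1 : e <= e1 by rewrite ge_min lexx.
have ee2 : e <= e2 by rewrite ge_min lexx orbT.
have s12 : s1 = - s2.
  have [e12|//] : s1 = s2 \/ s1 = - s2 by case: hs1 => ->; case: hs2 => ->; rewrite ?opprK; [left|right|right|left].
  have he : 0 < e / 2 < e by apply/andP; split; lra.
  have [|t [t1 Ut ht]] := h1 (e / 2); first by lra.
  have [|u [u1 Uu hu]] := h2 (e / 2); first by lra.
  have /andP[i1 i2] := in1 _ t1; have /andP[j1 j2] := in2 _ u1.
  have ct : 0 <= t0 + t * (1 - t0) <= 1 by apply/andP; split; lra.
  have cu : 0 <= t0 + u * (0 - t0) <= 1 by apply/andP; split; lra.
  have /bi : b (t0 + t * (1 - t0)) = b (t0 + u * (0 - t0)).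
    by apply: hxi => //; [exact: bZ|exact: bZ|rewrite ht hu e12].
  by move=> /(_ ct cu); lra.
have nx : \forall q \near b t0, `|xi q - xi (b t0)| < e.
  have hh : \forall q \near b t0, ball (xi (b t0)) e (xi q).
    by apply: ((hU _ Ut0).2); exact: nbhsx_ballx.
  by apply: filterS hh => q; rewrite /ball /= distrC.
apply: filterS2 nU nx => q Uq xq cq.
pose y := s1 * (xi q - xi (b t0)).
have s11 : s1 * s1 = 1 by case: hs1 => ->; rewrite ?mulrNN mulr1.
have xe : xi q = xi (b t0) + s1 * y by rewrite /y mulrA s11 mul1r addrC subrK.
have ye : `|y| < e by rewrite /y normrM; case: hs1 => ->; rewrite ?normrN normr1 mul1r.
case: (ltgtP y 0) => hy.
- have [|u [u1 Uu hu]] := h2 (- y).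
    by rewrite oppr_gt0 hy /=; move: ye; rewrite ltr0_norm//; lra.
  have /andP[j1 j2] := in2 _ u1; exists (t0 + u * (0 - t0)); first by rewrite /= j1 (lt_trans j2).
  apply: hxi => //; last by rewrite hu xe s12 mulrN mulNr.
  by apply: bZ; apply/andP; split; lra.
- have [|u [u1 Uu hu]] := h1 y; first by rewrite hy /=; move: ye; rewrite gtr0_norm//; lra.
  have /andP[j1 j2] := in1 _ u1; exists (t0 + u * (1 - t0)); first by rewrite /= j2 (lt_trans t00).
  by apply: hxi => //; [apply: bZ; apply/andP; split; lra|rewrite hu xe].
- by exists t0; [rewrite /= t00|apply: hxi => //; [exact: bZ|rewrite xe hy mulr0 addr0]].
Qed.

Lemma arc_closed b : continuous b -> closed (b @` `[0, 1]).
Proof.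
move=> bc; apply: compact_closed; first exact: RP2_hausdorff.
by apply: continuous_compact; [exact: continuous_subspaceT|exact: segment_compact].
Qed.

Lemma ins_sub b q : (b @` `[0, 1]) q -> q <> b 0 -> q <> b 1 -> ins b q.
Proof.
move=> [t]; rewrite /= in_itv /= => /andP[t0 t1] <- h0 h1; exists t => //=.
have n0 : t != 0 by apply/eqP => e; apply: h0; rewrite e.
have n1 : t != 1 by apply/eqP => e; apply: h1; rewrite e.
by rewrite !lt_neqAle eq_sym n0 n1 t0.
Qed.

(** A crosscut of [D] along the curve: its interior is in [D], its ends are not. *)
Definition carc (D : set (RP2 R)) c b := [/\ arc (real_points c) b, ins b `<=` D, ~ D (b 0) & ~ D (b 1)].

(** The part of one crosscut that lies on another is open by [arc_open]. It is also closed, because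
    the ends of the other are outside [D]; connectedness gives inclusion both ways. *)
Lemma arcs_eq d c D b b' q : nonsingular d c -> carc D c b -> carc D c b' ->
  ins b q -> ins b' q -> ins b = ins b'.
Proof.
move=> cn.
have key b1 b2 : carc D c b1 -> carc D c b2 -> (ins b1 `&` ins b2) !=set0 -> ins b1 `<=` ins b2.
  move=> [a1 iD1 _ _] [a2 iD2 n0 n1] h0.
  have h : ins b1 `&` ins b2 = ins b1.
    apply: (ins_connected (let: And3 bc _ _ := a1 in bc)) => //.
    - exists (interior [set q | real_points c q -> ins b2 q]); first exact: open_interior.
      apply/seteqP; split=> x [x1 x2]; split=> //.
        by have [t t01 <-] := x2; exact: arc_open cn a2 t01.
      apply: (interior_subset x2); have [t /andP[t0 t1] <-] := x1.
      by have [_ bZ _] := a1; apply: bZ; rewrite !ltW.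
    - exists (b2 @` `[0, 1]); first by apply: arc_closed; case: a2.
      apply/seteqP; split=> x [x1 x2]; split=> //.
        by have [t /andP[t0 t1] <-] := x2; exists t => //; rewrite /= in_itv /= !ltW.
      by apply: ins_sub x2 _ _ => e; [apply: n0|apply: n1]; rewrite -e; exact: iD1.
  by move=> x; rewrite -h => -[].
move=> cb cb' bq bq'; apply/seteqP; split; apply: key => //; by exists q.
Qed.

Definition adh (A : set (RP2 R)) q := forall W, nbhs q W -> (A `&` W) !=set0.

Lemma component_eq (A : set (RP2 R)) P Q q : components A P -> components A Q -> P q -> Q q -> P = Q.
Proof.
by move=> [x Ax <-] [y Ay <-] h1 h2; rewrite (same_connected_component h1) (same_connected_component h2).
Qed.

Lemma sub_component (A S : set (RP2 R)) : connected S -> S !=set0 -> S `<=` A ->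
  exists2 P, components A P & S `<=` P.
Proof.
move=> cS [x Sx] SA; exists (connected_component A x); first by exists x => //; exact: SA.
exact: connected_component_max.
Qed.

(** Near each inner point the curve has two sides, each contained in one piece. The set of points of
    the arc adherent to a given piece is open and closed in the arc, so the same two pieces,
    possibly equal, border the whole arc. *)
Lemma arc_adj d c (D B : set (RP2 R)) b x0 : nonsingular d c -> open D ->
  B `<=` real_points c -> carc D c b -> ins b `<=` B -> ins b x0 ->
  exists P Q, [/\ components (D `\` B) P, components (D `\` B) Q,
    forall x, ins b x -> nbhs x (P `|` Q `|` ins b) &
    forall x, ins b x -> adh P x /\ adh Q x].
Proof.
move=> cn oD BC [ab iD n0 n1] iB bx0; have [bc bZ bi] := ab.
have loc x : ins b x -> exists U P Q, [/\ nbhs x U, components (D `\` B) P, components (D `\` B) Q,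
    U `<=` P `|` Q `|` ins b & forall x', U x' -> ins b x' -> adh P x' /\ adh Q x'].
  move=> [t t01 <-]; have tt : 0 <= t <= 1 by case/andP: t01 => ? ?; rewrite !ltW.
  have hU0 : nbhs (b t) (D `&` [set q | real_points c q -> ins b q]).
    apply: filterI; last exact: arc_open cn ab t01.
    by apply: open_nbhs_nbhs; split=> //; apply: iD; exists t.
  have [U [Up [Um [xi [[nU hU] UU0 UE [cUp cUm UpU UmU] [hadh _]]]]]] := local_structure cn (bZ _ tt) hU0.
  have sub S : S `<=` U `\` real_points c -> S `<=` D `\` B.
    move=> h q /h[Uq cq]; split; first exact: (UU0 _ Uq).1.
    by move=> /BC.
  have [n1' n2'] := hadh _ (nbhs_singleton nU) (bZ _ tt) _ nU.
  have [P cP UpP] := sub_component cUp (let: ex_intro x (conj h _) := n1' in ex_intro _ x h) (sub _ UpU).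
  have [Q cQ UmQ] := sub_component cUm (let: ex_intro x (conj h _) := n2' in ex_intro _ x h) (sub _ UmU).
  exists U, P, Q; split=> //.
    move=> q Uq; have [cq|cq] := pselect (real_points c q); first by right; exact: (UU0 _ Uq).2.
    by left; have [/UpP|/UmQ] := UE _ Uq cq; [left|right].
  move=> x' Ux' [t' /andP[t0' t1'] ex']; have cx' : real_points c x' by rewrite -ex'; apply: bZ; rewrite !ltW.
  by split=> W nW; have [[y [y1 y2]] [z [z1 z2]]] := hadh _ Ux' cx' _ nW;
    [exists y; split=> //; exact: UpP|exists z; split=> //; exact: UmQ].
have meet U P Q S : U `<=` P `|` Q `|` ins b -> components (D `\` B) P -> components (D `\` B) Q ->
    components (D `\` B) S -> (S `&` U) !=set0 -> S = P \/ S = Q.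
  move=> UE cP cQ cS [y [Sy Uy]].
  have [y0 _ eS] := cS; have [Dy By] : (D `\` B) y by move: Sy; rewrite -eS => /connected_component_sub.
  have [[Py|Qy]|/iB//] := UE _ Uy; [left|right].
    exact: (component_eq cS cP Sy Py).
  exact: (component_eq cS cQ Sy Qy).
have clop S x : components (D `\` B) S -> ins b x -> adh S x -> forall y, ins b y -> adh S y.
  move=> cS bx Sx; have h : ins b `&` closure S = ins b.
    apply: (ins_connected bc).
    - by exists x; split=> //; exact: Sx.
    - exists (interior [set q | ins b q -> adh S q]); first exact: open_interior.
      apply/seteqP; split=> y [y1 y2]; split=> //; last exact: (interior_subset y2).
      have [U [P [Q [nU cP cQ UE hadh]]]] := loc y y1.
      have [eS|eS] := meet U P Q S UE cP cQ cS (y2 _ nU).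
        by apply: (filterS _ nU) => z Uz bz; rewrite eS; exact: (hadh z Uz bz).1.
      by apply: (filterS _ nU) => z Uz bz; rewrite eS; exact: (hadh z Uz bz).2.
    - by exists (closure S); [exact: closed_closure|].
  by move=> y; rewrite -h => -[].
have [U0 [P0 [Q0 [nU0 cP0 cQ0 U0E hadh0]]]] := loc x0 bx0.
have [aP aQ] := hadh0 x0 (nbhs_singleton nU0) bx0.
exists P0, Q0; split=> // x bx; last by split; [exact: clop cP0 bx0 aP x bx|exact: clop cQ0 bx0 aQ x bx].
have [U [P [Q [nU cP cQ UE hadh]]]] := loc x bx.
have [aP' aQ'] := hadh x (nbhs_singleton nU) bx.
have hP := meet U0 P0 Q0 P U0E cP0 cQ0 cP (clop P x cP bx aP' x0 bx0 _ nU0).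
have hQ := meet U0 P0 Q0 Q U0E cP0 cQ0 cQ (clop Q x cQ bx aQ' x0 bx0 _ nU0).
apply: (filterS _ nU) => q /UE[[Pq|Qq]|bq]; [left|left|by right].
  by case: hP => <-; [left|right].
by case: hQ => <-; [left|right].
Qed.

End Arcs.

(** * Boundaries of quadrangles and digons *)

Section Pieces.
Variable R : realType.
Implicit Types (p q : RP2 R) (c f : mpoly 3 R) (b : R -> RP2 R).

(** Besides the point, an arc of [O] leaving it inside the closure of [P] is kept: one point may be
    a corner of several pieces, and the arc tells on which side of the point each of them lies. *)
Definition corner (O P : set (RP2 R)) p :=
  exists al, [/\ arc O al, al 0 = p & forall t, 0 <= t <= 1 -> closure P (al t)].

Definition side (O B P : set (RP2 R)) b :=
  [/\ arc B b, corner O P (b 0), corner O P (b 1) & forall t, 0 <= t <= 1 -> closure P (b t)].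

Lemma comp_within (K : set (R * R)) (h : R * R -> RP2 R) (g : R -> R * R) :
  {within K, continuous h} -> continuous g -> (forall t, K (g t)) -> continuous (fun t => h (g t)).
Proof.
move=> /subspace_continuousP hc gc gK t U nU.
have hU := hc (g t) (gK t) U nU.
have : \forall s \near t, K (g s) -> U (h (g s)) by exact: gc hU.
by apply: filterS => s; apply; exact: gK.
Qed.

(** K is star-shaped about (x, y), and any contraction towards this centre sends it into K0; so K0
    is dense in K. *)
Lemma closure_image (K K0 : set (R * R)) (h : R * R -> RP2 R) (x y : R) :
  compact K -> {within K, continuous h} -> K0 `<=` K ->
  (forall z s, K z -> 0 < s -> s <= 1 -> K0 (z.1 + s * (x - z.1), z.2 + s * (y - z.2))) ->
  closure (h @` K0) = h @` K.
Proof.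
move=> cK hc K0K hs; apply/seteqP; split.
  have cl : closed (h @` K).
    by apply: compact_closed; [exact: RP2_hausdorff|exact: continuous_compact].
  rewrite [X in _ `<=` X](closure_id _).1//; apply: closure_subset.
  by move=> _ [z Kz <-]; exists z => //; exact: K0K.
move=> _ [z Kz <-] W nW.
have /subspace_continuousP/(_ z Kz W nW) hW := hc.
have gc : continuous_at (0 : R) (fun s : R => (z.1 + s * (x - z.1), z.2 + s * (y - z.2))).
  by apply: cont_pair; (apply: contD; [exact: contC|apply: contM; [exact: cvg_id|exact: contC]]).
have h0 : \forall s \near (0 : R), K (z.1 + s * (x - z.1), z.2 + s * (y - z.2)) ->
    W (h (z.1 + s * (x - z.1), z.2 + s * (y - z.2))).
  have ez : (z.1 + 0 * (x - z.1), z.2 + 0 * (y - z.2)) = z by rewrite !mul0r !addr0; case: (z).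
  have hW' : nbhs (z.1 + 0 * (x - z.1), z.2 + 0 * (y - z.2)) (fun z' => K z' -> W (h z')).
    by rewrite ez.
  exact: (gc _ hW').
have /nbhs_ballP[e e0 he] := h0; pose s := Num.min (e / 2) 1.
have s0 : 0 < s by rewrite lt_min divr_gt0//=.
have s1 : s <= 1 by rewrite ge_min lexx orbT.
have se : s < e.
  by apply: (@le_lt_trans _ _ (e / 2)); [rewrite ge_min lexx|rewrite ltr_pdivrMr// ltr_pMr// ltr1n].
have k0 := hs z s Kz s0 s1.
exists (h (z.1 + s * (x - z.1), z.2 + s * (y - z.2))); split; first by eexists; [exact: k0|].
by apply: he; [rewrite /ball /= sub0r normrN gtr0_norm|exact: K0K].
Qed.

Lemma image_arc (K : set (R * R)) (h : R * R -> RP2 R) (Z : set (RP2 R)) (g : R -> R * R) :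
  {within K, continuous h} -> set_inj K h -> continuous g -> (forall t, K (g t)) ->
  (forall t, 0 <= t <= 1 -> Z (h (g t))) ->
  (forall t u, 0 <= t <= 1 -> 0 <= u <= 1 -> g t = g u -> t = u) -> arc Z (fun t => h (g t)).
Proof.
move=> hc hi gc gK gZ gi; split=> //; first exact: comp_within hc gc gK.
by move=> t u t1 u1 e; apply: gi => //; apply: hi => //; exact: mem_set.
Qed.

Notation cl := (clam (0 : R) 1).
Lemma cl01 t : 0 <= cl t <= 1. Proof. exact: clamP ler01. Qed.

(** The lower half circle gives the side [b], the upper one the arc [al]. The clauses on [al] serve
    to show that the only corners of a digon are the ends of [b]. *)
Lemma digon_data (O B P : set (RP2 R)) : digon O B P ->
  exists b (al : R -> RP2 R), [/\ side O B P b, closure P `<=` P `|` O `|` ins b,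
    continuous al, closure P `<=` P `|` (al @` `[0, 1]) `|` (b @` `[0, 1]) &
    (forall t, 0 <= t <= 1 -> O (al t)) /\
    (forall t u, 0 <= t <= 1 -> 0 <= u <= 1 -> al t = b u -> b u = b 0 \/ b u = b 1)].
Proof.
move=> [h [hc hi hP hO hB]].
have cP : closure P = h @` @unit_disk R.
  rewrite -hP; apply: (@closure_image _ _ _ 0 0) => //; first exact: compact_disk.
    exact: open_disk_sub.
  move=> z s; rewrite /unit_disk /open_unit_disk /= => hz s0 s1.
  have -> : (z.1 + s * (0 - z.1)) ^+ 2 + (z.2 + s * (0 - z.2)) ^+ 2 = (1 - s) ^+ 2 * (z.1 ^+ 2 + z.2 ^+ 2) by ring.
  have s2 : (1 - s) ^+ 2 < 1 by nra.
  by apply: le_lt_trans s2; rewrite ler_piMr// sqr_ge0.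
(* A half circle parametrized by its abscissa a + e t: it runs from -1 to 1 for (a, e) = (-1, 2) and
   backwards for (1, -2), and d = 1 or -1 selects the upper or lower half. *)
pose g (a e d : R) t : R * R := (a + e * cl t, d * Num.sqrt (1 - (a + e * cl t) ^+ 2)).
have gc a e d : continuous (g a e d).
  move=> t; have c1 : continuous_at t (fun t => a + e * cl t).
    by apply: contD; [exact: contC|apply: contM; [exact: contC|exact: clam_cont]].
  apply: cont_pair => //; apply: contM; first exact: contC.
  apply: (contT (h := fun t => 1 - (a + e * cl t) ^+ 2)); last exact: sqrt_continuous.
  by apply: contB; [exact: contC|exact: contX].
have ok a e t : (a = -1 /\ e = 2) \/ (a = 1 /\ e = -2) -> 0 <= 1 - (a + e * cl t) ^+ 2.
  by have /andP[? ?] := cl01 t; move=> [[-> ->]|[-> ->]]; nra.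
have gE a e d t : (a = -1 /\ e = 2) \/ (a = 1 /\ e = -2) -> d ^+ 2 = 1 -> unit_circle (g a e d t).
  by move=> ae d2; rewrite /unit_circle /= exprMn d2 mul1r sqr_sqrtr ?ok// addrC subrK.
have cd z : unit_circle z -> unit_disk z by rewrite /unit_circle /unit_disk /= => ->.
have gi a e d t u : (a = -1 /\ e = 2) \/ (a = 1 /\ e = -2) -> 0 <= t <= 1 -> 0 <= u <= 1 -> g a e d t = g a e d u -> t = u.
  by move=> ae t1 u1 []; rewrite !clam_id//; case: ae => -[-> ->]; lra.
have m2 : (-1 : R) ^+ 2 = 1 by rewrite sqrrN expr1n.
have p2 : (1 : R) ^+ 2 = 1 by rewrite expr1n.
have A1 : ((-1 : R) = -1 /\ (2 : R) = 2) \/ ((-1 : R) = 1 /\ (2 : R) = -2) by left.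
have A2 : ((1 : R) = -1 /\ (-2 : R) = 2) \/ ((1 : R) = 1 /\ (-2 : R) = -2) by right.
have cl0 : cl 0 = 0 by rewrite clam_id// lexx ler01.
have cl1 : cl 1 = 1 by rewrite clam_id// lexx ler01.
have Kg a e d : (a = -1 /\ e = 2) \/ (a = 1 /\ e = -2) -> d ^+ 2 = 1 -> forall t, unit_disk (g a e d t).
  by move=> ae d2 t; apply: cd; exact: gE.
have aO a e : (a = -1 /\ e = 2) \/ (a = 1 /\ e = -2) -> arc O (fun t => h (g a e 1 t)).
  move=> ae; apply: (image_arc hc hi (gc _ _ _) (Kg _ _ _ ae p2)) => [t _|t u].
    by apply: hO; [exact: gE|rewrite /= mul1r sqrtr_ge0].
  exact: gi.
have clo a e d t : (a = -1 /\ e = 2) \/ (a = 1 /\ e = -2) -> d ^+ 2 = 1 -> closure P (h (g a e d t)).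
  by move=> ae d2; rewrite cP; exists (g a e d t) => //; exact: Kg.
have g0 a e d : (a = -1 /\ e = 2) \/ (a = 1 /\ e = -2) -> g a e d 0 = (a, 0).
  by move=> ae; rewrite /g cl0 mulr0 addr0; case: ae => -[-> _]; rewrite ?sqrrN expr1n subrr sqrtr0 mulr0.
have gz (z : R * R) d : z.1 ^+ 2 + z.2 ^+ 2 = 1 -> -1 <= z.1 <= 1 -> d * `|z.2| = z.2 ->
    h (g (-1) 2 d ((z.1 + 1) / 2)) = h (z.1, z.2).
  move=> e1 hx dz; congr h; rewrite /g clam_id; last by apply/andP; split; lra.
  have -> : -1 + 2 * ((z.1 + 1) / 2) = z.1 by field.
  rewrite (_ : 1 - z.1 ^+ 2 = z.2 ^+ 2); last by rewrite -e1; ring.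
  by rewrite sqrtr_sqr dz.
exists (fun t => h (g (-1) 2 (-1) t)), (fun t => h (g (-1) 2 1 t)); split.
- split.
  - apply: (image_arc hc hi (gc _ _ _) (Kg _ _ _ A1 m2)) => [t _|t u].
      by apply: hB; [exact: gE|rewrite /= mulN1r oppr_le0 sqrtr_ge0].
    exact: gi.
  - exists (fun t => h (g (-1) 2 1 t)); split; [exact: aO|by rewrite !g0|by move=> t _; exact: clo].
  - exists (fun t => h (g 1 (-2) 1 t)); split; [exact: aO| |by move=> t _; exact: clo].
    rewrite g0// /g cl1 mulr1 (_ : -1 + 2 = 1 :> R); last by lra.
    by rewrite expr1n subrr sqrtr0 mulr0.
  - by move=> t _; exact: clo.
- rewrite cP => _ [z hz <-]; case: (ltrP (z.1 ^+ 2 + z.2 ^+ 2) 1) => z1.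
    by left; left; rewrite -hP; exists z.
  have zc : unit_circle z by apply: le_anti; rewrite z1 andbT.
  case: (lerP 0 z.2) => z2; first by left; right; exact: hO.
  have e1 : z.1 ^+ 2 + z.2 ^+ 2 = 1 := zc.
  have hx : -1 < z.1 < 1 by apply/andP; split; nra.
  right; exists ((z.1 + 1) / 2); first by rewrite /=; apply/andP; split; lra.
  rewrite gz//; [by case: (z)|by case/andP: hx => ? ?; rewrite !ltW|by rewrite ltr0_norm// mulN1r opprK].
- exact: (comp_within hc (gc _ _ _) (Kg _ _ _ A1 p2)).
- rewrite cP => _ [z hz <-]; case: (ltrP (z.1 ^+ 2 + z.2 ^+ 2) 1) => z1.
    by left; left; rewrite -hP; exists z.
  have zc : unit_circle z by apply: le_anti; rewrite z1 andbT.
  have e1 : z.1 ^+ 2 + z.2 ^+ 2 = 1 := zc.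
  have hx : -1 <= z.1 <= 1 by apply/andP; split; nra.
  have ht : 0 <= (z.1 + 1) / 2 <= 1 by apply/andP; split; lra.
  case: (lerP 0 z.2) => z2; [left; right|right]; exists ((z.1 + 1) / 2); rewrite /= ?in_itv//=.
    by rewrite gz//; [case: (z)|rewrite ger0_norm// mul1r].
  by rewrite gz//; [case: (z)|rewrite ltr0_norm// mulN1r opprK].
- split=> [t _|t u t1 u1 e]; first by apply: hO; [exact: gE|rewrite /= mul1r sqrtr_ge0].
  have [_] : g (-1) 2 1 t = g (-1) 2 (-1) u by apply: hi e; apply: mem_set; exact: Kg.
  set x := -1 + 2 * cl u; set y := Num.sqrt (1 - (-1 + 2 * cl t) ^+ 2) => e2.
  have y0 : 0 <= y by rewrite sqrtr_ge0.
  have x0 : 0 <= Num.sqrt (1 - x ^+ 2) by rewrite sqrtr_ge0.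
  have : Num.sqrt (1 - x ^+ 2) = 0 by lra.
  move/eqP; rewrite sqrtr_eq0 subr_le0 /x clam_id// => h2.
  have : u * (u - 1) = 0 by case/andP: u1 => u0 u1; nra.
  move/eqP; rewrite mulf_eq0 subr_eq0 => /orP[] /eqP ->; [by left|by right].
Qed.

Lemma square_compact : compact (@unit_square R).
Proof.
have -> : @unit_square R = `[0, 1]%classic `*` `[0, 1]%classic.
  by apply/seteqP; split=> z; rewrite /unit_square /= !in_itv.
by apply: compact_setX; exact: segment_compact.
Qed.

(** The left and right edges of the square are the two sides; at each vertex the horizontal edge
    supplies the arc of [O] that a corner requires. *)
Lemma quad_data (O B P : set (RP2 R)) : quadrangle O B P ->
  exists b0 b1, [/\ side O B P b0, side O B P b1,
    forall t u, 0 <= t <= 1 -> 0 <= u <= 1 -> b0 t <> b1 u &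
    closure P `<=` P `|` O `|` (ins b0 `|` ins b1)].
Proof.
move=> [h [hc hi hP hO hB]].
have cP : closure P = h @` @unit_square R.
  rewrite -hP; apply: (@closure_image _ _ _ 2^-1 2^-1) => //; first exact: square_compact.
    by move=> z [/andP[? ?] /andP[? ?]]; split; apply/andP; split; exact: ltW.
  move=> z s [/andP[a1 a2] /andP[b1 b2]] s0 s1.
  have h2 : (0 : R) < 2^-1 by rewrite invr_gt0.
  have h3 : 2 * 2^-1 = 1 :> R by rewrite mulfV.
  by split; apply/andP; split=> /=; nra.
have i01 : (0 : R) <= 0 <= (1 : R) by rewrite lexx ler01.
have i11 : (0 : R) <= 1 <= (1 : R) by rewrite ler01 lexx.
have cln t : 0 <= 1 - cl t <= 1 by have /andP[? ?] := cl01 t; apply/andP; split; lra.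
have clc := @clam_cont R 0 1.
have kc (x : R) : continuous (fun _ : R => x) by move=> t; exact: contC.
have nc : continuous (fun t => 1 - cl t) by move=> t; apply: contB; [exact: kc|exact: clc].
have cl0 : cl 0 = 0 by rewrite clam_id.
have cl1 : cl 1 = 1 by rewrite clam_id.
have Karc (Z : set (RP2 R)) (g1 g2 : R -> R) : continuous g1 -> continuous g2 ->
    (forall t, 0 <= g1 t <= 1 /\ 0 <= g2 t <= 1) -> (forall t, 0 <= t <= 1 -> Z (h (g1 t, g2 t))) ->
    (forall t u, 0 <= t <= 1 -> 0 <= u <= 1 -> g1 t = g1 u -> g2 t = g2 u -> t = u) ->
    arc Z (fun t => h (g1 t, g2 t)) /\ (forall t, 0 <= t <= 1 -> closure P (h (g1 t, g2 t))).
  move=> c1 c2 gK gZ gi; split.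
    apply: (image_arc hc hi) => //; first by move=> t; apply: cont_pair; [exact: c1|exact: c2].
    by move=> t u t1 u1 [? ?]; exact: gi.
  by move=> t _; rewrite cP; exists (g1 t, g2 t) => //; exact: gK.
have inj t u : 0 <= t <= 1 -> 0 <= u <= 1 -> cl t = cl u -> t = u by move=> t1 u1; rewrite !clam_id.
have injn t u : 0 <= t <= 1 -> 0 <= u <= 1 -> 1 - cl t = 1 - cl u -> t = u.
  by move=> t1 u1; rewrite !clam_id//; lra.
have cor x y : (x = 0 \/ x = 1) -> (y = 0 \/ y = 1) -> corner O P (h (x, y)).
  move=> hx hy.
  have hOy t : 0 <= t <= 1 -> O (h (t, y)) by move=> /hO[]; case: hy => ->.
  have y01 : 0 <= y <= 1 by case: hy => ->.
  case: hx => ->.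
    have [|||||a1 a2] := Karc O cl (fun=> y); [by []|exact: kc|by move=> t; split=> //; exact: cl01| | |].
    + by move=> t _; apply: hOy; exact: cl01.
    + by move=> t u t1 u1 e _; exact: inj e.
    by exists (fun t => h (cl t, y)); rewrite cl0.
  have [|||||a1 a2] := Karc O (fun t => 1 - cl t) (fun=> y); [by []|exact: kc|by move=> t; split=> //| | |].
  + by move=> t _; apply: hOy.
  + by move=> t u t1 u1 e _; exact: injn e.
  by exists (fun t => h (1 - cl t, y)); rewrite cl0 subr0.
have sid x : (x = 0 \/ x = 1) -> side O B P (fun t => h (x, cl t)).
  move=> hx.
  have [|||||a1 a2] := Karc B (fun=> x) cl; [exact: kc|by []| | | |].
  + by move=> t; split; [case: hx => ->|exact: cl01].
  + by move=> t _; have /hB[] := cl01 t; case: hx => ->.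
  + by move=> t u t1 u1 _ e; exact: inj e.
  by split=> //; rewrite ?cl0 ?cl1; apply: cor => //; [left|right].
exists (fun t => h (0, cl t)), (fun t => h (1, cl t)); split.
- by apply: sid; left.
- by apply: sid; right.
- move=> t u t1 u1 e.
  have [] : (0 : R, cl t) = (1, cl u) by apply: hi => //; apply: mem_set; split=> //=; exact: cl01.
  by move/eqP; rewrite eq_sym oner_eq0.
rewrite cP => _ [[x y] [/= /andP[x0 x1] /andP[y0 y1]] <-].
have [y00|y00] := eqVneq y 0; first by left; right; rewrite y00; apply: (hO x _).1; rewrite x0.
have [y11|y11] := eqVneq y 1; first by left; right; rewrite y11; apply: (hO x _).2; rewrite x0.
have yi : 0 < y < 1 by rewrite !lt_neqAle eq_sym y00 y0 y11.
have cy : cl y = y by rewrite clam_id// y0.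
have [x00|x00] := eqVneq x 0; first by right; left; exists y => //; rewrite x00 cy.
have [x11|x11] := eqVneq x 1; first by right; right; exists y => //; rewrite x11 cy.
by left; left; rewrite -hP; exists (x, y) => //; split=> //=; rewrite !lt_neqAle eq_sym x00 x0 x11.
Qed.

End Pieces.

(** * Bezout's bound for real points and its equality case *)

Section RealBezout.
Variable R : realType.
Notation C := R[i].

(* The plane orthogonal to [n] is spanned by two cross products. *)
Lemma orth_indep (n v : 'rV[C]_3) : n != 0 -> v != 0 -> exists2 v', indep v v' & dot n v' = 0.
Proof.
move=> n0 v0; have [u1 hu1] := indep_ex n0; have [u2 d0] := indep_det3 hu1.
have dc (u : 'rV[C]_3) : dot n (cross n u) = 0 by rewrite dotC dot_cross /det3; ring.
apply: contrapT => hn.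
have dep (u : 'rV[C]_3) : exists b : C, cross n u = b *: v.
  have [c0|c0] := eqVneq (cross v (cross n u)) 0; first exact: cross_dep v0 c0.
  exfalso; apply: hn; exists (cross n u); last exact: dc.
  move=> a b e.
  have [b0|b0] := eqVneq b 0.
    split=> //; move: e; rewrite b0 scale0r addr0 => /eqP; rewrite scaler_eq0 (negbTE v0) orbF.
    by move/eqP.
  case/eqP: c0; have -> : cross n u = - (a / b) *: v.
    apply: (scalerI b0); rewrite scalerA mulrN [b * _]mulrC divfK// scaleNr.
    by apply/eqP; rewrite -addr_eq0 addrC e.
  by apply: row3P; rewrite !mxE /=; ring.
have [b1 e1] := dep u1; have [b2 e2] := dep u2.
have cz : cross n (b2 *: u1 - b1 *: u2) = 0.
  have -> : cross n (b2 *: u1 - b1 *: u2) = b2 *: cross n u1 - b1 *: cross n u2.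
    by apply: row3P; rewrite !mxE /=; ring.
  by rewrite e1 e2 !scalerA mulrC subrr.
have [k hk] := cross_dep n0 cz.
have [_ b20 b10] : [/\ - k = 0, b2 = 0 & - b1 = 0].
  by apply: (det3_free d0); rewrite scaleNr -hk; apply/rowP => j; rewrite !mxE; ring.
by move/eqP: (cross_neq0 hu1); rewrite e1 -[b1]opprK b10 oppr0 scale0r.
Qed.

Lemma rank2 (g n : 'rV[C]_3) : indep g n -> \rank (col_mx g n) = 2%N.
Proof.
move=> I; apply/eqP; apply: inj_row_free => x; rewrite -[x]hsubmxK mul_row_col.
rewrite (mx11_scalar (lsubmx x)) (mx11_scalar (rsubmx x)) !mul_scalar_mx => /I[-> ->].
by apply/rowP => j; rewrite !mxE; case: splitP => j' _; rewrite !mxE mul0rn.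
Qed.

(** In the case of equality, a complex zero with dependent gradients is either one of the points,
    where a common tangent costs two intersections, or a new point. Both exceed k m. *)
Lemma bezout_real k m (c f : mpoly 3 R) N (P : 'I_N -> RP2 R) : nonsingular k c ->
  is_form m f -> (0 < m)%N -> (exists p0, real_points c p0 /\ ~ real_points f p0) ->
  injective P -> (forall j, real_points c (P j) /\ real_points f (P j)) ->
  (N <= k * m)%N /\ (N = (k * m)%N -> transversal_curves f c).
Proof.
move=> cn fm m0 [p0 [cp0 fp0]] Pi hP.
have cs := nonsingular_smooth cn; have fm' := complexify_form fm.
pose V j := cv (rep (P j)); pose b := cv (rep p0).
have V0 j : V j != 0 by rewrite cv_eq0 rep_neq0.
have b0 : b != 0 by rewrite cv_eq0 rep_neq0.
have z d (g : mpoly 3 R) p : is_form d g -> real_points g p -> eval_form (complexify g) (cv (rep p)) = 0.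
  by move=> gd gp; rewrite eval_complexify (_ : eval_form g (rep p) = 0) ?rmorph0.
have cb := z k c p0 cn.1 cp0; rewrite -/b in cb.
have fb : eval_form (complexify f) b != 0.
  by rewrite eval_complexify; apply/eqP => /complexI h; apply: fp0.
have hV j : eval_form (complexify c) (V j) = 0 /\ eval_form (complexify f) (V j) = 0.
  by split; [exact: (z k _ _ cn.1 (hP j).1)|exact: (z m _ _ fm (hP j).2)].
have VI j l : j != l -> indep (V j) (V l).
  move=> jl; apply: cv_indep; apply: indep_pt; rewrite ?rep_neq0// !pt_rep => e.
  by case/eqP: jl; exact: Pi.
split; first exact: (bezout_card cs fm' m0 b0 cb fb V0 hV VI).
move=> Nk v v0 fv cv0; apply: rank2.
pose n := grad (complexify c) v; have n0 : n != 0 := cs.2 _ v0 cv0.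
have nv : dot n v = 0 := euler0 cs.1 cv0.
move=> x y; change (x *: grad (complexify f) v + y *: n = 0 -> x = 0 /\ y = 0) => e.
apply: contrapT => hxy.
have x0 : x != 0.
  apply/eqP => x0; apply: hxy; split=> //; move: e; rewrite x0 scale0r add0r => /eqP.
  by rewrite scaler_eq0 (negbTE n0) orbF => /eqP.
have [v' Iv nv'] := orth_indep n0 v0.
have fv' : dot (grad (complexify f) v) v' = 0.
  apply: (mulfI x0); rewrite mulr0 -dotZl; have -> : x *: grad (complexify f) v = - y *: n.
    by apply/eqP; rewrite scaleNr -addr_eq0 e.
  by rewrite dotZl nv' mulr0.
have [[t et]|hno] := pselect (exists t, ~ indep v (V t)).
- have [a ea] : exists a, V t = a *: v.
    have [c0|c0] := eqVneq (cross v (V t)) 0; first exact: cross_dep v0 c0.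
    exfalso; apply: et => x' y' e'.
    have [y0|y0] := eqVneq y' 0.
      split=> //; move: e'; rewrite y0 scale0r addr0 => /eqP; rewrite scaler_eq0 (negbTE v0) orbF.
      by move/eqP.
    case/eqP: c0; have -> : V t = - (x' / y') *: v.
      apply: (scalerI y0); rewrite scalerA mulrN [y' * _]mulrC divfK// scaleNr.
      by apply/eqP; rewrite -addr_eq0 addrC e'.
    by apply: row3P; rewrite !mxE /=; ring.
  have a0 : a != 0 by apply: contraNneq (V0 t) => a0; rewrite ea a0 scale0r.
  have gs d (g : mpoly 3 C) u : is_form d g -> (0 < d)%N -> dot (grad g v) u = 0 -> dot (grad g (V t)) u = 0.
    case: d => // d gd _ h; rewrite ea (grad_scale _ _ gd) dotZl h; exact: mulr0.
  have k0 : (0 < k)%N := smooth_pos cs v0 cv0.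
  have It : indep (V t) v'.
    move=> x' y'; rewrite ea scalerA => /Iv[h ->]; split=> //.
    by move/eqP: h; rewrite mulf_eq0 (negbTE a0) orbF => /eqP.
  have := bezout_tangent cs fm' m0 b0 cb fb V0 hV VI It (gs _ _ _ cs.1 k0 nv') (gs _ _ _ fm' m0 fv').
  by rewrite Nk ltnn.
- have hall t : indep v (V t) by apply: contrapT => h; apply: hno; exists t.
  pose W (j : 'I_N.+1) := if unlift ord0 j is Some j' then V j' else v.
  have := bezout_card cs fm' m0 b0 cb fb (P := W); rewrite -Nk ltnn => h; suff : false by [].
  apply: h => [j|j|j l]; rewrite /W.
  + by case: unliftP => [j'|] _; [exact: V0|exact: v0].
  + by case: unliftP => [j'|] _; [exact: hV|exact: conj cv0 fv].
  + case: unliftP => [j'|] ->; case: unliftP => [l'|] -> jl.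
    * by apply: VI; apply: contraNneq jl => ->.
    * by move=> x' y' e'; have [-> ->] := hall j' y' x' (etrans (addrC _ _) e').
    * exact: hall.
    * by exfalso; case/negP: jl; exact: eqxx.
Qed.

End RealBezout.

(** * The pieces of a snake and their corners *)

Section Snake.
Variable R : realType.
Variables (k : nat) (c s : mpoly 3 R) (O D : set (RP2 R)) (h : R * R -> RP2 R).
Hypothesis cn : nonsingular k c.
Hypothesis sn : nonsingular 4 s.
Hypothesis OS : O `<=` real_points s.
Hypothesis hc : {within @unit_disk R, continuous h}.
Hypothesis hi : set_inj (@unit_disk R) h.
Hypothesis hO : h @` @unit_circle R = O.
Hypothesis hD : h @` @open_unit_disk R = D.
Let B := branches_meeting c O.
Hypothesis Vbound : forall N (P : 'I_N -> RP2 R), injective P ->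
  (forall j, real_points c (P j) /\ real_points s (P j)) -> (N <= k * 4)%N.

Lemma branchesC : B `<=` real_points c.
Proof. by move=> q [A [[x _ <-] _]] /connected_component_sub. Qed.

Lemma disjOD q : O q -> D q -> False.
Proof.
rewrite -hO -hD => -[z z1 <-] [w w1 e].
have zd : unit_disk z by rewrite /unit_disk /= z1.
have e2 := hi (mem_set (open_disk_sub w1)) (mem_set zd) e.
by move: w1; rewrite e2 /open_unit_disk /= z1 ltxx.
Qed.

Lemma openD : open D. Proof. by rewrite -hD; exact: disk_open. Qed.

(** The parameters e / (j + 2), for 4k + 1 values of j, give more common points of the curves than
    Bezout allows. *)
Lemma many_points (g : R -> RP2 R) (e : R) : 0 < e ->
  (forall y, 0 < y < e -> real_points c (g y) /\ real_points s (g y)) ->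
  (forall y y', 0 < y < e -> 0 < y' < e -> g y = g y' -> y = y') -> False.
Proof.
move=> e0 hg gi; pose N := (k * 4).+1.
have y01 (j : 'I_N) : 0 < e / (j%:R + 2) < e.
  have j0 : (0 : R) <= j%:R by rewrite ler0n.
  have j2 : (0 : R) < j%:R + 2 by lra.
  by apply/andP; split; [rewrite divr_gt0|rewrite ltr_pdivrMr// ltr_pMr//; lra].
have := @Vbound N (fun j => g (e / (j%:R + 2))) _ (fun j => hg _ (y01 j)).
rewrite /N ltnn; suff h0 : injective (fun j : 'I_N => g (e / (j%:R + 2))) by move=> /(_ h0).
move=> j l /gi => /(_ (y01 j) (y01 l)) /(mulfI (lt0r_neq0 e0)) /invr_inj /addIr /eqP.
by rewrite eqr_nat => /eqP; exact: val_inj.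
Qed.

Lemma closedC (f : mpoly 3 R) d : is_form d f -> closed (real_points f).
Proof.
move=> fd; have f2 : is_form (2 * d) (f * f) by rewrite mul2n -addnn; exact: dhomogM.
have -> : real_points f = evfun d (f * f) @^-1` [set 0].
  apply/seteqP; split=> p.
    move=> fp; apply/(evfun_eq0 p f2); rewrite /real_points /= -/(rep p) eval_formM.
    by have -> : eval_form f (rep p) = 0 := fp; rewrite mulr0.
  move=> /= /(evfun_eq0 p f2); rewrite /real_points /= -/(rep p) eval_formM => /eqP.
  by rewrite mulf_eq0 orbb => /eqP.
by apply: closed_comp => [p _|]; [exact: evfun_continuous|exact: closed_eq].
Qed.

(** Only finitely many branches meet [O]: each contains a common point of c and s, and different
    branches are disjoint. *)
Lemma closedB : closed B.
Proof.
apply: closed_bigcup; last by move=> A [[x cx <-] _]; apply: component_closed; exact: closedC cn.1.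
apply: contrapT => /infiniteP /pcard_leP[f].
have fA j : branch c (f j) /\ f j `&` O !=set0 by have := 'funS_f (I : setT j).
have /choice[g hg] j : exists x, (f j `&` O) x by have [_ [x hx]] := fA j; exists x.
have gi : injective g.
  move=> j l e; have := 'inj_f => fi; apply: fi; rewrite ?inE//.
  have [cj _] := fA j; have [cl _] := fA l.
  by apply: (component_eq cj cl (q := g j)); [exact: (hg j).1|rewrite e; exact: (hg l).1].
have := @Vbound (k * 4).+1 (fun j => g j) _ _; rewrite ltnn => h0.
suff : false by []; apply: h0 => [j l /gi /val_inj//|j].
have [[x _ <-] _] := fA j; split; last by apply: OS; exact: (hg j).2.
have [cj _] := fA j; have [y _ ey] := cj.
by have := (hg j).1; rewrite -ey => /connected_component_sub.
Qed.

Lemma openDB : open (D `\` B).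
Proof. by apply: openI; [exact: openD|apply: closed_openC; exact: closedB]. Qed.

Lemma conv_lt (a b r t : R) : 0 <= t -> t <= 1 -> a < r -> b < r -> (1 - t) * a + t * b < r.
Proof.
move=> t0 t1 ar br; have [t2|t2] := ltrP t 1; last by have -> : t = 1 by [apply/le_anti; rewrite t1]; rewrite subrr mul0r add0r mul1r.
have p1 : 0 < (1 - t) * (r - a) by rewrite mulr_gt0 ?subr_gt0.
have p2 : 0 <= t * (r - b) by apply: mulr_ge0 => //; rewrite subr_ge0 ltW.
by nra.
Qed.

(** Near a point of [O] off the curve, the disk is the image of a convex set that avoids [B]. This
    set is connected, hence inside one piece, and every piece adherent to the point meets it. *)
Lemma piece_unique P1 P2 x : components (D `\` B) P1 -> components (D `\` B) P2 ->
  O x -> ~ real_points c x -> closure P1 x -> closure P2 x -> P1 = P2.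
Proof.
move=> c1 c2 Ox cx x1 x2; have := Ox; rewrite -hO => -[z zc ex].
have zd : unit_disk z by rewrite /unit_disk /= zc.
have nB : nbhs x (~` B) by apply: open_nbhs_nbhs; split; [exact: closed_openC closedB|move=> /branchesC].
have /subspace_continuousP hx0 := hc; have nB' : nbhs (h z) (~` B) by rewrite ex.
have /nbhs_ballP[r r0 hr] := hx0 z zd _ nB'.
pose S := h @` (@open_unit_disk R `&` [set w | `|w.1 - z.1| < r /\ `|w.2 - z.2| < r]).
have SD : S `<=` D `\` B.
  move=> _ [w [w1 [w2 w3]] <-]; split; first by rewrite -hD; exists w.
  apply: hr; last exact: open_disk_sub.
  by split; rewrite /= /ball /= distrC.
have meet P : components (D `\` B) P -> closure P x -> (P `&` S) !=set0.
  move=> [y0 _ eP] Px.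
  have oU : open [set w : R * R | `|w.1 - z.1| < r /\ `|w.2 - z.2| < r].
    have -> : [set w : R * R | `|w.1 - z.1| < r /\ `|w.2 - z.2| < r] = ball z r.
      by apply/seteqP; split=> w [a b]; split; rewrite /= /ball /= distrC.
    exact: ball_open.
  have [|W nW hW] := inverse_near (@compact_disk R) hc hi zd oU; first by rewrite /= !subrr normr0.
  rewrite ex in nW; have [q [Pq Wq]] := Px _ nW.
  have [Dq _] : (D `\` B) q by move: Pq; rewrite -eP => /connected_component_sub.
  move: Dq; rewrite -hD => -[w ow ew]; exists q; split=> //; exists w => //; split=> //.
  by apply: hW; [exact: open_disk_sub|rewrite ew].
have [q1 [Pq1 Sq1]] := meet _ c1 x1; have [q2 [Pq2 Sq2]] := meet _ c2 x2.
have cS : connected S.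
  have [w0 hw0 _] := Sq1.
  pose L (w : R * R) t := (w0.1 + t * (w.1 - w0.1), w0.2 + t * (w.2 - w0.2)).
  pose T := @open_unit_disk R `&` [set w | `|w.1 - z.1| < r /\ `|w.2 - z.2| < r].
  have LT w t : T w -> 0 <= t <= 1 -> T (L w t).
    move=> [w1 [w2 w3]] /andP[t0 t1]; have [a1 [a2 a3]] := hw0; split.
      move: w1 a1; rewrite /open_unit_disk /=.
      case: (w) (w0) => [wx wy] [ax ay] /= w1 a1.
      have -> : (ax + t * (wx - ax)) ^+ 2 + (ay + t * (wy - ay)) ^+ 2 =
        (1 - t) * (ax ^+ 2 + ay ^+ 2) + t * (wx ^+ 2 + wy ^+ 2)
        - t * (1 - t) * ((wx - ax) ^+ 2 + (wy - ay) ^+ 2) by ring.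
      have q0 : 0 <= t * (1 - t) * ((wx - ax) ^+ 2 + (wy - ay) ^+ 2).
        by rewrite mulr_ge0 ?addr_ge0 ?sqr_ge0// mulr_ge0// subr_ge0.
      move: w1 a1 q0; set X := _ + _; set Y := _ + _; set Z := _ * _ => w1 a1 q0.
      by case: (ltrP t 1) => t2; nra.
    have bt x' y' z' : `|x' - z'| < r -> `|y' - z'| < r -> `|x' + t * (y' - x') - z'| < r.
      rewrite !ltr_norml => /andP[l1 l2] /andP[l3 l4].
      have -> : x' + t * (y' - x') - z' = (1 - t) * (x' - z') + t * (y' - z') by ring.
      apply/andP; split; last exact: conv_lt.
      rewrite ltrNl (_ : - _ = (1 - t) * - (x' - z') + t * - (y' - z')); last by ring.
      by apply: conv_lt => //; rewrite ltrNl.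
    by split=> /=; exact: bt.
  have -> : S = \bigcup_(w in T) ((fun t => h (L w (clam 0 1 t))) @` `[0, 1]).
    apply/seteqP; split=> q.
      move=> [w Tw <-]; exists w => //; exists 1; first by rewrite /= in_itv /= ler01 lexx.
      by rewrite clam_id ?ler01 ?lexx// /L !mul1r ![_ + (_ - _)]addrC !subrK; case: (w).
    by move=> [w Tw [t _ <-]]; eexists; [apply: (LT w _ Tw); exact: clamP ler01|].
  apply: bigcup_connected.
    exists (h w0) => w _; exists 0; first by rewrite /= in_itv /= ler01 lexx.
    by rewrite clam_id ?ler01 ?lexx// /L !mul0r !addr0; case: (w0).
  move=> w Tw; apply: seg_connected; apply: comp_within hc _ _ => t.
    apply: cont_pair; (apply: contD; first exact: contC);
      by apply: contM; [exact: clam_cont|exact: contC].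
  by apply: open_disk_sub; exact: (LT _ _ Tw (clamP _ ler01)).1.
have [P cP SP] := sub_component cS (ex_intro _ q1 Sq1) SD.
by rewrite (component_eq c1 cP Pq1 (SP _ Sq1)) (component_eq c2 cP Pq2 (SP _ Sq2)).
Qed.

Notation pc := (components (D `\` B)).

Lemma piece_sub P : pc P -> P `<=` D `\` B.
Proof. by move=> [x _ <-]; exact: connected_component_sub. Qed.

(** If the arc left the closed set, it would do so on a whole interval of parameters, and all these
    points would be common to c and s. *)
Lemma many_arc (A Z : set (RP2 R)) (x : R -> RP2 R) : closed A -> arc Z x ->
  (forall t : R, 0 <= t <= 1 -> ~ A (x t) -> real_points c (x t) /\ real_points s (x t)) ->
  forall t : R, 0 <= t <= 1 -> A (x t).
Proof.
move=> cA [xc _ xi] hx t1 t101; apply: contrapT => nA.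
have hn : nbhs (x t1) (~` A) by apply: open_nbhs_nbhs; split=> //; exact: closed_openC.
have /nbhs_ballP[d0 d00' hd] := xc t1 _ hn; have d00 : 0 < d0 := d00'.
pose e := Num.min d0 2^-1; have e0 : 0 < e by rewrite lt_min d00 invr_gt0 ltr0n.
have ee1 : e <= d0 by rewrite ge_min lexx.
have ee2 : e <= 2^-1 by rewrite ge_min lexx orbT.
have h2 : 2^-1 + 2^-1 = 1 :> R by field.
have [sg [sg1 hsg]] : exists sg : R, `|sg| = 1 /\ forall y : R, 0 < y < e -> 0 <= t1 + sg * y <= 1.
  have /andP[a b] := t101; have [hl|hl] := lerP t1 2^-1.
    by exists 1; rewrite normr1; split=> // y /andP[? ?]; apply/andP; split; lra.
  by exists (-1); rewrite normrN1; split=> // y /andP[? ?]; apply/andP; split; lra.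
have sg0 : sg != 0 by rewrite -normr_eq0 sg1 oner_neq0.
apply: (@many_points (fun y => x (t1 + sg * y)) e e0) => [y hy|y y' hy hy' /xi].
  apply: hx; first exact: hsg.
  apply: hd; rewrite /ball /= opprD addNKr normrN normrM sg1 mul1r.
  by have /andP[y0 ye] := hy; rewrite gtr0_norm//; exact: lt_le_trans ee1.
by move=> /(_ (hsg _ hy) (hsg _ hy')) /addrI /(mulfI sg0).
Qed.

(** The sides and corners of a quadrangle would lie, up to finitely many points, on the two sides of
    the digon, and by closedness entirely. Three distinct corners would then be among the two ends
    of [b]. *)
Lemma quad_not_digon P : pc P -> quadrangle O B P -> digon O B P -> False.
Proof.
move=> pP /quad_data[b0 [b1 [[a0 k00 k01 cl0] [a1 k10 k11 cl1] dis _]]] /digon_data[b [al [sd clb alc cl2 [alO albu]]]].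
have PB q : P q -> B q -> False by move=> Pq Bq; have [_ nB] := piece_sub pP Pq; exact: nB.
have PO q : P q -> O q -> False by move=> /(piece_sub pP)[? _] /disjOD; apply.
have bc : continuous b by case: sd => -[].
have bB (t : R) : 0 <= t <= 1 -> B (b t) by case: sd => -[_ hb _] _ _ _; exact: hb.
have im (f : R -> RP2 R) q : (f @` `[0, 1]) q -> exists2 t, 0 <= t <= 1 & f t = q.
  by move=> [t]; rewrite /= in_itv /=; exists t.
have key1 (x : R -> RP2 R) : arc B x -> (forall t : R, 0 <= t <= 1 -> closure P (x t)) -> forall t : R, 0 <= t <= 1 -> (b @` `[0, 1]) (x t).
  move=> ax clx; apply: (many_arc (arc_closed bc) ax) => t t01 nb.
  have Bx : B (x t) by case: ax => _ hh _; exact: hh.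
  split; first exact: branchesC.
  by have [[/PB/(_ Bx)//|/im[u u01 <-]]|//] := cl2 _ (clx t t01); exact/OS/alO.
have key2 (x : R -> RP2 R) : arc O x -> (forall t : R, 0 <= t <= 1 -> closure P (x t)) -> forall t : R, 0 <= t <= 1 -> (al @` `[0, 1]) (x t).
  move=> ax clx; apply: (many_arc (arc_closed alc) ax) => t t01 nb.
  have Ox : O (x t) by case: ax => _ hh _; exact: hh.
  split; last exact: OS.
  by have [[/PO/(_ Ox)//|//]|/im[u u01 <-]] := cl2 _ (clx t t01); exact/branchesC/bB.
have i0 : (0 : R) <= 0 <= (1 : R) by rewrite lexx ler01.
have i1 : (0 : R) <= 1 <= (1 : R) by rewrite ler01 lexx.
have two p : corner O P p -> (b @` `[0, 1]) p -> p = b 0 \/ p = b 1.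
  move=> [x [ax x0 clx]] /im[u u01 eu]; have /im[t t01 et] := key2 x ax clx 0 i0.
  by rewrite -eu; apply: (albu t u) => //; rewrite et x0 eu.
have h00 := two _ k00 (key1 _ a0 cl0 0 i0); have h01 := two _ k01 (key1 _ a0 cl0 1 i1).
have h10 := two _ k10 (key1 _ a1 cl1 0 i0).
have n1 : b0 0 <> b0 1.
  by case: a0 => _ _ bi /(bi _ _ i0 i1) /eqP; rewrite eq_sym oner_eq0.
have n2 : b0 0 <> b1 0 by exact: dis.
have n3 : b0 1 <> b1 0 by exact: dis.
by case: h00 h01 h10 => e1 [] e2 [] e3; (apply: n1; congruence) || (apply: n2; congruence) || (apply: n3; congruence).
Qed.

(** The piece [P] adheres to the half of [O] that leaves [p] on the side [sg] of the local
    coordinate [xi]. *)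
Definition germ (U : set (RP2 R)) (xi : RP2 R -> R) (p : RP2 R) (sg : R) (P : set (RP2 R)) :=
  exists al e, [/\ arc O al, (forall t : R, 0 <= t <= 1 -> closure P (al t)), 0 < e &
    forall y : R, 0 < y < e -> exists t, [/\ 0 < t < 1, U (al t) & xi (al t) = xi p + sg * y]].

(** Points with the same coordinate on both arcs coincide. Such a point off c is adherent to both
    pieces, so they are equal by [piece_unique]; if no such point existed, c and s would share
    infinitely many points. *)
Lemma germ_unique U xi p (sg : R) P1 P2 : sg = 1 \/ sg = -1 ->
  (forall q q', U q -> U q' -> real_points s q -> real_points s q' -> xi q = xi q' -> q = q') ->
  pc P1 -> pc P2 -> germ U xi p sg P1 -> germ U xi p sg P2 -> P1 = P2.
Proof.
move=> hsg hxi c1 c2 [al1 [e1 [a1 cl1 e10 h1]]] [al2 [e2 [a2 cl2 e20 h2]]].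
apply: contrapT => n12; pose e := Num.min e1 e2.
have e0 : 0 < e by rewrite lt_min e10.
have ee1 : e <= e1 by rewrite ge_min lexx.
have ee2 : e <= e2 by rewrite ge_min lexx orbT.
have sg0 : sg != 0 by case: hsg => ->; rewrite ?oppr_eq0 oner_neq0.
have w01 (t : R) : 0 < t < 1 -> 0 <= t <= 1 by move=> /andP[? ?]; rewrite !ltW.
have ht (y : R) : exists t, 0 < y < e -> [/\ 0 < t < 1, U (al1 t) & xi (al1 t) = xi p + sg * y].
  have [hy|hy] := pselect (0 < y < e); last by exists 0 => /hy.
  by have [|t ht] := h1 y; [have /andP[? ?] := hy; apply/andP; split; lra|exists t].
have [f hf] := choice ht.
apply: (@many_points (fun y => al1 (f y)) e e0) => [y hy|y y' hy hy' eq].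
- have [f01 Uf xf] := hf y hy.
  have Of : O (al1 (f y)) by case: a1 => _ hh _; apply: hh; exact: w01.
  split; last exact: OS.
  apply: contrapT => ncf; apply: n12.
  have [|u [u01 Uu xu]] := h2 y; first by have /andP[? ?] := hy; apply/andP; split; lra.
  have Ou : O (al2 u) by case: a2 => _ hh _; apply: hh; exact: w01.
  have e12 : al1 (f y) = al2 u by apply: hxi => //; [exact: OS|exact: OS|rewrite xf xu].
  by apply: (piece_unique c1 c2 Of ncf); [exact: cl1 (w01 _ f01)|rewrite e12; exact: cl2 (w01 _ u01)].
- have [_ _ x1] := hf y hy; have [_ _ x2] := hf y' hy'.
  by move: x1; rewrite eq x2 => /addrI /(mulfI sg0).
Qed.

Section Count.
Variables (n : nat) (Q : 'I_n -> set (RP2 R)) (E : 'I_2 -> set (RP2 R)).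
Hypothesis n2k : (n.+1 = 2 * k)%N.
Hypotheses (Qi : injective Q) (Ei : injective E).
Hypotheses (Qp : forall j, pc (Q j) /\ quadrangle O B (Q j)) (Ep : forall j, pc (E j) /\ digon O B (E j)).

(** The 2k - 1 quadrangles have four corners each and the digons two each: 8k in all. A point has
    two germs of [O], and each germ belongs to one piece, so there are at least 4k corner points,
    all of them common to c and s. *)
Lemma corners_count : exists P : 'I_(k * 4) -> RP2 R, injective P /\
  forall j, real_points c (P j) /\ real_points s (P j).
Proof.
have [bq hbq] := choice (fun j => quad_data (Qp j).2).
have [bq' hbq'] := choice hbq.
have [be hbe] := choice (fun j => digon_data (Ep j).2).
pose T := (('I_n * (bool * bool)) + ('I_2 * bool))%type.
pose en (a : bool) : R := if a then 1 else 0.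
have en01 a : 0 <= en a <= 1 by case: a; rewrite /en ?lexx ler01.
pose pp (x : T) := match x with inl z => Q z.1 | inr z => E z.1 end.
pose pq (x : T) := match x with
  | inl z => (if z.2.1 then bq' z.1 else bq z.1) (en z.2.2) | inr z => be z.1 (en z.2) end.
have ppc x : pc (pp x) by case: x => [[j z]|[j z]]; [exact: (Qp j).1|exact: (Ep j).1].
have cor x : corner O (pp x) (pq x) /\ B (pq x).
  case: x => [[j [a e]]|[j e]] /=.
    have [[[_ bB _] k0 k1 _] [[_ bB' _] k0' k1' _] _ _] := hbq' j.
    by split; [case: a; case: e|case: a; [apply: bB'|apply: bB]].
  have [al [[[_ bB _] k0 k1 _] _ _ _ _]] := hbe j.
  by split; [case: e|apply: bB].
have eni a e : en a = en e -> a = e.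
  by case: a; case: e => // /eqP; rewrite /en ?oner_eq0// eq_sym oner_eq0.
have inj x y : pp x = pp y -> pq x = pq y -> x = y.
  case: x y => [[j [a e]]|[j e]] [[j' [a' e']]|[j' e']] /=.
  - move=> /Qi <-; have [[[_ _ bi] _ _ _] [[_ _ bi'] _ _ _] dis _] := hbq' j.
    case: a; case: a' => hq.
    + by rewrite (eni _ _ (bi' _ _ (en01 _) (en01 _) hq)).
    + by case: (dis (en e') (en e) (en01 _) (en01 _)).
    + by case: (dis (en e) (en e') (en01 _) (en01 _)).
    + by rewrite (eni _ _ (bi _ _ (en01 _) (en01 _) hq)).
  - by move=> hq; case: (@quad_not_digon (Q j) (Qp j).1 (Qp j).2); rewrite hq; exact: (Ep j').2.
  - by move=> hq; case: (@quad_not_digon (Q j') (Qp j').1 (Qp j').2); rewrite -hq; exact: (Ep j).2.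
  - move=> /Ei <-; have [al [[[_ _ bi] _ _ _] _ _ _ _]] := hbe j.
    by move=> hq; rewrite (eni _ _ (bi _ _ (en01 _) (en01 _) hq)).
have loc p : exists Ux : set (RP2 R) * (RP2 R -> R), real_points s p ->
    [/\ Ux.1 p, forall q, Ux.1 q -> nbhs q Ux.1 /\ continuous_at q Ux.2 &
      forall q q', Ux.1 q -> Ux.1 q' -> real_points s q -> real_points s q' -> Ux.2 q = Ux.2 q' -> q = q'].
  have [sp|np] := pselect (real_points s p); last by exists (setT, fun=> 0) => /np.
  have [U [_ [_ [xi [[nU hU] _ _ _ [_ hxi]]]]]] := local_structure sn sp filterT.
  by exists (U, xi) => _; split=> //; exact: nbhs_singleton nU.
have [L hL] := choice loc.
have sO x : real_points s (pq x).
  have [[al [[_ aO _] a0 _]] _] := cor x; apply: OS; rewrite -a0; apply: aO.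
  by rewrite lexx ler01.
have gm x : exists sg : bool, germ (L (pq x)).1 (L (pq x)).2 (pq x) ((-1) ^+ sg) (pp x).
  have [[al [aa a0 cl]] _] := cor x; have [L1 L2 L3] := hL _ (sO x).
  have aS : arc (real_points s) al by case: aa => ac aO ai; split=> // t t01; exact/OS/aO.
  have [|sg [e [hsg e0 h1]]] := half_branch L2 L3 aS; first by rewrite a0.
  rewrite a0 in h1.
  by case: hsg h1 => -> h1; [exists false|exists true]; exists al, e; split=> // y hy; rewrite ?expr0 ?expr1; exact: h1.
have [sgn hsgn] := choice gm.
(* Corners are listed together with the side of their arc. The pairs are distinct, and each point
   occurs in at most two. *)
pose w := [seq (pq x, sgn x) | x <- enum {: T}].
have uw : uniq w.
  rewrite map_inj_in_uniq ?enum_uniq// => x y _ _ [e1 e2].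
  apply: inj => //; have [L1 L2 L3] := hL _ (sO x).
  apply: (germ_unique (sg := (-1) ^+ sgn x) _ L3 (ppc x) (ppc y) (hsgn x)).
    by case: (sgn x); [right|left].
  by rewrite e2 e1; exact: hsgn.
have [W [uW memW sW]] : exists W : seq (RP2 R), [/\ uniq W, (forall p, p \in W -> exists x, p = pq x) & (k * 4 <= size W)%N].
  exists (undup [seq pq x | x <- enum {: T}]); split; first exact: undup_uniq.
    by move=> p; rewrite mem_undup => /mapP[x _ ->]; exists x.
  have sw : {subset w <= [seq (p, b) | p <- undup [seq pq x | x <- enum {: T}], b <- [:: true; false]]}.
    move=> _ /mapP[x xT ->]; apply/allpairsP; exists (pq x, sgn x); split=> //=.
      have hm : pq x \in undup [seq pq x | x <- enum {: T}] by rewrite mem_undup; exact: map_f.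
      exact: hm.
    by case: (sgn x); rewrite !inE.
  have := uniq_leq_size uw sw; rewrite size_allpairs size_map -cardE card_sum !card_prod !card_bool !card_ord /=.
  by move: n2k; move: (size _) => z; clear; lia.
pose x0 : RP2 R := pq (inr (ord0, true)).
have spq x : real_points c (pq x) /\ real_points s (pq x) by split; [exact: branchesC (cor x).2|exact: sO].
move: x0 => x0; clear w uw gm sgn hsgn.
have lt (j : 'I_(k * 4)) : (j < size W)%N by exact: leq_trans (ltn_ord j) sW.
exists (fun j => nth x0 W j); split=> [j l e|j].
  by apply: val_inj; apply/eqP; rewrite -(nth_uniq x0 (lt j) (lt l) uW); apply/eqP.
by have [x ->] := memW _ (mem_nth x0 (lt j)).
Qed.

End Count.

Lemma rank_eq (X Y X' Y' : 'rV[R[i]]_3) : X = X' -> Y = Y' ->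
  \rank (col_mx X Y) = 2%N -> \rank (col_mx X' Y') = 2%N.
Proof. by move=> -> ->. Qed.

(* A transversal crossing changes the sign of the quartic along the curve. *)
Lemma not_tangent p : real_points c p -> real_points s p -> transversal_curves s c ->
  ~ (\forall q \near p, real_points c q -> eval_form s (rep q) <= 0).
Proof.
move=> cp sp tr hn; have w0 := rep_neq0 p; set w := rep p in w0.
have cf := cn.1; have sf := sn.1; have pw : pt w = p by exact: pt_rep.
have cw : eval_form c w = 0 := cp; have sw : eval_form s w = 0 := sp.
set n := grad c w; set t := cross w n; have d0 : det3 w t n != 0 := chart_grad cn w0 cw.
have n0 : n != 0 := nonsingular_grad cn w0 cw.
(* The derivative of s along the tangent of c; if it vanished, the gradients would be
   proportional. *)
pose a := dot (grad s w) t.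
have a0 : a != 0.
  apply/eqP => a0.
  pose la := dot (grad s w) n / dot n n.
  have nn : dot n n != 0 by rewrite gt_eqF// dotvv_gt0.
  have nt : dot n t = 0 by rewrite /t dotC dot_cross /det3; ring.
  have gE : grad s w = la *: n.
    apply/eqP; rewrite -subr_eq0; apply/eqP; apply: dot_eq0 => x; rewrite (det3_basis x d0).
    have dB (u1 u2 y : 'rV[R]_3) l : dot (u1 - l *: u2) y = dot u1 y - l * dot u2 y.
      by rewrite !dotE !mxE; ring.
    rewrite dB !dotDr !dotZr (real_euler sf sw) (real_euler cf cw) -/a a0 nt /la.
    by rewrite /la !mulr0 !add0r; set P1 := det3 w t x / _; rewrite [_ / _ * (P1 * _)]mulrCA divfK// subrr.
  have e1 : eval_form (complexify s) (cv w) = 0 by rewrite eval_complexify sw rmorph0.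
  have e2 : eval_form (complexify c) (cv w) = 0 by rewrite eval_complexify cw rmorph0.
  have v0 : cv w != 0 by rewrite cv_eq0.
  have rk := rank_eq (etrans (grad_complexify s w) (congr1 (@cv R) gE)) (grad_complexify c w)
    (tr (cv w) v0 e1 e2).
  have : row_free (col_mx (cv (la *: n)) (cv n)) by rewrite /row_free rk.
  move/row_free_inj => rf.
  have e3 : row_mx 1%:M (- real_complex R la)%:M *m col_mx (cv (la *: n)) (cv n) = 0 *m col_mx (cv (la *: n)) (cv n).
    rewrite mul0mx mul_row_col mul1mx mul_scalar_mx.
    by apply/rowP => j; rewrite !mxE rmorphM mulNr subrr.
  have /rowP/(_ (lshift 1 ord0)) := rf _ _ _ e3.
  by rewrite row_mxEl !mxE => /eqP; rewrite oner_eq0.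
pose sg := Num.sg a; have sg2 : sg * sg = 1 by rewrite -expr2 sqr_sg a0.
have sga : 0 < sg * a by rewrite /sg -normrEsg normr_gt0.
pose dir (y : R) := sg *: t + y *: n.
pose V (z : R * R) := w + z.1 *: t + z.2 *: n.
have Vc : continuous V.
  move=> z; apply: row_continuous => j.
  apply: (contE (g := fun z : R * R => w 0 j + z.1 * t 0 j + z.2 * n 0 j)).
    by move=> y; rewrite !mxE.
  apply: contD; [apply: contD; first exact: contC|]; (apply: contM; last exact: contC).
    exact: cont_fst.
  exact: cont_snd.
have V0 : V (0, 0) = w by rewrite /V /= !scale0r !addr0.
have gc y : continuous_at (0, 0) (fun z => dot y (grad s (V z))).
  apply: (@continuous_comp _ _ _ V (fun u => dot y (grad s u))); first exact: Vc.
  by apply: dot_continuous; exact: grad_cont.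
pose M := `|dot n (grad s w)| + 1; have M0 : 0 < M by rewrite ltr_wpDl.
have n1 : \forall z \near (0, 0), 0 < sg * dot t (grad s (V z)) - sg * a / 2.
  apply: near_gt0; first by apply: contB; [apply: contM; [exact: contC|exact: gc]|exact: contC].
  by rewrite V0 dotC -/a; lra.
have n2 : \forall z \near (0, 0), 0 < M - `|dot n (grad s (V z))|.
  apply: near_gt0; last by rewrite V0 /M; lra.
  by apply: contB; [exact: contC|exact: (contT (gc n) (@norm_continuous _ _ _))].
have n3 : \forall z \near (0, 0), real_points c (pt (V z)) -> eval_form s (rep (pt (V z))) <= 0.
  have pc' : continuous_at (V (0, 0)) (@pt R) by apply: pt_continuous; rewrite V0.
  have c3 := contT (Vc (0, 0)) pc'; rewrite /continuous_at V0 pw in c3.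
  exact: c3 hn.
have n4 : \forall z \near (0, 0), V z != 0.
  have c4 := Vc (0, 0); rewrite /continuous_at V0 in c4; exact: c4 (near_neq0 w0).
have n5 : \forall z \near (0, 0), (0 < sg * dot t (grad s (V z)) - sg * a / 2 /\
    0 < M - `|dot n (grad s (V z))|) /\
    ((real_points c (pt (V z)) -> eval_form s (rep (pt (V z))) <= 0) /\ V z != 0).
  by apply: filterI; apply: filterI.
have /nbhs_ballP[r r0' hr] := n5.
have r0 : 0 < r := r0'.
(* In the directions sg t + y n with |y| <= ep, the tangential part of the derivative of s exceeds
   sg a / 2 while the normal part is at most ep M <= sg a / 4. So s increases along all of them. *)
pose ep := Num.min 1 (sg * a / (4 * M)).
have ep0 : 0 < ep by rewrite lt_min ltr01 divr_gt0// mulr_gt0.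
have ep1 : ep <= 1 by rewrite ge_min lexx.
have epM : ep * M <= sg * a / 4.
  have : ep <= sg * a / (4 * M) by rewrite ge_min lexx orbT.
  rewrite -(ler_pM2r M0) => h0; apply: le_trans h0 _.
  by rewrite le_eqVlt; apply/orP; left; apply/eqP; field; rewrite gt_eqF.
have sg1 : `|sg| = 1 by rewrite /sg normr_sg a0.
have VE x y : V (x * sg, x * y) = w + x *: dir y.
  by rewrite /V /dir scalerDr !scalerA addrA.
have inr' x y : 0 < x < r -> `|y| <= ep -> ball ((0 : R), (0 : R)) r (x * sg, x * y).
  move=> /andP[x0 xr] ye; split; rewrite /= /ball /= sub0r normrN normrM gtr0_norm//.
    by rewrite sg1 mulr1.
  by apply: le_lt_trans xr; rewrite ler_piMr ?(ltW x0)// (le_trans ye).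
have cdir y : 0 < y -> exists2 d, 0 < d & forall x, 0 < x < d -> 0 < eval_form c (w + x *: dir y) /\ eval_form c (w + x *: dir (- y)) < 0.
  move=> y0; have nt : dot n t = 0 by rewrite /t dotC dot_cross /det3; ring.
  have PE z x : (along (lineq w z) c).[x] = eval_form c (w + x *: z) by rewrite along_eval lineq_at.
  have gd z : dot n (dir z) = z * dot n n by rewrite /dir dotDr !dotZr nt mulr0 add0r.
  have dn := dotvv_gt0 n0.
  have [||d1 d10 h1] := @sign_near_root _ (along (lineq w (dir y)) c).
  - by rewrite PE scale0r addr0.
  - by rewrite along_deriv lineq_at lineq_deriv scale0r addr0 -/n gd mulr_gt0.
  have [||d2 d20 h2] := @sign_near_root _ (along (lineq w (- dir (- y))) c).
  - by rewrite PE scale0r addr0.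
  - have -> : - dir (- y) = (- sg) *: t + y *: n by rewrite /dir opprD scaleNr opprK scaleNr.
    by rewrite along_deriv lineq_at lineq_deriv scale0r addr0 -/n dotDr !dotZr nt mulr0 add0r mulr_gt0.
  exists (Num.min d1 d2) => [|x]; first by rewrite lt_min d10.
  rewrite lt_min => /and3P[x0 xd1 xd2].
  have [|p1 _] := h1 x; first by rewrite x0.
  have [|_ p2] := h2 x; first by rewrite x0.
  split; first by rewrite -PE.
  by move: p2; rewrite PE scaleNr scalerN opprK.
have [d d00 hd] := cdir ep ep0.
pose x := Num.min d r / 2.
have m0 : 0 < Num.min d r by rewrite lt_min d00.
have m1 : Num.min d r <= d by rewrite ge_min lexx.
have m2 : Num.min d r <= r by rewrite ge_min lexx orbT.
have x0 : 0 < x by rewrite /x; lra.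
have xd : 0 < x < d by rewrite x0 /x /=; lra.
have xr : 0 < x < r by rewrite x0 /x /=; lra.
have [p1 p2] := hd x xd.
have ee : - ep < ep by lra.
(* At a fixed small distance c changes sign between the two extreme directions, so c has a zero in
   one of them, and there s is positive. *)
have [||y /andP[y1 y2] cy] := @ivt_sign R (fun y => eval_form c (w + x *: dir y)) (- ep) ep ee.
- move=> y; have c1 : continuous_at y (fun y => w + x *: dir y).
    have -> : (fun y => w + x *: dir y) = (fun y => (w + (x * sg) *: t) + y *: (x *: n)).
      by apply/funext => y'; rewrite -VE /V /= scalerA [y' * x]mulrC.
    exact: (@cont_line R).
  have c2 : continuous_at (w + x *: dir y) (eval_form c) by exact: eval_form_continuous.
  exact: (contT c1 c2).
- by rewrite nmulr_rlt0.
have ye : `|y| <= ep by rewrite ler_norml; apply/andP; split; exact: ltW.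
have [_ [hs Vn]] := hr _ (inr' x y xr ye).
have [z /andP[z0 zx] ez] := poly_mvt (along (lineq w (dir y)) s) x0.
have zr : 0 < z < r by rewrite z0 (lt_trans zx)//; case/andP: xr.
have [[g1 g2] _] := hr _ (inr' z y zr ye).
have spos : 0 < eval_form s (w + x *: dir y).
  move: ez; rewrite !along_eval !lineq_at scale0r addr0 sw !subr0 => ->.
  apply: mulr_gt0 => //; rewrite along_deriv lineq_at lineq_deriv -VE dotC.
  have -> : dot (dir y) (grad s (V (z * sg, z * y))) =
      sg * dot t (grad s (V (z * sg, z * y))) + y * dot n (grad s (V (z * sg, z * y))).
    by rewrite /dir; move: (grad s _) => g; rewrite !dotE !mxE; ring.
  move: g1 g2; set T1 := dot t _; set N1 := dot n _ => g1 g2.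
  have : `|y * N1| <= ep * M by rewrite normrM; apply: ler_pM => //; lra.
  by rewrite ler_norml => /andP[? ?]; lra.
rewrite VE in hs Vn; have [l l0 el] := rep_pt Vn.
have : eval_form s (rep (pt (w + x *: dir y))) <= 0.
  by apply: hs; apply/(real_points_pt cf Vn).
rewrite el (eval_form_scale _ _ sf) leNgt => /negP; apply; apply: mulr_gt0 => //.
by rewrite (exprM l 2 2) exprn_gt0// lt_neqAle eq_sym sqrf_eq0 l0 sqr_ge0.
Qed.

Hypothesis tr : transversal_curves s c.
Hypothesis sD : forall q, D q -> eval_form s (rep q) < 0.

Lemma closureD : closure D `<=` D `|` O.
Proof.
rewrite -hD (@closure_image R (@unit_disk R) _ h 0 0) //; first last.
- move=> z e; rewrite /unit_disk /open_unit_disk /= => hz s0 s1.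
  have -> : (z.1 + e * (0 - z.1)) ^+ 2 + (z.2 + e * (0 - z.2)) ^+ 2 = (1 - e) ^+ 2 * (z.1 ^+ 2 + z.2 ^+ 2) by ring.
  have s2 : (1 - e) ^+ 2 < 1 by nra.
  by apply: le_lt_trans s2; rewrite ler_piMr// sqr_ge0.
- exact: open_disk_sub.
- exact: compact_disk.
move=> _ [z z1 <-]; case: (ltrP (z.1 ^+ 2 + z.2 ^+ 2) 1) => h1; first by left; exists z.
by right; rewrite -hO; exists z => //; apply: le_anti; rewrite h1 andbT.
Qed.

(** A side lies in the closed disk. If an inner point of it were on [O], then s would be nonpositive
    on c near this point, against [not_tangent]. *)
Lemma side_carc P (b : R -> RP2 R) : pc P -> side O B P b -> carc D c b /\ ins b `<=` B.
Proof.
move=> pP [[bc bB bi] k0 k1 cl].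
have aC : arc (real_points c) b by split=> // t t01; exact/branchesC/bB.
have bDO (t : R) : 0 <= t <= 1 -> (D `|` O) (b t).
  move=> t01; apply: closureD; apply: closure_subset (cl t t01) => q /(piece_sub pP)[]//.
have cO p : corner O P p -> O p.
  by move=> [al [[_ aO _] <- _]]; apply: aO; rewrite lexx ler01.
have i1 : (0 : R) <= 1 <= (1 : R) by rewrite ler01 lexx.
split; first split=> //.
- move=> _ [t t01 <-]; have tt : 0 <= t <= 1 by case/andP: t01 => ? ?; rewrite !ltW.
  have [//|Ot] := bDO t tt; exfalso; apply: (@not_tangent (b t)) => //.
  + exact/branchesC/bB.
  + exact: OS.
  + apply: filterS (arc_open cn aC t01) => q hq /hq [u /andP[u0 u1] <-].
    have [|/sD/ltW//|/OS ->//] := bDO u; by rewrite !ltW.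
- by move=> /(disjOD (cO _ k0)).
- by move=> /(disjOD (cO _ k1)).
- by move=> _ [t /andP[t0 t1] <-]; apply: bB; rewrite !ltW.
Qed.
Lemma clopen_sub (G W : set (RP2 R)) x : connected G -> open W -> G x -> W x ->
  (forall q, G q -> closure W q -> W q) -> G `<=` W.
Proof.
move=> cG oW Gx Wx h1; suff <- : G `&` W = G by move=> q [].
apply: cG; first by exists x.
- by exists W.
- exists (closure W); first exact: closed_closure.
  by apply/seteqP; split=> q [Gq Wq]; split=> //; [exact: subset_closure|exact: h1].
Qed.

Lemma connectedD : connected D.
Proof.
pose L (w : R * R) t := (t * w.1, t * w.2).
have LT w t : @open_unit_disk R w -> 0 <= t <= 1 -> @open_unit_disk R (L w t).
  rewrite /open_unit_disk /= => w1 /andP[t0 t1].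
  have -> : (t * w.1) ^+ 2 + (t * w.2) ^+ 2 = t ^+ 2 * (w.1 ^+ 2 + w.2 ^+ 2) by ring.
  by apply: le_lt_trans w1; rewrite ler_piMl ?addr_ge0 ?sqr_ge0//; nra.
have -> : D = \bigcup_(w in @open_unit_disk R) ((fun t => h (L w (clam 0 1 t))) @` `[0, 1]).
  rewrite -hD; apply/seteqP; split=> q.
    move=> [w Tw <-]; exists w => //; exists 1; first by rewrite /= in_itv /= ler01 lexx.
    by rewrite clam_id ?ler01 ?lexx// /L !mul1r; case: (w).
  by move=> [w Tw [t _ <-]]; eexists; [apply: (LT w _ Tw); exact: clamP ler01|].
apply: bigcup_connected.
  exists (h (0, 0)) => w _; exists 0; first by rewrite /= in_itv /= ler01 lexx.
  by rewrite clam_id ?ler01 ?lexx// /L !mul0r.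
move=> w Tw; apply: seg_connected; apply: comp_within hc _ _ => t.
  by apply: cont_pair; (apply: contM; [exact: clam_cont|exact: contC]).
by apply: open_disk_sub; exact: (LT _ _ Tw (clamP _ ler01)).
Qed.

Lemma carc_closed b q : carc D c b -> closure (ins b) q -> D q -> ins b q.
Proof.
move=> [[bc _ _] _ n0 n1] cq Dq; apply: ins_sub; last by move=> e; apply: n1; rewrite -e.
- apply: (arc_closed bc); apply: closure_subset cq => _ [t /andP[t0 t1] <-].
  by exists t => //; rewrite /= in_itv /= !ltW.
- by move=> e; apply: n0; rewrite -e.
Qed.

Lemma closure_union (A1 A2 : set (RP2 R)) q : closure (A1 `|` A2) q -> closure A1 q \/ closure A2 q.
Proof.
move=> h0; apply: (closedU (@closed_closure _ A1) (@closed_closure _ A2)).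
by apply: closure_subset h0 => x [|] hx; [left|right]; exact: subset_closure.
Qed.

Lemma side_ends P b : side O B P b -> O (b 0) /\ O (b 1).
Proof.
have cO p : corner O P p -> O p.
  by move=> [al [[_ aO _] <- _]]; apply: aO; rewrite lexx ler01.
by move=> [_ /cO k0 /cO k1 _].
Qed.

Lemma piece_open P : pc P -> open P.
Proof. by move=> [x _ <-]; exact: (component_open _ openDB). Qed.

(** * The walk through the pieces of the snake *)

Section Walk.
Variables (Gam E0 E1 : set (RP2 R)) (e1 e2 : RP2 R) (n0 : nat) (Q : 'I_n0 -> set (RP2 R)).
Hypothesis n2k : (n0.+1 = 2 * k)%N.
Hypothesis Qi : injective Q.
Hypothesis Qp : forall j, pc (Q j) /\ quadrangle O B (Q j).
Hypothesis Pp : forall P, pc P -> quadrangle O B P \/ digon O B P.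
Hypotheses (pE0 : pc E0) (dE0 : digon O B E0) (pE1 : pc E1) (dE1 : digon O B E1).
Hypothesis E01 : E0 <> E1.
Hypotheses (G1 : Gam e1) (G2 : Gam e2) (E1e : E0 e1) (E2e : E1 e2).
Hypotheses (GD : Gam `<=` D) (Gc : connected Gam).

Definition crossed n (be : nat -> R -> RP2 R) :=
  (forall j, (j < n)%N -> [/\ carc D c (be j), O (be j 0), O (be j 1) &
     exists q, ins (be j) q /\ Gam q]) /\
  (forall i j q, (i < n)%N -> (j < n)%N -> ins (be i) q -> ins (be j) q -> i = j).

(* W is the union of the pieces Pl 0, ..., Pl n and of the arcs be 0, ...,
   be n.-1 between them; it can only be left through ka. *)
Definition walk n (W : set (RP2 R)) be (Pl : nat -> set (RP2 R)) ka :=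
  [/\ crossed n be /\ (forall j, (j < n)%N -> ins (be j) `<=` W),
      [/\ open W, W `<=` D, W e1 & ~ W e2],
      [/\ carc D c ka, O (ka 0), O (ka 1), ins ka `<=` B & forall q, W q -> ins ka q -> False],
      (forall q, closure W q -> D q -> W q \/ ins ka q) &
      (forall q, W q -> B q -> exists2 j, (j < n)%N & ins (be j) q) /\
      (forall P, pc P -> (P `<=` W /\ exists2 j, (j <= n)%N & P = Pl j) \/
                         (forall q, P q -> ~ W q))].

Lemma pieceB P q : pc P -> P q -> ~ B q.
Proof. by move=> /piece_sub hP /hP[]. Qed.

(** There are 2k - 1 quadrangles and two digons, hence 2k + 1 different pieces among n + 1 names. *)
Lemma count_pieces n Pl : (forall P, pc P -> exists2 j, (j <= n)%N & P = Pl j) -> (2 * k <= n)%N.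
Proof.
move=> hn; pose T := ('I_n0 + bool)%type.
pose pp (x : T) := match x with inl j => Q j | inr b => if b then E0 else E1 end.
have ppc x : pc (pp x) by case: x => [j|[]] //=; exact: (Qp j).1.
have hx x : exists j : 'I_n.+1, pp x = Pl j.
  by have [j jn e] := hn _ (ppc x); exists (Ordinal (jn : (j < n.+1)%N)).
have [f hf] := choice hx.
have fi : injective f.
  move=> x y e; have : pp x = pp y by rewrite !hf e.
  case: x y {e} => [j|a] [j'|b] /=.
  - by move=> /Qi ->.
  - by case: b => e; case: (@quad_not_digon (Q j) (Qp j).1 (Qp j).2); rewrite e.
  - by case: a => e; case: (@quad_not_digon (Q j') (Qp j').1 (Qp j').2); rewrite -e.
  - by case: a; case: b => // e; case: E01; rewrite e.
have := leq_card f fi; rewrite card_sum card_bool !card_ord; move: n2k; clear; lia.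
Qed.

(** [Gam] is connected and leads out of [W], so it crosses [ka], the only exit. Beyond [ka] lies a
    piece [Q0], which is added. A quadrangle offers its other side as the new exit; if there is
    none, [W] is all of [D] and every piece has a name. *)
Lemma walk_step n W be Pl ka : walk n W be Pl ka ->
  (exists W' be' Pl' ka', walk n.+1 W' be' Pl' ka') \/
  (exists2 be', (2 * k <= n.+1)%N & crossed n.+1 be').
Proof.
move=> [[[h1 h2] h3] [oW WD W1 W2] [ck ck0 ck1 kB kW] hcl [hB hP]].
have De1 : D e1 := GD G1.
have kD q : ins ka q -> D q by case: ck => _ hk _ _; exact: hk.
have [x0 [Gx cx nx]] : exists x0, [/\ Gam x0, closure W x0 & ~ W x0].
  apply: contrapT => hn; apply: W2; apply: (clopen_sub Gc oW G1 W1 _ G2) => q Gq cq.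
  by apply: contrapT => nq; apply: hn; exists q.
have Dx : D x0 := GD Gx.
have kx : ins ka x0 by case: (hcl _ cx Dx).
have [P0 [Q0 [pP pQ nr ad [q0 [Wq0 Pq0]]]]] : exists P0 Q0, [/\ pc P0, pc Q0,
    forall x, ins ka x -> nbhs x (P0 `|` Q0 `|` ins ka),
    forall x, ins ka x -> adh P0 x /\ adh Q0 x & exists q, W q /\ P0 q].
  have [P [Q' [p1 p2 nr ad]]] := arc_adj cn openD branchesC ck kB kx.
  have [q [Wq [[Pq|Qq]|kq]]] := cx _ (nr _ kx).
  - by exists P, Q'; split=> //; exists q.
  - exists Q', P; split=> //; last by exists q.
      by move=> x /nr; rewrite [Q' `|` P]setUC.
    by move=> x /ad[? ?].
  - by case: (kW q).
have PW : P0 `<=` W by case: (hP _ pP) => [[]//|/(_ _ Pq0)].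
(* If both pieces along [ka] were in [W], adding [ka] would give a set open and closed in the
   connected [D], which would contain the last digon. *)
have [QW|Qn] : Q0 `<=` W \/ (forall q, Q0 q -> ~ W q).
  by case: (hP _ pQ) => [[]|]; [left|right].
  have oV : open (W `|` ins ka).
    rewrite openE => x [Wx|kx'].
      by apply: (filterS (P := W)) => [y|]; [left|exact: open_nbhs_nbhs].
    by apply: filterS (nr _ kx') => y [[/PW|/QW]|]; [left|left|right].
  exfalso; have : (W `|` ins ka) e2.
    apply: (clopen_sub connectedD oV De1 (or_introl W1) _ (GD G2)) => q Dq.
    by move=> /closure_union[/hcl hq|/(carc_closed ck) hq]; [exact: hq|right; exact: hq].
  by case=> [//|/kB]; exact: (pieceB pE1 E2e).
have oQ : open Q0 by exact: (piece_open pQ).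
pose W' := W `|` ins ka `|` Q0.
have oW' : open W'.
  rewrite openE => x [[Wx|kx']|Qx].
  - by apply: (filterS (P := W)) => [y Wy|]; [left; left|exact: open_nbhs_nbhs].
  - by apply: filterS (nr _ kx') => y [[/PW Wy|Qy]|ky]; [left; left|right|left; right].
  - by apply: (filterS (P := Q0)) => [y Qy|]; [right|exact: open_nbhs_nbhs].
have WW : W `<=` W' by move=> q; left; left.
pose be' j := if j == n then ka else be j.
have lt j : (j < n.+1)%N -> j <> n -> (j < n)%N by rewrite ltnS leq_eqVlt => /orP[/eqP|].
have hc' : crossed n.+1 be'.
  split.
  - move=> j jn; rewrite /be'; case: eqP => [_|/(lt _ jn)/h1//].
    by split=> //; exists x0.
  - move=> i j q ijn jn; rewrite /be'; case: eqP => [->|/(lt _ ijn) i1]; case: eqP => [->|/(lt _ jn) j1] // a b.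
    + by case: (kW q) => //; exact: (h3 j).
    + by case: (kW q) => //; exact: (h3 i).
    + exact: (h2 i j q).
have h3' j : (j < n.+1)%N -> ins (be' j) `<=` W'.
  move=> jn; rewrite /be'; case: eqP => [_ q kq|/(lt _ jn) j1 q /(h3 _ j1)]; first by left; right.
  exact: WW.
have cQ0 : closure Q0 x0 := (ad _ kx).2.
have nQ0x : ~ Q0 x0 by move=> Qx; exact: (pieceB pQ Qx (kB _ kx)).
have clW' q : closure W' q -> D q -> W' q \/ closure Q0 q.
  move=> /closure_union[/closure_union[cq|cq]|cq] Dq; last by right.
    by case: (hcl _ cq Dq) => hq; left; left; [left|right].
  by left; left; right; exact: (carc_closed ck).
pose Pl' j := if j == n.+1 then Q0 else Pl j.
have hP' P : pc P -> (P `<=` W' /\ exists2 j, (j <= n.+1)%N & P = Pl' j) \/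
    (forall q, P q -> ~ W' q).
  move=> pP'; have [e|ne] := pselect (P = Q0).
    by left; split; [rewrite e => q; right|exists n.+1 => //; rewrite /Pl' eqxx].
  case: (hP _ pP') => [[PW' [j jn ej]]|nW].
    left; split; first by move=> q /PW'/WW.
    by exists j; [exact: leqW|rewrite /Pl' ltn_eqF// ltnS].
  right=> q Pq [[/(nW _ Pq)//|/kB/(pieceB pP' Pq)//]|Qq].
  by apply: ne; exact: (component_eq pP' pQ Pq Qq).
(* Without a new exit [W'] is open and closed in [D], so it contains all the 2k + 1 pieces and the
   number of crossed arcs is at least 2k. *)
have fin' : (forall q, closure Q0 q -> D q -> W' q) ->
    exists2 be', (2 * k <= n.+1)%N & crossed n.+1 be'.
  move=> hq; have DW : D `<=` W'.
    move=> q Dq; apply: (clopen_sub connectedD oW' De1 (WW _ W1) _ Dq) => {Dq}q Dq cq.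
    by case: (clW' _ cq Dq) => // /hq; apply.
  exists be' => //; apply: (@count_pieces n.+1 Pl') => P pP'; case: (hP' _ pP') => [[_ //]|hn].
  have [q Pq] : exists q, P q by have [y Dy <-] := pP'; exists y; exact: connected_component_refl.
  by case: (hn _ Pq); apply: DW; have [] := piece_sub pP' Pq.
case: (Pp pQ) => [qd|dg]; last first.
  right; apply: fin' => q cq Dq.
  have [b [al [sd cl _ _ _]]] := digon_data dg.
  have [cb bB] := side_carc pQ sd.
  have bx : ins b x0 by case: (cl _ cQ0) => [[/nQ0x//|/disjOD/(_ Dx)//]|].
  have ee := arcs_eq cn ck cb kx bx.
  case: (cl _ cq) => [[Qq|/disjOD/(_ Dq)//]|]; first by right.
  by rewrite -ee => ?; left; right.
(* One side of the quadrangle contains [x0], so it is [ka] by [arcs_eq]; [b] is the other side. *)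
have [b [sb hb]] : exists b, side O B Q0 b /\
    forall q, closure Q0 q -> D q -> W' q \/ ins b q.
  have [b0 [b1 [s0 s1 _ cl]]] := quad_data qd.
  have hh b b' : side O B Q0 b ->
      (forall q, closure Q0 q -> D q -> Q0 q \/ ins b q \/ ins b' q) -> ins b x0 ->
      forall q, closure Q0 q -> D q -> W' q \/ ins b' q.
    move=> sb hq bx q cq Dq; have ee := arcs_eq cn ck (side_carc pQ sb).1 kx bx.
    case: (hq _ cq Dq) => [Qq|[|]]; [by left; right| |by right].
    by rewrite -ee => ?; left; left; right.
  have cl' q : closure Q0 q -> D q -> Q0 q \/ ins b0 q \/ ins b1 q.
    by move=> /cl[[Qq|/disjOD hq]|[?|?]] Dq; [left|case: (hq Dq)|right; left|right; right].
  case: (cl' _ cQ0 Dx) => [/nQ0x//|[bx|bx]].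
    by exists b1; split=> //; exact: (hh b0 b1 s0 cl' bx).
  exists b0; split=> //; apply: (hh b1 b0 s1 _ bx) => q cq Dq.
  by case: (cl' q cq Dq) => [|[|]] ?; [left|right; right|right; left].
have [cb bB] := side_carc pQ sb; have [ob0 ob1] := side_ends sb.
(* If the other side already meets [W'], it is one of the arcs crossed before, and the walk has
   closed up. *)
have [[q [Wq bq]]|hout] := pselect (exists q, W' q /\ ins b q).
  right; apply: fin' => y cy Dy; case: (hb _ cy Dy) => // byy.
  have [[Wq'|kq]|Qq] := Wq.
  - have [j jn jq] := hB _ Wq' (bB _ bq); have [cj _ _ _] := h1 _ jn.
    by apply: WW; apply: (h3 _ jn); rewrite (arcs_eq cn cj cb jq bq).
  - by left; right; rewrite (arcs_eq cn ck cb kq bq).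
  - by case: (pieceB pQ Qq (bB _ bq)).
left; exists W', be', Pl', b; split=> //.
- split=> //; last 1 first.
  + move=> [[//|/kB]|Qe]; first exact: (pieceB pE1 E2e).
    by apply: (@quad_not_digon Q0 pQ qd); rewrite (component_eq pQ pE1 Qe E2e).
  + by move=> q [[/WD//|/kD//]|/(piece_sub pQ)[]].
  + exact: WW.
- by split=> // q Wq bq; apply: hout; exists q.
- by move=> q cq Dq; case: (clW' _ cq Dq) => [|/hb]; [left|apply].
- split=> // q [[Wq|kq]|Qq] Bq.
  + have [j jn jq] := hB _ Wq Bq; exists j; first exact: ltnW.
    by rewrite /be' ltn_eqF.
  + by exists n => //; rewrite /be' eqxx.
  + by case: (pieceB pQ Qq).
Qed.

Lemma snake_arcs : exists be, crossed (2 * k) be.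
Proof.
have base : exists W be Pl ka, walk 0 W be Pl ka.
  have [b [al [sd cl _ _ _]]] := digon_data dE0.
  have [cb bB] := side_carc pE0 sd; have [ob0 ob1] := side_ends sd.
  exists E0, (fun _ => b), (fun _ => E0), b; split=> //.
  - split=> //; first exact: (piece_open pE0).
      by move=> q /(piece_sub pE0)[].
    by move=> Ee; apply: E01; exact: (component_eq pE0 pE1 Ee E2e).
  - by split=> // q Eq bq; exact: (pieceB pE0 Eq (bB _ bq)).
  - by move=> q /cl[[?|/disjOD hq]|?] Dq; [left|case: (hq Dq)|right].
  - split=> [q Eq /(pieceB pE0 Eq)//|P pP].
    have [->|ne] := pselect (P = E0); first by left; split=> //; exists 0%N.
    by right=> q Pq Eq; apply: ne; exact: (component_eq pP pE0 Pq Eq).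
have ind n : (exists W be Pl ka, walk n W be Pl ka) \/ exists m be, (2 * k <= m)%N /\ crossed m be.
  elim: n => [|n [[W [be [Pl [ka hw]]]]|hd]]; [by left| |by right].
  by case: (walk_step hw) => [h0|[be' h0 h1']]; [left|right; exists n.+1, be'].
case: (ind (2 * k)%N) => [[W [be [_ [_ [[h0 _] _ _ _ _]]]]]|[m [be [hm [h0 h1]]]]].
  by exists be.
exists be; split=> [j jk|i j q ik jk]; first by apply: h0; exact: leq_trans hm.
by apply: h1; exact: leq_trans hm.
Qed.

End Walk.

(** Seven alternating signs require six roots, too many for degree four. Subtracting the least of
    the three positive values makes the weak inequalities strict, at the price of weak gaps, which
    [gaps_size] accepts. *)
Lemma three_gaps (P : {poly R}) y1 z1 y2 z2 y3 z3 y4 : y1 < z1 -> z1 < y2 -> y2 < z2 ->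
  z2 < y3 -> y3 < z3 -> z3 < y4 -> P.[y1] <= 0 -> P.[y2] <= 0 -> P.[y3] <= 0 -> P.[y4] <= 0 ->
  0 < P.[z1] -> 0 < P.[z2] -> 0 < P.[z3] -> (size P <= 5)%N -> False.
Proof.
clear; move=> l1 l2 l3 l4 l5 l6 n1 n2 n3 n4 p1 p2 p3 sz.
pose e := Num.min (Num.min P.[z1] P.[z2]) P.[z3].
have e0 : 0 < e by rewrite !lt_min p1 p2 p3.
have ee1 : e <= P.[z1] by rewrite !ge_min lexx.
have ee2 : e <= P.[z2] by rewrite !ge_min lexx orbT.
have ee3 : e <= P.[z3] by rewrite !ge_min lexx orbT.
pose p' := P + (- e)%:P.
have pE u : p'.[u] = P.[u] - e by rewrite hornerD hornerC.
have sz' : (size p' <= 5)%N.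
  by rewrite (leq_trans (size_polyD _ _))// geq_max sz size_polyC; case: eqP.
have q1 : 0 <= p'.[z1] by rewrite pE subr_ge0.
have q2 : 0 <= p'.[z2] by rewrite pE subr_ge0.
have q3 : 0 <= p'.[z3] by rewrite pE subr_ge0.
have m1 : p'.[y1] < 0 by rewrite pE subr_lt0 (le_lt_trans n1).
have m2 : p'.[y2] < 0 by rewrite pE subr_lt0 (le_lt_trans n2).
have m3 : p'.[y3] < 0 by rewrite pE subr_lt0 (le_lt_trans n3).
have m4 : p'.[y4] < 0 by rewrite pE subr_lt0 (le_lt_trans n4).
have l12 := lt_trans l1 l2; have l23 := lt_trans l3 l4; have l34 := lt_trans l5 l6.
have l13 := lt_trans l12 l23; have l24 := lt_trans l23 l34; have l14 := lt_trans l12 l24.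
move: p' pE q1 q2 q3 m1 m2 m3 m4 sz' => p' _ q1 q2 q3 m1 m2 m3 m4 sz'.
have h1 : uniq [:: y1; y2; y3; y4].
  by rewrite /= !inE !negb_or !(lt_eqF l12, lt_eqF l13, lt_eqF l14, lt_eqF l23, lt_eqF l24, lt_eqF l34).
have h2 : {in [:: y1; y2; y3; y4], forall y, p'.[y] < 0}.
  by move=> y; rewrite !inE => /or4P[] /eqP ->.
have h3 : {in [:: y1; y2; y3; y4] &, forall y y', y < y' -> exists2 z, y < z < y' & 0 <= p'.[z]}.
  have w1 : y1 < z1 < y2 by rewrite l1.
  have w2 : y2 < z2 < y3 by rewrite l3.
  have w3 : y3 < z3 < y4 by rewrite l5.
  have w4 : y1 < z1 < y3 by rewrite l1 (lt_trans l2).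
  have w5 : y1 < z1 < y4 by rewrite l1 (lt_trans l2).
  have w6 : y2 < z2 < y4 by rewrite l3 (lt_trans l4).
  move=> y y'; rewrite !inE => /or4P[] /eqP -> /or4P[] /eqP -> lt;
    first [by move: lt; rewrite ltxx|by exists z1|by exists z2|by exists z3
          |by move: lt; rewrite (lt_gtF l12)|by move: lt; rewrite (lt_gtF l13)
          |by move: lt; rewrite (lt_gtF l14)|by move: lt; rewrite (lt_gtF l23)
          |by move: lt; rewrite (lt_gtF l24)|by move: lt; rewrite (lt_gtF l34)].
have := gaps_size h1 h2 h3.
by rewrite ltnNge (leq_trans sz').
Qed.

(** * The disk of the snake is in the negative region of its oval *)

Section Position.
Variables (v : 'I_4 -> RP2 R -> R) (A : 'I_4 -> set (RP2 R)) (a0 : 'I_4).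
Hypothesis rg : regions s v.
Hypothesis vA : forall i p, v i p = 0 <-> A i p.
Hypothesis acc : forall i a U, A i a -> nbhs a U ->
  (exists2 p, U p & v i p < 0) /\ (exists2 p, U p & 0 < v i p).
Hypothesis neg : forall i, exists p, v i p < 0.
Hypothesis OA : O = A a0.

Lemma exit_point (g : R -> RP2 R) : continuous g -> D (g 0) -> ~ D (g 1) ->
  exists2 t : R, 0 < t <= 1 & O (g t).
Proof.
move=> gc D0 D1; apply: contrapT => hn; apply: D1.
have in01 (t : R) : 0 <= t <= 1 -> (g @` `[0, 1]) (g t) by exists t => //; rewrite /= in_itv.
have i0 : (0 : R) <= 0 <= (1 : R) by rewrite lexx ler01.
have i1 : (0 : R) <= 1 <= (1 : R) by rewrite ler01 lexx.
apply: (clopen_sub (seg_connected gc) openD (in01 _ i0) D0 _ (in01 _ i1)).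
move=> _ [t + <-] /closureD[//|Ot]; rewrite /= in_itv /= => /andP[t0 t1].
case: hn; exists t => //; rewrite t1 andbT lt_neqAle t0 andbT; apply/eqP => t00.
by move: Ot; rewrite -t00 => /disjOD; apply.
Qed.

Section Outside.
Hypothesis vD : forall q, D q -> 0 < v a0 q.

Lemma ord4P (P : 'I_4 -> Prop) : P k0 -> P k1 -> P k2 -> P k3 -> forall i, P i.
Proof.
move=> p0 p1 p2 p3 [[|[|[|[|//]]]] hj].
- by rewrite (_ : Ordinal hj = k0)//; exact: val_inj.
- by rewrite (_ : Ordinal hj = k1)//; exact: val_inj.
- by rewrite (_ : Ordinal hj = k2)//; exact: val_inj.
- by rewrite (_ : Ordinal hj = k3)//; exact: val_inj.
Qed.

(** Near a point of [O] the three other functions are positive by separation, and inside [D] the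
    function of [O] is positive by assumption. *)
Lemma D_pos : exists2 q, D q & forall i, 0 < v i q.
Proof.
have [_ vc sep _] := rg.
pose a := h (1, 0).
have Oa : O a by rewrite -hO; exists (1, 0) => //; rewrite /unit_circle /= expr1n expr0n addr0.
have va : v a0 a = 0 by apply/vA; rewrite -OA.
have nj j : \forall p \near a, (j != a0 -> 0 < v j p).
  have [->|ja] := eqVneq j a0; first last.
    have : \forall p \near a, 0 < v j p.
      by apply: near_gt0; [exact: vc|apply: (sep a0); rewrite ?va// eq_sym].
    by apply: filterS => p hp _.
  have : \forall p \near a, 0 < (1 : R) by apply: near_gt0; [exact: contC|exact: ltr01].
  by apply: filterS => p _.
have nn : \forall p \near a, ((k0 != a0 -> 0 < v k0 p) /\ (k1 != a0 -> 0 < v k1 p)) /\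
    ((k2 != a0 -> 0 < v k2 p) /\ (k3 != a0 -> 0 < v k3 p)).
  by apply: filterI; apply: filterI; exact: nj.
have gc : continuous (fun t : R => h (clam 0 1 t, 0)).
  apply: comp_within hc _ _ => t.
    by apply: cont_pair; [exact: clam_cont|exact: contC].
  have /andP[l0 l1] := clamP t (@ler01 R).
  by rewrite /unit_disk /= expr0n addr0 expr2; nra.
have g1 : h (clam 0 1 1, 0) = a by rewrite clam_id ?ler01 ?lexx.
have := gc 1; rewrite /continuous_at g1 => gc1.
have /nbhs_ballP[r r0' hr] := gc1 _ nn; have r0 : 0 < r := r0'.
pose d := Num.min r 1 / 2.
have m0 : 0 < Num.min r 1 by rewrite lt_min r0 ltr01.
have m1 : Num.min r 1 <= r by rewrite ge_min lexx.
have m2 : Num.min r 1 <= 1 by rewrite ge_min lexx orbT.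
have d0 : 0 < d by rewrite /d; lra.
have d1 : d < r by rewrite /d; lra.
have d2 : d < 1 by rewrite /d; lra.
have c1 : clam 0 1 (1 - d) = 1 - d by rewrite clam_id//; apply/andP; split; lra.
have [|[q0 q1] [q2 q3]] := hr (1 - d).
  by rewrite /ball /= opprB addrC subrK gtr0_norm.
exists (h (clam 0 1 (1 - d), 0)).
  rewrite -hD; eexists; last reflexivity.
  by rewrite c1 /open_unit_disk /= expr0n addr0 expr2; nra.
have Dq : D (h (clam 0 1 (1 - d), 0)).
  rewrite -hD; eexists; last reflexivity.
  by rewrite c1 /open_unit_disk /= expr0n addr0 expr2; nra.
move=> j; have [->|ja] := eqVneq j a0; first exact: vD.
by move: j ja; apply: ord4P.
Qed.

(** Otherwise take the line through p and a point q of [D] with s > 0. It leaves [D] through [O] on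
    both sides of q, and s is positive between each of these zeros and p: the pattern of
    [three_gaps], with p near both ends. *)
Lemma far_in_D j p : j != a0 -> v j p < 0 -> D p.
Proof.
move=> ja vp; apply: contrapT => nD.
have [sf vc sep _] := rg; have [q Dq qpos] := D_pos.
have wq0 := rep_neq0 q; have wp0 := rep_neq0 p.
set wq := rep q in wq0; set wp := rep p in wp0.
have pq : pt wq = q by exact: pt_rep.
have pp : pt wp = p by exact: pt_rep.
have ind : indep wq wp by apply: indep_pt => //; rewrite pq pp => e; apply: nD; rewrite -e.
pose g u := pt (wq + u *: wp).
have gc : continuous g.
  move=> u; apply: (contT (@cont_line R wq wp u)); exact: pt_continuous (indep_neq0 u ind).
have nOp x : v j x < 0 -> ~ O x.
  move=> vx; rewrite OA => /vA v0; have : 0 < v j x by apply: (sep a0); rewrite 1?eq_sym// v0.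
  by move=> /(lt_trans vx); rewrite ltxx.
have nn : nbhs p (~` closure D `&` [set x | v j x < 0]).
  have nv : \forall x \near p, v j x < 0 by apply: near_lt0 => //; exact: vc.
  apply: filterI; last exact: nv.
  apply: open_nbhs_nbhs; split; first exact: closed_openC (@closed_closure _ D).
  by move=> /closureD[//|]; exact: nOp.
have G0 : 0 *: wq + wp = wp by rewrite scale0r add0r.
have [||M M0 hM] := infty_near (U := ~` closure D `&` [set x | v j x < 0]) (@line_infty R wq wp).
- by rewrite G0.
- by rewrite G0 pp.
have hM' u : M <= `|u| -> ~ D (g u) /\ v j (g u) < 0.
  move=> Mu; have u0 : u != 0 by rewrite -normr_gt0; exact: lt_le_trans Mu.
  rewrite /g line_pt_infty//; last exact: indep_neq0.
  by have [n1 n2] := hM u Mu; split=> // /subset_closure.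
have ex sg : `|sg| = 1 -> exists y : R, 0 < y <= M /\ O (g (sg * y)).
  move=> sg1; have [|||t /andP[t0 t1] Ot] := @exit_point (fun t => g (sg * (M * t))).
  - move=> t; apply: (contT (h := fun t => sg * (M * t))); last exact: gc.
    by apply: contM; [exact: contC|apply: contM; [exact: contC|move=> U hU; exact: hU]].
  - by rewrite !mulr0 /g scale0r addr0 pq.
  - by apply: (hM' _ _).1; rewrite normrM sg1 mul1r mulr1 gtr0_norm.
  by exists (M * t); split=> //; rewrite mulr_gt0//= ler_piMr// ltW.
have [|y2 [/andP[y20 y2M] O2]] := ex 1; first by rewrite normr1.
have [|y1 [/andP[y10 y1M] O1]] := ex (-1); first by rewrite normrN1.
rewrite mul1r in O2; rewrite mulN1r in O1.
have vO x : O x -> v a0 x <= 0 by rewrite OA => /vA ->.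
have [_ vR] : ~ D (g (2 * M)) /\ v j (g (2 * M)) < 0 by apply: hM'; rewrite ger0_norm; lra.
have [_ vL] : ~ D (g (- (2 * M))) /\ v j (g (- (2 * M))) < 0 by apply: hM'; rewrite normrN ger0_norm; lra.
pose P := along (lineq wq wp) s.
have PE u : P.[u] = eval_form s (wq + u *: wp) by rewrite along_eval lineq_at.
have Ppos z : (forall i, 0 < v i (g z)) -> 0 < P.[z].
  by move=> hz; rewrite PE; apply: (reg_pos rg) => //; exact: indep_neq0.
have [z1 /andP[za zb] /Ppos p1] : exists2 z, - (2 * M) < z < - y1 & forall i, 0 < v i (g z).
  by apply: (sep_pos rg gc _ ja (ltW vL) (vO _ O1)); lra.
have [z2 /andP[zc zd] /Ppos p2] : exists2 z, y2 < z < 2 * M & forall i, 0 < v i (g z).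
  by apply: (sep_pos rg gc _ _ (vO _ O2) (ltW vR)); [lra|rewrite eq_sym].
have p3 : 0 < P.[0] by apply: Ppos => i; rewrite /g scale0r addr0 pq.
have sO x w : O (pt w) -> w != 0 -> x = w -> eval_form s w = 0.
  by move=> Ow w0 _; apply: (reg_zero rg w0 (i := a0)); apply/vA; rewrite -OA.
have P1 : P.[- y1] = 0 by rewrite PE; apply: (sO _ _ O1 _ erefl); exact: indep_neq0.
have P2 : P.[y2] = 0 by rewrite PE; apply: (sO _ _ O2 _ erefl); exact: indep_neq0.
have P3 : P.[2 * M] < 0 by rewrite PE; apply: (reg_neg rg _ vR); exact: indep_neq0.
have P4 : P.[- (2 * M)] < 0 by rewrite PE; apply: (reg_neg rg _ vL); exact: indep_neq0.
apply: (@three_gaps P (- (2 * M)) z1 (- y1) 0 y2 z2 (2 * M) za zb _ y20 zc zd) => //.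
- by rewrite oppr_lt0.
- exact: ltW.
- by rewrite P1.
- by rewrite P2.
- exact: ltW.
- by rewrite /P (along_line_size _ _ sf).1.
Qed.

Lemma comp_disk (g : R * R -> R * R) : continuous g -> (forall z, @unit_disk R (g z)) ->
  continuous (fun z => h (g z)).
Proof.
move=> gc gd; have /subspace_continuousP hx := hc => z W nW.
have h1 := hx (g z) (gd z) _ nW; have h2 := gc z _ h1.
change (nbhs z [set y | W (h (g y))]).
have h3 : nbhs z [set y | @unit_disk R (g y) -> W (h (g y))] := h2.
by apply: filterS h3 => y hy; exact: (hy (gd y)).
Qed.

(* The line through p2 and p3 would be a one-sided loop in the disk D. *)
Lemma position : False.
Proof.
have [sf vc sep _] := rg.
have [j2] := @other4 [:: a0] isT; rewrite inE => j2a.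
have [j3] := @other4 [:: a0; j2] isT; rewrite !inE negb_or => /andP[j3a j32].
have [p2 v2] := neg j2; have [p3 v3] := neg j3; have [pn vn] := neg a0.
have D2 := far_in_D j2a v2.
have w20 := rep_neq0 p2; have w30 := rep_neq0 p3; have wn0 := rep_neq0 pn.
move: v2 v3 vn D2; rewrite -(pt_rep p2) -(pt_rep p3) -(pt_rep pn).
move: w20 w30 wn0; set w2 := rep p2; set w3 := rep p3; set wn := rep pn => w20 w30 wn0 v2 v3 vn D2.
have ind : indep w2 w3 by apply: (reg_indep rg w20 w30 _ v2 v3); rewrite eq_sym.
pose u t := cos t *: w2 + sin t *: w3.
have u0 t : u t != 0.
  apply/eqP => /ind[e1 e2]; have := cos2Dsin2 t; rewrite e1 e2 expr0n addr0 => /eqP.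
  by rewrite eq_sym oner_eq0.
have uc : continuous u.
  move=> t; apply: row_continuous => j.
  apply: (contE (g := fun t => cos t * w2 0 j + sin t * w3 0 j)); first by move=> y; rewrite !mxE.
  by apply: contD; (apply: contM; last exact: contC); [exact: continuous_cos|exact: continuous_sin].
pose L t := pt (u t).
have Lc : continuous L by move=> t; apply: (contT (uc t)); exact: pt_continuous (u0 t).
have L0 : L 0 = pt w2 by rewrite /L /u cos0 sin0 scale1r scale0r addr0.
(* A point of the line in the region [a0] would be a third region on it. If the function only
   vanishes there, a nearby point w in the region is used, and [w - cos t *: w2] replaces [w3]. *)
have pos t : 0 < v a0 (L t).
  rewrite ltNge; apply/negP => ht.
  have st : sin t != 0.
    apply/eqP => s0; move: ht; rewrite /L /u s0 scale0r addr0 pt_scale//.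
      by rewrite leNgt vD.
    by apply/eqP => c0; have := cos2Dsin2 t; rewrite c0 s0 expr0n addr0 => /eqP; rewrite eq_sym oner_eq0.
  pose S := [set w : 'rV[R]_3 | w != 0 /\ (w - cos t *: w2 != 0 /\ v j3 (pt (w - cos t *: w2)) < 0)].
  have cc : continuous_at (u t) (fun w : 'rV[R]_3 => w - cos t *: w2).
    apply: row_continuous => j; apply: (contE (g := fun w : 'rV[R]_3 => w 0 j - cos t * w2 0 j)).
      by move=> y; rewrite !mxE.
    by apply: contB; [exact: coord_continuous|exact: contC].
  have uE : u t - cos t *: w2 = sin t *: w3 by rewrite /u addrC addKr.
  have s30 : sin t *: w3 != 0 by rewrite scaler_eq0 negb_or st.
  have nS : \forall w \near u t, S w.
    apply: filterI; first exact: near_neq0.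
    have c1 := cc; rewrite /continuous_at uE in c1.
    apply: filterI; first exact: c1 (near_neq0 s30).
    have h3 : continuous_at (u t - cos t *: w2) (@pt R) by rewrite uE; exact: pt_continuous.
    have n5 : \forall w \near u t, v j3 (pt (w - cos t *: w2)) < 0.
      apply: near_lt0; first exact: (contT (contT cc h3) (vc _ _)).
      by rewrite uE pt_scale.
    exact: n5.
  have nU : nbhs (L t) [set p | exists2 w, S w & pt w = p].
    by apply/(nbhs_pt _ (u0 t)); apply: filterS nS => w Sw; exists w.
  have [p [w [w0 [w30' v3']] ew] vp] : exists2 p, (exists2 w, S w & pt w = p) & v a0 p < 0.
    have [e|ne] := eqVneq (v a0 (L t)) 0.
      have Aa : A a0 (L t) by apply/vA.
      by have [[p Up vp] _] := acc Aa nU; exists p.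
    by exists (L t); [exact: nbhs_singleton nU|rewrite lt_neqAle ne].
  rewrite -ew in vp.
  have := three_regions rg w20 w30' w0 (i := j2) (j := j3) (k := a0) _ v2 v3' vp.
  rewrite /= !inE negb_or j2a j3a [j2 == j3]eq_sym j32 => /(_ isT) /eqP; apply.
  by rewrite /det3 !mxE; ring.
(* The line starts in [D] at [pt w2] and, by [pos], never meets [O]. *)
have LD t : D (L t).
  have Lm : continuous (fun x : R => L (x * t)).
    move=> x; have h1 : continuous_at x (fun x : R => x * t).
      by apply: contM; [move=> U hU; exact: hU|exact: contC].
    first [exact: (contT h1 (Lc (x * t)))|exact: (continuous_comp h1 (Lc (x * t)))].
  apply: contrapT => nD; have [|||x _] := @exit_point (fun x : R => L (x * t)).
  - exact: Lm.
  - by rewrite mul0r L0.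
  - by rewrite mul1r.
  by rewrite OA => /vA e; have := pos (x * t); rewrite e ltxx.
have d0 : det3 w2 w3 wn != 0.
  apply: (three_regions rg w20 w30 wn0 (i := j2) (j := j3) (k := a0)) => //.
  by rewrite /= !inE negb_or j2a j3a [j2 == j3]eq_sym j32.
pose al x := det3 x w3 wn; pose be x := det3 w2 x wn.
have alc : continuous al by move=> x; exact: det3_cont1.
have bec : continuous be by move=> x; exact: det3_cont2.
have dc : continuous (fun x : 'rV[R]_3 => dot x x) by exact: dotvv_continuous.
(* Up to scale, the cosine and sine of the double angle of (al, be), which unlike the angle itself
   are defined on RP^2. They vanish together only at [pt wn], which is outside the closed disk. *)
pose fa : RP2 R -> R := lift_fun (fun x => (al x ^+ 2 - be x ^+ 2) / dot x x).
pose fb : RP2 R -> R := lift_fun (fun x => (al x * be x + al x * be x) / dot x x).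
have alZ (a : R) x : al (a *: x) = a * al x by rewrite /al /det3 !mxE; ring.
have beZ (a : R) x : be (a *: x) = a * be x by rewrite /be /det3 !mxE; ring.
have ddZ (a : R) (x : 'rV[R]_3) : dot (a *: x) (a *: x) = a ^+ 2 * dot x x by rewrite dotZl dotZr mulrA.
have ia (a : R) x : a != 0 -> x != 0 ->
    (al (a *: x) ^+ 2 - be (a *: x) ^+ 2) / dot (a *: x) (a *: x) = (al x ^+ 2 - be x ^+ 2) / dot x x.
  move=> an xn; rewrite alZ beZ ddZ; have dn : dot x x != 0 by rewrite gt_eqF// dotvv_gt0.
  by field; rewrite an dn.
have ib (a : R) x : a != 0 -> x != 0 ->
    (al (a *: x) * be (a *: x) + al (a *: x) * be (a *: x)) / dot (a *: x) (a *: x) =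
    (al x * be x + al x * be x) / dot x x.
  move=> an xn; rewrite alZ beZ ddZ; have dn : dot x x != 0 by rewrite gt_eqF// dotvv_gt0.
  by field; rewrite an dn.
have dV (x : 'rV[R]_3) : x != 0 -> continuous_at x (fun y : 'rV[R]_3 => (dot y y)^-1).
  by move=> xn; apply: contV; [rewrite gt_eqF// dotvv_gt0|exact: dc].
have fac : continuous fa.
  apply: lift_fun_continuous => // x xn; apply: contM; last exact: dV.
  by apply: contB; apply: contX; [exact: alc|exact: bec].
have fbc : continuous fb.
  apply: lift_fun_continuous => // x xn; apply: contM; last exact: dV.
  by apply: contD; (apply: contM; [exact: alc|exact: bec]).
(* The maximum of 1 and |z|^2; dividing by it retracts the plane onto the unit disk, so that the
   double angle can be lifted on a square. *)
pose m (z : R * R) := 1 + (z.1 ^+ 2 + z.2 ^+ 2) - Num.min 1 (z.1 ^+ 2 + z.2 ^+ 2).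
have nc : continuous (fun z : R * R => z.1 ^+ 2 + z.2 ^+ 2).
  by move=> z; apply: contD; apply: contX; [exact: cont_fst|exact: cont_snd].
have mE z : (z.1 ^+ 2 + z.2 ^+ 2 <= 1 /\ m z = 1) \/ (1 < z.1 ^+ 2 + z.2 ^+ 2 /\ m z = z.1 ^+ 2 + z.2 ^+ 2).
  rewrite /m; case: (lerP 1 (z.1 ^+ 2 + z.2 ^+ 2)) => hz; last by left; split; [exact: ltW|rewrite addrK].
  have [e|ne] := eqVneq (z.1 ^+ 2 + z.2 ^+ 2) 1; first by left; rewrite e lexx addrK.
  by right; split; [rewrite lt_neqAle eq_sym ne hz|rewrite addrAC subrr add0r].
have m0 z : 0 < m z by case: (mE z) => [[_ ->]|[h1 ->]]; rewrite ?ltr01// (lt_trans _ h1).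
pose rho (z : R * R) := (z.1 / m z, z.2 / m z).
have rhod z : @unit_disk R (rho z).
  rewrite /unit_disk /= !expr_div_n -mulrDl; case: (mE z) => [[hz ->]|[hz ->]].
    by rewrite expr1n divr1.
  have n0 : z.1 ^+ 2 + z.2 ^+ 2 != 0 by rewrite gt_eqF// (lt_trans _ hz).
  by rewrite expr2 invfM mulrA divff// mul1r invf_le1 ?ltW// (lt_trans _ hz).
have rho_id z : @unit_disk R z -> rho z = z.
  rewrite /unit_disk /= => hz; rewrite /rho; case: (mE z) => [[_ ->]|[h1 _]].
    by rewrite !divr1; case: (z).
  by move: (lt_le_trans h1 hz); rewrite ltxx.
have rhoc : continuous rho.
  move=> z; have mc : continuous_at z (fun y => (m y)^-1).
    apply: contV; first by rewrite gt_eqF.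
    apply: contB; first by apply: contD; [exact: contC|exact: nc].
    by apply: contMin; [exact: contC|exact: nc].
  by apply: cont_pair; apply: contM => //; [exact: cont_fst|exact: cont_snd].
have kc := comp_disk rhoc rhod.
have DO q : @unit_disk R q -> 0 <= v a0 (h q).
  rewrite /unit_disk /= le_eqVlt => /orP[/eqP e|lt].
    have : O (h q) by rewrite -hO; exists q.
    by rewrite OA => /vA ->.
  by apply/ltW/vD; rewrite -hD; exists q.
have [th hth] : exists th : R * R -> R, forall z : R * R, `|z.1| < 2 -> `|z.2| < 2 ->
    continuous_at z th /\ has_angle (th z) (fa (h (rho z))) (fb (h (rho z))).
  apply: angle_lift; first by [].
  - by move=> z; apply: (contT (kc z)); exact: fac.
  - by move=> z; apply: (contT (kc z)); exact: fbc.
  move=> z _; have := DO _ (rhod z); move: (h (rho z)) => p vp.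
  rewrite /fa /fb /lift_fun /=; set x := rep p; have xn : x != 0 := rep_neq0 p.
  have dn := dotvv_gt0 xn.
  have -> : ((al x ^+ 2 - be x ^+ 2) / dot x x) ^+ 2 + ((al x * be x + al x * be x) / dot x x) ^+ 2 =
      ((al x ^+ 2 + be x ^+ 2) / dot x x) ^+ 2 by field; rewrite gt_eqF.
  rewrite exprn_gt0// divr_gt0// lt_neqAle addr_ge0 ?sqr_ge0// andbT eq_sym; apply/eqP => e.
  have /andP[/eqP a1 /eqP b1] : (al x == 0) && (be x == 0).
    by move/eqP: e; rewrite paddr_eq0 ?sqr_ge0// !sqrf_eq0.
  move: vp; rewrite -(pt_rep p) -/x (det3_basis x d0) -/(al x) -/(be x) a1 b1 !mul0r !scale0r !add0r.
  rewrite pt_scale ?leNgt ?vn//; apply: contraNneq xn => e0.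
  by rewrite (det3_basis x d0) -/(al x) -/(be x) a1 b1 e0 !mul0r !scale0r !add0r.
have exg t : exists z, open_unit_disk z /\ h z = L t by have := LD t; rewrite -hD => -[z z1 z2]; exists z.
have [gam hgam] := choice exg.
have gd t : @unit_disk R (gam t) by exact: open_disk_sub (hgam t).1.
have gamc : continuous gam.
  move=> t U /nbhs_ballP[r r0 hr].
  have oB : open (ball (gam t) r) by exact: ball_open.
  have [|W nW hW] := inverse_near (@compact_disk R) hc hi (gd t) oB.
    exact: ballxx.
  rewrite (hgam t).2 in nW; have nL : nbhs t [set y | W (L y)] := Lc t _ nW.
  change (nbhs t [set y | U (gam y)]); apply: filterS nL => y Wy; apply: hr; apply: hW => //.
  by rewrite (hgam y).2.
have g2 t : `|(gam t).1| < 2 /\ `|(gam t).2| < 2.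
  have [hg _] := hgam t; move: hg; rewrite /open_unit_disk /= !ltr_norml !expr2 => hg.
  by split; apply/andP; split; nra.
(* Along the line the double angle is 2 t up to multiples of 2 pi. The loop closes at t = pi, where
   the lift must have its initial value although 2 t has grown by 2 pi. *)
pose d t := th (gam t) - (t + t).
have hd t : cos (d t) = 1.
  have [_ ha] := hth _ (g2 t).1 (g2 t).2; rewrite rho_id// (hgam t).2 in ha.
  have dn := dotvv_gt0 (u0 t); set N := dot (u t) (u t) in dn.
  pose C := det3 w2 w3 wn ^+ 2 / N.
  have C0 : 0 < C by rewrite divr_gt0// lt_neqAle sqr_ge0 andbT eq_sym sqrf_eq0.
  have aE : al (u t) = cos t * det3 w2 w3 wn by rewrite /al /u /det3 !mxE; ring.
  have bE : be (u t) = sin t * det3 w2 w3 wn by rewrite /be /u /det3 !mxE; ring.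
  have faE : fa (L t) = C * cos (t + t).
    by rewrite /fa lift_fun_pt// aE bE cosD /C -/N; field; rewrite gt_eqF.
  have fbE : fb (L t) = C * sin (t + t).
    by rewrite /fb lift_fun_pt// aE bE sinD /C -/N; field; rewrite gt_eqF.
  have sq : fa (L t) ^+ 2 + fb (L t) ^+ 2 = C ^+ 2.
    by rewrite faE fbE !exprMn -mulrDr cos2Dsin2 mulr1.
  apply: (has_angle_same _ ha); first by rewrite sq exprn_gt0.
  by rewrite /has_angle sq sqrtr_sqr gtr0_norm.
have gpi : gam pi = gam 0.
  apply: hi; rewrite ?inE//; rewrite !(hgam _).2 L0 /L /u cospi sinpi scale0r addr0.
  by rewrite pt_scale// oppr_eq0 oner_eq0.
have : d pi = d 0.
  apply: angle_const; first exact: pi_ge0.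
  - move=> t; apply: contB; last by apply: contD => U hU; exact: hU.
    by apply: (contT (gamc t)); exact: (hth _ (g2 t).1 (g2 t).2).1.
  - by move=> t _; rewrite hd.
  - rewrite /d gpi addr0 subr0 addrAC subrr add0r cosN cosD cospi sinpi; ring.
rewrite /d gpi addr0 subr0 => /eqP; rewrite -subr_eq0 addrAC subrr add0r oppr_eq0.
by have := @pi_gt0 R => p0; rewrite gt_eqF// addr_gt0.
Qed.

End Outside.

(** The function of [O] has no zero in the connected set [D], so it has constant sign there, and
    [position] excludes the positive one. *)
Lemma disk_negative q : D q -> v a0 q < 0.
Proof.
have [_ vc _ _] := rg.
have nz x : D x -> v a0 x != 0.
  by move=> Dx; apply/eqP => /vA; rewrite -OA => /disjOD; apply.
move=> Dq; rewrite ltNge; apply/negP => h1.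
have h2 : 0 < v a0 q by rewrite lt_neqAle eq_sym nz.
apply: position => x Dx.
have := connected_sign connectedD (g := v a0) _ nz Dq Dx.
by rewrite pmulr_rgt0//; apply => y _; exact: vc.
Qed.

End Position.
End Snake.

(** * The conic through five points *)

Section SnakeConic.
Variable R : realType.
Variables (s : mpoly 3 R) (v : 'I_4 -> RP2 R -> R).
Hypothesis rg : regions s v.

(** Regions are open, so a point on the line can be moved off it along a direction transverse to the
    line. *)
Lemma off_line j p (e w : 'rV[R]_3) : indep e w -> v j p < 0 ->
  exists x, [/\ x != 0, v j (pt x) < 0 & det3 e w x != 0].
Proof.
have [_ vc _ _] := rg => /indep_det3[n dn] vp.
have x0 := rep_neq0 p; set x := rep p in x0.
have [dx|dx] := eqVneq (det3 e w x) 0; last by exists x; split=> //; rewrite pt_rep.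
have nv : \forall y \near p, v j y < 0 by apply: near_lt0 => //; exact: vc.
have [|d d0 hd] := @vec_near R x n [set y | v j y < 0] x0; first by rewrite pt_rep.
have [|xn xv] := hd (d / 2); first by rewrite gtr0_norm; lra.
exists (x + (d / 2) *: n); split=> //.
have -> : det3 e w (x + (d / 2) *: n) = det3 e w x + d / 2 * det3 e w n by rewrite /det3 !mxE; ring.
by rewrite dx add0r mulf_neq0// gt_eqF; lra.
Qed.

Lemma off_curve k (c : mpoly 3 R) (U : set (RP2 R)) (p : RP2 R) : nonsingular k c -> nbhs p U ->
  exists x, [/\ x != 0, U (pt x) & eval_form c x != 0].
Proof.
move=> cn nU; have x0 := rep_neq0 p; set x := rep p in x0.
have [cx|cx] := eqVneq (eval_form c x) 0; last first.
  by exists x; split=> //; rewrite pt_rep; exact: nbhs_singleton.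
have [|y [_ [y0 _ Uy _ [cy _]]]] := sign_change (U := U) cn x0 cx; first by rewrite pt_rep.
by exists y; split=> //; rewrite gt_eqF.
Qed.

Definition lform (n : 'rV[R]_3) : mpoly 3 R := \sum_i n 0 i *: mpolyX R (mnm1 i).

Lemma lform_eval n w : eval_form (lform n) w = dot n w.
Proof.
rewrite /lform sum3 !eval_formD !eval_formZ dotE.
have mX i : eval_form (mpolyX R (mnm1 i)) w = w 0 i by exact: mevalXU.
by rewrite !mX.
Qed.

Lemma lform_form n : is_form 1 (lform n).
Proof.
apply: rpred_sum => i _; apply: rpredZ.
have h1 : (mdeg (mnm1 i) == 1%N) = true by apply/eqP; exact: mdeg1.
exact: (etrans (@dhomogX 3 R mdeg 1 (mnm1 i)) h1).
Qed.

Lemma lform2_form n m : is_form 2 (lform n * lform m).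
Proof.
have h2 : is_form (1 + 1) (lform n * lform m) by apply: dhomogM; exact: lform_form.
exact: h2.
Qed.

Section Points.
Variables (a0 j2 j3 j4 : 'I_4) (E W P2 P3 P4 : 'rV[R]_3).
Hypothesis ju : uniq [:: a0; j2; j3; j4].
Hypotheses (E0 : E != 0) (W0 : W != 0) (P20 : P2 != 0) (P30 : P3 != 0) (P40 : P4 != 0).
Hypotheses (vE : v a0 (pt E) < 0) (vW : v a0 (pt W) < 0).
Hypotheses (v2 : v j2 (pt P2) < 0) (v3 : v j3 (pt P3) < 0) (v4 : v j4 (pt P4) < 0).
Hypotheses (l2 : det3 E W P2 != 0) (l3 : det3 E W P3 != 0) (l4 : det3 E W P4 != 0).

(** In the basis (E, P3, P2) the conic through E, W, P2, P3, P4 is parametrized with [P2] at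
    infinity. Hence the clause on the coefficient of top degree, which is the value at [P2], and the
    separate mention of [P2] among the zeros of f. *)
Lemma five_points_conic : exists f (q : 'rV[{poly R}]_3) (u1 u2 : R),
  [/\ conic f /\ (forall u, curve_at q u != 0),
      forall d g, is_form d g -> (size (along q g) <= (d * 2).+1)%N /\
        exists2 l : R, l != 0 & (along q g)`_(d * 2) = l ^+ d * eval_form g P2,
      [/\ pt (curve_at q u1) = pt E, pt (curve_at q u2) = pt W &
        forall u, u1 <= u <= u2 \/ u2 <= u <= u1 -> eval_form s (curve_at q u) < 0],
      forall w, w != 0 -> (eval_form f w = 0 <->
        (exists u, pt w = pt (curve_at q u)) \/ pt w = pt P2) &
      forall i, (exists2 p, real_points f p & v i p = 0) /\ (exists2 p, real_points f p & v i p < 0)].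
Proof.
have [sf vc sep _] := rg.
move: (ju); rewrite /= !inE !negb_or => /and4P[/and3P[n02 n03 n04] /andP[n23 n24] n34 _].
have nn : [/\ j2 != a0, j3 != a0 & j4 != a0] /\ [/\ j3 != j2, j4 != j2 & j4 != j3].
  by split; split; rewrite eq_sym.
have [[n20 n30 n40] [n32 n42 n43]] := nn.
have tr i j k w1 w2 w3 : i != j -> i != k -> j != k -> w1 != 0 -> w2 != 0 -> w3 != 0 ->
    v i (pt w1) < 0 -> v j (pt w2) < 0 -> v k (pt w3) < 0 -> det3 w1 w2 w3 != 0.
  move=> ij ik jk h1 h2 h3 g1 g2 g3; apply: (three_regions rg h1 h2 h3 (i := i) (j := j) (k := k)) => //.
  by rewrite /= !inE negb_or ij ik jk.
have d0 : det3 E P3 P2 != 0 by exact: (tr a0 j3 j2).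
pose x w := det3 w P3 P2; pose y w := det3 E w P2; pose z w := det3 E P3 w.
have dW : det3 E W P2 = y W by [].
have dW3 : det3 E W P3 = - z W by rewrite /z /det3; ring.
have x4 : x P4 != 0 by exact: (tr j4 j3 j2).
have y4 : y P4 != 0 by exact: (tr a0 j4 j2).
have z4 : z P4 != 0 by exact: (tr a0 j3 j4).
have x5 : x W != 0 by exact: (tr a0 j3 j2).
have y5 : y W != 0 by exact: l2.
have z5 : z W != 0 by rewrite -oppr_eq0 -dW3.
(* The cross product of the values of (xy, yz, zx) at P4 and W. Each second factor is, up to sign, a
   product of determinants of triples among the five points, hence not zero. *)
pose al := z P4 * z W * (y P4 * x W - x P4 * y W).
pose be := x P4 * x W * (z P4 * y W - y P4 * z W).
pose ga := y P4 * y W * (x P4 * z W - z P4 * x W).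
have i1 : y P4 * x W - x P4 * y W = - (det3 E P3 P2 * det3 P4 W P2) by rewrite /x /y /det3; ring.
have i2 : z P4 * y W - y P4 * z W = - (det3 E P3 P2 * - det3 E W P4) by rewrite /z /y /det3; ring.
have i3 : x P4 * z W - z P4 * x W = det3 E P3 P2 * det3 P4 P3 W by rewrite /z /x /det3; ring.
have al0 : al != 0.
  by rewrite /al i1 mulf_neq0 ?mulf_neq0// oppr_eq0 mulf_neq0//; exact: (tr j4 a0 j2).
have be0 : be != 0.
  by rewrite /be i2 mulf_neq0 ?mulf_neq0// oppr_eq0 mulf_neq0// oppr_eq0.
have ga0 : ga != 0.
  by rewrite /ga i3 mulf_neq0 ?mulf_neq0//; exact: (tr j4 j3 a0).
have r4 : al * x P4 * y P4 + be * y P4 * z P4 + ga * z P4 * x P4 = 0 by rewrite /al /be /ga; ring.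
have r5 : al * x W * y W + be * y W * z W + ga * z W * x W = 0 by rewrite /al /be /ga; ring.
move: al be ga al0 be0 ga0 r4 r5 => al be ga al0 be0 ga0 r4 r5 {i1 i2 i3}.
pose q := conq E P3 P2 al be ga; pose G := conG E P3 P2 al be ga.
have q0 u : curve_at q u != 0 by apply: conq_neq0.
have qa : curve_at q 0 = al *: P3 by apply: conq_a.
have qe : curve_at q (- al / ga) = (be * al / ga) *: E by apply: conq_e.
have qG u : u != 0 -> curve_at q u = u ^+ 2 *: G u^-1 by move=> u0; apply: conq_infty.
have G0 : G 0 = ga *: P2 by apply: conG0.
have cr w : det3 E P3 P2 *: w = x w *: E + y w *: P3 + z w *: P2 by exact: cramer3.
have qp w : w != 0 -> y w != 0 -> al * x w * y w + be * y w * z w + ga * z w * x w = 0 ->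
    exists u, pt (curve_at q u) = pt w.
  move=> w0 yw e0; have : exists2 l : R, l != 0 & x w *: E + y w *: P3 + z w *: P2 = l *: curve_at q (z w / y w).
    by apply: conq_point => //; rewrite -cr scaler_eq0 negb_or d0.
  case=> l l0 el; exists (z w / y w).
  by rewrite -(pt_scale l0 (q0 _)) -el -cr pt_scale.
have [u4 e4] := qp _ P40 y4 r4; have [u2 e2] := qp _ W0 y5 r5.
have bag : be * al / ga != 0 by rewrite !mulf_neq0 ?invr_eq0.
have [u1 e1] : exists u, curve_at q u = (be * al / ga) *: E by exists (- al / ga).
have p1 : pt (curve_at q u1) = pt E by rewrite e1 pt_scale.
have p3 : pt (curve_at q 0) = pt P3 by rewrite qa pt_scale.
pose f : mpoly 3 R := al *: (lform (cross P3 P2) * lform (cross P2 E)) +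
  be *: (lform (cross P2 E) * lform (cross E P3)) + ga *: (lform (cross E P3) * lform (cross P3 P2)).
have fE w : eval_form f w = al * x w * y w + be * y w * z w + ga * z w * x w.
  rewrite !eval_formD !eval_formZ !eval_formM !lform_eval !dot_cross.
  have -> : det3 P3 P2 w = x w by rewrite /x /det3; ring.
  have -> : det3 P2 E w = y w by rewrite /y /det3; ring.
  by rewrite -/(z w) !mulrA.
have gc : continuous (fun u => pt (curve_at q u)).
  by move=> u; apply: (contT (@curve_cont R q u)); exact: pt_continuous (q0 u).
have Gc : continuous_at 0 G by exact: conG_cont.
have G00 : G 0 != 0 by rewrite G0 scaler_eq0 negb_or ga0.
have pG : pt (G 0) = pt P2 by rewrite G0 pt_scale.
have qf u : eval_form f (curve_at q u) = 0.
  rewrite fE /x /y /z conq_at /det3 !mxE; ring.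
have ys_neg : {in [:: u1; u2; 0; u4], forall t, eval_form s (curve_at q t) < 0 /\
    exists2 j, j2 != j & v j (pt (curve_at q t)) < 0}.
  move=> t; rewrite !inE => /or4P[] /eqP ->.
  - by split; [apply: (reg_neg rg (i := a0)) => //; rewrite p1|exists a0 => //; rewrite p1].
  - by split; [apply: (reg_neg rg (i := a0)) => //; rewrite e2|exists a0 => //; rewrite e2].
  - by split; [apply: (reg_neg rg (i := j3)) => //; rewrite p3|exists j3 => //; rewrite p3].
  - by split; [apply: (reg_neg rg (i := j4)) => //; rewrite e4|exists j4 => //; rewrite e4].
have w1 : v a0 (pt (curve_at q u1)) < 0 by rewrite p1.
have w2 : v a0 (pt (curve_at q u2)) < 0 by rewrite e2.
have w3 : v j3 (pt (curve_at q 0)) < 0 by rewrite p3.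
have w4 : v j4 (pt (curve_at q u4)) < 0 by rewrite e4.
have dj i j t t' : i != j -> v i (pt (curve_at q t)) < 0 -> v j (pt (curve_at q t')) < 0 -> t != t'.
  move=> ij h1 h2; apply/eqP => e; move/eqP: ij; apply; rewrite -e in h2.
  by apply: (reg_disj rg (ltW h1) (ltW h2)).
have n12 : u1 != u2.
  apply/eqP => e; move: l2; have [l l0 el] : exists2 l, l != 0 & E = l *: W.
    by apply/(pt_eq E0 W0); rewrite -p1 -e2 e.
  by rewrite el => /eqP; apply; rewrite /det3 !mxE; ring.
have arcneg u : u1 <= u <= u2 \/ u2 <= u <= u1 -> eval_form s (curve_at q u) < 0.
  move=> hu; rewrite ltNge; apply/negP => su.
  have un1 : u != u1 by apply/eqP => e; move: su; rewrite e leNgt (ys_neg u1 _).1// !inE eqxx.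
  have un2 : u != u2 by apply/eqP => e; move: su; rewrite e leNgt (ys_neg u2 _).1// !inE eqxx ?orbT.
  have btw : u1 < u < u2 \/ u2 < u < u1.
    case: hu => /andP[h1 h2]; [left|right]; apply/andP; split; rewrite lt_neqAle ?h1 ?h2 ?andbT//;
      by rewrite eq_sym.
  (* With [P2] at infinity there are five points. Four gaps come from different regions; between u1
     and u2, in the same region, the gap is u itself. Ten zeros would follow, but the degree is
     eight. *)
  pose ys : seq R := [:: u1; u2; 0; u4].
  have : (2 * (size ys).+1 < size (along q s))%N.
    apply: (curve_gaps rg (F := s) (q := q) (G := G) (d := 2) (D := 1) (i := j2)) => //.
    - by rewrite mul1r.
    - by move=> t; rewrite hornerC ler01.
    - by rewrite /= !inE !negb_or n12 (dj a0 j3)// (dj a0 j4)// (dj a0 j3 u2 0)// (dj a0 j4 u2 u4)// (dj j3 j4).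
    - by rewrite pG.
    - by apply: (reg_neg rg G00 (i := j2)); rewrite pG.
    - move=> t t'; rewrite !inE => /or4P[] /eqP -> /or4P[] /eqP -> lt;
        first [by rewrite ltxx in lt
              |by left; exists a0, j3; split|by left; exists a0, j4; split
              |by left; exists j3, a0; split|by left; exists j4, a0; split
              |by left; exists j3, j4; split|by left; exists j4, j3; split
              |right; exists u; last (by rewrite along_eval)].
      + by case: btw => // /andP[h1 h2]; have := lt_trans (lt_trans h1 h2) lt; rewrite ltxx.
      + by case: btw => // /andP[h1 h2]; have := lt_trans (lt_trans h1 h2) lt; rewrite ltxx.
  have : (size (along q s) <= 9)%N by apply: (conq_along_size _ _ _ _ _ _ sf).
  by move=> h1 /leq_trans/(_ h1).
exists f, q, u1, u2; split.
- split=> //; split.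
    apply/eqP => f0; have := fE (E + P3); rewrite f0 /eval_form meval0 => /esym/eqP; apply/negP.
    have -> : x (E + P3) = det3 E P3 P2 by rewrite /x /det3 !mxE; ring.
    have -> : y (E + P3) = det3 E P3 P2 by rewrite /y /det3 !mxE; ring.
    have -> : z (E + P3) = 0 by rewrite /z /det3 !mxE; ring.
    by rewrite !mulr0 mul0r !addr0 !mulf_neq0.
  by apply: rpredD; [apply: rpredD|]; apply: rpredZ; exact: lform2_form.
- move=> d g gf; split; first exact: (conq_along_size _ _ _ _ _ _ gf).
  have [_ ->] := @along_size R q g d 2 gf (conq_size E P3 P2 al be ga).
  exists ga => //; rewrite -(eval_form_scale _ _ gf); congr eval_form; apply/rowP => i.
  rewrite /q /conq !mxE !coefD coefZ coefX !coefCM !coefD !coefC !coefZ !coefX coefXn /=.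
  by ring.
- by split.
- move=> w w0; rewrite fE; split; last first.
    case=> [[u /(pt_eq w0 (q0 u))[l l0 ->]]|/(pt_eq w0 P20)[l l0 ->]].
      by rewrite -fE (eval_form_scale (d := 2))// ?qf ?mulr0//; apply: rpredD; [apply: rpredD|];
        apply: rpredZ; exact: lform2_form.
    by rewrite /x /y /z /det3 !mxE; ring.
  move=> e0; have [yw|yw] := eqVneq (y w) 0; last first.
    by have [u eu] := qp w w0 yw e0; left; exists u.
  move: e0; rewrite yw !mulr0 !mul0r ?mulr0 !add0r => /eqP; rewrite !mulf_eq0 (negbTE ga0) /= => /orP[] /eqP e0.
    left; exists u1; rewrite p1; have := cr w; rewrite yw e0 !scale0r !addr0 => ew.
    have xw : x w != 0.
      by apply: contraNneq w0 => xw; move/eqP: ew; rewrite xw scale0r scaler_eq0 (negbTE d0).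
    by rewrite -(pt_scale d0 w0) ew pt_scale.
  right; have := cr w; rewrite yw e0 !scale0r !add0r => ew.
  have zw : z w != 0.
    by apply: contraNneq w0 => zw; move/eqP: ew; rewrite zw scale0r scaler_eq0 (negbTE d0).
  by rewrite -(pt_scale d0 w0) ew pt_scale.
- move=> i; have rp u : real_points f (pt (curve_at q u)).
    have f2 : is_form 2 f by apply: rpredD; [apply: rpredD|]; apply: rpredZ; exact: lform2_form.
    by apply/(real_points_pt f2 (q0 u)).
  suff [t [t' [t1 t2]]] : exists t t', v i (pt (curve_at q t)) < 0 /\ 0 < v i (pt (curve_at q t')).
    have gvc : continuous (fun u => v i (pt (curve_at q u))) by move=> u; apply: (contT (gc u)); exact: vc.
    split; last by exists (pt (curve_at q t)).
    have [lt|lt|e] := ltgtP t t'.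
    + have [|u _ eu] := ivt_sign lt gvc; first by rewrite nmulr_rlt0.
      by exists (pt (curve_at q u)).
    + have [|u _ eu] := ivt_sign lt gvc; first by rewrite pmulr_rlt0.
      by exists (pt (curve_at q u)).
    + by move: (lt_trans t1 t2); rewrite e ltxx.
  (* The region of [P2] is reached only at infinity, so a large parameter is taken. *)
  have [e|i2'] := eqVneq i j2.
    have nv : nbhs (pt (G 0)) [set p | v j2 p < 0].
      by have nv : \forall p \near pt (G 0), v j2 p < 0 by apply: near_lt0; [exact: vc|rewrite pG].
    have [M M0 hM] := infty_near Gc G00 nv; exists M, 0; rewrite e; split.
      have := hM M; rewrite (gtr0_norm M0) => /(_ (lexx _)) /=.
      by rewrite qG ?gt_eqF// pt_scale// ?expf_neq0 ?gt_eqF//;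
        apply: contraNneq (q0 M) => g0; rewrite qG ?gt_eqF// g0 scaler0.
    by apply: (sep j3) => //; exact: ltW.
  have [e|i0'] := eqVneq i a0.
    by exists u1, 0; rewrite e; split=> //; apply: (sep j3) => //; exact: ltW.
  have [e|i3'] := eqVneq i j3.
    by exists 0, u1; rewrite e; split=> //; apply: (sep a0) => //; exact: ltW.
  have -> : i = j4.
    apply/eqP/negPn/negP => i4'; have : uniq [:: i; a0; j2; j3; j4] by rewrite cons_uniq ju !inE !negb_or i0' i2' i3' i4'.
    by move/card_uniqP => /=; apply/eqP; rewrite neq_ltn; apply/orP; left; rewrite ltnS (leq_trans (max_card _))// card_ord.
  by exists u4, 0; split=> //; apply: (sep j3) => //; exact: ltW.
Qed.

End Points.
End SnakeConic.

(** * The pencil of the quartic and the squared conic *)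

Section Perturbation.
Variable R : realType.
Variables (k : nat) (s c f : mpoly 3 R) (v : 'I_4 -> RP2 R -> R) (be : nat -> R -> RP2 R).
Hypothesis k0' : (0 < k)%N.
Hypothesis rg : regions s v.
Hypothesis cn : nonsingular k c.
Hypothesis f2 : is_form 2 f.
Hypothesis fv : forall i, exists2 p, real_points f p & v i p < 0.
Hypothesis cs : exists P : 'I_(k * 4) -> RP2 R, injective P /\
  forall j, real_points c (P j) /\ real_points s (P j).
Hypothesis hb1 : forall j, (j < 2 * k)%N -> arc (real_points c) (be j).
Hypothesis hb2 : forall j t, (j < 2 * k)%N -> t = 0 \/ t = 1 ->
  real_points s (be j t) /\ ~ real_points f (be j t).
Hypothesis hb3 : forall j, (j < 2 * k)%N ->
  exists q, [/\ ins (be j) q, real_points f q & eval_form s (rep q) < 0].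
Hypothesis hb4 : forall i j q, (i < 2 * k)%N -> (j < 2 * k)%N ->
  ins (be i) q -> ins (be j) q -> i = j.

Definition pert a b : mpoly 3 R := a *: s + b *: f ^+ 2.

Lemma pertE a b w : eval_form (pert a b) w = a * eval_form s w + b * eval_form f w ^+ 2.
Proof. by rewrite eval_formD !eval_formZ eval_formX. Qed.

Lemma pert_form a b : is_form 4 (pert a b).
Proof.
have [sf _ _ _] := rg; apply: rpredD; apply: rpredZ => //.
have ff : is_form (2 + 2) (f * f) by exact: dhomogM.
by rewrite expr2; exact: ff.
Qed.

(** The conic meets each region, and at such a point the value is a s < 0. Since b f^2 >= 0, the
    signs of the new quartic compare with those of s as [quartic_nonsingular] requires. *)
Lemma pert_nonsingular a b : 0 < a -> 0 <= b -> nonsingular 4 (pert a b).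
Proof.
move=> a0 b0; have sq w : 0 <= b * eval_form f w ^+ 2 by rewrite mulr_ge0 ?sqr_ge0.
have hx i : exists x, [/\ x != 0, v i (pt x) < 0 & eval_form (pert a b) x < 0].
  have [p fp vp] := fv i; exists (rep p); have p0 := rep_neq0 p; split=> //; first by rewrite pt_rep.
  have fp' : eval_form f (rep p) = 0 := fp.
  by rewrite pertE fp' expr0n mulr0 addr0 pmulr_rlt0// (reg_neg rg p0 (i := i))// pt_rep.
have [x hx'] := choice hx.
apply: (@quartic_nonsingular R s (pert a b) v x rg (pert_form a b)).
- by move=> w _ sw; rewrite pertE ltr_wpDr// mulr_gt0.
- by move=> w _; rewrite pertE => h0; rewrite -(pmulr_rlt0 _ a0); apply: le_lt_trans h0; rewrite lerDl.
- by move=> i; have [] := hx' i.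
- by move=> i; have [] := hx' i.
- by move=> i; have [] := hx' i.
Qed.

Lemma two_zeros a b j : 0 < a -> 0 < b -> (j < 2 * k)%N -> exists t : R * R,
  [/\ 0 < t.1, t.1 < t.2, t.2 < 1, real_points (pert a b) (be j t.1) &
    real_points (pert a b) (be j t.2)].
Proof.
move=> a0 b0 jk; have F4 : is_form (2 * 2) (pert a b) := pert_form a b.
have [bc _ _] := hb1 jk; have [_ [[t /andP[t0 t1] <-] fq sq]] := hb3 jk.
pose g u := evfun 2 (pert a b) (be j u).
have gc : continuous g by move=> u; apply: (contT (bc u)); exact: evfun_continuous.
have gs u : Num.sg (g u) = Num.sg (eval_form (pert a b) (rep (be j u))).
  by rewrite /g -{1}(pt_rep (be j u)) evfun_sg// rep_neq0.
have gpos u : u = 0 \/ u = 1 -> 0 < g u.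
  move=> /(hb2 jk)[su fu]; rewrite -sgr_gt0 gs sgr_gt0 pertE.
  have -> : eval_form s (rep (be j u)) = 0 := su.
  rewrite mulr0 add0r mulr_gt0// lt_neqAle sqr_ge0 andbT eq_sym sqrf_eq0; apply/eqP => e.
  by apply: fu.
have gneg : g t < 0.
  rewrite -sgr_lt0 gs sgr_lt0 pertE.
  have -> : eval_form f (rep (be j t)) = 0 := fq.
  by rewrite expr0n mulr0 addr0 pmulr_rlt0.
have [|x /andP[x0 xt] gx] := ivt_sign t0 gc; first by rewrite pmulr_rlt0// gpos//; left.
have [|y /andP[yt y1] gy] := ivt_sign t1 gc; first by rewrite nmulr_rlt0// gpos//; right.
exists (x, y); split=> //=; first exact: lt_trans yt.
- by apply/(evfun_eq0 _ F4).
- by apply/(evfun_eq0 _ F4).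
Qed.

Lemma pert_transversal a b : 0 < a -> 0 <= b -> transversal_curves (pert a b) c.
Proof.
move=> a0 b0; have k2 : (0 < 2 * k)%N by rewrite muln_gt0.
have ex : exists p0, real_points c p0 /\ ~ real_points (pert a b) p0.
  have [_ [[t /andP[t0 t1] <-] fq sq]] := hb3 k2; have [_ hc _] := hb1 k2.
  exists (be 0%N t); split; first by apply: hc; rewrite !ltW.
  move=> e; have := pertE a b (rep (be 0%N t)).
  have -> : eval_form f (rep (be 0%N t)) = 0 := fq.
  have -> : eval_form (pert a b) (rep (be 0%N t)) = 0 := e.
  by rewrite expr0n mulr0 addr0 => /esym/eqP; rewrite mulf_eq0 gt_eqF//= lt_eqF.
(* For b = 0 the 4k corners serve. For b > 0 each of the 2k disjoint arcs carries two zeros, one on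
   each side of the crossing with the conic. *)
have [P [Pi hP]] : exists P : 'I_(k * 4) -> RP2 R, injective P /\
    forall j, real_points c (P j) /\ real_points (pert a b) (P j).
  move: b0; rewrite le_eqVlt => /orP[/eqP <-|b0].
    have [P [Pi hP]] := cs; exists P; split=> // j; have [cj sj] := hP j; split=> //.
    have sj' : eval_form s (rep (P j)) = 0 := sj.
    by rewrite /real_points /= -/(rep (P j)) pertE sj' mulr0 mul0r addr0.
  have ht (j : 'I_(2 * k)) := two_zeros a0 b0 (ltn_ord j).
  have [t ht'] := choice ht.
  pose tt (x : 'I_(2 * k) * bool) := if x.2 then (t x.1).1 else (t x.1).2.
  have tt01 x : 0 < tt x < 1.
    have [h1 h2 h3 _ _] := ht' x.1; rewrite /tt; case: x.2; apply/andP; split=> //.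
      exact: lt_trans h3.
    exact: lt_trans h2.
  pose p (x : 'I_(2 * k) * bool) := be x.1 (tt x).
  have ip (x : 'I_(2 * k) * bool) : ins (be x.1) (p x) by exists (tt x) => //; exact: tt01.
  have pi : injective p.
    move=> x y e; have exy : x.1 = y.1.
      by apply: val_inj; apply: (hb4 (ltn_ord _) (ltn_ord _) (ip x)); rewrite e; exact: ip.
    have [_ _ bi] := hb1 (ltn_ord x.1).
    have /andP[x0 x1] := tt01 x; have /andP[y0 y1] := tt01 y.
    have et : tt x = tt y by apply: bi; rewrite ?(ltW x0) ?(ltW x1) ?(ltW y0) ?(ltW y1)//; rewrite -/(p x) e /p exy.
    move: et exy {e x0 x1 y0 y1 bi}; case: x y => [i a1] [j a2] /= + e; rewrite -e /tt /=.
    have [_ h2 _ _ _] := ht' i.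
    by case: a1; case: a2 => // e2; move: h2; rewrite e2 ltxx.
  have cE : (k * 4)%N = #|{: 'I_(2 * k) * bool}| by rewrite card_prod card_ord card_bool; lia.
  exists (fun i => p (enum_val (cast_ord cE i))); split.
    by move=> i j /pi /enum_val_inj /cast_ord_inj.
  move=> i; move: (enum_val _) => x; have [_ hc _] := hb1 (ltn_ord x.1).
  have /andP[x0 x1] := tt01 x; split; first by apply: hc; rewrite !ltW.
  by have [_ _ _ z1 z2] := ht' x.1; rewrite /p /tt; case: x.2.
exact: (bezout_real cn (pert_form a b) isT ex Pi hP).2.
Qed.

Lemma coeff_bound (g : mpoly 3 R) : exists2 M : R, 0 < M & forall m, `|mcoeff m g| < M.
Proof.
pose S := \sum_(m <- msupp g) `|mcoeff m g|.
have S0 : 0 <= S by apply: sumr_ge0.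
exists (S + 1) => [|m]; first by lra.
have [hm|hm] := boolP (m \in msupp g); last by rewrite memN_msupp_eq0// normr0; lra.
suff : `|mcoeff m g| <= S by lra.
by rewrite /S (big_rem m hm) /= lerDl sumr_ge0.
Qed.

(** The path runs straight from s to eta s + f^2. Its coefficient of s stays positive, so every
    curve on it is covered by the two previous lemmas, and its end differs from f^2 only by the
    small form eta s. *)
Lemma perturbation (s0 : mpoly 3 R) (e : R) : s = e *: s0 -> e != 0 -> forall ep : R, 0 < ep ->
  exists g, [/\ nonsingular 4 g, near_form ep g (f ^+ 2) &
    rigidly_isotopic (quartic_union k) (s0 * c) (g * c)].
Proof.
move=> es e0 ep ep0; have [M M0 hM] := coeff_bound s.
pose eta := ep / M; have eta0 : 0 < eta by rewrite divr_gt0.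
exists (pert eta 1); split; first exact: pert_nonsingular.
  move=> m; rewrite /pert scale1r mcoeffD mcoeffZ addrK normrM gtr0_norm//.
  by rewrite -(divfK (lt0r_neq0 M0) ep) -/eta ltr_pM2l.
exists (fun t => pert ((1 - t) + t * eta) t * c); split.
- move=> m; apply: continuous_subspaceT.
  have -> : (fun t : R => mcoeff m (pert ((1 - t) + t * eta) t * c)) =
      (fun t : R => ((1 - t) + t * eta) * mcoeff m (s * c) + t * mcoeff m (f ^+ 2 * c)).
    by apply/funext => y; rewrite /pert mulrDl -!scalerAl mcoeffD !mcoeffZ.
  move=> t.
  have idc : continuous_at t (fun t : R => t) by move=> U hU.
  apply: contD; apply: contM; try exact: contC; last exact: idc.
  by apply: contD; [apply: contB; [exact: contC|exact: idc]|apply: contM; [exact: idc|exact: contC]].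
- move=> t /andP[t0 t1]; have a0 : 0 < (1 - t) + t * eta.
    have [->|tn] := eqVneq t 0; first by rewrite subr0 mul0r addr0.
    by rewrite ltr_wpDl ?subr_ge0// mulr_gt0// lt_neqAle eq_sym tn.
  exists (pert ((1 - t) + t * eta) t), c; split; [exact: pert_nonsingular|exact: cn|exact: pert_transversal|reflexivity].
- by exists e => //; rewrite /pert subr0 mul0r addr0 scale1r scale0r addr0 es -scalerAl.
- by exists 1; rewrite ?oner_eq0// scale1r subrr mul1r add0r.
Qed.

End Perturbation.

(** * The conic of the theorem, its intersections and the isotopy *)

Local Open Scope card_scope.

Theorem theorem1 (R : realType) (k : nat) (hk : (1 <= k)%N)
    (c s : mpoly 3 R) (O : set (RP2 R))
    (hc : nonsingular k c) (hs : M_quartic s) (hO : snake k c s O) :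
  exists f : mpoly 3 R,
    [/\ conic f,
        (forall A, oval s A -> (real_points f `&` A) !=set0),
        (real_points f `&` real_points c #= `I_(2 * k)),
        (real_points f `&` real_points c `<=` inside O) &
        (forall e : R, 0 < e ->
           exists g : mpoly 3 R,
             [/\ nonsingular 4 g, near_form e g (f ^+ 2) &
                 rigidly_isotopic (quartic_union k) (s * c) (g * c)])].
Proof.
have [e [v [A [e2 rg Aeq vA acc]]]] := quartic_regions hs.
have e0 : e != 0 by rewrite -sqrf_eq0 e2 oner_eq0.
(* The sign e makes the quartic negative exactly in the four regions; it defines the same curve, and
   the factor e reappears only in [same_curve]. *)
pose s' := e *: s; have es : s' = e *: s by [].
rewrite -es in rg; move: s' es rg => s' es rg.
have [sf' vc sep _] := rg.
have rs : real_points s' = real_points s.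
  rewrite es; apply/seteqP; split=> p; rewrite /real_points /= eval_formZ => /eqP.
    by rewrite mulf_eq0 (negbTE e0) => /eqP.
  by move=> /eqP ->; rewrite mulr0.
have Ane i : exists x, A i x.
  have : components (real_points s) (A i) by rewrite Aeq; exists i.
  by case=> x sx <-; exists x; exact: connected_component_refl.
have neg i : exists p, v i p < 0.
  by have [x Ax] := Ane i; have [[p _ vp] _] := acc i x setT Ax filterT; exists p.
have [pv hpv] := choice neg.
have sn' : nonsingular 4 s'.
  apply: (@quartic_nonsingular R s' s' v (fun i => rep (pv i)) rg sf') => //.
  - by move=> i; exact: rep_neq0.
  - by move=> i; rewrite pt_rep.
  - by move=> i; apply: (reg_neg rg (rep_neq0 _) (i := i)); rewrite pt_rep.
case: hO => [[brO _] [D bd hsn]]; have [h [hcc hi hOc hD]] := bd.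
move: hsn; set B := branches_meeting c O => -[pcs quads digs].
have [a0 _ OA] : range A O by rewrite -Aeq.
have OA' : O = A a0 by [].
have OS : O `<=` real_points s'.
  by rewrite rs; have [y _ <-] := brO => x; exact: connected_component_sub.
have Dneg := disk_negative hcc hi hOc hD rg vA acc neg OA'.
have sD q : D q -> eval_form s' (rep q) < 0.
  by move=> Dq; apply: (reg_neg rg (rep_neq0 q) (i := a0)); rewrite pt_rep; exact: Dneg.
have BC : B `<=` real_points c by exact: branchesC.
have cD : connected D := connectedD hcc hD.
have oD : open D := openD hcc hi hD.
have [Ef [Efi EfE]] := enum_card_eq digs; have [Qf [Qfi QfE]] := enum_card_eq quads.
have Ep j : components (D `\` B) (Ef j) /\ digon O B (Ef j).
  have : range Ef (Ef j) by exists j.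
  by rewrite -EfE.
have Qp j : components (D `\` B) (Qf j) /\ quadrangle O B (Qf j).
  have : range Qf (Qf j) by exists j.
  by rewrite -QfE.
have E01 : Ef ord0 <> Ef ord_max by move=> /Efi /(congr1 val).
(* If [B] missed [D], the connected disk would be a single piece, but there are two different
   digons. The point obtained is on c and not on s, as Bezout's bound requires. *)
have [p0 [Bp0 Dp0]] : exists p0, B p0 /\ D p0.
  apply: contrapT => hn.
  have DB : D `\` B = D.
    by apply/seteqP; split=> [q []//|q Dq]; split=> // Bq; apply: hn; exists q.
  have [d0 _] := Ep ord0; have [d1 _] := Ep ord_max; rewrite DB in d0 d1.
  have [y Dy _] := d0.
  have [P cP DP] := sub_component cD (ex_intro _ y Dy) (fun q hq => hq).
  have pe j : components D (Ef j) -> Ef j = P.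
    move=> dj; have [x Dx ex] := dj; apply: (component_eq dj cP (q := x)); last exact: DP.
    by rewrite -ex; exact: connected_component_refl.
  by apply: E01; rewrite (pe _ d0) (pe _ d1).
have ep0 : exists p0, real_points c p0 /\ ~ real_points s' p0.
  exists p0; split; first exact: BC.
  move=> sp; have := sD _ Dp0; have -> : eval_form s' (rep p0) = 0 := sp.
  by rewrite ltxx.
have Vb N (P : 'I_N -> RP2 R) : injective P ->
    (forall j, real_points c (P j) /\ real_points s' (P j)) -> (N <= k * 4)%N.
  by move=> Pi hP; exact: (bezout_real hc sf' isT ep0 Pi hP).1.
have n2k : ((2 * k).-1.+1 = 2 * k)%N by rewrite prednK// muln_gt0.
have cs := corners_count hc sn' OS hcc hi hOc hD Vb n2k Qfi Efi Qp Ep.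
have tr : transversal_curves s' c.
  by have [P [Pi hP]] := cs; exact: (bezout_real hc sf' isT ep0 Pi hP).2.
have pO P : components (D `\` B) P -> open P.
  exact: (piece_open hc OS hcc hi hD Vb).
(* The points in the two digons are taken off c; then c does not vanish identically on the conic. *)
have pt_in j : exists x : 'rV[R]_3, [/\ x != 0, Ef j (pt x) & eval_form c x != 0].
  have [pj _] := Ep j; have [y Dy ey] := pj.
  have Ey : Ef j y by rewrite -ey; exact: connected_component_refl.
  by apply: (off_curve hc (p := y)); apply: open_nbhs_nbhs; split=> //; exact: pO.
have [E [E0 EE cE]] := pt_in ord0; have [W [W0 WE cW]] := pt_in ord_max.
have pD j q : Ef j q -> D q.
  by have [[x _ <-] _] := Ep j => /connected_component_sub[].
have ne : pt E <> pt W.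
  by move=> eEW; apply: E01; apply: (component_eq (Ep _).1 (Ep _).1 EE); rewrite eEW.
have ind := indep_pt E0 W0 ne.
have vE := Dneg _ (pD _ _ EE); have vW := Dneg _ (pD _ _ WE).
have [j2] := @other4 [:: a0] isT; rewrite inE => j2a.
have [j3] := @other4 [:: a0; j2] isT; rewrite !inE negb_or => /andP[j3a j32].
have [j4] := @other4 [:: a0; j2; j3] isT; rewrite !inE !negb_or => /and3P[j4a j42 j43].
have ju : uniq [:: a0; j2; j3; j4].
  by rewrite /= !inE !negb_or ![a0 == _]eq_sym j2a j3a j4a [j2 == j3]eq_sym j32 [j2 == j4]eq_sym j42 eq_sym j43.
have [P2 [P20 v2 l2]] := off_line rg ind (hpv j2).
have [P3 [P30 v3 l3]] := off_line rg ind (hpv j3).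
have [P4 [P40 v4 l4]] := off_line rg ind (hpv j4).
have [f [q [u1 [u2 [[fc q0] szq [pu1 pu2 arcneg] fz fi]]]]] :=
  five_points_conic rg ju E0 W0 P20 P30 P40 vE vW v2 v3 v4 l2 l3 l4.
have gq : continuous (fun u => pt (curve_at q u)).
  by move=> u; apply: (contT (@curve_cont R q u)); exact: pt_continuous (q0 u).
pose g t := pt (curve_at q (u1 + t * (u2 - u1))).
have gc : continuous g.
  move=> t; have h1 : continuous_at t (fun t : R => u1 + t * (u2 - u1)).
    by apply: contD; [exact: contC|apply: contM; [move=> U hU; exact: hU|exact: contC]].
  exact: (contT h1 (gq (u1 + t * (u2 - u1)))).
have g0 : g 0 = pt E by rewrite /g mul0r addr0.
have g1 : g 1 = pt W by rewrite /g mul1r addrC subrK.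
have gneg t : 0 <= t <= 1 -> eval_form s' (curve_at q (u1 + t * (u2 - u1))) < 0.
  move=> /andP[t0 t1]; apply: arcneg; have [lt|lt] := lerP u1 u2; [left|right].
    have h1 : 0 <= t * (u2 - u1) by rewrite mulr_ge0// subr_ge0.
    have h2 : t * (u2 - u1) <= u2 - u1 by rewrite ler_piMl// subr_ge0.
    by apply/andP; split; lra.
  have h1 : 0 <= t * (u1 - u2) by rewrite mulr_ge0// subr_ge0 ltW.
  have h2 : t * (u1 - u2) <= u1 - u2 by rewrite ler_piMl// subr_ge0 ltW.
  have h3 : t * (u2 - u1) = - (t * (u1 - u2)) by ring.
  by rewrite h3; apply/andP; split; lra.
pose Gam := g @` `[0, 1].
have in01 (t : R) : 0 <= t <= 1 -> Gam (g t) by exists t => //; rewrite /= in_itv.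
have G0 : Gam (pt E) by rewrite -g0; apply: in01; rewrite lexx ler01.
have G1 : Gam (pt W) by rewrite -g1; apply: in01; rewrite ler01 lexx.
have Gc : connected Gam := seg_connected gc.
(* The arc starts in [D] and cannot reach [O], since s is negative all along it. *)
have GD : Gam `<=` D.
  apply: (clopen_sub Gc oD G0 (pD _ _ EE)) => _ [t + <-].
  rewrite /= in_itv /= => t01 /(closureD hcc hOc hD)[//|/OS].
  by move=> /(real_points_pt sf' (q0 _)) e'; have := gneg t t01; rewrite e' ltxx.
have Pp P : components (D `\` B) P -> quadrangle O B P \/ digon O B P.
  by move=> /pcs[]; [left|right].
have [be [cr1 cr2]] := snake_arcs hc sn' OS hcc hi hOc hD Vb tr sD n2k Qfi Qp Pp (Ep ord0).1 (Ep ord0).2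
  (Ep ord_max).1 (Ep ord_max).2 E01 G0 G1 EE WE GD Gc.
have hX (j : 'I_(2 * k)) : exists u : R, [/\ ins (be j) (pt (curve_at q u)), D (pt (curve_at q u)) &
    eval_form s' (curve_at q u) < 0].
  have [_ _ _ [q' [iq Gq]]] := cr1 j (ltn_ord j); have Dq := GD _ Gq.
  have [t t01 et] := Gq; exists (u1 + t * (u2 - u1)); rewrite -/(g t) et; split=> //.
  by apply: gneg; move: t01; rewrite /= in_itv.
have [U hU] := choice hX.
pose X j := pt (curve_at q (U j)).
have Xi : injective X.
  move=> i j e1; apply: val_inj; have [ii _ _] := hU i; have [ij _ _] := hU j.
  by apply: (cr2 _ _ (X i) (ltn_ord i) (ltn_ord j) ii); rewrite e1.
have Xc j : real_points c (X j).
  have [[[_ hb _] _ _ _] _ _ _] := cr1 j (ltn_ord j); have [[t /andP[t0 t1] et] _ _] := hU j.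
  by rewrite /X -et; apply: hb; rewrite !ltW.
have f2 : is_form 2 f := fc.2.
have Xf j : real_points f (X j).
  by apply/(real_points_pt f2 (q0 _))/(fz _ (q0 _)); left; exists (U j).
pose r := along q c; have [szr [l l0 er]] := szq _ _ hc.1.
have rr u : root r u = (eval_form c (curve_at q u) == 0) by rewrite rootE along_eval.
have rU j : root r (U j) by rewrite rr; apply/eqP/(real_points_pt hc.1 (q0 _)); exact: Xc.
have r0 : r != 0.
  apply: contraNneq cE => r0; apply/eqP/(real_points_pt hc.1 E0); rewrite -pu1.
  by apply/(real_points_pt hc.1 (q0 _)); apply/eqP; rewrite -rr r0 root0.
have Ui : injective U by move=> i j eU; apply: Xi; rewrite /X eU.
pose us := [seq U j | j <- enum 'I_(2 * k)].
have us_uniq : uniq us by rewrite map_inj_uniq// enum_uniq.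
have us_size : size us = (2 * k)%N by rewrite size_map size_enum_ord.
have us_root : all (root r) us by apply/allP => _ /mapP[j _ ->]; exact: rU.
(* The 2k crossings are already roots of [r], so its degree is exactly 2k. Its top coefficient, a
   nonzero multiple of the value of c at the point at infinity [P2], is therefore not zero. *)
have cP2 : eval_form c P2 != 0.
  apply/eqP => c0; have := max_poly_roots r0 us_root us_uniq; rewrite us_size => sz.
  have sr : size r = (k * 2).+1 by apply/eqP; rewrite eqn_leq szr mulnC.
  by move/eqP: r0; apply; apply/eqP; rewrite -lead_coef_eq0 lead_coefE sr /= er c0 mulr0.
(* A further common point at a finite parameter would be root number 2k + 1 of [r], and [P2] is not
   on c. *)
have cover p : real_points f p -> real_points c p -> exists j, p = X j.
  move=> fp cp; have w0 := rep_neq0 p.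
  have fp' : eval_form f (rep p) = 0 := fp; have cp' : eval_form c (rep p) = 0 := cp.
  case/(fz _ w0): fp' => [[u]|]; rewrite pt_rep => ep.
    have ru : root r u.
      by rewrite rr; apply/eqP/(real_points_pt hc.1 (q0 _)); rewrite -ep.
    have [/mapP[j _ eu]|nu] := boolP (u \in us); first by exists j; rewrite ep /X eu.
    have := @max_poly_roots _ r (u :: us) r0; rewrite /= ru us_root nu us_uniq us_size => /(_ isT isT).
    by move=> h1; exfalso; move: (leq_trans h1 szr); rewrite ltnS mulnC ltnn.
  move/eqP: cP2; case; apply/(real_points_pt hc.1 P20); rewrite -ep; exact: cp.
have Xeq : real_points f `&` real_points c = range X.
  apply/seteqP; split=> [p [fp cp]|_ [j _ <-]]; last by split.
  by have [j ->] := cover p fp cp; exists j.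
exists f; split=> //.
- move=> A' [brA _]; have [i _ <-] : range A A' by rewrite -Aeq.
  by have [[p fp vp] _] := fi i; exists p; split=> //; apply/vA.
- by rewrite Xeq; exact: card_eq_enum.
- move=> p [fp cp]; have [j ->] := cover p fp cp; exists D => //.
  by have [_ Dx _] := hU j.
have fv i := (fi i).2.
have hb1 j : (j < 2 * k)%N -> arc (real_points c) (be j).
  by move=> jk; have [[ha _ _ _] _ _ _] := cr1 j jk.
(* The ends of an arc are on [O], hence zeros of s. They are not on the conic, because all common
   points of the conic and c are inside [D]. *)
have hb2 j t : (j < 2 * k)%N -> t = 0 \/ t = 1 ->
    real_points s' (be j t) /\ ~ real_points f (be j t).
  move=> jk ht; have [[[_ hb _] _ n0 n1] o0 o1 _] := cr1 j jk.
  have [Ot nt ct] : [/\ O (be j t), ~ D (be j t) & real_points c (be j t)].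
    by case: ht => ->; split=> //; apply: hb; rewrite ?lexx ?ler01.
  split; first exact: OS.
  by move=> ft; have [i ei] := cover _ ft ct; apply: nt; rewrite ei; have [] := hU i.
have hb3 j : (j < 2 * k)%N ->
    exists x, [/\ ins (be j) x, real_points f x & eval_form s' (rep x) < 0].
  move=> jk; have [ij Dx _] := hU (Ordinal jk); exists (X (Ordinal jk)); split=> //.
  exact: sD.
exact: (perturbation hk rg hc f2 fv cs hb1 hb2 hb3 cr2 es e0).
Qed.
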